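(* In the setting described in the context, the universe $\mathcal U^F$ is closed under dependent product types along arbitrary fibrations (for a fibration $\Gamma\vdash A$ and $B:A\to\mathcal U^F$ there is a code in $\mathcal U^F$ whose underlying fibration is $\prod_{x:A}Bx$ with its canonical fibration structure, up to isomorphism), under dependent sum types (for $A:\mathcal U^F$, $B:A\to\mathcal U^F$) and under path types (for $A:\mathcal U^F$, $a_0,a_1:A$, a code for $\mathrm{Path}(A,a_0,a_1)$). If moreover $\mathrm{Cof}$ belongs to $\mathcal U$ (i.e. $\mathrm{Cof}$ is isomorphic to $\mathrm{el}_{\mathcal U}(C)$ for some closed $C:\mathcal U$), then $\mathcal U^F$ is also closed under identity types $\mathrm{Id}(A,a_0,a_1)$.
   Context: Let $\mathcal E$ be a model of extensional dependent type theory (category with families) with dependent products, dependent sums, extensional identity types, unit type, disjoint finite coproducts and propositional truncation; we use its internal language. Propositions are types with at most one element up to equality; $\bot,\top,\wedge,\forall$ denote $\mathbf0,\mathbf1,\times,\prod$ on propositions, $\varphi\lor\psi:=\|\varphi+\psi\|$, $\{x:A\mid\varphi\}:=\sum_{x:A}\varphi$; $\mathbf 2:=\mathbf1+\mathbf1$ with $\bar0=1,\bar1=0$. A universe is a closed type $U$ with a family $\mathrm{el}_U$ over it (we often write $A$ for $\mathrm{el}_U(A)$); it is propositional if each $\mathrm{el}_U(A)$ is a proposition; it is impredicative if equipped with codes $\Sigma^U(A,B)$ ($A:U$, $B:\mathrm{el}A\to U$), $\mathrm{Id}^U(A,a_0,a_1)$, and, for every type $A$ in any context, $\Pi^U(A,B)$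 ($B:A\to U$), with substitution-stable isomorphisms of their $\mathrm{el}$ to $\sum_{x}\mathrm{el}(Bx)$, $(a_0=a_1)$, $\prod_{x:A}\mathrm{el}(Bx)$ respectively. A dependent right adjoint to a functor $H$ on contexts assigns to each context $\Gamma$ and type $A$ over $H\Gamma$ a type $G_\Gamma A$ over $\Gamma$ with a reindexing-stable bijection between terms of $A$ over $H\Gamma$ and terms of $G_\Gamma A$ over $\Gamma$. $\mathcal E$ is equipped with a closed type $\mathbb I$, $0,1:\mathbb I$, operations $\sqcap,\sqcup$; a dependent right adjoint $(-)_{\mathbb I}$ to $(\mathbb I\to-)$; a propositional universe $\mathrm{Cof}$; an impredicative universe $\mathcal U$; satisfying: (1) $\neg(0=1)$; (2) $0\sqcap i=i\sqcap0=0$, $1\sqcap i=i\sqcap1=i$; (3) $0\sqcup i=i\sqcup0=i$, $1\sqcup i=i\sqcup1=1$; (4),(5) $i=0$ and $i=1$ have codes in $\mathrm{Cof}$; (6) $\mathrm{Cof}$ closed under $\lor$; (7) for $\varphi:\mathrm{Cof}$, $\psi:\varphi\to\mathrm{Cof}$, $\sum_{u:\varphi}\psi u$ has a code in $\mathrm{Cof}$; (8) for $\varphi:\mathbb I\to\mathrm{Cof}$, $\forall_{i:\mathbb I}\varphi i$ has a code in $\mathrm{Cof}$; (9) $\forall_{\varphi,\psi:\mathrm{Cof}}(\varphi\leftrightarrow\psi)\to\varphi=\psi$; (10) an operation assigning to $\varphi:\mathrm{Cof}$, $A:\varphi\to\mathcal U$, $B:\mathcal U$, $f:\prod_{u:\varphi}Au\cong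 B$ a pair $(\bar A:\mathcal U,\bar f:\bar A\cong B)$ with $\forall_{u:\varphi}(Au,fu)=(\bar A,\bar f)$. Regard $\mathbf 2\subseteq\mathbb I$ via end-points. For $\Gamma,i:\mathbb I\vdash A(i)$: $\mathrm{Comp}^i(A(i)):=\prod_{e:\mathbf 2}\prod_{\varphi:\mathrm{Cof}}\prod_{f:\varphi\to\prod_{i}A(i)}\prod_{a:A(e)}(\forall_{u:\varphi}fue=a)\to\{a':A(\bar e)\mid\forall_{u:\varphi}fu\bar e=a'\}$; for $\gamma:\Gamma\vdash A(\gamma)$: $\mathrm{Fib}(A):=\prod_{p:\mathbb I\to\Gamma}\mathrm{Comp}^i(A(pi))$; a fibration is a type with a global element of $\mathrm{Fib}(A)$. For $\Gamma\vdash A$ let $FA:=\mathrm{C}(A)_{\mathbb I}$ where $p:\mathbb I\to\Gamma\vdash\mathrm{C}(A)(p):=\mathrm{Comp}^i(A(pi))$; then $\mathcal U^F:=\sum_{\mathcal U}F(\mathrm{el}_{\mathcal U})$ with $\mathrm{el}_{\mathcal U^F}(A,\alpha):=\mathrm{el}_{\mathcal U}(A)$, so $\mathcal U^F$ classifies fibrations whose underlying types belong to $\mathcal U$. Path types: $\mathrm{Path}(A,a_0,a_1):=\{p:\mathbb I\to A\mid p0=a_0\wedge p1=a_1\}$; identity types: $\mathrm{Id}(A,a_0,a_1):=\sum_{p:\mathrm{Path}(A,a_0,a_1)}\{\varphi:\mathrm{Cof}\mid\varphi\to\forall_{i:\mathbb I}pi=a_0\}$. Fibrations are closed under $\Pi$,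 $\Sigma$, $\mathrm{Path}$ and $\mathrm{Id}$ (with canonical fibration structures). *)

(* Defs.v *)
From Stdlib Require Import ProofIrrelevance.

Set Implicit Arguments.
Unset Strict Implicit.
Unset Printing Implicit Defensive.
#[global] Obligation Tactic := idtac.

(** A category with families, presented as a presheaf [Ty] of types, a presheaf [Tm]
    of terms and a natural map [ty : Tm -> Ty] (equivalently, a Fam-valued presheaf:
    the terms of type [A] are the fibre [El A] below), with context extension.  All
    equations between terms are equations in [Tm], so that no transport along
    equalities of types is needed to state them. *)

Class CwF := {
  Con : Type;
  Hom : Con -> Con -> Type;
  idm : forall G, Hom G G;
  comp : forall G D T, Hom D G -> Hom T D -> Hom T G;
  comp_idl : forall G D (s : Hom D G), comp (idm G) s = s;
  comp_idr : forall G D (s : Hom D G), comp s (idm D) = s;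
  comp_assoc : forall G D T X (s : Hom D G) (t : Hom T D) (r : Hom X T),
    comp (comp s t) r = comp s (comp t r);

  emp : Con;
  bang : forall G, Hom G emp;
  bang_uniq : forall G (s t : Hom G emp), s = t;

  Ty : Con -> Type;
  Tsub : forall G D, Ty G -> Hom D G -> Ty D;
  Tsub_id : forall G (A : Ty G), Tsub A (idm G) = A;
  Tsub_comp : forall G D T (A : Ty G) (s : Hom D G) (t : Hom T D),
    Tsub (Tsub A s) t = Tsub A (comp s t);

  Tm : Con -> Type;
  tsub : forall G D, Tm G -> Hom D G -> Tm D;
  tsub_id : forall G (a : Tm G), tsub a (idm G) = a;
  tsub_comp : forall G D T (a : Tm G) (s : Hom D G) (t : Hom T D),
    tsub (tsub a s) t = tsub a (comp s t);
  ty : forall G, Tm G -> Ty G;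
  ty_tsub : forall G D (a : Tm G) (s : Hom D G), ty (tsub a s) = Tsub (ty a) s;

  ext : forall G, Ty G -> Con;
  wk : forall G (A : Ty G), Hom (ext A) G;
  var : forall G (A : Ty G), Tm (ext A);
  ty_var : forall G (A : Ty G), ty (var A) = Tsub A (wk A);
  ext_pair : forall G D (A : Ty G) (s : Hom D G) (a : Tm D),
    ty a = Tsub A s -> Hom D (ext A);
  wk_pair : forall G D (A : Ty G) (s : Hom D G) (a : Tm D) (H : ty a = Tsub A s),
    comp (wk A) (ext_pair H) = s;
  var_pair : forall G D (A : Ty G) (s : Hom D G) (a : Tm D) (H : ty a = Tsub A s),
    tsub (var A) (ext_pair H) = a;
  ext_eta : forall G D (A : Ty G) (s t : Hom D (ext A)),
    comp (wk A) s = comp (wk A) t -> tsub (var A) s = tsub (var A) t -> s = t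
}.

Declare Scope cwf_scope.
Open Scope cwf_scope.
Notation "s ∘ t" := (comp s t) (at level 40, left associativity) : cwf_scope.
Notation "A ⟦ s ⟧" := (Tsub A s) (at level 8, s at level 200, left associativity, format "A ⟦ s ⟧") : cwf_scope.
Notation "G ▹ A" := (@ext _ G A) (at level 45, left associativity) : cwf_scope.

Section Basic.
Context {E : CwF}.

Record El (G : Con) (A : Ty G) := mkEl { val : Tm G; val_ty : ty val = A }.

Definition cast {G} {A B : Ty G} (H : A = B) (t : El A) : El B :=
  mkEl (eq_trans (val_ty t) H).

Lemma esub_ty {G D} {A : Ty G} (t : El A) (s : Hom D G) : ty (tsub (val t) s) = A⟦s⟧.
Proof. rewrite ty_tsub, (val_ty t); reflexivity. Qed.

Definition esub {G D} {A : Ty G} (t : El A) (s : Hom D G) : El (A⟦s⟧) :=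
  mkEl (esub_ty t s).

Definition evar {G} (A : Ty G) : El (A⟦wk A⟧) := mkEl (ty_var A).

Definition pair {G D} {A : Ty G} (s : Hom D G) (a : El (A⟦s⟧)) : Hom D (G ▹ A) :=
  ext_pair (val_ty a).

End Basic.

Arguments El {E G} A.
Notation "t ⟪ s ⟫" := (esub t s) (at level 8, s at level 200, left associativity, format "t ⟪ s ⟫") : cwf_scope.
(** Equality of terms whose types are equal, but not syntactically so. *)
Notation "s ≈ t" := (val s = val t) (at level 70) : cwf_scope.
(** A term, retyped along an equality of types that is left as an obligation. *)
Notation "⌊ t ⌋" := (cast _ t) (format "⌊ t ⌋") : cwf_scope.

Section Calculus.
Context {E : CwF}.

Lemma El_ext {G} {A : Ty G} (s t : El A) : s ≈ t -> s = t.
Proof.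
  destruct s as [s Hs], t as [t Ht]; simpl; intro H; subst t.
  f_equal; apply proof_irrelevance.
Qed.

Lemma wk_pair' {G D} {A : Ty G} (s : Hom D G) (a : El (A⟦s⟧)) : wk A ∘ pair a = s.
Proof. apply wk_pair. Qed.

Lemma wk_pair_assoc {G D T} {A : Ty G} (s : Hom D G) (a : El (A⟦s⟧)) (t : Hom T D) :
  wk A ∘ (pair a ∘ t) = s ∘ t.
Proof. rewrite <- comp_assoc, wk_pair'; reflexivity. Qed.

Lemma var_pair' {G D} {A : Ty G} (s : Hom D G) (a : El (A⟦s⟧)) :
  tsub (var A) (pair a) = val a.
Proof. apply var_pair. Qed.

Lemma var_pair_assoc {G D T} {A : Ty G} (s : Hom D G) (a : El (A⟦s⟧)) (t : Hom T D) :
  tsub (var A) (pair a ∘ t) = tsub (val a) t.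
Proof. rewrite <- tsub_comp, var_pair'; reflexivity. Qed.

(** The context morphism acting as [s] on [G] and as the identity on the last
    variable, for [A'] equal to [A⟦s⟧]. *)
Program Definition lift {G D} (s : Hom D G) {A : Ty G} {A' : Ty D} (H : A' = A⟦s⟧) :
  Hom (D ▹ A') (G ▹ A) :=
  pair (s := s ∘ wk A') ⌊evar A'⌋.
Next Obligation. intros; rewrite H, Tsub_comp; reflexivity. Qed.

Lemma wk_lift {G D} (s : Hom D G) {A : Ty G} {A' : Ty D} (H : A' = A⟦s⟧) :
  wk A ∘ lift H = s ∘ wk A'.
Proof. apply wk_pair'. Qed.

Lemma var_lift {G D} (s : Hom D G) {A : Ty G} {A' : Ty D} (H : A' = A⟦s⟧) :
  tsub (var A) (lift H) = var A'.
Proof. apply var_pair'. Qed.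

End Calculus.

Ltac cwf := repeat first
  [ rewrite Tsub_comp | rewrite Tsub_id | rewrite tsub_comp | rewrite tsub_id
  | rewrite comp_assoc | rewrite comp_idl | rewrite comp_idr
  | rewrite wk_pair' | rewrite wk_pair_assoc
  | rewrite var_pair' | rewrite var_pair_assoc | progress simpl ].

Section Instances.
Context {E : CwF}.

Definition IsProp {G} (A : Ty G) : Prop :=
  forall D (s : Hom D G) (a b : El (A⟦s⟧)), a = b.

(** Instantiation of the last variable: [B⟦inst a⟧] is B(a). *)
Program Definition inst {G} {A : Ty G} (a : El A) : Hom G (G ▹ A) :=
  pair (s := idm G) ⌊a⌋.
Next Obligation. intros; rewrite Tsub_id; reflexivity. Qed.

Lemma wk_inst {G} {A : Ty G} (a : El A) : wk A ∘ inst a = idm G.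
Proof. apply wk_pair'. Qed.

End Instances.

Class TypeFormers (E : CwF) := {
  Pi : forall G (A : Ty G), Ty (G ▹ A) -> Ty G;
  Pi_sub : forall G D (A : Ty G) (B : Ty (G ▹ A)) (s : Hom D G),
    (Pi B)⟦s⟧ = Pi (B⟦lift (s := s) (A := A) eq_refl⟧);
  lam : forall G (A : Ty G) (B : Ty (G ▹ A)), El B -> El (Pi B);
  unlam : forall G (A : Ty G) (B : Ty (G ▹ A)), El (Pi B) -> El B;
  unlam_lam : forall G (A : Ty G) (B : Ty (G ▹ A)) (b : El B), unlam (lam b) = b;
  lam_unlam : forall G (A : Ty G) (B : Ty (G ▹ A)) (f : El (Pi B)), lam (unlam f) = f;
  lam_sub : forall G D (A : Ty G) (B : Ty (G ▹ A)) (b : El B) (s : Hom D G),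
    (lam b)⟪s⟫ ≈ lam (b⟪lift (s := s) (A := A) eq_refl⟫);

  Sig : forall G (A : Ty G), Ty (G ▹ A) -> Ty G;
  Sig_sub : forall G D (A : Ty G) (B : Ty (G ▹ A)) (s : Hom D G),
    (Sig B)⟦s⟧ = Sig (B⟦lift (s := s) (A := A) eq_refl⟧);
  dpair : forall G (A : Ty G) (B : Ty (G ▹ A)) (a : El A), El (B⟦inst a⟧) -> El (Sig B);
  dfst : forall G (A : Ty G) (B : Ty (G ▹ A)), El (Sig B) -> El A;
  dsnd : forall G (A : Ty G) (B : Ty (G ▹ A)) (t : El (Sig B)), El (B⟦inst (dfst t)⟧);
  dfst_dpair : forall G (A : Ty G) (B : Ty (G ▹ A)) (a : El A) (b : El (B⟦inst a⟧)),
    dfst (dpair b) = a;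
  dsnd_dpair : forall G (A : Ty G) (B : Ty (G ▹ A)) (a : El A) (b : El (B⟦inst a⟧)),
    dsnd (dpair b) ≈ b;
  dpair_eta : forall G (A : Ty G) (B : Ty (G ▹ A)) (t : El (Sig B)), dpair (dsnd t) = t;
  dpair_sub : forall G D (A : Ty G) (B : Ty (G ▹ A)) (a : El A) (b : El (B⟦inst a⟧))
    (s : Hom D G) (b' : El (B⟦lift (s := s) (A := A) eq_refl⟧⟦inst (a⟪s⟫)⟧)),
    b' ≈ b⟪s⟫ -> (dpair b)⟪s⟫ ≈ dpair b';

  Id : forall G (A : Ty G), El A -> El A -> Ty G;
  Id_sub : forall G D (A : Ty G) (a b : El A) (s : Hom D G),
    (Id a b)⟦s⟧ = Id (a⟪s⟫) (b⟪s⟫);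
  rfl : forall G (A : Ty G) (a : El A), El (Id a a);
  Id_reflection : forall G (A : Ty G) (a b : El A), El (Id a b) -> a = b;
  Id_unique : forall G (A : Ty G) (a b : El A) (t t' : El (Id a b)), t = t';

  One : forall G, Ty G;
  One_sub : forall G D (s : Hom D G), (One G)⟦s⟧ = One D;
  star : forall G, El (One G);
  star_unique : forall G (t : El (One G)), t = star G;

  Zero : forall G, Ty G;
  Zero_sub : forall G D (s : Hom D G), (Zero G)⟦s⟧ = Zero D;
  absurd : forall G (C : Ty G), El (Zero G) -> El C;
  absurd_unique : forall G (C : Ty G) (t t' : El C), El (Zero G) -> t = t';

  Sum : forall G, Ty G -> Ty G -> Ty G;
  Sum_sub : forall G D (A B : Ty G) (s : Hom D G), Sum (A⟦s⟧) (B⟦s⟧) = (Sum A B)⟦s⟧;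
  inl : forall G (A B : Ty G), Hom (G ▹ A) (G ▹ Sum A B);
  inr : forall G (A B : Ty G), Hom (G ▹ B) (G ▹ Sum A B);
  wk_inl : forall G (A B : Ty G), wk (Sum A B) ∘ inl A B = wk A;
  wk_inr : forall G (A B : Ty G), wk (Sum A B) ∘ inr A B = wk B;
  inl_sub : forall G D (A B : Ty G) (s : Hom D G),
    lift (Sum_sub A B s) ∘ inl (A⟦s⟧) (B⟦s⟧) = inl A B ∘ lift (s := s) (A := A) eq_refl;
  inr_sub : forall G D (A B : Ty G) (s : Hom D G),
    lift (Sum_sub A B s) ∘ inr (A⟦s⟧) (B⟦s⟧) = inr A B ∘ lift (s := s) (A := B) eq_refl;
  case : forall G (A B : Ty G) (C : Ty (G ▹ Sum A B)),
    El (C⟦inl A B⟧) -> El (C⟦inr A B⟧) -> El C;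
  case_inl : forall G (A B : Ty G) (C : Ty (G ▹ Sum A B))
    (c : El (C⟦inl A B⟧)) (d : El (C⟦inr A B⟧)), (case c d)⟪inl A B⟫ = c;
  case_inr : forall G (A B : Ty G) (C : Ty (G ▹ Sum A B))
    (c : El (C⟦inl A B⟧)) (d : El (C⟦inr A B⟧)), (case c d)⟪inr A B⟫ = d;
  case_unique : forall G (A B : Ty G) (C : Ty (G ▹ Sum A B)) (t t' : El C),
    t⟪inl A B⟫ = t'⟪inl A B⟫ -> t⟪inr A B⟫ = t'⟪inr A B⟫ -> t = t';
  Sum_disjoint : forall G D (A B : Ty G) (a : Hom D (G ▹ A)) (b : Hom D (G ▹ B)),
    inl A B ∘ a = inr A B ∘ b -> El (Zero D);

  Trunc : forall G, Ty G -> Ty G;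
  Trunc_sub : forall G D (A : Ty G) (s : Hom D G), (Trunc A)⟦s⟧ = Trunc (A⟦s⟧);
  Trunc_prop : forall G (A : Ty G), IsProp (Trunc A);
  trunc : forall G (A : Ty G), Hom (G ▹ A) (G ▹ Trunc A);
  wk_trunc : forall G (A : Ty G), wk (Trunc A) ∘ trunc A = wk A;
  trunc_elim : forall G (A : Ty G) (C : Ty (G ▹ Trunc A)),
    IsProp C -> El (C⟦trunc A⟧) -> El C
}.

Section Derived.
Context {E : CwF} {T : TypeFormers E}.

Definition Arr {G} (A B : Ty G) : Ty G := Pi (B⟦wk A⟧).
Definition And {G} (A B : Ty G) : Ty G := Sig (B⟦wk A⟧).
Definition Or {G} (A B : Ty G) : Ty G := Trunc (Sum A B).

Definition ecomp {G D K} {A : Ty G} {s : Hom D G} {t : Hom K D} (a : El (A⟦s⟧⟦t⟧)) :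
  El (A⟦s ∘ t⟧) := cast (Tsub_comp A s t) a.

Program Definition app {G D} {A : Ty G} {B : Ty (G ▹ A)} {s : Hom D G}
  (f : El ((Pi B)⟦s⟧)) (a : El (A⟦s⟧)) : El (B⟦pair a⟧) :=
  ⌊(unlam (B := B⟦lift (s := s) (A := A) eq_refl⟧) ⌊f⌋)⟪inst a⟫⌋.
Next Obligation.
  intros; cwf. f_equal. apply ext_eta; unfold inst, lift; cwf; reflexivity.
Qed.
Next Obligation. intros; apply Pi_sub. Qed.

Program Definition sfst {G D} {A : Ty G} {B : Ty (G ▹ A)} {s : Hom D G}
  (t : El ((Sig B)⟦s⟧)) : El (A⟦s⟧) :=
  dfst (B := B⟦lift (s := s) (A := A) eq_refl⟧) ⌊t⌋.
Next Obligation. intros; apply Sig_sub. Qed.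

Program Definition ssnd {G D} {A : Ty G} {B : Ty (G ▹ A)} {s : Hom D G}
  (t : El ((Sig B)⟦s⟧)) : El (B⟦pair (sfst t)⟧) :=
  ⌊dsnd (B := B⟦lift (s := s) (A := A) eq_refl⟧) ⌊t⌋⌋.
Next Obligation. intros; apply Sig_sub. Qed.
Next Obligation.
  intros; cwf. f_equal. apply ext_eta; unfold inst, lift; cwf.
  - reflexivity.
  - unfold sfst; f_equal; f_equal; apply El_ext; reflexivity.
Qed.

Definition app_id {G} {A : Ty G} {B : Ty (G ▹ A)} (f : El (Pi B)) (a : El A) :
  El (B⟦inst a⟧) := (unlam f)⟪inst a⟫.

Record Iso {G} (X Y : Ty G) := mkIso {
  fwd : El (Y⟦wk X⟧);
  bwd : El (X⟦wk Y⟧);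
  bwd_fwd : bwd⟪pair fwd⟫ ≈ evar X;
  fwd_bwd : fwd⟪pair bwd⟫ ≈ evar Y
}.

Program Definition iso_app {G} {X Y : Ty G} (h : Iso X Y) {D} {s : Hom D G}
  (x : El (X⟦s⟧)) : El (Y⟦s⟧) := ⌊(fwd h)⟪pair x⟫⌋.
Next Obligation. intros; cwf; reflexivity. Qed.

(** [h'] is the reindexing of [h] along [s]; here [X'] is [X⟦s⟧] and [Y'] is
    [Y⟦s⟧], possibly up to a non-trivial equality of types. *)
Definition IsoReindex {G D} (s : Hom D G) {X Y : Ty G} {X' Y' : Ty D}
  (h : Iso X Y) (h' : Iso X' Y') : Prop :=
  forall T (t : Hom T D) (x : El (X⟦s ∘ t⟧)) (x' : El (X'⟦t⟧)),
    x ≈ x' -> iso_app h x ≈ iso_app h' x'.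

(** An element of the closed type [X] in context [G] is given as a morphism from
    [G] to the context [emp ▹ X]; [elem] turns it into a term. *)

Definition Elc (X : Ty emp) (G : Con) : Type := Hom G (emp ▹ X).

End Derived.

Notation "G ▸ X" := (@ext _ G (Tsub X (bang G))) (at level 45, left associativity) : cwf_scope.

Section Closed.
Context {E : CwF} {T : TypeFormers E}.

Definition const (X : Ty emp) (G : Con) (x : Elc X emp) : Elc X G := x ∘ bang G.

Program Definition elem {X : Ty emp} {G} (x : Elc X G) : El (X⟦bang G⟧) :=
  ⌊(evar X)⟪x⟫⌋.
Next Obligation. intros; cwf; f_equal; apply bang_uniq. Qed.

Program Definition cvar (X : Ty emp) (G : Con) : Elc X (G ▸ X) :=
  pair (s := bang (G ▸ X)) ⌊evar (X⟦bang G⟧)⌋.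
Next Obligation. intros; cwf; f_equal; apply bang_uniq. Qed.

Program Definition cpair {X : Ty emp} {G D} (s : Hom D G) (x : Elc X D) : Hom D (G ▸ X) :=
  pair (s := s) ⌊elem x⌋.
Next Obligation. intros; cwf; f_equal; apply bang_uniq. Qed.

Definition clift (X : Ty emp) {G D} (s : Hom D G) : Hom (D ▸ X) (G ▸ X) :=
  cpair (s ∘ wk (X⟦bang D⟧)) (cvar X D).

Definition Two : Ty emp := Sum (One emp) (One emp).

(** The point 0 is [two false] and the point 1 is [two true]. *)
Definition two (b : bool) : Elc Two emp :=
  (if b then inr _ _ else inl _ _) ∘ inst (star emp).

Program Definition two_rec {X : Ty emp} (x0 x1 : Elc X emp) : Hom (emp ▹ Two) (emp ▹ X) :=
  pair (s := wk Two)
    (case (C := X⟦wk Two⟧) ⌊(elem x0)⟪bang _⟫⌋ ⌊(elem x1)⟪bang _⟫⌋).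
Next Obligation. intros; cwf; f_equal; apply bang_uniq. Qed.
Next Obligation. intros; cwf; f_equal; apply bang_uniq. Qed.

Lemma two_rec_two {X : Ty emp} (x0 x1 : Elc X emp) (b : bool) :
  two_rec x0 x1 ∘ two b = if b then x1 else x0.
Proof.
  apply ext_eta; [apply bang_uniq|].
  unfold two_rec, two; rewrite var_pair_assoc.
  destruct b; rewrite <- tsub_comp.
  - match goal with |- tsub (tsub (val (case ?c ?d)) _) _ = _ =>
      change (tsub (val ((case c d)⟪inr (One emp) (One emp)⟫)) (inst (star emp))
              = tsub (var X) x1); rewrite case_inr end.
    simpl; cwf; f_equal. etransitivity; [|apply comp_idr]. f_equal; apply bang_uniq.
  - match goal with |- tsub (tsub (val (case ?c ?d)) _) _ = _ =>
      change (tsub (val ((case c d)⟪inl (One emp) (One emp)⟫)) (inst (star emp))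
              = tsub (var X) x0); rewrite case_inl end.
    simpl; cwf; f_equal. etransitivity; [|apply comp_idr]. f_equal; apply bang_uniq.
Qed.

Definition opp : Hom (emp ▹ Two) (emp ▹ Two) := two_rec (two true) (two false).

End Closed.

Section Stability.
Context {E : CwF} {T : TypeFormers E}.

Lemma Pi_sub' {G D} {A : Ty G} (B : Ty (G ▹ A)) {s : Hom D G} {A' : Ty D}
  (H : A' = A⟦s⟧) : (Pi B)⟦s⟧ = Pi (B⟦lift H⟧).
Proof. subst A'; apply Pi_sub. Qed.

Lemma Sig_sub' {G D} {A : Ty G} (B : Ty (G ▹ A)) {s : Hom D G} {A' : Ty D}
  (H : A' = A⟦s⟧) : (Sig B)⟦s⟧ = Sig (B⟦lift H⟧).
Proof. subst A'; apply Sig_sub. Qed.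

Lemma Id_sub' {G D} {A : Ty G} (a b : El A) (s : Hom D G) {A' : Ty D}
  (H : A' = A⟦s⟧) (a' b' : El A') :
  a' ≈ a⟪s⟫ -> b' ≈ b⟪s⟫ -> (Id a b)⟦s⟧ = Id a' b'.
Proof.
  subst A'; intros Ha Hb; rewrite Id_sub; f_equal; apply El_ext; symmetry; assumption.
Qed.

Lemma unlam_sub {G D} {A : Ty G} {B : Ty (G ▹ A)} {s : Hom D G} {A' : Ty D}
  (H : A' = A⟦s⟧) {B' : Ty (D ▹ A')} (HB : B' = B⟦lift H⟧)
  (f : El (Pi B)) (f' : El (Pi B')) :
  f' ≈ f⟪s⟫ -> unlam f' ≈ (unlam f)⟪lift H⟫.
Proof.
  subst A' B'; intro Hf.
  assert (f' = lam ((unlam f)⟪lift (s := s) (A := A) eq_refl⟫)) as ->.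
  { apply El_ext; rewrite Hf, <- lam_sub, lam_unlam; reflexivity. }
  rewrite unlam_lam; reflexivity.
Qed.

End Stability.

Class Interval (E : CwF) (T : TypeFormers E) := {
  II : Ty emp;
  i0 : Elc II emp;
  i1 : Elc II emp;
  meet : forall G, Elc II G -> Elc II G -> Elc II G;
  join : forall G, Elc II G -> Elc II G -> Elc II G;
  meet_sub : forall G D (i j : Elc II G) (s : Hom D G),
    meet i j ∘ s = meet (i ∘ s) (j ∘ s);
  join_sub : forall G D (i j : Elc II G) (s : Hom D G),
    join i j ∘ s = join (i ∘ s) (j ∘ s);
  i0_neq_i1 : El (Arr (Id (elem i0) (elem i1)) (Zero emp));
  meet_0i : forall G (i : Elc II G), meet (const G i0) i = const G i0;
  meet_i0 : forall G (i : Elc II G), meet i (const G i0) = const G i0;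
  meet_1i : forall G (i : Elc II G), meet (const G i1) i = i;
  meet_i1 : forall G (i : Elc II G), meet i (const G i1) = i;
  join_0i : forall G (i : Elc II G), join (const G i0) i = i;
  join_i0 : forall G (i : Elc II G), join i (const G i0) = i;
  join_1i : forall G (i : Elc II G), join (const G i1) i = const G i1;
  join_i1 : forall G (i : Elc II G), join i (const G i1) = const G i1
}.

(** The functor [(I -> -)] on contexts, right adjoint to [- ▸ II]. *)
Class PathContexts (E : CwF) (T : TypeFormers E) (I : Interval T) := {
  Exp : Con -> Con;
  ev : forall G, Hom (Exp G ▸ II) G;
  cur : forall G D, Hom (D ▸ II) G -> Hom D (Exp G);
  ev_cur : forall G D (p : Hom (D ▸ II) G), ev G ∘ clift II (cur p) = p;
  cur_ev : forall G D (s : Hom D (Exp G)), cur (ev G ∘ clift II s) = s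
}.

Definition exp_map {E : CwF} {T : TypeFormers E} {I : Interval T} {P : PathContexts I}
  {G D} (s : Hom D G) : Hom (Exp D) (Exp G) := cur (s ∘ ev D).

Class DependentRightAdjoint (E : CwF) (T : TypeFormers E) (I : Interval T)
  (P : PathContexts I) := {
  Rt : forall G, Ty (Exp G) -> Ty G;
  Rt_sub : forall G D (A : Ty (Exp G)) (s : Hom D G), (Rt A)⟦s⟧ = Rt (A⟦exp_map s⟧);
  transp : forall G (A : Ty (Exp G)), El A -> El (Rt A);
  untransp : forall G (A : Ty (Exp G)), El (Rt A) -> El A;
  untransp_transp : forall G (A : Ty (Exp G)) (a : El A), untransp (transp a) = a;
  transp_untransp : forall G (A : Ty (Exp G)) (b : El (Rt A)), transp (untransp b) = b;
  transp_sub : forall G D (A : Ty (Exp G)) (a : El A) (s : Hom D G),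
    (transp a)⟪s⟫ ≈ transp (a⟪exp_map s⟫)
}.

Record Universe {E : CwF} := mkUniverse {
  code : Ty emp;
  el : Ty (emp ▹ code)
}.

(** [D ▹ el⟦c ∘ s⟧ -> G ▹ el⟦c⟧] over [s]. *)
Definition lift_el {E : CwF} {U : Universe} {G D} (c : Elc (code U) G) (s : Hom D G) :
  Hom (D ▹ (el U)⟦c ∘ s⟧) (G ▹ (el U)⟦c⟧) :=
  lift (eq_sym (Tsub_comp (el U) c s)).

Definition HasCode {E : CwF} {T : TypeFormers E} (U : Universe) {G} (X : Ty G) : Prop :=
  exists c : Elc (code U) G, inhabited (Iso ((el U)⟦c⟧) X).

Class Cofibrations (E : CwF) (T : TypeFormers E) (I : Interval T) := {
  Cof : Universe;
  Cof_prop : IsProp (el Cof);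
  cof_eq : forall b : bool, forall G, Elc II G -> Elc (code Cof) G;
  cof_eq_iso : forall b G (i : Elc II G),
    Iso ((el Cof)⟦cof_eq b i⟧) (Id (elem i) (elem (const G (if b then i1 else i0))));
  cof_or : forall G, Elc (code Cof) G -> Elc (code Cof) G -> Elc (code Cof) G;
  cof_or_iso : forall G (phi psi : Elc (code Cof) G),
    Iso ((el Cof)⟦cof_or phi psi⟧) (Or ((el Cof)⟦phi⟧) ((el Cof)⟦psi⟧));
  cof_sig : forall G (phi : Elc (code Cof) G),
    Elc (code Cof) (G ▹ (el Cof)⟦phi⟧) -> Elc (code Cof) G;
  cof_sig_iso : forall G (phi : Elc (code Cof) G)
    (psi : Elc (code Cof) (G ▹ (el Cof)⟦phi⟧)),
    Iso ((el Cof)⟦cof_sig psi⟧) (Sig ((el Cof)⟦psi⟧));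
  cof_all : forall G, Elc (code Cof) (G ▸ II) -> Elc (code Cof) G;
  cof_all_iso : forall G (phi : Elc (code Cof) (G ▸ II)),
    Iso ((el Cof)⟦cof_all phi⟧) (Pi ((el Cof)⟦phi⟧));
  cof_ext : forall G (phi psi : Elc (code Cof) G),
    El (Arr ((el Cof)⟦phi⟧) ((el Cof)⟦psi⟧)) ->
    El (Arr ((el Cof)⟦psi⟧) ((el Cof)⟦phi⟧)) -> phi = psi
}.

Class Impredicative (E : CwF) (T : TypeFormers E) (U : Universe) := {
  cSig : forall G (A : Elc (code U) G), Elc (code U) (G ▹ (el U)⟦A⟧) -> Elc (code U) G;
  cSig_sub : forall G D (A : Elc (code U) G) (B : Elc (code U) (G ▹ (el U)⟦A⟧)) (s : Hom D G),
    cSig B ∘ s = cSig (B ∘ lift_el A s);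
  cSig_iso : forall G (A : Elc (code U) G) (B : Elc (code U) (G ▹ (el U)⟦A⟧)),
    Iso ((el U)⟦cSig B⟧) (Sig ((el U)⟦B⟧));
  cSig_iso_sub : forall G D (A : Elc (code U) G) (B : Elc (code U) (G ▹ (el U)⟦A⟧))
    (s : Hom D G), IsoReindex s (cSig_iso B) (cSig_iso (B ∘ lift_el A s));

  cId : forall G (A : Elc (code U) G), El ((el U)⟦A⟧) -> El ((el U)⟦A⟧) -> Elc (code U) G;
  cId_sub : forall G D (A : Elc (code U) G) (a b : El ((el U)⟦A⟧)) (s : Hom D G)
    (a' b' : El ((el U)⟦A ∘ s⟧)),
    a' ≈ a⟪s⟫ -> b' ≈ b⟪s⟫ -> cId a b ∘ s = cId a' b';
  cId_iso : forall G (A : Elc (code U) G) (a b : El ((el U)⟦A⟧)),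
    Iso ((el U)⟦cId a b⟧) (Id a b);
  cId_iso_sub : forall G D (A : Elc (code U) G) (a b : El ((el U)⟦A⟧)) (s : Hom D G)
    (a' b' : El ((el U)⟦A ∘ s⟧)),
    a' ≈ a⟪s⟫ -> b' ≈ b⟪s⟫ -> IsoReindex s (cId_iso a b) (cId_iso a' b');

  cPi : forall G (A : Ty G), Elc (code U) (G ▹ A) -> Elc (code U) G;
  cPi_sub : forall G D (A : Ty G) (B : Elc (code U) (G ▹ A)) (s : Hom D G),
    cPi B ∘ s = cPi (B ∘ lift (s := s) (A := A) eq_refl);
  cPi_iso : forall G (A : Ty G) (B : Elc (code U) (G ▹ A)),
    Iso ((el U)⟦cPi B⟧) (Pi ((el U)⟦B⟧));
  cPi_iso_sub : forall G D (A : Ty G) (B : Elc (code U) (G ▹ A)) (s : Hom D G),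
    IsoReindex s (cPi_iso B) (cPi_iso (B ∘ lift (s := s) (A := A) eq_refl))
}.

(** Strictification: a partial isomorphism onto [B] extends strictly to a total one. *)
Class Strictification (E : CwF) (T : TypeFormers E) (I : Interval T) (C : Cofibrations I)
  (U : Universe) := {
  glue : forall G (phi : Elc (code Cof) G) (A : Elc (code U) (G ▹ (el Cof)⟦phi⟧))
    (B : Elc (code U) G),
    Iso ((el U)⟦A⟧) ((el U)⟦B⟧⟦wk ((el Cof)⟦phi⟧)⟧) -> Elc (code U) G;
  glue_iso : forall G (phi : Elc (code Cof) G) (A : Elc (code U) (G ▹ (el Cof)⟦phi⟧))
    (B : Elc (code U) G) (f : Iso ((el U)⟦A⟧) ((el U)⟦B⟧⟦wk ((el Cof)⟦phi⟧)⟧)),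
    Iso ((el U)⟦glue f⟧) ((el U)⟦B⟧);
  glue_strict : forall G (phi : Elc (code Cof) G) (A : Elc (code U) (G ▹ (el Cof)⟦phi⟧))
    (B : Elc (code U) G) (f : Iso ((el U)⟦A⟧) ((el U)⟦B⟧⟦wk ((el Cof)⟦phi⟧)⟧)),
    glue f ∘ wk ((el Cof)⟦phi⟧) = A /\ IsoReindex (wk ((el Cof)⟦phi⟧)) (glue_iso f) f;
  glue_sub : forall G D (phi : Elc (code Cof) G) (A : Elc (code U) (G ▹ (el Cof)⟦phi⟧))
    (B : Elc (code U) G) (f : Iso ((el U)⟦A⟧) ((el U)⟦B⟧⟦wk ((el Cof)⟦phi⟧)⟧))
    (s : Hom D G)
    (f' : Iso ((el U)⟦A ∘ lift_el phi s⟧) ((el U)⟦B ∘ s⟧⟦wk ((el Cof)⟦phi ∘ s⟧)⟧)),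
    IsoReindex (lift_el phi s) f f' ->
    glue f ∘ s = glue f' /\ IsoReindex s (glue_iso f) (glue_iso f')
}.

Section Composition.
Context {E : CwF} {T : TypeFormers E} {I : Interval T} {P : PathContexts I}
  {C : Cofibrations I}.

Definition endpoint (b : bool) (G : Con) : Elc II G := const G (if b then i1 else i0).

Definition incl : Hom (emp ▹ Two) (emp ▹ II) := two_rec i0 i1.

Definition holds {G} (phi : Elc (code Cof) G) : Ty G := (el Cof)⟦phi⟧.

(** A(i), for i:I |- A(i). *)
Definition at_ {G} (A : Ty (G ▸ II)) (i : Elc II G) : Ty G := A⟦cpair (idm G) i⟧.

(** phi -> forall i, A(i) *)
Definition Tube {G} (A : Ty (G ▸ II)) (phi : Elc (code Cof) G) : Ty G :=
  Pi (A := holds phi) (Pi (A := II⟦bang _⟧) (A⟦clift II (wk (holds phi))⟧)).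

Lemma at_sub {G D} (A : Ty (G ▸ II)) (i : Elc II G) (s : Hom D G) :
  (at_ A i)⟦s⟧ = at_ (A⟦clift II s⟧) (i ∘ s).
Proof.
  unfold at_, clift; cwf; f_equal.
  apply ext_eta; unfold cpair, elem, cvar; cwf; reflexivity.
Qed.

Lemma closed_sub {X : Ty emp} {G D} (s : Hom D G) : X⟦bang D⟧ = X⟦bang G⟧⟦s⟧.
Proof. rewrite Tsub_comp; f_equal; apply bang_uniq. Qed.

Lemma Tube_inner_sub {G D} (A : Ty (G ▸ II)) (phi : Elc (code Cof) G) (s : Hom D G) :
  A⟦clift II s⟧⟦clift II (wk (holds (phi ∘ s)))⟧
  = A⟦clift II (wk (holds phi))⟧⟦lift (closed_sub (lift_el phi s))⟧.
Proof.
  unfold clift, holds; cwf; f_equal.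
  apply ext_eta; unfold lift_el, lift, cpair, elem, cvar; cwf; reflexivity.
Qed.

Lemma Tube_body_sub {G D} (A : Ty (G ▸ II)) (phi : Elc (code Cof) G) (s : Hom D G) :
  Pi (A⟦clift II s⟧⟦clift II (wk (holds (phi ∘ s)))⟧)
  = (Pi (A := II⟦bang _⟧) (A⟦clift II (wk (holds phi))⟧))⟦lift_el phi s⟧.
Proof. rewrite Tube_inner_sub; symmetry; apply Pi_sub'. Qed.

Lemma Tube_sub {G D} (A : Ty (G ▸ II)) (phi : Elc (code Cof) G) (s : Hom D G) :
  (Tube A phi)⟦s⟧ = Tube (A⟦clift II s⟧) (phi ∘ s).
Proof.
  unfold Tube.
  rewrite (Pi_sub' _ (eq_sym (Tsub_comp (el Cof) phi s))).
  f_equal. symmetry; apply Tube_body_sub.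
Qed.

(** u:phi |- f u i *)
Program Definition tube_at {G} {A : Ty (G ▸ II)} {phi : Elc (code Cof) G}
  (f : El (Tube A phi)) (i : Elc II G) : El ((at_ A i)⟦wk (holds phi)⟧) :=
  ⌊(unlam (unlam f))⟪cpair (idm _) (i ∘ wk (holds phi))⟫⌋.
Next Obligation.
  intros; unfold at_, clift; cwf; f_equal.
  apply ext_eta; unfold cpair, elem, cvar; cwf; reflexivity.
Qed.

(** forall u:phi, f u i = a *)
Definition Agree {G} {A : Ty (G ▸ II)} {phi : Elc (code Cof) G}
  (f : El (Tube A phi)) (i : Elc II G) (a : El (at_ A i)) : Ty G :=
  Pi (A := holds phi) (Id (tube_at f i) (a⟪wk (holds phi)⟫)).

Lemma tube_at_sub {G D} {A : Ty (G ▸ II)} {phi : Elc (code Cof) G}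
  (f : El (Tube A phi)) (i : Elc II G) (s : Hom D G)
  (f' : El (Tube (A⟦clift II s⟧) (phi ∘ s))) :
  f' ≈ f⟪s⟫ -> tube_at f' (i ∘ s) ≈ (tube_at f i)⟪lift_el phi s⟫.
Proof.
  intro Hf; unfold tube_at; simpl.
  rewrite (unlam_sub (Tube_inner_sub A phi s) (unlam_sub (Tube_body_sub A phi s) Hf)).
  simpl; cwf; f_equal.
  apply ext_eta; unfold lift_el, lift, cpair, elem; cwf; reflexivity.
Qed.

Lemma Agree_sub {G D} {A : Ty (G ▸ II)} {phi : Elc (code Cof) G}
  (f : El (Tube A phi)) (i : Elc II G) (a : El (at_ A i)) (s : Hom D G)
  (f' : El (Tube (A⟦clift II s⟧) (phi ∘ s))) (a' : El (at_ (A⟦clift II s⟧) (i ∘ s))) :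
  f' ≈ f⟪s⟫ -> a' ≈ a⟪s⟫ -> (Agree f a)⟦s⟧ = Agree f' a'.
Proof.
  intros Hf Ha; unfold Agree.
  rewrite (Pi_sub' _ (eq_sym (Tsub_comp (el Cof) phi s))).
  f_equal. apply Id_sub'.
  - rewrite <- at_sub; cwf; f_equal. symmetry; apply wk_lift.
  - apply tube_at_sub; assumption.
  - simpl; rewrite Ha; simpl; cwf; f_equal. symmetry; apply wk_lift.
Qed.

Lemma Agree_sub' {G D} {A : Ty (G ▸ II)} {phi : Elc (code Cof) G} {i : Elc II G}
  (f : El (Tube A phi)) (a : El (at_ A i)) (s : Hom D G)
  {A' : Ty (D ▸ II)} {phi' : Elc (code Cof) D} {i' : Elc II D}
  (f' : El (Tube A' phi')) (a' : El (at_ A' i')) :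
  A' = A⟦clift II s⟧ -> phi' = phi ∘ s -> i' = i ∘ s ->
  f' ≈ f⟪s⟫ -> a' ≈ a⟪s⟫ -> (Agree f a)⟦s⟧ = Agree f' a'.
Proof. intros -> -> ->; apply Agree_sub. Qed.

(** {a':A(i) | forall u:phi, f u i = a'} *)
Program Definition Extn {G} {A : Ty (G ▸ II)} {phi : Elc (code Cof) G}
  (f : El (Tube A phi)) (i : Elc II G) : Ty G :=
  let w := wk (at_ A i) in
  Sig (A := at_ A i)
    (Agree (A := A⟦clift II w⟧) (phi := phi ∘ w) (i := i ∘ w) ⌊f⟪w⟫⌋ ⌊evar (at_ A i)⌋).
Next Obligation. intros; apply Tube_sub. Qed.
Next Obligation. intros; apply at_sub. Qed.

Lemma clift_comp (X : Ty emp) {G D K} (s : Hom D G) (t : Hom K D) :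
  clift X s ∘ clift X t = clift X (s ∘ t).
Proof.
  unfold clift; apply ext_eta; unfold cpair, elem, cvar; cwf; reflexivity.
Qed.

Lemma clift_id (X : Ty emp) {G} : clift X (idm G) = idm _.
Proof.
  unfold clift; apply ext_eta; unfold cpair, elem, cvar; cwf; reflexivity.
Qed.

Lemma clift_sub {G D K} (A : Ty (G ▸ II)) (s : Hom D G) (t : Hom K D) :
  A⟦clift II s⟧⟦clift II t⟧ = A⟦clift II (s ∘ t)⟧.
Proof. rewrite Tsub_comp, clift_comp; reflexivity. Qed.

Lemma Extn_sub {G D} {A : Ty (G ▸ II)} {phi : Elc (code Cof) G} {i : Elc II G}
  (f : El (Tube A phi)) (s : Hom D G)
  {A' : Ty (D ▸ II)} {phi' : Elc (code Cof) D} {i' : Elc II D} (f' : El (Tube A' phi')) :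
  A' = A⟦clift II s⟧ -> phi' = phi ∘ s -> i' = i ∘ s ->
  f' ≈ f⟪s⟫ -> (Extn f i)⟦s⟧ = Extn f' i'.
Proof.
  intros -> -> -> Hf; unfold Extn.
  rewrite (Sig_sub' _ (eq_sym (at_sub A i s))). f_equal.
  apply Agree_sub'.
  - rewrite !clift_sub, wk_lift; reflexivity.
  - cwf; rewrite wk_lift; reflexivity.
  - cwf; rewrite wk_lift; reflexivity.
  - simpl; rewrite Hf; simpl; cwf; rewrite wk_lift; reflexivity.
  - simpl; rewrite var_lift; reflexivity.
Qed.

(** The type Comp, in stages: [CompN] is what remains to be quantified over once
    the data among e, phi, f, a that it takes as arguments are given. *)

(** (forall u:phi, f u e = a) -> {a':A(e') | forall u:phi, f u e' = a'},
    where e' is the end-point opposite to e *)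
Program Definition Comp4 {G} {A : Ty (G ▸ II)} (e : Elc Two G) {phi : Elc (code Cof) G}
  (f : El (Tube A phi)) (a : El (at_ A (incl ∘ e))) : Ty G :=
  Arr (Agree f a) (Extn f (incl ∘ (opp ∘ e))).

Program Definition Comp3 {G} {A : Ty (G ▸ II)} (e : Elc Two G) {phi : Elc (code Cof) G}
  (f : El (Tube A phi)) : Ty G :=
  let w := wk (at_ A (incl ∘ e)) in
  Pi (A := at_ A (incl ∘ e))
    (Comp4 (A := A⟦clift II w⟧) (e := e ∘ w) (phi := phi ∘ w) ⌊f⟪w⟫⌋ ⌊evar _⌋).
Next Obligation. intros; apply Tube_sub. Qed.
Next Obligation. intros; rewrite <- comp_assoc; apply at_sub. Qed.

Program Definition Comp2 {G} (A : Ty (G ▸ II)) (e : Elc Two G) (phi : Elc (code Cof) G) :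
  Ty G :=
  let w := wk (Tube A phi) in
  Pi (A := Tube A phi)
    (Comp3 (A := A⟦clift II w⟧) (e ∘ w) (phi := phi ∘ w) ⌊evar _⌋).
Next Obligation. intros; apply Tube_sub. Qed.

Definition Comp1 {G} (A : Ty (G ▸ II)) (e : Elc Two G) : Ty G :=
  let w := wk ((code Cof)⟦bang G⟧) in
  Pi (A := (code Cof)⟦bang G⟧)
    (Comp2 (A⟦clift II w⟧) (e ∘ w) (cvar (code Cof) G)).

Definition Comp {G} (A : Ty (G ▸ II)) : Ty G :=
  Pi (A := Two⟦bang G⟧) (Comp1 (A⟦clift II (wk (Two⟦bang G⟧))⟧) (cvar Two G)).

Lemma Comp4_sub {G D} {A : Ty (G ▸ II)} {e : Elc Two G} {phi : Elc (code Cof) G}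
  (f : El (Tube A phi)) (a : El (at_ A (incl ∘ e))) (s : Hom D G)
  {A' : Ty (D ▸ II)} {e' : Elc Two D} {phi' : Elc (code Cof) D}
  (f' : El (Tube A' phi')) (a' : El (at_ A' (incl ∘ e'))) :
  A' = A⟦clift II s⟧ -> e' = e ∘ s -> phi' = phi ∘ s ->
  f' ≈ f⟪s⟫ -> a' ≈ a⟪s⟫ -> (Comp4 f a)⟦s⟧ = Comp4 f' a'.
Proof.
  intros -> -> -> Hf Ha; unfold Comp4, Arr.
  assert (H : (Agree f a)⟦s⟧ = Agree f' a').
  { apply Agree_sub'; cwf; trivial. }
  rewrite (Pi_sub' _ (eq_sym H)). f_equal.
  rewrite Tsub_comp, wk_lift, <- Tsub_comp. f_equal.
  apply Extn_sub; cwf; trivial.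
Qed.

Lemma Comp3_sub {G D} {A : Ty (G ▸ II)} {e : Elc Two G} {phi : Elc (code Cof) G}
  (f : El (Tube A phi)) (s : Hom D G)
  {A' : Ty (D ▸ II)} {e' : Elc Two D} {phi' : Elc (code Cof) D} (f' : El (Tube A' phi')) :
  A' = A⟦clift II s⟧ -> e' = e ∘ s -> phi' = phi ∘ s ->
  f' ≈ f⟪s⟫ -> (Comp3 e f)⟦s⟧ = Comp3 e' f'.
Proof.
  intros -> -> -> Hf; unfold Comp3.
  assert (H : at_ (A⟦clift II s⟧) (incl ∘ (e ∘ s)) = (at_ A (incl ∘ e))⟦s⟧)
    by (rewrite at_sub; cwf; reflexivity).
  rewrite (Pi_sub' _ H). f_equal.
  apply Comp4_sub.
  - rewrite !clift_sub, wk_lift; reflexivity.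
  - cwf; rewrite wk_lift; reflexivity.
  - cwf; rewrite wk_lift; reflexivity.
  - simpl; rewrite Hf; simpl; cwf; rewrite wk_lift; reflexivity.
  - simpl; rewrite var_lift; reflexivity.
Qed.

Lemma Comp2_sub {G D} (A : Ty (G ▸ II)) (e : Elc Two G) (phi : Elc (code Cof) G)
  (s : Hom D G) (A' : Ty (D ▸ II)) (e' : Elc Two D) (phi' : Elc (code Cof) D) :
  A' = A⟦clift II s⟧ -> e' = e ∘ s -> phi' = phi ∘ s ->
  (Comp2 A e phi)⟦s⟧ = Comp2 A' e' phi'.
Proof.
  intros -> -> ->; unfold Comp2.
  rewrite (Pi_sub' _ (eq_sym (Tube_sub A phi s))). f_equal.
  apply Comp3_sub.
  - rewrite !clift_sub, wk_lift; reflexivity.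
  - cwf; rewrite wk_lift; reflexivity.
  - cwf; rewrite wk_lift; reflexivity.
  - simpl; rewrite var_lift; reflexivity.
Qed.

Lemma cvar_lift (X : Ty emp) {G D} (s : Hom D G) (H : X⟦bang D⟧ = X⟦bang G⟧⟦s⟧) :
  cvar X D = cvar X G ∘ lift H.
Proof.
  apply ext_eta; [apply bang_uniq|].
  unfold cvar, lift; cwf; reflexivity.
Qed.

Lemma Comp1_sub {G D} (A : Ty (G ▸ II)) (e : Elc Two G)
  (s : Hom D G) (A' : Ty (D ▸ II)) (e' : Elc Two D) :
  A' = A⟦clift II s⟧ -> e' = e ∘ s -> (Comp1 A e)⟦s⟧ = Comp1 A' e'.
Proof.
  intros -> ->; unfold Comp1.
  rewrite (Pi_sub' _ (closed_sub s)). f_equal.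
  apply Comp2_sub.
  - rewrite !clift_sub, wk_lift; reflexivity.
  - cwf; rewrite wk_lift; reflexivity.
  - apply cvar_lift.
Qed.

Lemma Comp_sub {G D} (A : Ty (G ▸ II)) (s : Hom D G) :
  (Comp A)⟦s⟧ = Comp (A⟦clift II s⟧).
Proof.
  unfold Comp.
  rewrite (Pi_sub' _ (closed_sub s)). f_equal.
  apply Comp1_sub.
  - rewrite !clift_sub, wk_lift; reflexivity.
  - apply cvar_lift.
Qed.

Lemma clift_inst {G} {B : Ty G} (b : El B) (A : Ty (G ▸ II)) :
  A = A⟦clift II (wk B)⟧⟦clift II (inst b)⟧.
Proof. rewrite clift_sub, wk_inst, clift_id, Tsub_id; reflexivity. Qed.

Lemma wk_inst_assoc {G X} {B : Ty G} (b : El B) (s : Hom G X) :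
  s = s ∘ wk B ∘ inst b.
Proof. rewrite comp_assoc, wk_inst, comp_idr; reflexivity. Qed.

Lemma cvar_inst (X : Ty emp) {G} (x : Elc X G) : x = cvar X G ∘ inst (elem x).
Proof.
  apply ext_eta; [apply bang_uniq|].
  unfold cvar, inst, elem; cwf; reflexivity.
Qed.

Lemma incl_two (b : bool) G : incl ∘ const G (two b) = endpoint b G.
Proof.
  unfold incl, const, endpoint; rewrite <- comp_assoc, two_rec_two.
  destruct b; reflexivity.
Qed.

Lemma opp_two (b : bool) G : opp ∘ const G (two b) = const G (two (negb b)).
Proof.
  unfold opp, const; rewrite <- comp_assoc, two_rec_two; destruct b; reflexivity.
Qed.

(** A composition problem from the end-point [b]: a partial line and an element at
    [b] extending it there, [tube] being given in uncurried form. *)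
Record Problem {G} (A : Ty (G ▸ II)) (b : bool) (phi : Elc (code Cof) G) := mkProblem {
  tube : El (A⟦clift II (wk (holds phi))⟧);
  base : El (at_ A (endpoint b G));
  tube_base : tube⟪cpair (idm _) (endpoint b _)⟫ ≈ base⟪wk (holds phi)⟫
}.

(** The element of A(negb b) obtained by applying an element of Comp to a problem. *)
Section Solve.
Context {G : Con} {A : Ty (G ▸ II)} {b : bool} {phi : Elc (code Cof) G}
  (c : El (Comp A)) (pb : Problem A b phi).

Let e : Elc Two G := const G (two b).

Program Definition solve1 : El (Comp1 A e) := ⌊app_id c (elem e)⌋.
Next Obligation. apply Comp1_sub; [apply clift_inst | apply cvar_inst]. Qed.

Program Definition solve2 : El (Comp2 A e phi) := ⌊app_id solve1 (elem phi)⌋.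
Next Obligation.
  apply Comp2_sub; [apply clift_inst | apply wk_inst_assoc | apply cvar_inst].
Qed.

Definition tube_fun : El (Tube A phi) := lam (lam (tube pb)).

Program Definition solve3 : El (Comp3 e tube_fun) := ⌊app_id solve2 tube_fun⌋.
Next Obligation.
  apply Comp3_sub; [apply clift_inst | apply wk_inst_assoc | apply wk_inst_assoc |].
  simpl; unfold inst; rewrite var_pair'; reflexivity.
Qed.

Program Definition base_elt : El (at_ A (incl ∘ e)) := ⌊base pb⌋.
Next Obligation. unfold e; rewrite incl_two; reflexivity. Qed.

Program Definition solve4 : El (Comp4 tube_fun base_elt) := ⌊app_id solve3 base_elt⌋.
Next Obligation.
  apply Comp4_sub; [apply clift_inst | apply wk_inst_assoc | apply wk_inst_assoc | |].
  - simpl; rewrite tsub_comp, wk_inst, tsub_id; reflexivity.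
  - simpl; unfold inst; rewrite var_pair'; reflexivity.
Qed.

Program Definition agree_elt : El (Agree tube_fun base_elt) :=
  lam (cast (A := Id (tube_at tube_fun (incl ∘ e)) (tube_at tube_fun (incl ∘ e))) _ (rfl _)).
Next Obligation.
  f_equal; apply El_ext.
  unfold tube_at, tube_fun; rewrite !unlam_lam.
  change (tsub (val (tube pb)) (cpair (idm _) (incl ∘ e ∘ wk (holds phi)))
          = val ((base pb)⟪wk (holds phi)⟫)).
  rewrite <- tube_base; simpl; f_equal; f_equal.
  unfold e; rewrite incl_two; unfold endpoint, const; rewrite comp_assoc.
  f_equal; apply bang_uniq.
Qed.

Program Definition solve5 : El (Extn tube_fun (incl ∘ (opp ∘ e))) :=
  ⌊app_id (solve4 : El (Pi _)) agree_elt⌋.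
Next Obligation. rewrite Tsub_comp, wk_inst, Tsub_id; reflexivity. Qed.

Program Definition solve : El (at_ A (endpoint (negb b) G)) :=
  ⌊dfst (solve5 : El (Sig _))⌋.
Next Obligation. unfold e; rewrite opp_two, incl_two; reflexivity. Qed.

End Solve.

End Composition.

Section Fibrations.
Context {E : CwF} {T : TypeFormers E} {I : Interval T} {P : PathContexts I}
  {C : Cofibrations I}.

(** C(A)(p) = Comp^i(A(p i)), for p:I -> G. *)
Definition CompPath {G} (A : Ty G) : Ty (Exp G) := Comp (A⟦ev G⟧).

(** Fibration structures on [A], that is, global elements of
    Fib(A) = forall p:I -> G, Comp^i(A(p i)).  The context [G] need not be a closed
    type, so the quantification over p is expressed by working in context [Exp G]. *)
Definition FibStr {G} (A : Ty G) : Type := El (CompPath A).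

Program Definition fib_sub {G D} {A : Ty G} (st : FibStr A) (s : Hom D G) :
  FibStr (A⟦s⟧) := ⌊st⟪exp_map s⟫⌋.
Next Obligation.
  intros; unfold CompPath; rewrite Comp_sub, Tsub_comp; unfold exp_map.
  rewrite ev_cur, Tsub_comp; reflexivity.
Qed.

(** The solution of a composition problem along the path [p]. *)
Program Definition fcomp {G} {A : Ty G} (st : FibStr A) {D} (p : Hom (D ▸ II) G)
  {b : bool} {phi : Elc (code Cof) D} (pb : Problem (A⟦p⟧) b phi) :
  El (at_ (A⟦p⟧) (endpoint (negb b) D)) := solve ⌊st⟪cur p⟫⌋ pb.
Next Obligation.
  intros; unfold CompPath; rewrite Comp_sub, Tsub_comp, ev_cur; reflexivity.
Qed.

(** [h] carries [sx] to [sy].  It suffices to consider compositions from each of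
    the two end-points, since maps out of [Two] are determined by their values on them. *)
Definition IsFibIso {G} {X Y : Ty G} (h : Iso X Y) (sx : FibStr X) (sy : FibStr Y) : Prop :=
  forall D (p : Hom (D ▸ II) G) b (phi : Elc (code Cof) D)
    (px : Problem (X⟦p⟧) b phi) (py : Problem (Y⟦p⟧) b phi),
    tube py ≈ iso_app h (ecomp (tube px)) ->
    base py ≈ iso_app h (ecomp (base px)) ->
    fcomp sy py ≈ iso_app h (ecomp (fcomp sx px)).

(** Canonical fibration structures are specified by the value of composition on an
    arbitrary problem over an arbitrary context.  The auxiliary problems whose
    existence is asserted are determined uniquely. *)

Definition conn (b : bool) {G} (i j : Elc II G) : Elc II G :=
  if b then join i j else meet i j.

(** (i, j) |-> conn b i j *)
Definition conn_path (b : bool) (D : Con) : Hom (D ▸ II ▸ II) (D ▸ II) :=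
  cpair (wk (II⟦bang D⟧) ∘ wk (II⟦bang (D ▸ II)⟧))
    (conn b (cvar II D ∘ wk (II⟦bang (D ▸ II)⟧)) (cvar II (D ▸ II))).

(** [y] is the canonical filler of [pb]: y(i) is the composite along
    j |-> p (conn b i j) of the system [phi |-> f (conn b i j), i = b |-> a]. *)
Definition IsFill {G} {A : Ty G} (st : FibStr A) {D} (p : Hom (D ▸ II) G)
  {b : bool} {phi : Elc (code Cof) D} (pb : Problem (A⟦p⟧) b phi) (y : El (A⟦p⟧)) : Prop :=
  let w := wk (II⟦bang D⟧) in
  let psi := cof_or (phi ∘ w) (cof_eq b (cvar II D)) in
  exists q : Problem (A⟦p ∘ conn_path b D⟧) b psi,
    (forall K (r : Hom K (D ▸ II ▹ holds psi ▸ II)),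
       let di := wk (holds psi) ∘ (wk (II⟦bang _⟧) ∘ r) in
       let d := w ∘ di in
       let i := cvar II D ∘ di in
       let j := cvar II _ ∘ r in
       (forall u : El ((holds phi)⟦d⟧),
          (tube q)⟪r⟫ ≈ (tube pb)⟪cpair (pair u) (conn b i j)⟫) /\
       (i = endpoint b K -> (tube q)⟪r⟫ ≈ (base pb)⟪d⟫)) /\
    base q ≈ (base pb)⟪w⟫ /\
    y ≈ fcomp st q.

Definition cof_bot (D : Con) : Elc (code Cof) D := cof_eq true (const D i0).

(** (comp f a) x = comp (f y) (a (y b)), where y is the filler of x from [negb b] to
    [b] with empty system. *)
Definition CanonPi {G} {A : Ty G} {B : Ty (G ▹ A)} (sa : FibStr A) (sb : FibStr B)
  (st : FibStr (Pi B)) : Prop :=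
  forall D (p : Hom (D ▸ II) G) b (phi : Elc (code Cof) D)
    (pb : Problem ((Pi B)⟦p⟧) b phi) (x : El (at_ (A⟦p⟧) (endpoint (negb b) D))),
  exists (px : Problem (A⟦p⟧) (negb b) (cof_bot D)) (y : El (A⟦p⟧))
    (q : Problem (B⟦pair y⟧) b phi),
    base px = x /\ IsFill sa px y /\
    tube q ≈ app (ecomp (tube pb)) (ecomp (y⟪clift II (wk (holds phi))⟫)) /\
    base q ≈ app (ecomp (base pb)) (ecomp (y⟪cpair (idm D) (endpoint b D)⟫)) /\
    app (ecomp (fcomp st pb)) (ecomp x) ≈ fcomp sb q.

(** comp f a = (y (negb b), comp (snd f) (snd a)), where y is the filler of
    (fst f, fst a). *)
Definition CanonSig {G} {A : Ty G} {B : Ty (G ▹ A)} (sa : FibStr A) (sb : FibStr B)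
  (st : FibStr (Sig B)) : Prop :=
  forall D (p : Hom (D ▸ II) G) b (phi : Elc (code Cof) D)
    (pb : Problem ((Sig B)⟦p⟧) b phi),
  exists (pa : Problem (A⟦p⟧) b phi) (y : El (A⟦p⟧)) (q : Problem (B⟦pair y⟧) b phi),
    tube pa ≈ sfst (ecomp (tube pb)) /\ base pa ≈ sfst (ecomp (base pb)) /\
    IsFill sa pa y /\
    tube q ≈ ssnd (ecomp (tube pb)) /\ base q ≈ ssnd (ecomp (base pb)) /\
    sfst (ecomp (fcomp st pb)) ≈ y⟪cpair (idm D) (endpoint (negb b) D)⟫ /\
    ssnd (ecomp (fcomp st pb)) ≈ fcomp sb q.

Program Definition line_app {G D} {A : Ty G} {s : Hom D G}
  (f : El ((Arr (II⟦bang G⟧) A)⟦s⟧)) (i : Elc II D) : El (A⟦s⟧) :=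
  ⌊app (A := II⟦bang G⟧) f ⌊elem i⌋⌋.
Next Obligation. intros; apply closed_sub. Qed.
Next Obligation. intros; rewrite Tsub_comp, wk_pair'; reflexivity. Qed.

(** {l:I -> A | l 0 = a0 /\ l 1 = a1} *)
Definition Path {G} {A : Ty G} (a0 a1 : El A) : Ty G :=
  let L := Arr (II⟦bang G⟧) A in
  Sig (A := L)
    (And (Id (line_app (evar L) (endpoint false _)) (a0⟪wk L⟫))
         (Id (line_app (evar L) (endpoint true _)) (a1⟪wk L⟫))).

Definition path_app {G D} {A : Ty G} {a0 a1 : El A} {s : Hom D G}
  (t : El ((Path a0 a1)⟦s⟧)) (i : Elc II D) : El (A⟦s⟧) := line_app (sfst t) i.

(** (comp f a) k is the composite of the system
    [phi |-> f k, k = 0 |-> a0, k = 1 |-> a1] with base [a k]. *)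
Definition CanonPath {G} {A : Ty G} {a0 a1 : El A} (sa : FibStr A)
  (st : FibStr (Path a0 a1)) : Prop :=
  forall D (p : Hom (D ▸ II) G) b (phi : Elc (code Cof) D)
    (pb : Problem ((Path a0 a1)⟦p⟧) b phi),
  let w := wk (II⟦bang D⟧) in
  let psi := cof_or (phi ∘ w) (cof_or (cof_eq false (cvar II D)) (cof_eq true (cvar II D))) in
  exists q : Problem (A⟦p ∘ clift II w⟧) b psi,
    (forall K (r : Hom K (D ▸ II ▹ holds psi ▸ II)),
       let dk := wk (holds psi) ∘ (wk (II⟦bang _⟧) ∘ r) in
       let d := w ∘ dk in
       let k := cvar II D ∘ dk in
       let i := cvar II _ ∘ r in
       (forall u : El ((holds phi)⟦d⟧),
          (tube q)⟪r⟫ ≈ path_app (ecomp (ecomp ((tube pb)⟪cpair (pair u) i⟫))) k) /\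
       (k = endpoint false K -> (tube q)⟪r⟫ ≈ a0⟪p ∘ cpair d i⟫) /\
       (k = endpoint true K -> (tube q)⟪r⟫ ≈ a1⟪p ∘ cpair d i⟫)) /\
    base q ≈ path_app (ecomp (ecomp ((base pb)⟪w⟫))) (cvar II D) /\
    path_app (ecomp (ecomp ((fcomp st pb)⟪w⟫))) (cvar II D) ≈ fcomp sa q.

(** Over (l:Path a0 a1): {phi:Cof | phi -> forall i, l i = a0} *)
Definition ConstOn {G} {A : Ty G} (a0 a1 : El A) : Ty (G ▹ Path a0 a1) :=
  let G1 := G ▹ Path a0 a1 in
  let G2 := G1 ▸ code Cof in
  let phi := cvar (code Cof) G1 in
  let w := wk ((code Cof)⟦bang G1⟧) ∘ wk (II⟦bang G2⟧) in
  Sig (A := (code Cof)⟦bang G1⟧)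
    (Arr (holds phi)
       (Pi (A := II⟦bang G2⟧)
          (Id (path_app (ecomp ((evar (Path a0 a1))⟪w⟫)) (cvar II G2))
              (a0⟪wk (Path a0 a1) ∘ w⟫)))).

Definition IdT {G} {A : Ty G} (a0 a1 : El A) : Ty G := Sig (ConstOn a0 a1).

Program Definition id_cof {G D} {A : Ty G} {a0 a1 : El A} {s : Hom D G}
  (t : El ((IdT a0 a1)⟦s⟧)) : Elc (code Cof) D :=
  pair (s := bang D) ⌊sfst (B := Arr _ _) (ssnd t)⌋.
Next Obligation. intros; symmetry; apply closed_sub. Qed.

(** comp f a is the composite of the underlying paths together with the cofibration
    exists u:phi, (cofibration part of f u (negb b)). *)
Definition CanonId {G} {A : Ty G} {a0 a1 : El A} (sa : FibStr A)
  (st : FibStr (IdT a0 a1)) : Prop :=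
  exists sp : FibStr (Path a0 a1), CanonPath sa sp /\
  forall D (p : Hom (D ▸ II) G) b (phi : Elc (code Cof) D)
    (pb : Problem ((IdT a0 a1)⟦p⟧) b phi),
  exists q : Problem ((Path a0 a1)⟦p⟧) b phi,
    tube q ≈ sfst (ecomp (tube pb)) /\ base q ≈ sfst (ecomp (base pb)) /\
    sfst (ecomp (fcomp st pb)) ≈ fcomp sp q /\
    id_cof (ecomp (fcomp st pb))
    = cof_sig (phi := phi)
        (id_cof (ecomp (ecomp ((tube pb)⟪cpair (idm _) (endpoint (negb b) _)⟫)))).

End Fibrations.

Section UniverseOfFibrations.
Context {E : CwF} {T : TypeFormers E} {I : Interval T} {P : PathContexts I}
  {R : DependentRightAdjoint P} {C : Cofibrations I}.

Definition FF {G} (A : Ty G) : Ty G := Rt (CompPath A).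

Definition UFcode (U : Universe) : Ty emp := Sig (A := code U) (FF (el U)).

Definition UFfst (U : Universe) : Hom (emp ▹ UFcode U) (emp ▹ code U) :=
  pair (sfst (evar (UFcode U))).

Definition UF (U : Universe) : Universe :=
  {| code := UFcode U; el := (el U)⟦UFfst U⟧ |}.

(** The tautological fibration structure on [el (UF U)]. *)
Program Definition UFstr (U : Universe) : FibStr (el (UF U)) :=
  ⌊untransp (A := (CompPath (el U))⟦exp_map (UFfst U)⟧) ⌊ssnd (evar (UFcode U))⌋⌋.
Next Obligation.
  intros; unfold CompPath; rewrite Comp_sub; simpl; unfold exp_map.
  rewrite !Tsub_comp, ev_cur; reflexivity.
Qed.
Next Obligation. intros; apply Rt_sub. Qed.

Definition code_fib {U : Universe} {G} (c : Elc (code (UF U)) G) :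
  FibStr ((el (UF U))⟦c⟧) := fib_sub (UFstr U) c.

Record ClosedPi (U : Universe) := {
  ufPi : forall G (A : Ty G) (sa : FibStr A) (B : Elc (code (UF U)) (G ▹ A)),
    Elc (code (UF U)) G;
  ufPi_sub : forall G D (A : Ty G) (sa : FibStr A) (B : Elc (code (UF U)) (G ▹ A))
    (s : Hom D G),
    ufPi sa B ∘ s = ufPi (fib_sub sa s) (B ∘ lift (s := s) (A := A) eq_refl);
  ufPi_iso : forall G (A : Ty G) (sa : FibStr A) (B : Elc (code (UF U)) (G ▹ A)),
    Iso ((el (UF U))⟦ufPi sa B⟧) (Pi ((el (UF U))⟦B⟧));
  ufPi_iso_sub : forall G D (A : Ty G) (sa : FibStr A) (B : Elc (code (UF U)) (G ▹ A))
    (s : Hom D G),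
    IsoReindex s (ufPi_iso sa B)
      (ufPi_iso (fib_sub sa s) (B ∘ lift (s := s) (A := A) eq_refl));
  ufPi_fib : forall G (A : Ty G) (sa : FibStr A) (B : Elc (code (UF U)) (G ▹ A)),
    exists st : FibStr (Pi ((el (UF U))⟦B⟧)),
      CanonPi sa (code_fib B) st /\ IsFibIso (ufPi_iso sa B) (code_fib (ufPi sa B)) st
}.

Record ClosedSig (U : Universe) := {
  ufSig : forall G (A : Elc (code (UF U)) G),
    Elc (code (UF U)) (G ▹ (el (UF U))⟦A⟧) -> Elc (code (UF U)) G;
  ufSig_sub : forall G D (A : Elc (code (UF U)) G)
    (B : Elc (code (UF U)) (G ▹ (el (UF U))⟦A⟧)) (s : Hom D G),
    ufSig B ∘ s = ufSig (B ∘ lift_el A s);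
  ufSig_iso : forall G (A : Elc (code (UF U)) G)
    (B : Elc (code (UF U)) (G ▹ (el (UF U))⟦A⟧)),
    Iso ((el (UF U))⟦ufSig B⟧) (Sig ((el (UF U))⟦B⟧));
  ufSig_iso_sub : forall G D (A : Elc (code (UF U)) G)
    (B : Elc (code (UF U)) (G ▹ (el (UF U))⟦A⟧)) (s : Hom D G),
    IsoReindex s (ufSig_iso B) (ufSig_iso (B ∘ lift_el A s));
  ufSig_fib : forall G (A : Elc (code (UF U)) G)
    (B : Elc (code (UF U)) (G ▹ (el (UF U))⟦A⟧)),
    exists st : FibStr (Sig ((el (UF U))⟦B⟧)),
      CanonSig (code_fib A) (code_fib B) st /\
      IsFibIso (ufSig_iso B) (code_fib (ufSig B)) st
}.

Record ClosedPath (U : Universe) := {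
  ufPath : forall G (A : Elc (code (UF U)) G),
    El ((el (UF U))⟦A⟧) -> El ((el (UF U))⟦A⟧) -> Elc (code (UF U)) G;
  ufPath_sub : forall G D (A : Elc (code (UF U)) G) (a0 a1 : El ((el (UF U))⟦A⟧))
    (s : Hom D G) (b0 b1 : El ((el (UF U))⟦A ∘ s⟧)),
    b0 ≈ a0⟪s⟫ -> b1 ≈ a1⟪s⟫ -> ufPath a0 a1 ∘ s = ufPath b0 b1;
  ufPath_iso : forall G (A : Elc (code (UF U)) G) (a0 a1 : El ((el (UF U))⟦A⟧)),
    Iso ((el (UF U))⟦ufPath a0 a1⟧) (Path a0 a1);
  ufPath_iso_sub : forall G D (A : Elc (code (UF U)) G) (a0 a1 : El ((el (UF U))⟦A⟧))
    (s : Hom D G) (b0 b1 : El ((el (UF U))⟦A ∘ s⟧)),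
    b0 ≈ a0⟪s⟫ -> b1 ≈ a1⟪s⟫ -> IsoReindex s (ufPath_iso a0 a1) (ufPath_iso b0 b1);
  ufPath_fib : forall G (A : Elc (code (UF U)) G) (a0 a1 : El ((el (UF U))⟦A⟧)),
    exists st : FibStr (Path a0 a1),
      CanonPath (code_fib A) st /\ IsFibIso (ufPath_iso a0 a1) (code_fib (ufPath a0 a1)) st
}.

Record ClosedId (U : Universe) := {
  ufId : forall G (A : Elc (code (UF U)) G),
    El ((el (UF U))⟦A⟧) -> El ((el (UF U))⟦A⟧) -> Elc (code (UF U)) G;
  ufId_sub : forall G D (A : Elc (code (UF U)) G) (a0 a1 : El ((el (UF U))⟦A⟧))
    (s : Hom D G) (b0 b1 : El ((el (UF U))⟦A ∘ s⟧)),
    b0 ≈ a0⟪s⟫ -> b1 ≈ a1⟪s⟫ -> ufId a0 a1 ∘ s = ufId b0 b1;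
  ufId_iso : forall G (A : Elc (code (UF U)) G) (a0 a1 : El ((el (UF U))⟦A⟧)),
    Iso ((el (UF U))⟦ufId a0 a1⟧) (IdT a0 a1);
  ufId_iso_sub : forall G D (A : Elc (code (UF U)) G) (a0 a1 : El ((el (UF U))⟦A⟧))
    (s : Hom D G) (b0 b1 : El ((el (UF U))⟦A ∘ s⟧)),
    b0 ≈ a0⟪s⟫ -> b1 ≈ a1⟪s⟫ -> IsoReindex s (ufId_iso a0 a1) (ufId_iso b0 b1);
  ufId_fib : forall G (A : Elc (code (UF U)) G) (a0 a1 : El ((el (UF U))⟦A⟧)),
    exists st : FibStr (IdT a0 a1),
      CanonId (code_fib A) st /\ IsFibIso (ufId_iso a0 a1) (code_fib (ufId a0 a1)) st
}.

End UniverseOfFibrations.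

(* Main.v *)
Require Import Defs.
From Stdlib Require Import ProofIrrelevance.

(** A fibration structure on [A] is the same thing as an operation that solves all
    composition problems in [A] in all contexts, naturally in the context, so canonical
    structures can be built externally, problem by problem.  For products, lines are
    filled backwards in the domain; for sums, the second component is composed over a
    filling of the first; a path is composed with its end-points added to the system; in
    an identity type the new cofibration is exists u:phi, (cofibration at u).  Each of
    these operations is natural in all its data.

    A code in [UF U] amounts to a code [c] in [U] together with a fibration structure on
    [el c], by transposition along the dependent right adjoint.  Hence a type that has a
    code in [U] up to isomorphism, and carries a fibration structure, has a code in [UF U]:
    transport the structure along the isomorphism.  Impredicativity gives the codes in
    [U]; products are the only place where the index type is not required to have one, and
    identity types need one for [Cof]. *)

Set Implicit Arguments.
Unset Strict Implicit.
Unset Printing Implicit Defensive.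

(** * Context morphisms, products and sums *)

(** Equations between types hold only propositionally, so a chosen reindexing seldom has the type
    that the next step expects. Hence elements are compared by [≈] in [Tm], and stability is
    relational throughout: [PNat], [FNat], [CNat] and [IsoReindex] say that a given object is a
    reindexing of another, whichever way its type is written.

    Stability is needed in two directions. Problems move along a change of stage [t], because an
    element of [Comp] must be natural; fibrations move along a change of base [o], because codes
    must commute strictly with substitution. Each construction has one lemma for both, over a square
    [o ∘ p' = p ∘ clift II t], from which the cases [o = id] and [t = id] are read off.

    The obstacle between external operations and [Comp] is that [Comp] is a tower of five products
    in which the type of each argument depends on the earlier ones. It is crossed one quantifier at
    a time: the problem stays fixed over [D], the types live over a base [G], and the stage in
    [Hom D G] grows by one component at each quantifier. *)

Section Homs.
Context {E : CwF}.

Lemma pair_ext {G D} {A : Ty G} (s s' : Hom D G) (a : El (A⟦s⟧)) (a' : El (A⟦s'⟧)) :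
  s = s' -> a ≈ a' -> pair a = pair a'.
Proof. intros; apply ext_eta; cwf; assumption. Qed.

Lemma hom_pair {G D} {A : Ty G} (s : Hom D (G ▹ A)) (t : Hom D G) (a : El (A⟦t⟧)) :
  wk A ∘ s = t -> tsub (var A) s = val a -> s = pair a.
Proof. intros; apply ext_eta; cwf; assumption. Qed.

Lemma cpair_wk {X : Ty emp} {G D} (s : Hom D G) (x : Elc X D) :
  wk (X⟦bang G⟧) ∘ cpair s x = s.
Proof. apply wk_pair'. Qed.

Lemma cpair_wk_assoc {X : Ty emp} {G D K} (s : Hom D G) (x : Elc X D) (t : Hom K D) :
  wk (X⟦bang G⟧) ∘ (cpair s x ∘ t) = s ∘ t.
Proof. rewrite <- comp_assoc, cpair_wk; reflexivity. Qed.

Lemma cvar_cpair {X : Ty emp} {G D} (s : Hom D G) (x : Elc X D) :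
  cvar X G ∘ cpair s x = x.
Proof.
  apply ext_eta; [apply bang_uniq|].
  unfold cvar, cpair; cwf; reflexivity.
Qed.

Lemma cvar_cpair_assoc {X : Ty emp} {G D K} (s : Hom D G) (x : Elc X D) (t : Hom K D) :
  cvar X G ∘ (cpair s x ∘ t) = x ∘ t.
Proof. rewrite <- comp_assoc, cvar_cpair; reflexivity. Qed.

Lemma var_cvar (X : Ty emp) G : tsub (var X) (cvar X G) = var (X⟦bang G⟧).
Proof. unfold cvar; cwf; reflexivity. Qed.

Lemma var_cvar_assoc (X : Ty emp) {G D} (t : Hom D (G ▸ X)) :
  tsub (var X) (cvar X G ∘ t) = tsub (var (X⟦bang G⟧)) t.
Proof. rewrite <- tsub_comp, var_cvar; reflexivity. Qed.

Lemma chom_ext {X : Ty emp} {G D} (s t : Hom D (G ▸ X)) :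
  wk (X⟦bang G⟧) ∘ s = wk (X⟦bang G⟧) ∘ t -> cvar X G ∘ s = cvar X G ∘ t -> s = t.
Proof.
  intros H1 H2; apply ext_eta; [assumption|].
  apply (f_equal (tsub (var X))) in H2.
  rewrite <- !tsub_comp, var_cvar in H2; assumption.
Qed.

Lemma elc_ext {X : Ty emp} {G} (x y : Elc X G) : tsub (var X) x = tsub (var X) y -> x = y.
Proof. intro; apply ext_eta; [apply bang_uniq | assumption]. Qed.

Lemma cpair_comp {X : Ty emp} {G D K} (s : Hom D G) (x : Elc X D) (t : Hom K D) :
  cpair s x ∘ t = cpair (s ∘ t) (x ∘ t).
Proof.
  apply chom_ext; rewrite ?cpair_wk_assoc, ?cpair_wk, ?cvar_cpair_assoc, ?cvar_cpair;
    reflexivity.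
Qed.

Lemma pair_comp {G D K} {A : Ty G} (s : Hom D G) (a : El (A⟦s⟧)) (t : Hom K D) :
  pair a ∘ t = pair (ecomp (a⟪t⟫)).
Proof. apply ext_eta; cwf; reflexivity. Qed.

Lemma wk_lift_assoc {G D K} (s : Hom D G) {A : Ty G} {A' : Ty D} (H : A' = A⟦s⟧)
  (t : Hom K (D ▹ A')) : wk A ∘ (lift H ∘ t) = s ∘ (wk A' ∘ t).
Proof. rewrite <- comp_assoc, wk_lift, comp_assoc; reflexivity. Qed.

Lemma var_lift_assoc {G D K} (s : Hom D G) {A : Ty G} {A' : Ty D} (H : A' = A⟦s⟧)
  (t : Hom K (D ▹ A')) : tsub (var A) (lift H ∘ t) = tsub (var A') t.
Proof. rewrite <- tsub_comp, var_lift; reflexivity. Qed.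

Lemma cvar_lift' (X : Ty emp) {G D} (s : Hom D G) (H : X⟦bang D⟧ = X⟦bang G⟧⟦s⟧) :
  cvar X G ∘ lift H = cvar X D.
Proof. symmetry; apply cvar_lift. Qed.

Lemma cvar_lift_assoc (X : Ty emp) {G D K} (s : Hom D G) (H : X⟦bang D⟧ = X⟦bang G⟧⟦s⟧)
  (t : Hom K _) : cvar X G ∘ (lift H ∘ t) = cvar X D ∘ t.
Proof. rewrite <- comp_assoc, cvar_lift'; reflexivity. Qed.

Lemma wk_inst_comp {G D} {A : Ty G} (a : El A) (t : Hom D G) : wk A ∘ (inst a ∘ t) = t.
Proof. rewrite <- comp_assoc, wk_inst, comp_idl; reflexivity. Qed.

Lemma var_inst {G} {A : Ty G} (a : El A) : tsub (var A) (inst a) = val a.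
Proof. unfold inst; cwf; reflexivity. Qed.

Lemma var_inst_comp {G D} {A : Ty G} (a : El A) (t : Hom D G) :
  tsub (var A) (inst a ∘ t) = tsub (val a) t.
Proof. rewrite <- tsub_comp, var_inst; reflexivity. Qed.

Lemma cvar_inst_elem (X : Ty emp) {G} (x : Elc X G) : cvar X G ∘ inst (elem x) = x.
Proof. symmetry; apply cvar_inst. Qed.

End Homs.

#[global] Hint Rewrite @cpair_wk @cpair_wk_assoc @cvar_cpair @cvar_cpair_assoc @comp_assoc
  @comp_idl @comp_idr @wk_pair' @wk_pair_assoc @wk_lift @wk_lift_assoc
  @cvar_lift' @cvar_lift_assoc @wk_inst @wk_inst_comp @cvar_inst_elem : hom.
#[global] Hint Rewrite @Tsub_comp @Tsub_id @tsub_comp @tsub_id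
  @var_pair' @var_pair_assoc @var_lift @var_lift_assoc @var_inst @var_inst_comp @var_cvar @var_cvar_assoc : hom.

(** [autorewrite] gives up when the first instance of a rule occurs in a dependent
    position; the second tactic tries all instances. *)
Ltac nf_all := match goal with
  | |- context [comp (comp ?s ?t) ?r] => rewrite (comp_assoc s t r)
  | |- context [Tsub (Tsub ?A ?s) ?t] => rewrite (Tsub_comp A s t)
  | |- context [tsub (tsub ?a ?s) ?t] => rewrite (tsub_comp a s t)
  end.
Ltac nf := repeat first [progress autorewrite with hom | progress simpl | nf_all].

Ltac hom_eq :=
  unfold clift in *; nf; try reflexivity;
  lazymatch goal with
  | |- @eq (Hom _ emp) _ _ => apply bang_uniq
  | |- @eq (Hom _ (@ext _ emp _)) _ _ =>
      try (apply elc_ext; nf; first [reflexivity | congruence])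
  | |- @eq (Hom _ (@ext _ ?G (Tsub ?X (bang ?G)))) _ _ => apply chom_ext; hom_eq
  | |- @eq (Hom _ _) _ _ => apply ext_eta; [hom_eq | nf; try reflexivity]
  | |- _ => idtac
  end.
Ltac ty_eq := intros; nf; try reflexivity; f_equal; hom_eq.

(** * Products, sums and extensional identity types at an arbitrary stage *)

Section PiSig.
Context {E : CwF} {T : TypeFormers E}.

(** The square [o ∘ s' = s ∘ t] combines a change of base [o] of the family with a change of stage
    [t] of the elements. All later naturality lemmas have this shape; taking [o] or [t] to be an
    identity gives the one-sided forms. *)
Lemma app_nat {G G'} {A : Ty G} {B : Ty (G ▹ A)} {A' : Ty G'} {B' : Ty (G' ▹ A')}
  (o : Hom G' G) (HA : A' = A⟦o⟧) (HB : B' = B⟦lift HA⟧)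
  {D D'} {s : Hom D G} {s' : Hom D' G'} {t : Hom D' D} (Hs : o ∘ s' = s ∘ t)
  (f : El ((Pi B)⟦s⟧)) (a : El (A⟦s⟧)) (f' : El ((Pi B')⟦s'⟧)) (a' : El (A'⟦s'⟧)) :
  f' ≈ f⟪t⟫ -> a' ≈ a⟪t⟫ -> app f' a' ≈ (app f a)⟪t⟫.
Proof.
  subst B'; intros Hf Ha. unfold app; simpl.
  assert (H : A'⟦s'⟧ = A⟦s⟧⟦t⟧) by (rewrite HA; nf; rewrite Hs; reflexivity).
  rewrite (@unlam_sub E T _ _ (A⟦s⟧) (B⟦lift (s := s) (A := A) eq_refl⟧) t _ H
             (B⟦lift HA⟧⟦lift (s := s') (A := A') eq_refl⟧)
             ltac:(nf; f_equal; apply ext_eta; nf; [rewrite <- !comp_assoc, Hs|]; reflexivity)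
             (cast (Pi_sub B s) f)).
  - simpl. nf. f_equal.
    + do 2 f_equal; apply El_ext; reflexivity.
    + apply ext_eta; nf; [reflexivity | exact Ha].
  - exact Hf.
Qed.

Definition pi_lam {G D} {A : Ty G} {B : Ty (G ▹ A)} {s : Hom D G}
  (b : El (B⟦lift (s := s) (A := A) eq_refl⟧)) : El ((Pi B)⟦s⟧) :=
  cast (eq_sym (Pi_sub B s)) (lam b).

Lemma app_lam {G D} {A : Ty G} {B : Ty (G ▹ A)} {s : Hom D G}
  (b : El (B⟦lift (s := s) (A := A) eq_refl⟧)) (a : El (A⟦s⟧)) :
  app (pi_lam b) a ≈ b⟪inst a⟫.
Proof.
  unfold app; simpl.
  match goal with |- tsub (val (unlam ?f)) _ = _ => replace f with (lam b) end.
  - rewrite unlam_lam; reflexivity.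
  - apply El_ext; reflexivity.
Qed.

(** A function is recovered from its value at the generic argument, which is why [pi_ext] may
    compare functions by their applications at later stages. *)
Lemma app_generic {G D} {A : Ty G} {B : Ty (G ▹ A)} {s : Hom D G} (f : El ((Pi B)⟦s⟧)) :
  app (s := s ∘ wk (A⟦s⟧)) (ecomp (f⟪wk (A⟦s⟧)⟫)) (ecomp (evar (A⟦s⟧)))
  ≈ unlam (B := B⟦lift (s := s) (A := A) eq_refl⟧) (cast (Pi_sub B s) f).
Proof.
  unfold app; simpl.
  rewrite (@unlam_sub E T _ _ (A⟦s⟧) (B⟦lift (s := s) (A := A) eq_refl⟧) (wk (A⟦s⟧)) _
     (eq_sym (Tsub_comp A s (wk (A⟦s⟧))))
             (B⟦lift (s := s ∘ wk (A⟦s⟧)) (A := A) eq_refl⟧)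
             ltac:(ty_eq)
             (cast (Pi_sub B s) f)) by reflexivity.
  nf. etransitivity; [|apply tsub_id]. f_equal; hom_eq.
Qed.

Lemma pi_ext {G D} {A : Ty G} {B : Ty (G ▹ A)} {s : Hom D G} (f f' : El ((Pi B)⟦s⟧)) :
  (forall K (t : Hom K D) (x : El (A⟦s ∘ t⟧)),
     app (ecomp (f⟪t⟫)) x ≈ app (ecomp (f'⟪t⟫)) x) -> f = f'.
Proof.
  intro H. specialize (H _ (wk (A⟦s⟧)) (ecomp (evar (A⟦s⟧)))).
  rewrite !app_generic in H. apply El_ext in H.
  apply (f_equal (@lam _ _ _ _ _)) in H. rewrite !lam_unlam in H.
  apply El_ext. exact (f_equal (@val _ _ _) H).
Qed.

(** Only pairing is assumed to commute with substitution. Stability of the projections follows by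
    writing [t'] as the pair of the reindexed components of [t]. *)
Lemma dfst_sub {G D} {A : Ty G} {B : Ty (G ▹ A)} {s : Hom D G} {A' : Ty D}
  (H : A' = A⟦s⟧) {B' : Ty (D ▹ A')} (HB : B' = B⟦lift H⟧)
  (t : El (Sig B)) (t' : El (Sig B')) :
  t' ≈ t⟪s⟫ -> dfst t' ≈ (dfst t)⟪s⟫ /\ dsnd t' ≈ (dsnd t)⟪s⟫.
Proof.
  subst A' B'; intro Ht.
  assert (HT : B⟦inst (dfst t)⟧⟦s⟧
    = B⟦lift (s := s) (A := A) eq_refl⟧⟦inst ((dfst t)⟪s⟫)⟧) by ty_eq.
  assert (t' = dpair (cast HT ((dsnd t)⟪s⟫))) as ->.
  { apply El_ext. rewrite Ht. rewrite <- (dpair_sub (a := dfst t) (b := dsnd t) (s := s)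
      (b' := cast HT ((dsnd t)⟪s⟫))) by reflexivity.
    rewrite dpair_eta; reflexivity. }
  split.
  - rewrite dfst_dpair; reflexivity.
  - rewrite dsnd_dpair; reflexivity.
Qed.

Lemma Sig_nat_ty {G G'} {A : Ty G} {B : Ty (G ▹ A)} {A' : Ty G'} {B' : Ty (G' ▹ A')}
  (o : Hom G' G) (HA : A' = A⟦o⟧) (HB : B' = B⟦lift HA⟧) : Sig B' = (Sig B)⟦o⟧.
Proof. subst A' B'; rewrite Sig_sub; reflexivity. Qed.

Lemma Pi_nat_ty {G G'} {A : Ty G} {B : Ty (G ▹ A)} {A' : Ty G'} {B' : Ty (G' ▹ A')}
  (o : Hom G' G) (HA : A' = A⟦o⟧) (HB : B' = B⟦lift HA⟧) : Pi B' = (Pi B)⟦o⟧.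
Proof. subst A' B'; rewrite Pi_sub; reflexivity. Qed.

Section SigNat.
Context {G G'} {A : Ty G} {B : Ty (G ▹ A)} {A' : Ty G'} {B' : Ty (G' ▹ A')}
  (o : Hom G' G) (HA : A' = A⟦o⟧) (HB : B' = B⟦lift HA⟧)
  {D D'} {s : Hom D G} {s' : Hom D' G'} {t : Hom D' D} (Hs : o ∘ s' = s ∘ t)
  (x : El ((Sig B)⟦s⟧)) (x' : El ((Sig B')⟦s'⟧)) (Hx : x' ≈ x⟪t⟫).

Lemma sfst_ssnd_nat : sfst x' ≈ (sfst x)⟪t⟫ /\ ssnd x' ≈ (ssnd x)⟪t⟫.
Proof.
  revert x' Hx; subst B'; intros x' Hx. unfold sfst, ssnd.
  assert (H : A'⟦s'⟧ = A⟦s⟧⟦t⟧) by (rewrite HA; nf; rewrite Hs; reflexivity).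
  assert (HB : B⟦lift HA⟧⟦lift (s := s') (A := A') eq_refl⟧
               = B⟦lift (s := s) (A := A) eq_refl⟧⟦lift H⟧).
  { nf; f_equal; apply ext_eta; nf; [rewrite <- !comp_assoc, Hs|]; reflexivity. }
  split.
  - refine (proj1 (dfst_sub HB _)); exact Hx.
  - refine (proj2 (dfst_sub (t := cast _ x) (t' := cast _ x') HB _)); exact Hx.
Qed.

Lemma sfst_nat : sfst x' ≈ (sfst x)⟪t⟫.
Proof. apply sfst_ssnd_nat. Qed.

Lemma ssnd_nat : ssnd x' ≈ (ssnd x)⟪t⟫.
Proof. apply sfst_ssnd_nat. Qed.

End SigNat.

Section SigPair.
Context {G D} {A : Ty G} {B : Ty (G ▹ A)} {s : Hom D G}.

Lemma sig_pair_ty (a : El (A⟦s⟧)) :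
  B⟦pair a⟧ = B⟦lift (s := s) (A := A) eq_refl⟧⟦inst a⟧.
Proof. ty_eq. Qed.

Definition sig_pair (a : El (A⟦s⟧)) (b : El (B⟦pair a⟧)) : El ((Sig B)⟦s⟧) :=
  cast (eq_sym (Sig_sub B s)) (dpair (cast (sig_pair_ty a) b)).

Lemma cast_sig_pair (a : El (A⟦s⟧)) (b : El (B⟦pair a⟧)) H :
  cast H (sig_pair b) = dpair (cast (sig_pair_ty a) b).
Proof. apply El_ext; reflexivity. Qed.

Lemma sfst_pair (a : El (A⟦s⟧)) (b : El (B⟦pair a⟧)) : sfst (sig_pair b) = a.
Proof. unfold sfst; rewrite cast_sig_pair, dfst_dpair; reflexivity. Qed.

Lemma ssnd_pair (a : El (A⟦s⟧)) (b : El (B⟦pair a⟧)) : ssnd (sig_pair b) ≈ b.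
Proof. unfold ssnd; simpl; rewrite cast_sig_pair, dsnd_dpair; reflexivity. Qed.

End SigPair.

Lemma dpair_ext {G} {A : Ty G} {B : Ty (G ▹ A)} (t t' : El (Sig B)) :
  dfst t ≈ dfst t' -> dsnd t ≈ dsnd t' -> t = t'.
Proof.
  intros H1 H2. rewrite <- (dpair_eta t), <- (dpair_eta t').
  revert H2; generalize (dsnd t) (dsnd t'). apply El_ext in H1; rewrite H1.
  intros b b' H2; f_equal; apply El_ext, H2.
Qed.

Lemma dfst_val {G} {A : Ty G} {B : Ty (G ▹ A)} (t t' : El (Sig B)) :
  t ≈ t' -> dfst t ≈ dfst t' /\ dsnd t ≈ dsnd t'.
Proof. intro H; apply El_ext in H; subst t'; split; reflexivity. Qed.

Lemma sig_ext {G D} {A : Ty G} {B : Ty (G ▹ A)} {s : Hom D G} (t t' : El ((Sig B)⟦s⟧)) :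
  sfst t ≈ sfst t' -> ssnd t ≈ ssnd t' -> t = t'.
Proof.
  intros H1 H2; apply El_ext.
  refine (f_equal (@val _ _ _) (dpair_ext (t := cast (Sig_sub B s) t)
    (t' := cast (Sig_sub B s) t') _ _)).
  - etransitivity; [|etransitivity; [exact H1|]]; apply dfst_val; reflexivity.
  - etransitivity; [|etransitivity; [exact H2|]]; simpl; apply dfst_val; reflexivity.
Qed.

Lemma Id_eq {G D} {A : Ty G} {a b : El A} {s : Hom D G} (e : El ((Id a b)⟦s⟧)) :
  tsub (val a) s = tsub (val b) s.
Proof.
  rewrite Id_sub in e. apply Id_reflection in e.
  exact (f_equal (@val _ _ _) e).
Qed.

Lemma Id_intro_ty {G D} {A : Ty G} {a b : El A} {s : Hom D G} :
  tsub (val a) s = tsub (val b) s -> Id (a⟪s⟫) (a⟪s⟫) = (Id a b)⟦s⟧.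
Proof. intro H; rewrite Id_sub; f_equal; apply El_ext, H. Qed.

Definition Id_intro {G D} {A : Ty G} {a b : El A} {s : Hom D G}
  (H : tsub (val a) s = tsub (val b) s) : El ((Id a b)⟦s⟧) :=
  cast (Id_intro_ty H) (rfl _).

Lemma Id_prop {G D} {A : Ty G} {a b : El A} {s : Hom D G} (e e' : El ((Id a b)⟦s⟧)) :
  e = e'.
Proof. revert e e'; rewrite Id_sub; apply Id_unique. Qed.

End PiSig.

(** * Maps and isomorphisms of types, described on elements at all stages *)

Section Calc.
Context {E : CwF} {T : TypeFormers E}.

(** The equality of families that the two-sided lemmas ask for when [o] is the identity. *)
Lemma lift_idm_ty {G} {A : Ty G} (B : Ty (G ▹ A)) :
  B = B⟦lift (eq_sym (Tsub_id A))⟧.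
Proof.
  symmetry; etransitivity; [|apply Tsub_id]; f_equal; hom_eq.
Qed.

Section Sub.
Context {G D D' : Con} {A : Ty G} {B : Ty (G ▹ A)} {s : Hom D G} {s' : Hom D' G}
  {t : Hom D' D} (Hs : s' = s ∘ t).

Lemma app_sub (f : El ((Pi B)⟦s⟧)) (a : El (A⟦s⟧)) (f' : El ((Pi B)⟦s'⟧)) (a' : El (A⟦s'⟧)) :
  f' ≈ f⟪t⟫ -> a' ≈ a⟪t⟫ -> app f' a' ≈ (app f a)⟪t⟫.
Proof.
  apply (app_nat (o := idm G) (lift_idm_ty B)); rewrite comp_idl; assumption.
Qed.

Lemma sfst_sub (x : El ((Sig B)⟦s⟧)) (x' : El ((Sig B)⟦s'⟧)) :
  x' ≈ x⟪t⟫ -> sfst x' ≈ (sfst x)⟪t⟫.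
Proof.
  apply (sfst_nat (o := idm G) (lift_idm_ty B)); rewrite comp_idl; assumption.
Qed.

Lemma ssnd_sub (x : El ((Sig B)⟦s⟧)) (x' : El ((Sig B)⟦s'⟧)) :
  x' ≈ x⟪t⟫ -> ssnd x' ≈ (ssnd x)⟪t⟫.
Proof.
  apply (ssnd_nat (o := idm G) (lift_idm_ty B)); rewrite comp_idl; assumption.
Qed.

End Sub.

Section Congr.
Context {G D : Con} {A : Ty G} {B : Ty (G ▹ A)} {s s' : Hom D G} (Hs : s' = s).

Lemma app_congr (f : El ((Pi B)⟦s⟧)) (a : El (A⟦s⟧)) (f' : El ((Pi B)⟦s'⟧)) (a' : El (A⟦s'⟧)) :
  f' ≈ f -> a' ≈ a -> app f' a' ≈ app f a.
Proof.
  subst s'; intros Hf Ha; apply El_ext in Hf, Ha; subst; reflexivity.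
Qed.

Lemma sfst_congr (x : El ((Sig B)⟦s⟧)) (x' : El ((Sig B)⟦s'⟧)) : x' ≈ x -> sfst x' ≈ sfst x.
Proof. subst s'; intros Hf; apply El_ext in Hf; subst; reflexivity. Qed.

Lemma sig_ext' (x : El ((Sig B)⟦s⟧)) (x' : El ((Sig B)⟦s'⟧)) :
  sfst x' ≈ sfst x -> ssnd x' ≈ ssnd x -> x' ≈ x.
Proof. subst s'; intros H1 H2; f_equal; apply sig_ext; assumption. Qed.

Lemma pi_ext' (f : El ((Pi B)⟦s⟧)) (f' : El ((Pi B)⟦s'⟧)) :
  (forall K (t : Hom K D) (x : El (A⟦s ∘ t⟧)) (x' : El (A⟦s' ∘ t⟧)), x' ≈ x ->
     app (ecomp (f'⟪t⟫)) x' ≈ app (ecomp (f⟪t⟫)) x) -> f' ≈ f.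
Proof. subst s'; intros H; f_equal; apply pi_ext; intros; apply H; reflexivity. Qed.

End Congr.

(** The Yoneda description of a map [X -> Y] over [G]: a natural family of functions on elements.
    Isomorphisms can then be defined element by element and become terms by evaluation at the
    generic element. *)
Record NatMap {G} (X Y : Ty G) := mkNatMap {
  nfun : forall D (s : Hom D G), El (X⟦s⟧) -> El (Y⟦s⟧);
  nfun_nat : forall D K (s : Hom D G) (t : Hom K D) (s' : Hom K G) (x : El (X⟦s⟧))
    (x' : El (X⟦s'⟧)), s' = s ∘ t -> x' ≈ x⟪t⟫ -> nfun x' ≈ (nfun x)⟪t⟫
}.

Lemma nfun_pair {G} {X Y : Ty G} (f : NatMap X Y) {D} {s : Hom D G} (x : El (X⟦s⟧)) :
  tsub (val (nfun f (evar X))) (pair x) = val (nfun f x).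
Proof.
  symmetry; apply (nfun_nat f (t := pair x)); [symmetry; apply wk_pair'|].
  simpl; symmetry; apply var_pair'.
Qed.

Program Definition iso_of {G} {X Y : Ty G} (f : NatMap X Y) (g : NatMap Y X)
  (gf : forall D (s : Hom D G) (x : El (X⟦s⟧)), nfun g (nfun f x) = x)
  (fg : forall D (s : Hom D G) (y : El (Y⟦s⟧)), nfun f (nfun g y) = y) : Iso X Y :=
  {| fwd := nfun f (evar X); bwd := nfun g (evar Y) |}.
Next Obligation. intros; simpl; rewrite nfun_pair, gf; reflexivity. Qed.
Next Obligation. intros; simpl; rewrite nfun_pair, fg; reflexivity. Qed.

Lemma iso_app_of {G} {X Y : Ty G} (f : NatMap X Y) (g : NatMap Y X) gf fg
  {D} {s : Hom D G} (x : El (X⟦s⟧)) : iso_app (iso_of (f := f) (g := g) gf fg) x = nfun f x.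
Proof. apply El_ext; simpl; apply nfun_pair. Qed.

Lemma iso_app_nat {G} {X Y : Ty G} (h : Iso X Y) {D K} {s : Hom D G} {t : Hom K D}
  {s' : Hom K G} (x : El (X⟦s⟧)) (x' : El (X⟦s'⟧)) :
  s' = s ∘ t -> x' ≈ x⟪t⟫ -> iso_app h x' ≈ (iso_app h x)⟪t⟫.
Proof.
  intros -> Hx; simpl. rewrite tsub_comp; f_equal.
  rewrite pair_comp; apply pair_ext; [reflexivity | exact Hx].
Qed.

Lemma iso_app_congr {G} {X Y : Ty G} (h : Iso X Y) {D} {s s' : Hom D G}
  (x : El (X⟦s⟧)) (x' : El (X⟦s'⟧)) :
  s' = s -> x' ≈ x -> iso_app h x' ≈ iso_app h x.
Proof. intros -> Hx; apply El_ext in Hx; subst; reflexivity. Qed.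

Definition iso_sym {G} {X Y : Ty G} (h : Iso X Y) : Iso Y X :=
  {| fwd := bwd h; bwd := fwd h; bwd_fwd := fwd_bwd h; fwd_bwd := bwd_fwd h |}.

Lemma iso_sym_app {G} {X Y : Ty G} (h : Iso X Y) {D} {s : Hom D G} (x : El (X⟦s⟧)) :
  iso_app (iso_sym h) (iso_app h x) = x.
Proof.
  apply El_ext; simpl.
  replace (pair (iso_app h x)) with (pair (fwd h) ∘ pair x).
  - rewrite <- tsub_comp. pose proof (bwd_fwd h) as e; simpl in e; rewrite e; simpl.
    apply var_pair'.
  - apply ext_eta; nf; reflexivity.
Qed.

Lemma iso_app_sym {G} {X Y : Ty G} (h : Iso X Y) {D} {s : Hom D G} (y : El (Y⟦s⟧)) :
  iso_app h (iso_app (iso_sym h) y) = y.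
Proof. exact (iso_sym_app (iso_sym h) y). Qed.

(** [IsoReindex] speaks of forward maps only. The backward statement follows because [y'] is the
    image under [h'] of the preimage of [y], retyped. *)
Lemma iso_sym_reindex {G D} {s : Hom D G} {X Y : Ty G} {X' Y' : Ty D} (h : Iso X Y)
  (h' : Iso X' Y') : X' = X⟦s⟧ -> Y' = Y⟦s⟧ -> IsoReindex s h h' ->
  IsoReindex s (iso_sym h) (iso_sym h').
Proof.
  intros HX HY H K t y y' Hy.
  assert (e : X⟦s ∘ t⟧ = X'⟦t⟧) by (rewrite HX, Tsub_comp; reflexivity).
  pose (x' := cast e (iso_app (iso_sym h) y)).
  assert (Hx : iso_app h (iso_app (iso_sym h) y) ≈ iso_app h' x') by (apply H; reflexivity).
  rewrite iso_app_sym in Hx.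
  assert (y' = iso_app h' x') as -> by (apply El_ext; rewrite <- Hy; exact Hx).
  rewrite iso_sym_app; reflexivity.
Qed.

Lemma iso_reindex_app {G G' D} {X Y : Ty G} {X' Y' : Ty G'} {o : Hom G' G} {h : Iso X Y}
  {h' : Iso X' Y'} (H : IsoReindex o h h') {s : Hom D G} {s' : Hom D G'} (x : El (X⟦s⟧))
  (x' : El (X'⟦s'⟧)) : s = o ∘ s' -> x ≈ x' -> iso_app h x ≈ iso_app h' x'.
Proof. intros -> Hx; apply H, Hx. Qed.

End Calc.

(** * Gluing over unions of propositions *)

Section Gluing.
Context {E : CwF} {T : TypeFormers E}.

Lemma IsProp_sub {G D} {A : Ty G} (s : Hom D G) : IsProp A -> IsProp (A⟦s⟧).
Proof. intros H K t; rewrite Tsub_comp; apply H. Qed.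

(** Context morphisms into an extension by a proposition need be compared only on the base. This
    settles every comparison of witnesses of cofibrations, even when their types are merely
    equal. *)
Lemma IsProp_hom {G D} {A : Ty G} (HA : IsProp A) (s t : Hom D (G ▹ A)) :
  wk A ∘ s = wk A ∘ t -> s = t.
Proof.
  intro H; apply ext_eta; [assumption|].
  assert (e : ty (tsub (var A) s) = A⟦wk A ∘ s⟧) by (rewrite ty_tsub, ty_var, Tsub_comp; reflexivity).
  assert (e' : ty (tsub (var A) t) = A⟦wk A ∘ s⟧) by (rewrite ty_tsub, ty_var, Tsub_comp, H; reflexivity).
  exact (f_equal (@val _ _ _) (HA _ _ (mkEl e) (mkEl e'))).
Qed.

Program Definition sum_inl {G} {A B : Ty G} (a : El A) : El (Sum A B) :=
  ⌊(evar (Sum A B))⟪inl A B ∘ inst a⟫⌋.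
Next Obligation.
  intros; nf; rewrite <- (comp_assoc (wk _) (inl A B)), wk_inl, wk_inst; nf; reflexivity.
Qed.

Program Definition sum_inr {G} {A B : Ty G} (a : El B) : El (Sum A B) :=
  ⌊(evar (Sum A B))⟪inr A B ∘ inst a⟫⌋.
Next Obligation.
  intros; nf; rewrite <- (comp_assoc (wk _) (inr A B)), wk_inr, wk_inst; nf; reflexivity.
Qed.

Program Definition trunc_intro {G} {A : Ty G} (a : El A) : El (Trunc A) :=
  ⌊(evar (Trunc A))⟪trunc A ∘ inst a⟫⌋.
Next Obligation.
  intros; nf; rewrite <- (comp_assoc (wk _) (trunc A)), wk_trunc, wk_inst; nf; reflexivity.
Qed.

Definition or_inl {G} {A B : Ty G} (a : El A) : El (Or A B) := trunc_intro (sum_inl a).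
Definition or_inr {G} {A B : Ty G} (a : El B) : El (Or A B) := trunc_intro (sum_inr a).

Lemma Or_sub {G D} (A B : Ty G) (s : Hom D G) : (Or A B)⟦s⟧ = Or (A⟦s⟧) (B⟦s⟧).
Proof. unfold Or; rewrite Trunc_sub, Sum_sub; reflexivity. Qed.

Program Definition or_elim {H} {X Y C : Ty H} (HC : IsProp C) (v : El (Or X Y))
  (c1 : El (C⟦wk X⟧)) (c2 : El (C⟦wk Y⟧)) : El C :=
  ⌊(trunc_elim (C := C⟦wk (Trunc (Sum X Y))⟧) (IsProp_sub HC)
     ⌊case (C := C⟦wk (Sum X Y)⟧) ⌊c1⌋ ⌊c2⌋⌋)⟪inst v⟫⌋.
Next Obligation. intros; nf; rewrite ?wk_inl, ?wk_inr, ?wk_trunc; reflexivity. Qed.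
Next Obligation. intros; nf; rewrite ?wk_inl, ?wk_inr, ?wk_trunc; reflexivity. Qed.
Next Obligation. intros; nf; rewrite ?wk_inl, ?wk_inr, ?wk_trunc; reflexivity. Qed.
Next Obligation. intros; nf; rewrite ?wk_inl, ?wk_inr, ?wk_trunc; reflexivity. Qed.

(** Equality of elements is a proposition, the extensional identity type, so the truncated
    disjunction may be eliminated into it. *)
Lemma or_ext {H} {X Y : Ty H} (v : El (Or X Y)) (A : Ty H) (a b : El A) :
  a⟪wk X⟫ ≈ b⟪wk X⟫ -> a⟪wk Y⟫ ≈ b⟪wk Y⟫ -> a = b.
Proof.
  intros H1 H2. apply Id_reflection.
  apply (or_elim (X := X) (Y := Y)); [|exact v|apply Id_intro, H1|apply Id_intro, H2].
  intros D s x y; apply Id_prop.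
Qed.

(** [x : A |- forall u:X, x = a1 u] *)
Section Restricts.
Context {H : Con} {X : Ty H} {A : Ty H} (a1 : El (A⟦wk X⟧)).

Program Definition Restricts : Ty (H ▹ A) :=
  Pi (A := X⟦wk A⟧)
    (Id ((evar A)⟪wk (X⟦wk A⟧)⟫) ⌊a1⟪lift (s := wk A) (A := X) eq_refl⟫⌋).
Next Obligation. ty_eq. Qed.

Lemma Restricts_prop : IsProp Restricts.
Proof. intros D s f f'. apply pi_ext; intros; f_equal; apply Id_prop. Qed.

Lemma Restricts_elim {D} {s : Hom D H} {a : El (A⟦s⟧)} (f : El (Restricts⟦pair a⟧))
  {K} (t : Hom K D) (x : El (X⟦s ∘ t⟧)) : tsub (val a) t = tsub (val a1) (pair x).
Proof.
  assert (e : X⟦s ∘ t⟧ = X⟦wk A⟧⟦pair a ∘ t⟧) by ty_eq.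
  pose proof (Id_eq (app (s := pair a ∘ t) (ecomp (f⟪t⟫)) (cast e x))) as H0.
  simpl in H0. revert H0; nf. intros ->. f_equal. hom_eq.
Qed.

Program Definition Restricts_intro {D} {s : Hom D H} {a : El (A⟦s⟧)}
  (Ha : forall K (t : Hom K D) (x : El (X⟦s ∘ t⟧)), tsub (val a) t = tsub (val a1) (pair x)) :
  El (Restricts⟦pair a⟧) := pi_lam (Id_intro _).
Next Obligation.
  intros. nf.
  assert (e : X⟦wk A⟧⟦pair a⟧⟦wk (X⟦wk A⟧⟦pair a⟧)⟧
    = X⟦s ∘ wk (X⟦wk A⟧⟦pair a⟧)⟧) by ty_eq.
  rewrite (Ha _ _ (cast e (evar _))). f_equal. hom_eq.
Qed.

End Restricts.

Section Glue.
Context {H : Con} {X Y : Ty H} (HX : IsProp X) (HY : IsProp Y) (v : El (Or X Y)) {A : Ty H}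
  (a1 : El (A⟦wk X⟧)) (a2 : El (A⟦wk Y⟧))
  (compat : forall K (r : Hom K H) (x : El (X⟦r⟧)) (y : El (Y⟦r⟧)),
     tsub (val a1) (pair x) = tsub (val a2) (pair y)).

(** [A] need not be a proposition, so the truncated disjunction cannot be eliminated into it
    directly. The type of elements of [A] that extend both [a1] and [a2] is a proposition once [X]
    or [Y] holds, and serves as the target. *)
Definition Glued : Ty H := Sig (A := A) (And (Restricts a1) (Restricts a2)).

Lemma And_sub_ty {G} {A1 B1 : Ty G} {D} {s : Hom D G} (a : El (A1⟦s⟧)) :
  B1⟦wk A1⟧⟦pair a⟧ = B1⟦s⟧.
Proof. ty_eq. Qed.

Definition and_fst {G} {A1 B1 : Ty G} {D} {s : Hom D G} (x : El ((And A1 B1)⟦s⟧)) :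
  El (A1⟦s⟧) := sfst (B := B1⟦wk A1⟧) x.
Definition and_snd {G} {A1 B1 : Ty G} {D} {s : Hom D G} (x : El ((And A1 B1)⟦s⟧)) :
  El (B1⟦s⟧) := cast (And_sub_ty _) (ssnd (B := B1⟦wk A1⟧) x).
Definition and_intro {G} {A1 B1 : Ty G} {D} {s : Hom D G} (x : El (A1⟦s⟧)) (y : El (B1⟦s⟧)) :
  El ((And A1 B1)⟦s⟧) := sig_pair (B := B1⟦wk A1⟧) (a := x) (cast (eq_sym (And_sub_ty _)) y).

Lemma And_prop {G} (A1 B1 : Ty G) : IsProp A1 -> IsProp B1 -> IsProp (And A1 B1).
Proof.
  intros H1 H2 D s x y. apply sig_ext.
  - f_equal; apply H1.
  - exact (f_equal (@val _ _ _) (H2 _ _ (and_snd x) (and_snd y))).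
Qed.

(** Two common extensions agree with [a1] on [X] and with [a2] on [Y], hence agree by [or_ext]; the
    extension conditions themselves are propositions. *)
Lemma Glued_prop : IsProp Glued.
Proof.
  intros D s x y.
  assert (Hxy : sfst x = sfst y).
  { pose (v' := cast (Or_sub X Y s) (v⟪s⟫)).
    pose proof (ssnd x) as px. pose proof (ssnd y) as py.
    apply (or_ext v'); simpl.
    - rewrite (Restricts_elim (and_fst px) (ecomp (evar (X⟦s⟧)))).
      rewrite (Restricts_elim (and_fst py) (ecomp (evar (X⟦s⟧)))). reflexivity.
    - rewrite (Restricts_elim (and_snd px) (ecomp (evar (Y⟦s⟧)))).
      rewrite (Restricts_elim (and_snd py) (ecomp (evar (Y⟦s⟧)))). reflexivity. }
  apply sig_ext; [f_equal; exact Hxy|].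
  generalize (ssnd x) (ssnd y); rewrite Hxy; intros p q.
  f_equal; apply (And_prop (Restricts_prop (a1 := a1)) (Restricts_prop (a1 := a2))).
Qed.

Definition glue_el : El Glued.
Proof.
  refine (or_elim Glued_prop v _ _).
  (* Over [X] the element is [a1]: it extends itself because [X] is a proposition, and it extends
     [a2] by [compat]. The other case is symmetric. *)
  - unshelve refine (sig_pair (a := a1) (and_intro (Restricts_intro _) (Restricts_intro _))).
    + intros K t x; f_equal; apply IsProp_hom; [exact HX|]; nf; reflexivity.
    + intros K t y. rewrite <- (compat (ecomp ((evar X)⟪t⟫)) y).
      f_equal; apply IsProp_hom; [exact HX|]; nf; reflexivity.
  - unshelve refine (sig_pair (a := a2) (and_intro (Restricts_intro _) (Restricts_intro _))).
    + intros K t x. rewrite (compat x (ecomp ((evar Y)⟪t⟫))).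
      f_equal; apply IsProp_hom; [exact HY|]; nf; reflexivity.
    + intros K t y; f_equal; apply IsProp_hom; [exact HY|]; nf; reflexivity.
Defined.

Definition or_glue : El A := dfst glue_el.

Lemma or_glue_spec : or_glue⟪wk X⟫ ≈ a1 /\ or_glue⟪wk Y⟫ ≈ a2.
Proof.
  unfold or_glue.
  pose (g := cast (eq_sym (Tsub_id Glued)) glue_el).
  assert (Hg : sfst g ≈ dfst glue_el).
  { unfold sfst. etransitivity; [refine (proj1 (dfst_sub (s := idm H) (H := eq_refl) eq_refl
      (t := glue_el) _))|]; [simpl; symmetry; apply tsub_id|].
    simpl; apply tsub_id. }
  split; simpl; rewrite <- Hg.
  - rewrite (Restricts_elim (and_fst (ssnd g)) (cast (f_equal (Tsub X) (eq_sym (comp_idl (wk X)))) (evar X))).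
    etransitivity; [|apply tsub_id]; f_equal; hom_eq.
  - rewrite (Restricts_elim (and_snd (ssnd g)) (cast (f_equal (Tsub Y) (eq_sym (comp_idl (wk Y)))) (evar Y))).
    etransitivity; [|apply tsub_id]; f_equal; hom_eq.
Qed.

End Glue.
End Gluing.

(** * Cofibrations *)

Section CofLemmas.
Context {E : CwF} {T : TypeFormers E} {I : Interval T} {C : Cofibrations I}.

Lemma holds_prop {G} (phi : Elc (code Cof) G) : IsProp (holds phi).
Proof. apply IsProp_sub, Cof_prop. Qed.

Lemma holds_hom {G D} {phi : Elc (code Cof) G} (s t : Hom D (G ▹ holds phi)) :
  wk (holds phi) ∘ s = wk (holds phi) ∘ t -> s = t.
Proof. apply IsProp_hom, holds_prop. Qed.

Lemma holds_sub {G D} (phi : Elc (code Cof) G) (s : Hom D G) :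
  holds (phi ∘ s) = (holds phi)⟦s⟧.
Proof. symmetry; apply Tsub_comp. Qed.

Definition hcast {G G' D} {phi : Elc (code Cof) G} {phi' : Elc (code Cof) G'} {d : Hom D G}
  {d' : Hom D G'} (u : El ((holds phi)⟦d⟧)) (e : phi ∘ d = phi' ∘ d') : El ((holds phi')⟦d'⟧).
Proof. refine (cast _ u). rewrite <- !holds_sub, e; reflexivity. Defined.

(** Extensionality in external form. The two implications are used only at the generic witness,
    which is then abstracted. *)
Lemma cof_ext' {G} (phi psi : Elc (code Cof) G) :
  (forall K (d : Hom K G), El ((holds phi)⟦d⟧) -> El ((holds psi)⟦d⟧)) ->
  (forall K (d : Hom K G), El ((holds psi)⟦d⟧) -> El ((holds phi)⟦d⟧)) -> phi = psi.
Proof.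
  intros H1 H2; apply cof_ext; apply lam; [apply H1 | apply H2]; apply evar.
Qed.

Lemma elem_eq {X : Ty emp} {G} (x y : Elc X G) : val (elem x) = val (elem y) -> x = y.
Proof. apply elc_ext. Qed.

Lemma cof_eq_elim {G D} {b : bool} {i : Elc II G} {d : Hom D G}
  (u : El ((holds (cof_eq b i))⟦d⟧)) : i ∘ d = endpoint b D.
Proof.
  pose proof (Id_eq (iso_app (cof_eq_iso b i) u)) as H.
  apply elc_ext. simpl in H. rewrite <- tsub_comp, H. unfold endpoint, const; nf.
  f_equal; apply f_equal. apply bang_uniq.
Qed.

Definition cof_eq_intro {G D} {b : bool} {i : Elc II G} {d : Hom D G}
  (H : i ∘ d = endpoint b D) : El ((holds (cof_eq b i))⟦d⟧).
Proof.
  refine (iso_app (iso_sym (cof_eq_iso b i)) (Id_intro _)).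
  simpl. rewrite !tsub_comp. f_equal. rewrite H; unfold endpoint, const; nf.
  f_equal. apply bang_uniq.
Defined.

Definition cof_or_elim {G D} {phi psi : Elc (code Cof) G} {d : Hom D G}
  (u : El ((holds (cof_or phi psi))⟦d⟧)) : El (Or ((holds phi)⟦d⟧) ((holds psi)⟦d⟧)) :=
  cast (Or_sub _ _ _) (iso_app (cof_or_iso phi psi) u).

Definition cof_or_intro {G D} {phi psi : Elc (code Cof) G} {d : Hom D G}
  (u : El (Or ((holds phi)⟦d⟧) ((holds psi)⟦d⟧))) : El ((holds (cof_or phi psi))⟦d⟧) :=
  iso_app (iso_sym (cof_or_iso phi psi)) (cast (eq_sym (Or_sub _ _ _)) u).

Definition cof_inl {G D} {phi psi : Elc (code Cof) G} {d : Hom D G}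
  (u : El ((holds phi)⟦d⟧)) : El ((holds (cof_or phi psi))⟦d⟧) := cof_or_intro (or_inl u).
Definition cof_inr {G D} {phi psi : Elc (code Cof) G} {d : Hom D G}
  (u : El ((holds psi)⟦d⟧)) : El ((holds (cof_or phi psi))⟦d⟧) := cof_or_intro (or_inr u).

Definition cof_sig_fst {G D} {phi : Elc (code Cof) G} {psi : Elc (code Cof) (G ▹ holds phi)}
  {d : Hom D G} (u : El ((holds (cof_sig psi))⟦d⟧)) : El ((holds phi)⟦d⟧) :=
  sfst (iso_app (cof_sig_iso psi) u).

Definition cof_sig_snd {G D} {phi : Elc (code Cof) G} {psi : Elc (code Cof) (G ▹ holds phi)}
  {d : Hom D G} (u : El ((holds (cof_sig psi))⟦d⟧)) (v : El ((holds phi)⟦d⟧)) :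
  El ((holds psi)⟦pair v⟧).
Proof.
  refine (hcast (ssnd (iso_app (cof_sig_iso psi) u)) _).
  f_equal; apply holds_hom; nf; reflexivity.
Defined.

Definition cof_sig_intro {G D} {phi : Elc (code Cof) G} {psi : Elc (code Cof) (G ▹ holds phi)}
  {d : Hom D G} (v : El ((holds phi)⟦d⟧)) (w : El ((holds psi)⟦pair v⟧)) :
  El ((holds (cof_sig psi))⟦d⟧) := iso_app (iso_sym (cof_sig_iso psi)) (sig_pair w).

Lemma or_cases {G D} {phi psi : Elc (code Cof) G} {d : Hom D G}
  (u : El ((holds (cof_or phi psi))⟦d⟧)) {A : Ty D} (a b : El A) :
  (forall K (t : Hom K D), El ((holds phi)⟦d ∘ t⟧) -> a⟪t⟫ ≈ b⟪t⟫) ->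
  (forall K (t : Hom K D), El ((holds psi)⟦d ∘ t⟧) -> a⟪t⟫ ≈ b⟪t⟫) -> a = b.
Proof.
  intros H1 H2; apply (or_ext (cof_or_elim u)); [apply H1 | apply H2];
    exact (ecomp (evar _)).
Qed.

(** The operations on cofibrations are not assumed to commute with substitution. They do by
    extensionality: both sides hold at the same stages. The same argument serves [cof_or] and
    [cof_sig]. *)
Lemma cof_eq_sub {G D} (b : bool) (i : Elc II G) (s : Hom D G) :
  cof_eq b i ∘ s = cof_eq b (i ∘ s).
Proof.
  apply cof_ext'; intros K d u.
  - rewrite holds_sub, Tsub_comp in u.
    apply cof_eq_intro; rewrite comp_assoc; apply (cof_eq_elim u).
  - rewrite holds_sub, Tsub_comp.
    apply cof_eq_intro; rewrite <- comp_assoc; apply (cof_eq_elim u).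
Qed.

Lemma cof_or_sub {G D} (phi psi : Elc (code Cof) G) (s : Hom D G) :
  cof_or phi psi ∘ s = cof_or (phi ∘ s) (psi ∘ s).
Proof.
  apply cof_ext'; intros K d u.
  - rewrite holds_sub, Tsub_comp in u. apply cof_or_elim in u.
    apply cof_or_intro. rewrite !holds_sub, !Tsub_comp; exact u.
  - rewrite holds_sub, Tsub_comp. apply cof_or_elim in u.
    rewrite !holds_sub, !Tsub_comp in u. apply cof_or_intro; exact u.
Qed.

(** [psi] and [psi'] live over different context extensions, so they are compared through their
    values at witnesses. *)
Lemma cof_sig_sub {G D} (phi : Elc (code Cof) G) (psi : Elc (code Cof) (G ▹ holds phi))
  (s : Hom D G) (phi' : Elc (code Cof) D) (psi' : Elc (code Cof) (D ▹ holds phi')) :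
  phi' = phi ∘ s ->
  (forall K (d : Hom K D) (u : El ((holds phi)⟦s ∘ d⟧)) (u' : El ((holds phi')⟦d⟧)),
     psi' ∘ pair u' = psi ∘ pair u) ->
  cof_sig psi ∘ s = cof_sig psi'.
Proof.
  intros -> H. apply cof_ext'; intros K d u.
  - rewrite holds_sub, Tsub_comp in u.
    pose (v := cof_sig_fst u).
    assert (e : phi ∘ (s ∘ d) = phi ∘ s ∘ d) by (symmetry; apply comp_assoc).
    apply (cof_sig_intro (v := hcast v e)).
    refine (hcast (cof_sig_snd u v) _). symmetry; apply H.
  - rewrite holds_sub, Tsub_comp.
    pose (v := cof_sig_fst u).
    assert (e : phi ∘ s ∘ d = phi ∘ (s ∘ d)) by apply comp_assoc.
    apply (cof_sig_intro (v := hcast v e)).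
    refine (hcast (cof_sig_snd u v) _). apply H.
Qed.

Lemma endpoint_sub (b : bool) {G D} (s : Hom D G) : endpoint b G ∘ s = endpoint b D.
Proof. unfold endpoint, const; rewrite comp_assoc; f_equal; apply bang_uniq. Qed.

Lemma conn_sub (b : bool) {G D} (i j : Elc II G) (s : Hom D G) :
  conn b i j ∘ s = conn b (i ∘ s) (j ∘ s).
Proof. destruct b; [apply join_sub | apply meet_sub]. Qed.

(** With the next two laws: [j |-> conn b i j] runs from [b] to [i], and is constant when [i] is
    [b]. This is what turns composition along it into filling. *)
Lemma conn_end (b : bool) {G} (i : Elc II G) : conn b i (endpoint b G) = endpoint b G.
Proof. destruct b; [apply join_i1 | apply meet_i0]. Qed.

Lemma conn_end_l (b : bool) {G} (j : Elc II G) : conn b (endpoint b G) j = endpoint b G.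
Proof. destruct b; [apply join_1i | apply meet_0i]. Qed.

Lemma conn_opp (b : bool) {G} (i : Elc II G) : conn b i (endpoint (negb b) G) = i.
Proof. destruct b; [apply join_i0 | apply meet_i1]. Qed.

Lemma endpoints_disjoint {D} : endpoint false D = endpoint true D -> El (Zero D).
Proof.
  intro H.
  assert (e : tsub (val (elem i0)) (bang D) = tsub (val (elem i1)) (bang D)).
  { simpl. rewrite !tsub_comp. f_equal. exact H. }
  pose (f := cast (eq_sym (Tsub_id _)) (i0_neq_i1 (Interval := I))).
  pose proof (app (s := idm emp ∘ bang D) (ecomp (f⟪bang D⟫))
    (cast (f_equal (Tsub _) (eq_sym (comp_idl (bang D)))) (Id_intro e))) as z.
  rewrite Tsub_comp, Zero_sub in z; exact z.
Qed.

Lemma cof_bot_elim {D K} {d : Hom K D} (u : El ((holds (cof_bot D))⟦d⟧)) : El (Zero K).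
Proof.
  apply endpoints_disjoint. rewrite <- (cof_eq_elim u).
  symmetry; exact (endpoint_sub false d).
Qed.

Lemma cof_bot_sub {D K} (s : Hom K D) : cof_bot D ∘ s = cof_bot K.
Proof. unfold cof_bot. rewrite cof_eq_sub. f_equal. exact (endpoint_sub false s). Qed.

Lemma absurd_eq {G} {A B : Ty G} (a : El A) (b : El B) : A = B -> El (Zero G) -> a ≈ b.
Proof. intros ->; intro z; f_equal; apply absurd_unique, z. Qed.

End CofLemmas.
#[global] Hint Rewrite @endpoint_sub : hom.

(** * The type of composition operations *)

Section AppMore.
Context {E : CwF} {T : TypeFormers E}.

(** Links the application [app_id] at the identity stage, from which [solve] is built, with
    application at a stage. *)
Lemma app_app_id {G D} {A : Ty G} {B : Ty (G ▹ A)} {s : Hom D G} {A' : Ty D}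
  (H : A' = A⟦s⟧) {B' : Ty (D ▹ A')} (HB : B' = B⟦lift H⟧)
  (f : El ((Pi B)⟦s⟧)) (a : El (A⟦s⟧)) (f' : El (Pi B')) (a' : El A') :
  f' ≈ f -> a' ≈ a -> app_id f' a' ≈ app f a.
Proof.
  subst A' B'; intros Hf Ha. unfold app, app_id; simpl.
  apply El_ext in Ha; subst a'. do 3 f_equal. apply El_ext, Hf.
Qed.

Lemma app_lam_sub {G D} {A : Ty G} {B : Ty (G ▹ A)} {s : Hom D G} (b : El B)
  (f : El ((Pi B)⟦s⟧)) (a : El (A⟦s⟧)) :
  f ≈ (lam b)⟪s⟫ -> app f a ≈ b⟪pair a⟫.
Proof.
  intro Hf.
  assert (f = pi_lam (b⟪lift (s := s) (A := A) eq_refl⟫)) as ->.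
  { apply El_ext. rewrite Hf, lam_sub; reflexivity. }
  rewrite app_lam; simpl; nf; f_equal; hom_eq.
Qed.

End AppMore.

(** * The constituents of [Comp] at a stage *)

Section CompStage.
Context {E : CwF} {T : TypeFormers E} {I : Interval T} {P : PathContexts I}
  {C : Cofibrations I}.

Lemma clift_hom (X : Ty emp) {G D} (s : Hom D G) : wk (X⟦bang G⟧) ∘ clift X s = s ∘ wk (X⟦bang D⟧).
Proof. hom_eq. Qed.

Definition tubev {G} {A : Ty (G ▸ II)} {phi : Elc (code Cof) G} (f : El (Tube A phi)) :
  El (A⟦clift II (wk (holds phi))⟧) := unlam (unlam f).

Lemma tubev_stage {G D} {A : Ty (G ▸ II)} {phi : Elc (code Cof) G} {A' : Ty (D ▸ II)}
  {phi' : Elc (code Cof) D} (s : Hom D G) (f : El (Tube A phi)) (f' : El (Tube A' phi')) :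
  A' = A⟦clift II s⟧ -> phi' = phi ∘ s -> f' ≈ f⟪s⟫ ->
  forall K (r : Hom K D) (u : El ((holds phi)⟦s ∘ r⟧)) (u' : El ((holds phi')⟦r⟧)) (i : Elc II K),
  tsub (val (tubev f')) (cpair (pair u') i) = tsub (val (tubev f)) (cpair (pair u) i).
Proof.
  intros -> -> Hf K r u u' i. unfold tubev.
  rewrite (unlam_sub (Tube_inner_sub A phi s) (unlam_sub (Tube_body_sub A phi s) Hf)).
  simpl; nf; f_equal.
  apply chom_ext; [|nf; reflexivity].
  apply holds_hom; unfold lift_el; nf. reflexivity.
Qed.

Lemma tube_at_val {G} {A : Ty (G ▸ II)} {phi : Elc (code Cof) G} (f : El (Tube A phi))
  (i : Elc II G) {K} (r : Hom K G) (u : El ((holds phi)⟦r⟧)) :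
  tsub (val (tube_at f i)) (pair u) = tsub (val (tubev f)) (cpair (pair u) (i ∘ r)).
Proof. simpl; rewrite tsub_comp; f_equal. hom_eq. Qed.

Section AgreeStage.
Context {G} {A : Ty (G ▸ II)} {phi : Elc (code Cof) G} (f : El (Tube A phi)) {i : Elc II G}
  (a : El (at_ A i)) {D} {s : Hom D G}.

Lemma agree_elim (h : El ((Agree f a)⟦s⟧)) {K} {r : Hom K D} (u : El ((holds phi)⟦s ∘ r⟧)) :
  tsub (val (tubev f)) (cpair (pair u) (i ∘ s ∘ r)) = tsub (val a) (s ∘ r).
Proof.
  pose proof (Id_eq (app (s := s ∘ r) (ecomp (h⟪r⟫)) u)) as H.
  rewrite tube_at_val in H. rewrite comp_assoc, H. simpl. nf. reflexivity.
Qed.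

Definition agree_intro
  (H : forall K (r : Hom K D) (u : El ((holds phi)⟦s ∘ r⟧)),
    tsub (val (tubev f)) (cpair (pair u) (i ∘ s ∘ r)) = tsub (val a) (s ∘ r)) :
  El ((Agree f a)⟦s⟧).
Proof.
  refine (pi_lam (Id_intro _)).
  pose (u := ecomp (evar ((holds phi)⟦s⟧))).
  replace (lift (s := s) (A := holds phi) eq_refl) with (pair u) by hom_eq.
  rewrite tube_at_val, <- comp_assoc, H. simpl; nf; reflexivity.
Defined.

Lemma agree_prop (h h' : El ((Agree f a)⟦s⟧)) : h = h'.
Proof. apply pi_ext; intros; f_equal; apply Id_prop. Qed.

End AgreeStage.

Section BodySub.
Context {G D} {A : Ty (G ▸ II)} {e : Elc Two G} {s : Hom D G} {A' : Ty (D ▸ II)}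
  {e' : Elc Two D} (HA : A' = A⟦clift II s⟧) (He : e' = e ∘ s).

(** [app_nat] asks for stability of the codomain of a product. Stability of the whole type does not
    yield it, as [Pi] is not known to be injective, so it is established for each quantifier of
    [Comp] separately. *)
Lemma Comp0_body (H : Two⟦bang D⟧ = Two⟦bang G⟧⟦s⟧) :
  Comp1 (A'⟦clift II (wk (Two⟦bang D⟧))⟧) (cvar Two D)
  = (Comp1 (A⟦clift II (wk (Two⟦bang G⟧))⟧) (cvar Two G))⟦lift H⟧.
Proof.
  subst; symmetry; apply Comp1_sub.
  - rewrite !clift_sub, wk_lift; reflexivity.
  - apply cvar_lift.
Qed.

Lemma Comp1_body (H : (code Cof)⟦bang D⟧ = (code Cof)⟦bang G⟧⟦s⟧) :
  Comp2 (A'⟦clift II (wk ((code Cof)⟦bang D⟧))⟧) (e' ∘ wk ((code Cof)⟦bang D⟧)) (cvar (code Cof) D)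
  = (Comp2 (A⟦clift II (wk ((code Cof)⟦bang G⟧))⟧) (e ∘ wk ((code Cof)⟦bang G⟧))
      (cvar (code Cof) G))⟦lift H⟧.
Proof.
  subst; symmetry; apply Comp2_sub.
  - rewrite !clift_sub, wk_lift; reflexivity.
  - rewrite !comp_assoc, wk_lift; reflexivity.
  - apply cvar_lift.
Qed.

Context {phi : Elc (code Cof) G} {phi' : Elc (code Cof) D} (Hp : phi' = phi ∘ s).

(** The casts [q] and [q'] are arbitrary, so that the statement matches the retyped variables inside
    [Comp2] whatever proofs they carry. *)
Lemma Comp2_body (H : Tube A' phi' = (Tube A phi)⟦s⟧) :
  let w := wk (Tube A phi) in
  let w' := wk (Tube A' phi') in
  forall (q : (Tube A phi)⟦w⟧ = Tube (A⟦clift II w⟧) (phi ∘ w))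
    (q' : (Tube A' phi')⟦w'⟧ = Tube (A'⟦clift II w'⟧) (phi' ∘ w')),
  Comp3 (A := A'⟦clift II w'⟧) (e' ∘ w') (phi := phi' ∘ w')
    (cast q' (evar (Tube A' phi')))
  = (Comp3 (A := A⟦clift II w⟧) (e ∘ w) (phi := phi ∘ w)
      (cast q (evar (Tube A phi))))⟦lift H⟧.
Proof.
  intros w w' *; subst w w'; subst; symmetry; apply Comp3_sub.
  - rewrite !clift_sub, wk_lift; reflexivity.
  - rewrite !comp_assoc, wk_lift; reflexivity.
  - rewrite !comp_assoc, wk_lift; reflexivity.
  - simpl; rewrite var_lift; reflexivity.
Qed.

Context {f : El (Tube A phi)} {f' : El (Tube A' phi')} (Hf : f' ≈ f⟪s⟫).

Lemma Comp3_body (H : at_ A' (incl ∘ e') = (at_ A (incl ∘ e))⟦s⟧) :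
  let w := wk (at_ A (incl ∘ e)) in
  let w' := wk (at_ A' (incl ∘ e')) in
  forall (q : (Tube A phi)⟦w⟧ = Tube (A⟦clift II w⟧) (phi ∘ w))
    (q' : (Tube A' phi')⟦w'⟧ = Tube (A'⟦clift II w'⟧) (phi' ∘ w'))
    (p : (at_ A (incl ∘ e))⟦w⟧ = at_ (A⟦clift II w⟧) (incl ∘ (e ∘ w)))
    (p' : (at_ A' (incl ∘ e'))⟦w'⟧ = at_ (A'⟦clift II w'⟧) (incl ∘ (e' ∘ w'))),
  Comp4 (A := A'⟦clift II w'⟧) (e := e' ∘ w') (phi := phi' ∘ w')
    (cast q' (f'⟪w'⟫)) (cast p' (evar _))
  = (Comp4 (A := A⟦clift II w⟧) (e := e ∘ w) (phi := phi ∘ w)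
     (cast q (f⟪w⟫)) (cast p (evar _)))⟦lift H⟧.
Proof.
  intros w w' *; subst w w'; subst; symmetry; apply Comp4_sub.
  - rewrite !clift_sub, wk_lift; reflexivity.
  - rewrite !comp_assoc, wk_lift; reflexivity.
  - rewrite !comp_assoc, wk_lift; reflexivity.
  - simpl; rewrite Hf; simpl; rewrite !tsub_comp, wk_lift; reflexivity.
  - simpl; rewrite var_lift; reflexivity.
Qed.

End BodySub.
End CompStage.

(** * Case analysis on the closed type [Two] in an arbitrary context *)

Section TwoElim.
Context {E : CwF} {T : TypeFormers E}.

Lemma idm_ty {G} {A B : Ty G} : A = B -> A = B⟦idm G⟧.
Proof. intros ->; symmetry; apply Tsub_id. Qed.

(** [Two⟦bang D⟧] is a sum over [D] only up to an equality of types. Realising the equality as a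
    context morphism lets it be composed and cancelled by rewriting. *)
Definition ext_eq {G} {A B : Ty G} (q : A = B) : Hom (G ▹ A) (G ▹ B) :=
  lift (s := idm G) (A := B) (idm_ty q).

Lemma ext_eq_inv {G} {A B : Ty G} (q : A = B) : ext_eq q ∘ ext_eq (eq_sym q) = idm _.
Proof. unfold ext_eq; apply ext_eta; nf; reflexivity. Qed.

Lemma ext_eq_inv_assoc' {G D} {A B : Ty G} (q : A = B) (t : Hom D (G ▹ A)) :
  ext_eq (eq_sym q) ∘ (ext_eq q ∘ t) = t.
Proof. unfold ext_eq; apply ext_eta; nf; reflexivity. Qed.

Definition two_eq (D : Con) := Sum_sub (One emp) (One emp) (bang D).

Lemma one_hom {D} (s t : Hom D (emp ▹ One emp)) : s = t.
Proof.
  apply IsProp_hom; [|apply bang_uniq].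
  intros K r a b; revert a b; rewrite One_sub; intros a b.
  rewrite (star_unique a), (star_unique b); reflexivity.
Qed.

Definition two_pt (b : bool) (D : Con) : Hom D (D ▸ Two) := inst (elem (const D (two b))).

(** By [inl_sub] the injection over [D] is the closed injection reindexed, and any two morphisms
    into the unit type coincide, so it factors through the point. *)
Lemma two_pt_inl D : ext_eq (two_eq D) ∘ inl _ _ = two_pt false D ∘ wk _.
Proof.
  unfold two_pt; apply chom_ext.
  - unfold ext_eq; nf. apply wk_inl.
  - apply elc_ext. etransitivity; [apply var_cvar_assoc|].
    etransitivity; [|symmetry; apply var_cvar_assoc].
    pose proof (f_equal (tsub (var Two)) (inl_sub (One emp) (One emp) (bang D))) as H.
    rewrite !var_lift_assoc in H.
    unfold ext_eq; rewrite var_lift_assoc. etransitivity; [exact H|].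
    rewrite var_inst_comp. simpl. rewrite tsub_comp. unfold const, two. rewrite !comp_assoc.
    do 2 f_equal. apply one_hom.
Qed.

Lemma two_pt_inr D : ext_eq (two_eq D) ∘ inr _ _ = two_pt true D ∘ wk _.
Proof.
  unfold two_pt; apply chom_ext.
  - unfold ext_eq; nf. apply wk_inr.
  - apply elc_ext. etransitivity; [apply var_cvar_assoc|].
    etransitivity; [|symmetry; apply var_cvar_assoc].
    pose proof (f_equal (tsub (var Two)) (inr_sub (One emp) (One emp) (bang D))) as H.
    rewrite !var_lift_assoc in H.
    unfold ext_eq; rewrite var_lift_assoc. etransitivity; [exact H|].
    rewrite var_inst_comp. simpl. rewrite tsub_comp. unfold const, two. rewrite !comp_assoc.
    do 2 f_equal. apply one_hom.
Qed.

Lemma two_ext {D} {C : Ty (D ▸ Two)} (y y' : El C) :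
  (forall b, y⟪two_pt b D⟫ ≈ y'⟪two_pt b D⟫) -> y = y'.
Proof.
  intro H.
  assert (e : y⟪ext_eq (two_eq D)⟫ = y'⟪ext_eq (two_eq D)⟫).
  { apply case_unique; apply El_ext; simpl; rewrite !tsub_comp, ?two_pt_inl, ?two_pt_inr,
      <- !tsub_comp; f_equal; apply H. }
  apply El_ext. apply (f_equal (@val _ _ _)) in e. simpl in e.
  apply (f_equal (fun z => tsub z (ext_eq (eq_sym (two_eq D))))) in e.
  rewrite !tsub_comp, !ext_eq_inv, !tsub_id in e. exact e.
Qed.

Section TwoCase.
Context {D} {C : Ty (D ▸ Two)} (c : forall b, El (C⟦two_pt b D⟧)).

Program Definition two_case : El C :=
  ⌊(case (C := C⟦ext_eq (two_eq D)⟧) ⌊(c false)⟪wk _⟫⌋ ⌊(c true)⟪wk _⟫⌋)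
    ⟪ext_eq (eq_sym (two_eq D))⟫⌋.
Next Obligation. rewrite !Tsub_comp. etransitivity; [|apply Tsub_id]. f_equal; apply ext_eq_inv. Qed.
Next Obligation. rewrite !Tsub_comp; f_equal; symmetry; apply two_pt_inl. Qed.
Next Obligation. rewrite !Tsub_comp; f_equal; symmetry; apply two_pt_inr. Qed.

(** At any element [a] of the unit type, the point [two_pt b D] becomes an injection after undoing
    the equality of types, and the computation rule of [case] applies. *)
Lemma two_case_pt b : two_case⟪two_pt b D⟫ ≈ c b.
Proof.
  assert (a : El ((One emp)⟦bang D⟧)) by (rewrite One_sub; apply star).
  assert (H0 : ext_eq (eq_sym (two_eq D)) ∘ two_pt false D = inl _ _ ∘ inst a).
  { transitivity (ext_eq (eq_sym (two_eq D)) ∘ (ext_eq (two_eq D) ∘ (inl _ _ ∘ inst a)));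
      [|apply ext_eq_inv_assoc'].
    f_equal. rewrite <- comp_assoc. symmetry.
    etransitivity; [apply (f_equal (fun z => z ∘ inst a)), two_pt_inl|].
    rewrite comp_assoc, wk_inst, comp_idr; reflexivity. }
  assert (H1 : ext_eq (eq_sym (two_eq D)) ∘ two_pt true D = inr _ _ ∘ inst a).
  { transitivity (ext_eq (eq_sym (two_eq D)) ∘ (ext_eq (two_eq D) ∘ (inr _ _ ∘ inst a)));
      [|apply ext_eq_inv_assoc'].
    f_equal. rewrite <- comp_assoc. symmetry.
    etransitivity; [apply (f_equal (fun z => z ∘ inst a)), two_pt_inr|].
    rewrite comp_assoc, wk_inst, comp_idr; reflexivity. }
  unfold two_case. simpl. etransitivity; [apply tsub_comp|].
  destruct b.
  - etransitivity; [apply f_equal, H1|]. rewrite <- tsub_comp.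
    match goal with |- tsub (tsub (val (case ?c ?d)) _) _ = _ =>
      etransitivity; [apply (f_equal (fun z => tsub z (inst a))), (f_equal (@val _ _ _) (case_inr c d))|] end.
    simpl. rewrite tsub_comp, wk_inst, tsub_id; reflexivity.
  - etransitivity; [apply f_equal, H0|]. rewrite <- tsub_comp.
    match goal with |- tsub (tsub (val (case ?c ?d)) _) _ = _ =>
      etransitivity; [apply (f_equal (fun z => tsub z (inst a))), (f_equal (@val _ _ _) (case_inl c d))|] end.
    simpl. rewrite tsub_comp, wk_inst, tsub_id; reflexivity.
Qed.
End TwoCase.
End TwoElim.

(** * Composition problems and their reindexing *)

Section Ops.
Context {E : CwF} {T : TypeFormers E} {I : Interval T} {C : Cofibrations I}.

Lemma lam_nat {G D} {A : Ty G} {B : Ty (G ▹ A)} {s : Hom D G} {A' : Ty D}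
  (H : A' = A⟦s⟧) {B' : Ty (D ▹ A')} (HB : B' = B⟦lift H⟧) (b : El B) (b' : El B') :
  b' ≈ b⟪lift H⟫ -> lam b' ≈ (lam b)⟪s⟫.
Proof.
  subst A' B'; intro Hb; apply El_ext in Hb; subst b'. rewrite lam_sub; reflexivity.
Qed.

Lemma sig_ext_prop {G D} {A : Ty G} {B : Ty (G ▹ A)} {s : Hom D G} (t t' : El ((Sig B)⟦s⟧)) :
  IsProp B -> sfst t ≈ sfst t' -> t = t'.
Proof.
  intros HB H. apply sig_ext; [assumption|].
  generalize (ssnd t) (ssnd t'). apply El_ext in H; rewrite H. intros p q; f_equal; apply HB.
Qed.

(** The context of a tube depends on its cofibration, so tubes of two problems are compared through
    their values at a witness and a point of the interval. *)
Definition tapp {D} {A : Ty (D ▸ II)} {b : bool} {phi : Elc (code Cof) D} (pb : Problem A b phi)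
  {K} {d : Hom K D} (u : El ((holds phi)⟦d⟧)) (i : Elc II K) : Tm K :=
  tsub (val (tube pb)) (cpair (pair u) i).

(** [pb'] is the reindexing of [pb] along [t]. *)
Record PNat {D D'} (t : Hom D' D) {A : Ty (D ▸ II)} {b : bool} {phi : Elc (code Cof) D}
  (pb : Problem A b phi) {A' : Ty (D' ▸ II)} {phi' : Elc (code Cof) D'}
  (pb' : Problem A' b phi') : Prop := {
  pnat_ty : A' = A⟦clift II t⟧;
  pnat_phi : phi' = phi ∘ t;
  pnat_tube : forall K (d : Hom K D') (u : El ((holds phi)⟦t ∘ d⟧)) (u' : El ((holds phi')⟦d⟧))
    (i : Elc II K), tapp pb' u' i = tapp pb u i;
  pnat_base : base pb' ≈ (base pb)⟪t⟫
}.

Lemma tapp_irr {D} {A : Ty (D ▸ II)} {b : bool} {phi : Elc (code Cof) D} (pb : Problem A b phi)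
  {K} {d d' : Hom K D} (u : El ((holds phi)⟦d⟧)) (u' : El ((holds phi)⟦d'⟧)) (i : Elc II K) :
  d = d' -> tapp pb u i = tapp pb u' i.
Proof.
  intros ->. rewrite (holds_prop u u'); reflexivity.
Qed.

Lemma tapp_sub {D} {A : Ty (D ▸ II)} {b : bool} {phi : Elc (code Cof) D} (pb : Problem A b phi)
  {K K'} {d : Hom K D} (u : El ((holds phi)⟦d⟧)) (i : Elc II K) (r : Hom K' K)
  (u' : El ((holds phi)⟦d ∘ r⟧)) : tsub (tapp pb u i) r = tapp pb u' (i ∘ r).
Proof.
  unfold tapp; rewrite tsub_comp; f_equal. rewrite cpair_comp; f_equal.
  apply holds_hom; nf; reflexivity.
Qed.

Lemma tapp_base {D} {A : Ty (D ▸ II)} {b : bool} {phi : Elc (code Cof) D} (pb : Problem A b phi)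
  {K} {d : Hom K D} (u : El ((holds phi)⟦d⟧)) :
  tapp pb u (endpoint b K) = tsub (val (base pb)) d.
Proof.
  transitivity (tsub (val ((base pb)⟪wk (holds phi)⟫)) (pair u)).
  - rewrite <- tube_base; simpl. unfold tapp; rewrite tsub_comp; f_equal; hom_eq.
  - simpl; rewrite tsub_comp, wk_pair'; reflexivity.
Qed.

Lemma tube_generic {D} {A : Ty (D ▸ II)} {b : bool} {phi : Elc (code Cof) D}
  (pb : Problem A b phi) {K} (r : Hom K (D ▹ holds phi ▸ II))
  (u : El ((holds phi)⟦wk (holds phi) ∘ (wk (II⟦bang _⟧) ∘ r)⟧)) :
  tsub (val (tube pb)) r = tapp pb u (cvar II _ ∘ r).
Proof.
  unfold tapp; f_equal. apply chom_ext; [|nf; reflexivity].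
  apply holds_hom; nf; reflexivity.
Qed.

(** [PNat] controls values only; equality of the curried tubes comes from the values at the generic
    witness and the generic point. *)
Lemma tube_fun_nat {D D'} {t : Hom D' D} {A : Ty (D ▸ II)} {b : bool} {phi : Elc (code Cof) D}
  {pb : Problem A b phi} {A' : Ty (D' ▸ II)} {phi' : Elc (code Cof) D'}
  {pb' : Problem A' b phi'} : PNat t pb pb' -> tube_fun pb' ≈ (tube_fun pb)⟪t⟫.
Proof.
  intros [-> -> Ht _]. unfold tube_fun.
  apply (lam_nat (Tube_body_sub A phi t)).
  apply (lam_nat (Tube_inner_sub A phi t)).
  simpl. etransitivity; [symmetry; apply tsub_id|].
  assert (v : El ((holds (phi ∘ t))⟦wk (holds (phi ∘ t)) ∘ (wk (II⟦bang _⟧) ∘ idm _)⟧)).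
  { rewrite comp_idr. exact (ecomp ((evar (holds (phi ∘ t)))⟪wk (II⟦bang _⟧)⟫)). }
  rewrite (tube_generic pb' v).
  assert (v' : El ((holds phi)⟦wk (holds phi) ∘ (wk (II⟦bang _⟧) ∘ (lift (closed_sub (lift_el phi t))))⟧)).
  { rewrite wk_lift. refine (hcast v _). unfold lift_el; nf; reflexivity. }
  etransitivity; [|symmetry; apply (tube_generic pb v')].
  assert (v'' : El ((holds phi)⟦t ∘ (wk (holds (phi ∘ t)) ∘ (wk (II⟦bang _⟧) ∘ idm _))⟧)).
  { refine (hcast v _). nf; reflexivity. }
  etransitivity; [apply (Ht _ _ v'')|].
  etransitivity; [apply (tapp_irr _ _ v')|].
  - unfold lift_el; nf. reflexivity.
  - f_equal. etransitivity; [apply comp_idr|]. symmetry; apply cvar_lift'.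
Qed.

Section ProblemOf.
Context {G} {A : Ty (G ▸ II)} {i : Elc II G} {phi : Elc (code Cof) G}
  (f : El (Tube A phi)) (a : El (at_ A i)) {D} {s : Hom D G}
  (h : El ((Agree f a)⟦s⟧)) {A' : Ty (D ▸ II)} (HA : A' = A⟦clift II s⟧) {b : bool}
  (He : i ∘ s = endpoint b D).

(** The passage back from the internal arguments of [Comp] at a stage to an external problem; [h]
    supplies the compatibility of tube and base. *)
Program Definition problem_of : Problem A' b (phi ∘ s) :=
  {| tube := ⌊(tubev f)⟪clift II (lift_el phi s)⟫⌋; base := ⌊a⟪s⟫⌋ |}.
Next Obligation.
  rewrite HA, !clift_sub; unfold lift_el; nf; reflexivity.
Qed.
Next Obligation. rewrite HA, at_sub, He; reflexivity. Qed.
Next Obligation.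
  simpl. rewrite !tsub_comp.
  assert (u : El ((holds phi)⟦s ∘ wk (holds (phi ∘ s))⟧)).
  { refine (hcast (evar (holds (phi ∘ s))) _). nf; reflexivity. }
  rewrite <- (agree_elim h u). f_equal.
  apply chom_ext; [apply holds_hom|]; unfold clift, lift_el; nf; try reflexivity.
  etransitivity; [|apply comp_assoc]. rewrite He, endpoint_sub; reflexivity.
Qed.

Lemma problem_of_tapp {K} {d : Hom K D} (u : El ((holds phi)⟦s ∘ d⟧))
  (u' : El ((holds (phi ∘ s))⟦d⟧)) (j : Elc II K) :
  tapp problem_of u' j = tsub (val (tubev f)) (cpair (pair u) j).
Proof.
  unfold tapp; simpl. rewrite tsub_comp; f_equal.
  apply chom_ext; [apply holds_hom|]; unfold clift, lift_el; nf; reflexivity.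
Qed.

End ProblemOf.

Program Definition extn_intro {G D} {A : Ty (G ▸ II)} {phi : Elc (code Cof) G}
  (f : El (Tube A phi)) (i : Elc II G) {s : Hom D G} (x : El ((at_ A i)⟦s⟧))
  (H : forall K (r : Hom K D) (u : El ((holds phi)⟦s ∘ r⟧)),
     tsub (val (tubev f)) (cpair (pair u) (i ∘ (s ∘ r))) = tsub (val x) r) :
  El ((Extn f i)⟦s⟧) := sig_pair (a := x) (agree_intro (a := _) _).
Next Obligation.
  intros; simpl.
  rewrite var_pair_assoc.
  assert (v : El ((holds phi)⟦s ∘ r⟧)).
  { refine (hcast u _). nf; reflexivity. }
  assert (v' : El ((holds phi)⟦wk (at_ A i) ∘ (pair x ∘ r)⟧)).
  { refine (hcast v _). nf; reflexivity. }
  rewrite <- (H _ _ v).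
  etransitivity; [refine (tubev_stage (s := wk (at_ A i)) (f := f) _ _ _ v' _ _); reflexivity|].
  f_equal. apply chom_ext; [apply holds_hom|]; nf; reflexivity.
Qed.

Lemma extn_intro_fst {G D} {A : Ty (G ▸ II)} {phi : Elc (code Cof) G}
  (f : El (Tube A phi)) (i : Elc II G) {s : Hom D G} (x : El ((at_ A i)⟦s⟧)) H :
  sfst (extn_intro (f := f) (x := x) H : El ((Sig _)⟦s⟧)) = x.
Proof. apply sfst_pair. Qed.

Lemma extn_ext {G D} {A : Ty (G ▸ II)} {phi : Elc (code Cof) G}
  (f : El (Tube A phi)) (i : Elc II G) {s : Hom D G} (x y : El ((Extn f i)⟦s⟧)) :
  sfst (x : El ((Sig _)⟦s⟧)) ≈ sfst (y : El ((Sig _)⟦s⟧)) -> x = y.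
Proof.
  apply sig_ext_prop. intros K r h h'; apply agree_prop.
Qed.

Lemma extn_agree {G D} {A : Ty (G ▸ II)} {phi : Elc (code Cof) G}
  (f : El (Tube A phi)) (i : Elc II G) {s : Hom D G} (x : El ((Extn f i)⟦s⟧))
  {K} {r : Hom K D} (u : El ((holds phi)⟦s ∘ r⟧)) :
  tsub (val (tubev f)) (cpair (pair u) (i ∘ (s ∘ r))) = tsub (val (sfst (x : El ((Sig _)⟦s⟧)))) r.
Proof.
  pose proof (ssnd (x : El ((Sig _)⟦s⟧))) as h.
  set (x0 := sfst (x : El ((Sig _)⟦s⟧))) in *.
  assert (v : El ((holds (phi ∘ wk (at_ A i)))⟦pair x0 ∘ r⟧)).
  { refine (hcast u _). nf; reflexivity. }
  assert (v' : El ((holds phi)⟦wk (at_ A i) ∘ (pair x0 ∘ r)⟧)).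
  { refine (hcast v _). nf; reflexivity. }
  pose proof (agree_elim h v) as e. simpl in e. rewrite var_pair_assoc in e.
  rewrite <- e.
  etransitivity; [|symmetry; refine (tubev_stage (s := wk (at_ A i)) (f := f) _ _ _ v' _ _); reflexivity].
  f_equal. apply chom_ext; [apply holds_hom|]; nf; reflexivity.
Qed.

End Ops.

(** * Solutions extracted from an element of [Comp] at an arbitrary stage *)

Section Stage.
Context {E : CwF} {T : TypeFormers E} {I : Interval T} {C : Cofibrations I}.

Lemma clift_wk_pair {G D} {A : Ty (G ▸ II)} {A' : Ty (D ▸ II)} {s : Hom D G} {X : Ty G}
  (a : El (X⟦s⟧)) : A' = A⟦clift II s⟧ -> A' = A⟦clift II (wk X)⟧⟦clift II (pair a)⟧.
Proof. intros ->; rewrite clift_sub, wk_pair'; reflexivity. Qed.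

Lemma comp_wk_pair {G D K} {x : Hom G K} {x' : Hom D K} {s : Hom D G} {X : Ty G}
  (a : El (X⟦s⟧)) : x' = x ∘ s -> x' = x ∘ wk X ∘ pair a.
Proof. intros ->; rewrite comp_assoc, wk_pair'; reflexivity. Qed.

Lemma clift_wk_lift {G D} {A : Ty (G ▸ II)} {A' : Ty (D ▸ II)} {s : Hom D G} {X : Ty G}
  {X' : Ty D} (H : X' = X⟦s⟧) :
  A' = A⟦clift II s⟧ -> A'⟦clift II (wk X')⟧ = A⟦clift II (wk X)⟧⟦clift II (lift H)⟧.
Proof. intros ->; rewrite !clift_sub, wk_lift; reflexivity. Qed.

Lemma comp_wk_lift {G D K} {x : Hom G K} {x' : Hom D K} {s : Hom D G} {X : Ty G}
  {X' : Ty D} (H : X' = X⟦s⟧) :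
  x' = x ∘ s -> x' ∘ wk X' = x ∘ wk X ∘ lift H.
Proof. intros ->; rewrite !comp_assoc, wk_lift; reflexivity. Qed.

Lemma incl_end {b : bool} {D} {e : Elc Two D} :
  const D (two b) = e -> incl ∘ e = endpoint b D.
Proof. intros <-; apply incl_two. Qed.

Section AgreeOf.
Context {D} {A' : Ty (D ▸ II)} {b : bool} {phi' : Elc (code Cof) D} (pb : Problem A' b phi').

Definition agree_of {G} {A : Ty (G ▸ II)} {phi : Elc (code Cof) G} (f : El (Tube A phi))
  {i : Elc II G} (a : El (at_ A i)) {s : Hom D G} (HA : A' = A⟦clift II s⟧)
  (Hp : phi' = phi ∘ s) (Hi : i ∘ s = endpoint b D) (Hf : tube_fun pb ≈ f⟪s⟫)
  (Ha : base pb ≈ a⟪s⟫) : El ((Agree f a)⟦s⟧).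
Proof.
  apply agree_intro. intros K r u.
  assert (e : phi ∘ (s ∘ r) = phi' ∘ r) by (rewrite Hp, comp_assoc; reflexivity).
  rewrite <- (tubev_stage HA Hp Hf u (hcast u e)).
  unfold tubev, tube_fun; rewrite !unlam_lam, Hi, endpoint_sub.
  transitivity (tsub (val (base pb)) r).
  - transitivity (tsub (val ((base pb)⟪wk (holds phi')⟫)) (pair (hcast u e))).
    + rewrite <- tube_base; simpl; rewrite tsub_comp; f_equal. hom_eq.
    + simpl; rewrite tsub_comp, wk_pair'; reflexivity.
  - rewrite Ha; simpl; rewrite tsub_comp; reflexivity.
Defined.

Section Solve4.
Context {G} {A : Ty (G ▸ II)} {e : Elc Two G} {phi : Elc (code Cof) G} (f : El (Tube A phi))
  (a : El (at_ A (incl ∘ e))) {s : Hom D G} (HA : A' = A⟦clift II s⟧)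
  (He : const D (two b) = e ∘ s) (Hp : phi' = phi ∘ s) (Hf : tube_fun pb ≈ f⟪s⟫)
  (Ha : base pb ≈ a⟪s⟫).

Lemma solve4_end : incl ∘ e ∘ s = endpoint b D.
Proof. rewrite comp_assoc; apply incl_end, He. Qed.

Lemma solve4_opp_end : incl ∘ (opp ∘ e) ∘ s = endpoint (negb b) D.
Proof. rewrite !comp_assoc, <- He, opp_two, incl_two; reflexivity. Qed.

Definition stage_agree : El ((Agree f a)⟦s⟧) := agree_of HA Hp solve4_end Hf Ha.

Definition stage_extn (x : El ((Comp4 f a)⟦s⟧)) :
  El ((Extn f (incl ∘ (opp ∘ e)))⟦wk (Agree f a) ∘ pair stage_agree⟧) :=
  ecomp (app (x : El ((Pi _)⟦s⟧)) stage_agree).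

Lemma stage_solve_ty : (at_ A (incl ∘ (opp ∘ e)))⟦wk (Agree f a) ∘ pair stage_agree⟧
  = at_ A' (endpoint (negb b) D).
Proof. rewrite wk_pair', at_sub, HA, solve4_opp_end; reflexivity. Qed.

(** A variant of [solve] suited to induction on the quantifiers. [HA], [He], [Hp], [Hf] and [Ha] say
    that the data over [G] restrict along [s] to the fixed problem [pb] over [D]; each outer variant
    supplies one more argument and extends [s] by [pair]. *)
Definition stage_solve4 (x : El ((Comp4 f a)⟦s⟧)) : El (at_ A' (endpoint (negb b) D)) :=
  cast stage_solve_ty (sfst (stage_extn x : El ((Sig _)⟦_⟧))).

Lemma stage_solve4_ext (x : El ((Comp4 f a)⟦s⟧)) {K} {d : Hom K D} (u : El ((holds phi')⟦d⟧)) :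
  tsub (val (stage_solve4 x)) d = tapp pb u (endpoint (negb b) K).
Proof.
  unfold stage_solve4; simpl val.
  assert (v : El ((holds phi)⟦s ∘ d⟧)).
  { refine (hcast u _). rewrite Hp, comp_assoc; reflexivity. }
  assert (v' : El ((holds phi)⟦wk (Agree f a) ∘ pair (stage_agree) ∘ d⟧)).
  { refine (hcast v _). nf; reflexivity. }
  rewrite <- (extn_agree (stage_extn x) v').
  transitivity (tsub (val (tubev (tube_fun pb))) (cpair (pair u) (endpoint (negb b) K))).
  - rewrite (tubev_stage HA Hp Hf v u).
    f_equal. apply chom_ext; [apply holds_hom; nf; reflexivity|].
    rewrite !cvar_cpair, <- (endpoint_sub (negb b) d), <- solve4_opp_end, wk_pair'.
    rewrite !comp_assoc; reflexivity.
  - unfold tubev, tube_fun. rewrite !unlam_lam; reflexivity.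
Qed.

End Solve4.

Section Solve3.
Context {G} {A : Ty (G ▸ II)} {e : Elc Two G} {phi : Elc (code Cof) G} (f : El (Tube A phi))
  {s : Hom D G} (HA : A' = A⟦clift II s⟧)
  (He : const D (two b) = e ∘ s) (Hp : phi' = phi ∘ s) (Hf : tube_fun pb ≈ f⟪s⟫).

Lemma base_arg_ty : at_ A' (endpoint b D) = (at_ A (incl ∘ e))⟦s⟧.
Proof.
  rewrite at_sub, HA; f_equal. symmetry; rewrite comp_assoc; apply incl_end, He.
Qed.

Definition base_arg : El ((at_ A (incl ∘ e))⟦s⟧) := cast base_arg_ty (base pb).

Lemma stage_tube3 {Z} (q : (Tube A phi)⟦wk (at_ A (incl ∘ e))⟧ = Z) :
  tube_fun pb ≈ (cast q (f⟪wk (at_ A (incl ∘ e))⟫))⟪pair base_arg⟫.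
Proof. rewrite Hf; simpl; rewrite tsub_comp, wk_pair'; reflexivity. Qed.

Lemma stage_base3 {Z} (q : (at_ A (incl ∘ e))⟦wk (at_ A (incl ∘ e))⟧ = Z) :
  base pb ≈ (cast q (evar (at_ A (incl ∘ e))))⟪pair base_arg⟫.
Proof. simpl; rewrite var_pair'; reflexivity. Qed.

Definition stage_solve3 (x : El ((Comp3 e f)⟦s⟧)) : El (at_ A' (endpoint (negb b) D)) :=
  stage_solve4 (clift_wk_pair _ HA) (comp_wk_pair _ He) (comp_wk_pair _ Hp)
    (stage_tube3 _) (stage_base3 _) (app (x : El ((Pi _)⟦s⟧)) base_arg).

Lemma stage_solve3_ext (x : El ((Comp3 e f)⟦s⟧)) {K} {d : Hom K D} (u : El ((holds phi')⟦d⟧)) :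
  tsub (val (stage_solve3 x)) d = tapp pb u (endpoint (negb b) K).
Proof. unfold stage_solve3; apply stage_solve4_ext. Qed.

End Solve3.

Section Solve2.
Context {G} {A : Ty (G ▸ II)} {e : Elc Two G} {phi : Elc (code Cof) G}
  {s : Hom D G} (HA : A' = A⟦clift II s⟧)
  (He : const D (two b) = e ∘ s) (Hp : phi' = phi ∘ s).

Lemma tube_arg_ty : Tube A' phi' = (Tube A phi)⟦s⟧.
Proof. rewrite Tube_sub, HA, Hp; reflexivity. Qed.

Definition tube_arg : El ((Tube A phi)⟦s⟧) := cast tube_arg_ty (tube_fun pb).

Lemma stage_tube2 {Z} (q : (Tube A phi)⟦wk (Tube A phi)⟧ = Z) :
  tube_fun pb ≈ (cast q (evar (Tube A phi)))⟪pair tube_arg⟫.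
Proof. simpl; rewrite var_pair'; reflexivity. Qed.

Definition stage_solve2 (x : El ((Comp2 A e phi)⟦s⟧)) : El (at_ A' (endpoint (negb b) D)) :=
  stage_solve3 (clift_wk_pair _ HA) (comp_wk_pair _ He) (comp_wk_pair _ Hp)
    (stage_tube2 _) (app (x : El ((Pi _)⟦s⟧)) tube_arg).

Lemma stage_solve2_ext (x : El ((Comp2 A e phi)⟦s⟧)) {K} {d : Hom K D} (u : El ((holds phi')⟦d⟧)) :
  tsub (val (stage_solve2 x)) d = tapp pb u (endpoint (negb b) K).
Proof. unfold stage_solve2; apply stage_solve3_ext. Qed.

End Solve2.

Section Solve1.
Context {G} {A : Ty (G ▸ II)} {e : Elc Two G} {s : Hom D G} (HA : A' = A⟦clift II s⟧)
  (He : const D (two b) = e ∘ s).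

Definition elem_arg {X : Ty emp} {K} (r : Hom D K) (x : Elc X D) : El (X⟦bang K⟧⟦r⟧) :=
  cast (closed_sub r) (elem x).

Lemma cvar_elem_arg {X : Ty emp} {K} (r : Hom D K) (x : Elc X D) :
  x = cvar X K ∘ pair (elem_arg r x).
Proof. apply elc_ext; nf; reflexivity. Qed.

Definition stage_solve1 (x : El ((Comp1 A e)⟦s⟧)) : El (at_ A' (endpoint (negb b) D)) :=
  stage_solve2 (clift_wk_pair _ HA) (comp_wk_pair _ He) (cvar_elem_arg s phi')
    (app (x : El ((Pi _)⟦s⟧)) (elem_arg s phi')).

Lemma stage_solve1_ext (x : El ((Comp1 A e)⟦s⟧)) {K} {d : Hom K D} (u : El ((holds phi')⟦d⟧)) :
  tsub (val (stage_solve1 x)) d = tapp pb u (endpoint (negb b) K).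
Proof. unfold stage_solve1; apply stage_solve2_ext. Qed.

End Solve1.

Section Solve0.
Context {G} {A : Ty (G ▸ II)} {s : Hom D G} (HA : A' = A⟦clift II s⟧).

Definition stage_solve (x : El ((Comp A)⟦s⟧)) : El (at_ A' (endpoint (negb b) D)) :=
  stage_solve1 (clift_wk_pair _ HA) (cvar_elem_arg s (const D (two b)))
    (app (x : El ((Pi _)⟦s⟧)) (elem_arg s (const D (two b)))).

Lemma stage_solve_ext (x : El ((Comp A)⟦s⟧)) {K} {d : Hom K D} (u : El ((holds phi')⟦d⟧)) :
  tsub (val (stage_solve x)) d = tapp pb u (endpoint (negb b) K).
Proof. unfold stage_solve; apply stage_solve1_ext. Qed.

End Solve0.
End AgreeOf.

Lemma Extn_body {G D} {A : Ty (G ▸ II)} {phi : Elc (code Cof) G} {i : Elc II G}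
  (f : El (Tube A phi)) (s : Hom D G)
  {A' : Ty (D ▸ II)} {phi' : Elc (code Cof) D} {i' : Elc II D} (f' : El (Tube A' phi'))
  (H : at_ A' i' = (at_ A i)⟦s⟧) :
  A' = A⟦clift II s⟧ -> phi' = phi ∘ s -> i' = i ∘ s -> f' ≈ f⟪s⟫ ->
  let w := wk (at_ A i) in
  let w' := wk (at_ A' i') in
  forall (q : (Tube A phi)⟦w⟧ = Tube (A⟦clift II w⟧) (phi ∘ w))
    (q' : (Tube A' phi')⟦w'⟧ = Tube (A'⟦clift II w'⟧) (phi' ∘ w'))
    (p : (at_ A i)⟦w⟧ = at_ (A⟦clift II w⟧) (i ∘ w))
    (p' : (at_ A' i')⟦w'⟧ = at_ (A'⟦clift II w'⟧) (i' ∘ w')),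
  Agree (cast q' (f'⟪w'⟫)) (cast p' (evar _)) = (Agree (cast q (f⟪w⟫)) (cast p (evar _)))⟦lift H⟧.
Proof.
  intros -> -> -> Hf w w' *; subst w w'; symmetry; apply Agree_sub'.
  - rewrite !clift_sub, wk_lift; reflexivity.
  - rewrite !comp_assoc, wk_lift; reflexivity.
  - rewrite !comp_assoc, wk_lift; reflexivity.
  - simpl; rewrite Hf; simpl; rewrite !tsub_comp, wk_lift; reflexivity.
  - simpl; rewrite var_lift; reflexivity.
Qed.

(** Agreement is a proposition, so the chosen witnesses of compatibility are automatically
    natural. *)
Lemma agree_eq {G D K} {A : Ty (G ▸ II)} {phi : Elc (code Cof) G} (f : El (Tube A phi))
  {i : Elc II G} (a : El (at_ A i)) {s : Hom D G} {X : Ty D} {Y : Ty K} (t : Hom K D)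
  (h : El X) (h' : El Y) :
  X = (Agree f a)⟦s⟧ -> Y = (Agree f a)⟦s ∘ t⟧ -> h' ≈ h⟪t⟫.
Proof.
  intros -> ->. pose proof (agree_prop h' (ecomp (h⟪t⟫))) as H.
  exact (f_equal (@val _ _ _) H).
Qed.

Section Nat.
Context {D} {A' : Ty (D ▸ II)} {b : bool} {phi' : Elc (code Cof) D} (pb : Problem A' b phi').
Context {D1} {A1' : Ty (D1 ▸ II)} {phi1' : Elc (code Cof) D1} (pb1 : Problem A1' b phi1').
Context {t : Hom D1 D} (Hpb : PNat t pb pb1).

Section Nat4.
Context {G} {A : Ty (G ▸ II)} {e : Elc Two G} {phi : Elc (code Cof) G} (f : El (Tube A phi))
  (a : El (at_ A (incl ∘ e))) {s : Hom D G} (HA : A' = A⟦clift II s⟧)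
  (He : const D (two b) = e ∘ s) (Hp : phi' = phi ∘ s) (Hf : tube_fun pb ≈ f⟪s⟫)
  (Ha : base pb ≈ a⟪s⟫).
Context {G1} {A1 : Ty (G1 ▸ II)} {e1 : Elc Two G1} {phi1 : Elc (code Cof) G1} (f1 : El (Tube A1 phi1))
  (a1 : El (at_ A1 (incl ∘ e1))) {s1 : Hom D1 G1} (HA1 : A1' = A1⟦clift II s1⟧)
  (He1 : const D1 (two b) = e1 ∘ s1) (Hp1 : phi1' = phi1 ∘ s1) (Hf1 : tube_fun pb1 ≈ f1⟪s1⟫)
  (Ha1 : base pb1 ≈ a1⟪s1⟫).
Context {o : Hom G1 G} (Ho : o ∘ s1 = s ∘ t) (OA : A1 = A⟦clift II o⟧)
  (Oe : e1 = e ∘ o) (Op : phi1 = phi ∘ o) (Of : f1 ≈ f⟪o⟫) (Oa : a1 ≈ a⟪o⟫).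

(** Innermost case. The outer quantifiers reduce to it with [o] replaced by its lift, each argument
    being natural by [PNat] and the application by [app_nat]. *)
Lemma stage_solve4_nat (x : El ((Comp4 f a)⟦s⟧)) (x1 : El ((Comp4 f1 a1)⟦s1⟧)) :
  x1 ≈ x⟪t⟫ ->
  stage_solve4 HA1 He1 Hp1 Hf1 Ha1 x1 ≈ (stage_solve4 HA He Hp Hf Ha x)⟪t⟫.
Proof.
  intro Hx. unfold stage_solve4.
  assert (Oi : incl ∘ e1 = incl ∘ e ∘ o) by (rewrite Oe, comp_assoc; reflexivity).
  assert (Oj : incl ∘ (opp ∘ e1) = incl ∘ (opp ∘ e) ∘ o) by (rewrite Oe, !comp_assoc; reflexivity).
  assert (H1 : Agree f1 a1 = (Agree f a)⟦o⟧).
  { symmetry; apply Agree_sub'; assumption. }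
  assert (H2 : at_ A1 (incl ∘ (opp ∘ e1)) = (at_ A (incl ∘ (opp ∘ e)))⟦o⟧).
  { rewrite at_sub, OA, Oj; reflexivity. }
  assert (H3 : Extn f1 (incl ∘ (opp ∘ e1)) = (Extn f (incl ∘ (opp ∘ e)))⟦o⟧).
  { symmetry; apply Extn_sub; assumption. }
  refine (sfst_nat (o := o) (HA := H2) _ (t := t) _ _).
  - unfold at_; apply Extn_body; assumption.
  - rewrite !wk_pair'; exact Ho.
  - refine (app_nat (o := o) (HA := H1) _ (t := t) Ho Hx _).
    + rewrite H3, !Tsub_comp, wk_lift; reflexivity.
    + apply (agree_eq (f := f) (a := a) (s := s)); [reflexivity|].
      rewrite H1, Tsub_comp, Ho; reflexivity.
Qed.

End Nat4.

Lemma pair_lift {G D2 K G2} {X : Ty G} {o : Hom G2 G} {X1 : Ty G2} (H : X1 = X⟦o⟧) {s : Hom K G}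
  {r : Hom D2 K} {s1 : Hom D2 G2} (x : El (X⟦s⟧)) (x1 : El (X1⟦s1⟧)) :
  o ∘ s1 = s ∘ r -> x1 ≈ x⟪r⟫ -> lift H ∘ pair x1 = pair x ∘ r.
Proof. intros Ho Hx; apply ext_eta; nf; [exact Ho | exact Hx]. Qed.

Section Nat3.
Context {G} {A : Ty (G ▸ II)} {e : Elc Two G} {phi : Elc (code Cof) G} (f : El (Tube A phi))
  {s : Hom D G} (HA : A' = A⟦clift II s⟧)
  (He : const D (two b) = e ∘ s) (Hp : phi' = phi ∘ s) (Hf : tube_fun pb ≈ f⟪s⟫).
Context {G1} {A1 : Ty (G1 ▸ II)} {e1 : Elc Two G1} {phi1 : Elc (code Cof) G1} (f1 : El (Tube A1 phi1))
  {s1 : Hom D1 G1} (HA1 : A1' = A1⟦clift II s1⟧)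
  (He1 : const D1 (two b) = e1 ∘ s1) (Hp1 : phi1' = phi1 ∘ s1) (Hf1 : tube_fun pb1 ≈ f1⟪s1⟫).
Context {o : Hom G1 G} (Ho : o ∘ s1 = s ∘ t) (OA : A1 = A⟦clift II o⟧)
  (Oe : e1 = e ∘ o) (Op : phi1 = phi ∘ o) (Of : f1 ≈ f⟪o⟫).

Lemma stage_solve3_nat (x : El ((Comp3 e f)⟦s⟧)) (x1 : El ((Comp3 e1 f1)⟦s1⟧)) :
  x1 ≈ x⟪t⟫ -> stage_solve3 HA1 He1 Hp1 Hf1 x1 ≈ (stage_solve3 HA He Hp Hf x)⟪t⟫.
Proof.
  intro Hx. unfold stage_solve3.
  assert (c4 : at_ A1 (incl ∘ e1) = (at_ A (incl ∘ e))⟦o⟧).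
  { rewrite at_sub, OA, Oe, comp_assoc; reflexivity. }
  refine (stage_solve4_nat _ _ _ _ _ _ _ _ _ _ (o := lift c4) _ _ _ _ _ _ _).
  - apply pair_lift; [exact Ho | exact (pnat_base Hpb)].
  - apply clift_wk_lift, OA.
  - apply comp_wk_lift, Oe.
  - apply comp_wk_lift, Op.
  - simpl; rewrite Of; simpl; rewrite !tsub_comp, wk_lift; reflexivity.
  - simpl; rewrite var_lift; reflexivity.
  - refine (app_nat (o := o) (HA := c4) _ (t := t) Ho Hx _).
    + apply Comp3_body; assumption.
    + exact (pnat_base Hpb).
Qed.
End Nat3.

Section Nat2.
Context {G} {A : Ty (G ▸ II)} {e : Elc Two G} {phi : Elc (code Cof) G}
  {s : Hom D G} (HA : A' = A⟦clift II s⟧)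
  (He : const D (two b) = e ∘ s) (Hp : phi' = phi ∘ s).
Context {G1} {A1 : Ty (G1 ▸ II)} {e1 : Elc Two G1} {phi1 : Elc (code Cof) G1}
  {s1 : Hom D1 G1} (HA1 : A1' = A1⟦clift II s1⟧)
  (He1 : const D1 (two b) = e1 ∘ s1) (Hp1 : phi1' = phi1 ∘ s1).
Context {o : Hom G1 G} (Ho : o ∘ s1 = s ∘ t) (OA : A1 = A⟦clift II o⟧)
  (Oe : e1 = e ∘ o) (Op : phi1 = phi ∘ o).

Lemma stage_solve2_nat (x : El ((Comp2 A e phi)⟦s⟧)) (x1 : El ((Comp2 A1 e1 phi1)⟦s1⟧)) :
  x1 ≈ x⟪t⟫ -> stage_solve2 pb1 HA1 He1 Hp1 x1 ≈ (stage_solve2 pb HA He Hp x)⟪t⟫.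
Proof.
  intro Hx. unfold stage_solve2.
  assert (c3 : Tube A1 phi1 = (Tube A phi)⟦o⟧).
  { rewrite Tube_sub, OA, Op; reflexivity. }
  refine (stage_solve3_nat _ _ _ _ _ _ _ _ (o := lift c3) _ _ _ _ _ _).
  - apply pair_lift; [exact Ho | exact (tube_fun_nat Hpb)].
  - apply clift_wk_lift, OA.
  - apply comp_wk_lift, Oe.
  - apply comp_wk_lift, Op.
  - simpl; rewrite var_lift; reflexivity.
  - refine (app_nat (o := o) (HA := c3) _ (t := t) Ho Hx _).
    + apply Comp2_body; assumption.
    + exact (tube_fun_nat Hpb).
Qed.
End Nat2.

Section Nat1.
Context {G} {A : Ty (G ▸ II)} {e : Elc Two G} {s : Hom D G} (HA : A' = A⟦clift II s⟧)
  (He : const D (two b) = e ∘ s).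
Context {G1} {A1 : Ty (G1 ▸ II)} {e1 : Elc Two G1} {s1 : Hom D1 G1} (HA1 : A1' = A1⟦clift II s1⟧)
  (He1 : const D1 (two b) = e1 ∘ s1).
Context {o : Hom G1 G} (Ho : o ∘ s1 = s ∘ t) (OA : A1 = A⟦clift II o⟧)
  (Oe : e1 = e ∘ o).

Lemma stage_solve1_nat (x : El ((Comp1 A e)⟦s⟧)) (x1 : El ((Comp1 A1 e1)⟦s1⟧)) :
  x1 ≈ x⟪t⟫ -> stage_solve1 pb1 HA1 He1 x1 ≈ (stage_solve1 pb HA He x)⟪t⟫.
Proof.
  intro Hx. unfold stage_solve1.
  assert (Hc : elem_arg s1 phi1' ≈ (elem_arg s phi')⟪t⟫).
  { simpl; rewrite (pnat_phi Hpb), tsub_comp; reflexivity. }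
  refine (stage_solve2_nat _ _ _ _ _ _ (o := lift (closed_sub o)) _ _ _ _ _).
  - apply pair_lift; [exact Ho | exact Hc].
  - apply clift_wk_lift, OA.
  - apply comp_wk_lift, Oe.
  - apply cvar_lift.
  - refine (app_nat (o := o) (HA := closed_sub o) _ (t := t) Ho Hx Hc).
    apply Comp1_body; assumption.
Qed.
End Nat1.

Lemma const_comp {X : Ty emp} {G K} (x : Elc X emp) (r : Hom K G) : const G x ∘ r = const K x.
Proof. unfold const; rewrite comp_assoc; f_equal; apply bang_uniq. Qed.

Section Nat0.
Context {G} {A : Ty (G ▸ II)} {s : Hom D G} (HA : A' = A⟦clift II s⟧).
Context {G1} {A1 : Ty (G1 ▸ II)} {s1 : Hom D1 G1} (HA1 : A1' = A1⟦clift II s1⟧).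
Context {o : Hom G1 G} (Ho : o ∘ s1 = s ∘ t) (OA : A1 = A⟦clift II o⟧).

Lemma stage_solve_nat (x : El ((Comp A)⟦s⟧)) (x1 : El ((Comp A1)⟦s1⟧)) :
  x1 ≈ x⟪t⟫ -> stage_solve pb1 HA1 x1 ≈ (stage_solve pb HA x)⟪t⟫.
Proof.
  intro Hx. unfold stage_solve.
  assert (Hc : elem_arg s1 (const D1 (two b)) ≈ (elem_arg s (const D (two b)))⟪t⟫).
  { simpl. rewrite tsub_comp, const_comp; reflexivity. }
  refine (stage_solve1_nat _ _ _ _ (o := lift (closed_sub o)) _ _ _ _).
  - apply pair_lift; [exact Ho | exact Hc].
  - apply clift_wk_lift, OA.
  - apply cvar_lift.
  - refine (app_nat (o := o) (HA := closed_sub o) _ (t := t) Ho Hx Hc).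
    apply Comp0_body; assumption.
Qed.
End Nat0.
End Nat.
End Stage.

(** * Comparison of [solve] with the staged solution, and its laws *)

Section SolveStage.
Context {E : CwF} {T : TypeFormers E} {I : Interval T} {C : Cofibrations I}.

Lemma dfst_sfst {G D} {A : Ty G} {B : Ty (G ▹ A)} {s : Hom D G} {A' : Ty D}
  (H : A' = A⟦s⟧) {B' : Ty (D ▹ A')} (HB : B' = B⟦lift H⟧)
  (x : El ((Sig B)⟦s⟧)) (x' : El (Sig B')) : x' ≈ x -> dfst x' ≈ sfst x.
Proof. subst A' B'; intro Hx; apply dfst_val, Hx. Qed.

Lemma agree_irr {G D} {A : Ty (G ▸ II)} {phi : Elc (code Cof) G} (f : El (Tube A phi))
  {i : Elc II G} (a : El (at_ A i)) {s : Hom D G} {X : Ty D} (h : El X)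
  (h' : El ((Agree f a)⟦s⟧)) : X = (Agree f a)⟦s⟧ -> h ≈ h'.
Proof. intros ->; f_equal; apply agree_prop. Qed.

Context {D} {A' : Ty (D ▸ II)} {b : bool} {phi' : Elc (code Cof) D} (c : El (Comp A'))
  (pb : Problem A' b phi').

(** The partial results [solve4], [solve3], and so on are compared with staged ones by hypothesis,
    so that the chain of lemmas discharges one application each, ending with the element of [Comp]
    itself. *)
Lemma solve_stage4 {G} {A : Ty (G ▸ II)} {e : Elc Two G} {phi : Elc (code Cof) G}
  (f : El (Tube A phi)) (a : El (at_ A (incl ∘ e))) {s : Hom D G} (HA : A' = A⟦clift II s⟧)
  (He : const D (two b) = e ∘ s) (Hp : phi' = phi ∘ s) (Hf : tube_fun pb ≈ f⟪s⟫)
  (Ha : base pb ≈ a⟪s⟫) (x : El ((Comp4 f a)⟦s⟧)) :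
  solve4 c pb ≈ x -> solve c pb ≈ stage_solve4 HA He Hp Hf Ha x.
Proof.
  intro Hx. unfold solve, stage_solve4. simpl val.
  assert (Oi : incl ∘ const D (two b) = incl ∘ e ∘ s).
  { rewrite comp_assoc; f_equal; exact He. }
  assert (Oj : incl ∘ (opp ∘ const D (two b)) = incl ∘ (opp ∘ e) ∘ s).
  { rewrite !comp_assoc; do 2 f_equal; exact He. }
  assert (c5 : Agree (tube_fun pb) (base_elt pb) = (Agree f a)⟦s⟧).
  { symmetry; apply Agree_sub'; assumption. }
  assert (c6 : Extn (tube_fun pb) (incl ∘ (opp ∘ const D (two b)))
    = (Extn f (incl ∘ (opp ∘ e)))⟦s⟧).
  { symmetry; apply Extn_sub; assumption. }
  unshelve refine (dfst_sfst (H := _) _ _).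
  - etransitivity; [|symmetry; apply at_sub]. rewrite wk_pair'; f_equal; assumption.
  - apply Extn_body; rewrite ?wk_pair'; assumption.
  - refine (app_app_id (H := c5) _ Hx _).
    + rewrite c6, !Tsub_comp, wk_lift; reflexivity.
    + apply (agree_irr (f := f) (a := a) (s := s)); exact c5.
Qed.

Lemma solve_stage3 {G} {A : Ty (G ▸ II)} {e : Elc Two G} {phi : Elc (code Cof) G}
  (f : El (Tube A phi)) {s : Hom D G} (HA : A' = A⟦clift II s⟧)
  (He : const D (two b) = e ∘ s) (Hp : phi' = phi ∘ s) (Hf : tube_fun pb ≈ f⟪s⟫)
  (x : El ((Comp3 e f)⟦s⟧)) :
  solve3 c pb ≈ x -> solve c pb ≈ stage_solve3 HA He Hp Hf x.
Proof.
  intro Hx. unfold stage_solve3. apply solve_stage4.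
  unshelve refine (app_app_id (H := _) _ Hx _).
  - rewrite at_sub, comp_assoc, <- He, <- HA; reflexivity.
  - apply Comp3_body; assumption.
  - reflexivity.
Qed.

Lemma solve_stage2 {G} {A : Ty (G ▸ II)} {e : Elc Two G} {phi : Elc (code Cof) G}
  {s : Hom D G} (HA : A' = A⟦clift II s⟧)
  (He : const D (two b) = e ∘ s) (Hp : phi' = phi ∘ s) (x : El ((Comp2 A e phi)⟦s⟧)) :
  solve2 (b := b) (phi := phi') c ≈ x -> solve c pb ≈ stage_solve2 pb HA He Hp x.
Proof.
  intro Hx. unfold stage_solve2. apply solve_stage3.
  refine (app_app_id (H := tube_arg_ty HA Hp) _ Hx _).
  - apply Comp2_body; assumption.
  - reflexivity.
Qed.

Lemma solve_stage1 {G} {A : Ty (G ▸ II)} {e : Elc Two G}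
  {s : Hom D G} (HA : A' = A⟦clift II s⟧)
  (He : const D (two b) = e ∘ s) (x : El ((Comp1 A e)⟦s⟧)) :
  solve1 (b := b) c ≈ x -> solve c pb ≈ stage_solve1 pb HA He x.
Proof.
  intro Hx. unfold stage_solve1. apply solve_stage2.
  refine (app_app_id (H := closed_sub s) _ Hx _).
  - apply Comp1_body; assumption.
  - reflexivity.
Qed.

Lemma solve_stage {G} {A : Ty (G ▸ II)} {s : Hom D G} (HA : A' = A⟦clift II s⟧)
  (x : El ((Comp A)⟦s⟧)) :
  c ≈ x -> solve c pb ≈ stage_solve pb HA x.
Proof.
  intro Hx. unfold stage_solve. apply solve_stage1.
  refine (app_app_id (H := closed_sub s) _ Hx _).
  - apply Comp0_body; assumption.
  - reflexivity.
Qed.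

End SolveStage.

Section SolveLaws.
Context {E : CwF} {T : TypeFormers E} {I : Interval T} {C : Cofibrations I}.

Lemma clift_idm_eq {D} (A : Ty (D ▸ II)) : A = A⟦clift II (idm D)⟧.
Proof. rewrite clift_id, Tsub_id; reflexivity. Qed.

(** Both sides are staged solutions over the same base [D], one at stage [t] and one at stage
    [idm D]. *)
Lemma solve_nat {D D'} {t : Hom D' D} {A : Ty (D ▸ II)} {b : bool} {phi : Elc (code Cof) D}
  {pb : Problem A b phi} {A' : Ty (D' ▸ II)} {phi' : Elc (code Cof) D'}
  {pb' : Problem A' b phi'} (c : El (Comp A)) (c' : El (Comp A')) :
  PNat t pb pb' -> c' ≈ c⟪t⟫ -> solve c' pb' ≈ (solve c pb)⟪t⟫.
Proof.
  intros Hpb Hc.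
  pose proof (pnat_ty Hpb) as HA.
  assert (H1 : (Comp A)⟦t⟧ = Comp A') by (rewrite Comp_sub, <- HA; reflexivity).
  change (val (solve c' pb') = tsub (val (solve c pb)) t).
  rewrite (solve_stage (s := t) (c := c') pb' HA (x := cast (eq_sym H1) c')) by reflexivity.
  rewrite (solve_stage (s := idm D) (c := c) pb (clift_idm_eq A) (x := cast (eq_sym (Tsub_id _)) c))
    by reflexivity.
  refine (stage_solve_nat Hpb _ _ (o := idm _) _ _ _).
  - rewrite !comp_idl; reflexivity.
  - apply clift_idm_eq.
  - exact Hc.
Qed.

Lemma solve_ext {D} {A : Ty (D ▸ II)} {b : bool} {phi : Elc (code Cof) D}
  (c : El (Comp A)) (pb : Problem A b phi) {K} {d : Hom K D} (u : El ((holds phi)⟦d⟧)) :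
  tsub (val (solve c pb)) d = tapp pb u (endpoint (negb b) K).
Proof.
  rewrite (solve_stage (s := idm D) (c := c) pb (clift_idm_eq A) (x := cast (eq_sym (Tsub_id _)) c))
    by reflexivity.
  apply stage_solve_ext.
Qed.

End SolveLaws.

(** * Elements of [Comp] from external operations, and their uniqueness *)

Section CompIntro.
Context {E : CwF} {T : TypeFormers E} {I : Interval T} {C : Cofibrations I}.

Lemma app_unlam_sub {G D} {A : Ty G} {B : Ty (G ▹ A)} {s : Hom D G} (y : El (Pi B))
  (f : El ((Pi B)⟦s⟧)) (a : El (A⟦s⟧)) :
  f ≈ y⟪s⟫ -> app f a ≈ (unlam y)⟪pair a⟫.
Proof. intro Hf; apply app_lam_sub; rewrite lam_unlam; exact Hf. Qed.

Lemma clift_sub_eq {G D K} {A : Ty (G ▸ II)} {A' : Ty (D ▸ II)} {t : Hom D G} (r : Hom K D) :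
  A' = A⟦clift II t⟧ -> A'⟦clift II r⟧ = A⟦clift II (t ∘ r)⟧.
Proof. intros ->; rewrite clift_sub; reflexivity. Qed.

Lemma const_sub_eq {X : Ty emp} {G D} {x : Elc X emp} {e : Elc X G} (r : Hom D G) :
  e = const G x -> e ∘ r = const D x.
Proof. intros ->; apply const_comp. Qed.

Lemma const_sub_eq' {X : Ty emp} {G D} {x : Elc X emp} {e : Elc X G} (r : Hom D G) :
  e = const G x -> const D x = e ∘ r.
Proof. intro H; symmetry; apply const_sub_eq, H. Qed.

Lemma incl_const_end {b : bool} {G D} {e : Elc Two G} (r : Hom D G) :
  e = const G (two b) -> incl ∘ e ∘ r = endpoint b D.
Proof. intros ->. rewrite incl_two; apply endpoint_sub. Qed.

Lemma incl_opp_end {b : bool} {G D} {e : Elc Two G} (r : Hom D G) :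
  e = const G (two b) -> incl ∘ (opp ∘ e) ∘ r = endpoint (negb b) D.
Proof. intros ->. rewrite opp_two, incl_two; apply endpoint_sub. Qed.

Lemma problem_of_fun {G} {A : Ty (G ▸ II)} {i : Elc II G} {phi : Elc (code Cof) G}
  (f : El (Tube A phi)) (a : El (at_ A i)) {D} {s : Hom D G}
  (h : El ((Agree f a)⟦s⟧)) {A' : Ty (D ▸ II)} (HA : A' = A⟦clift II s⟧) {b : bool}
  (He : i ∘ s = endpoint b D) : tube_fun (problem_of h HA He) ≈ f⟪s⟫.
Proof.
  subst A'. transitivity (val ((lam (lam (tubev f)) : El (Tube A phi))⟪s⟫)).
  - apply (lam_nat (Tube_body_sub A phi s)).
    apply (lam_nat (Tube_inner_sub A phi s)).
    simpl. f_equal. apply chom_ext; [apply holds_hom|]; unfold lift_el, clift; nf; reflexivity.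
  - unfold tubev; rewrite !lam_unlam; reflexivity.
Qed.

(** The universal problem with tube [f] and base [a], living over the context of their agreement.
    Every problem with these data at a stage is a reindexing of it. *)
Definition generic_problem {G} {A : Ty (G ▸ II)} {e : Elc Two G} {phi : Elc (code Cof) G}
  (f : El (Tube A phi)) (a : El (at_ A (incl ∘ e))) {b : bool} (He : e = const G (two b)) :
  Problem (A⟦clift II (wk (Agree f a))⟧) b (phi ∘ wk (Agree f a)) :=
  problem_of (evar (Agree f a)) eq_refl (incl_const_end _ He).

Lemma generic_problem_nat {G} {A : Ty (G ▸ II)} {e : Elc Two G} {phi : Elc (code Cof) G}
  (f : El (Tube A phi)) (a : El (at_ A (incl ∘ e))) {b : bool} (He : e = const G (two b))
  {D} {A' : Ty (D ▸ II)} {phi' : Elc (code Cof) D} (pb : Problem A' b phi')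
  {s : Hom D G} {r : Hom D (G ▹ Agree f a)} :
  wk _ ∘ r = s -> A' = A⟦clift II s⟧ -> phi' = phi ∘ s -> tube_fun pb ≈ f⟪s⟫ -> base pb ≈ a⟪s⟫ ->
  PNat r (generic_problem f a He) pb.
Proof.
  intros Hr HA Hp Hf Ha. split.
  - rewrite clift_sub, Hr; exact HA.
  - rewrite comp_assoc, Hr; exact Hp.
  - intros K d u u' i.
    assert (v : El ((holds phi)⟦wk (Agree f a) ∘ (r ∘ d)⟧)).
    { refine (hcast u _). nf; reflexivity. }
    assert (v' : El ((holds phi)⟦s ∘ d⟧)).
    { refine (hcast v _). rewrite <- (comp_assoc (wk _)), Hr; reflexivity. }
    unfold generic_problem; rewrite (problem_of_tapp _ _ _ v).
    transitivity (tsub (val (tubev f)) (cpair (pair v') i)).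
    + rewrite <- (tubev_stage HA Hp Hf v' u'). unfold tubev, tube_fun; rewrite !unlam_lam. reflexivity.
    + f_equal. apply chom_ext; [apply holds_hom|]; nf; try reflexivity.
      rewrite <- (comp_assoc (wk _)), Hr; reflexivity.
  - rewrite Ha; simpl. rewrite tsub_comp, Hr; reflexivity.
Qed.

(** Operations solving all composition problems over reindexings of [A], which are the
    elements of [Comp A] viewed from outside. *)
Record CompOp {G} (A : Ty (G ▸ II)) := {
  op : forall D (t : Hom D G) (A' : Ty (D ▸ II)) (HA : A' = A⟦clift II t⟧) b
    (phi : Elc (code Cof) D), Problem A' b phi -> El (at_ A' (endpoint (negb b) D));
  op_ext : forall D (t : Hom D G) (A' : Ty (D ▸ II)) (HA : A' = A⟦clift II t⟧) b
    (phi : Elc (code Cof) D) (pb : Problem A' b phi) K (d : Hom K D) (u : El ((holds phi)⟦d⟧)),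
    tapp pb u (endpoint (negb b) K) = tsub (val (op HA pb)) d;
  op_nat : forall D (t : Hom D G) (A' : Ty (D ▸ II)) (HA : A' = A⟦clift II t⟧) b
    (phi : Elc (code Cof) D) (pb : Problem A' b phi)
    D1 (t1 : Hom D1 G) (A1 : Ty (D1 ▸ II)) (HA1 : A1 = A⟦clift II t1⟧)
    (phi1 : Elc (code Cof) D1) (pb1 : Problem A1 b phi1) (r : Hom D1 D),
    t1 = t ∘ r -> PNat r pb pb1 -> op HA1 pb1 ≈ (op HA pb)⟪r⟫
}.

Section OfOp.
Context {G0} {A0 : Ty (G0 ▸ II)} (F : CompOp A0) {b : bool}.

Section Of4.
Context {G} {t : Hom G G0} {A : Ty (G ▸ II)} {e : Elc Two G} {phi : Elc (code Cof) G}
  (f : El (Tube A phi)) (a : El (at_ A (incl ∘ e)))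
  (HA : A = A0⟦clift II t⟧) (He : e = const G (two b)).

Program Definition comp4_body : El ((Extn f (incl ∘ (opp ∘ e)))⟦wk (Agree f a)⟧) :=
  extn_intro (x := ⌊op F (clift_sub_eq _ HA) (generic_problem f a He)⌋) _.
Next Obligation. rewrite at_sub, (incl_opp_end _ He); reflexivity. Qed.
Next Obligation.
  intros K r u. simpl.
  assert (v : El ((holds (phi ∘ wk (Agree f a)))⟦r⟧)).
  { refine (hcast u _). nf; reflexivity. }
  rewrite <- (op_ext F _ _ v). unfold generic_problem. rewrite (problem_of_tapp _ _ _ u).
  do 2 f_equal. etransitivity; [symmetry; apply comp_assoc|].
  rewrite (incl_opp_end _ He), endpoint_sub; reflexivity.
Qed.

Definition comp4_of : El (Comp4 f a) := lam comp4_body.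

(** The term was built from the operation at the generic problem alone; [op_nat] recovers its value
    at [pb], a reindexing of that problem. *)
Lemma comp4_of_solve {D} {A' : Ty (D ▸ II)} {phi' : Elc (code Cof) D} (pb : Problem A' b phi')
  {s : Hom D G} HA' He' Hp Hf Ha (x : El ((Comp4 f a)⟦s⟧)) {t0 : Hom D G0}
  (Ht : t0 = t ∘ s) (H0 : A' = A0⟦clift II t0⟧) :
  x ≈ comp4_of⟪s⟫ -> stage_solve4 (pb := pb) HA' He' Hp Hf Ha x ≈ op F H0 pb.
Proof.
  intro Hx. unfold stage_solve4, stage_extn.
  set (ag := stage_agree _ _ _ _ _).
  transitivity (val ((sfst (comp4_body : El ((Sig _)⟦_⟧)))⟪pair ag⟫)).
  - simpl val. refine (sfst_sub (t := pair ag) _ _); [reflexivity|].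
    refine (app_lam_sub _ _). exact Hx.
  - unfold comp4_body. simpl val. rewrite extn_intro_fst. symmetry.
    refine (op_nat _ _ _ _ _).
    + rewrite comp_assoc, wk_pair'; exact Ht.
    + eapply generic_problem_nat; try eassumption. apply wk_pair'.
Qed.
End Of4.

Section Of3.
Context {G} {t : Hom G G0} {A : Ty (G ▸ II)} {e : Elc Two G} {phi : Elc (code Cof) G}
  (f : El (Tube A phi)) (HA : A = A0⟦clift II t⟧) (He : e = const G (two b)).

Definition comp3_of : El (Comp3 e f) :=
  lam (comp4_of _ _ (clift_sub_eq _ HA) (const_sub_eq _ He)).

Lemma comp3_of_solve {D} {A' : Ty (D ▸ II)} {phi' : Elc (code Cof) D} (pb : Problem A' b phi')
  {s : Hom D G} HA' He' Hp Hf (x : El ((Comp3 e f)⟦s⟧)) {t0 : Hom D G0}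
  (Ht : t0 = t ∘ s) (H0 : A' = A0⟦clift II t0⟧) :
  x ≈ comp3_of⟪s⟫ -> stage_solve3 (pb := pb) HA' He' Hp Hf x ≈ op F H0 pb.
Proof.
  intro Hx. unfold stage_solve3.
  eapply comp4_of_solve; [|eapply app_lam_sub; exact Hx].
  apply comp_wk_pair, Ht.
Qed.
End Of3.

Section Of2.
Context {G} {t : Hom G G0} {A : Ty (G ▸ II)} {e : Elc Two G} {phi : Elc (code Cof) G}
  (HA : A = A0⟦clift II t⟧) (He : e = const G (two b)).

Definition comp2_of : El (Comp2 A e phi) :=
  lam (comp3_of _ (clift_sub_eq _ HA) (const_sub_eq _ He)).

Lemma comp2_of_solve {D} {A' : Ty (D ▸ II)} {phi' : Elc (code Cof) D} (pb : Problem A' b phi')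
  {s : Hom D G} HA' He' Hp (x : El ((Comp2 A e phi)⟦s⟧)) {t0 : Hom D G0}
  (Ht : t0 = t ∘ s) (H0 : A' = A0⟦clift II t0⟧) :
  x ≈ comp2_of⟪s⟫ -> stage_solve2 pb HA' He' Hp x ≈ op F H0 pb.
Proof.
  intro Hx. unfold stage_solve2.
  eapply comp3_of_solve; [|eapply app_lam_sub; exact Hx].
  apply comp_wk_pair, Ht.
Qed.
End Of2.

Section Of1.
Context {G} {t : Hom G G0} {A : Ty (G ▸ II)} {e : Elc Two G}
  (HA : A = A0⟦clift II t⟧) (He : e = const G (two b)).

Definition comp1_of : El (Comp1 A e) :=
  lam (comp2_of (clift_sub_eq _ HA) (const_sub_eq _ He)).

Lemma comp1_of_solve {D} {A' : Ty (D ▸ II)} {phi' : Elc (code Cof) D} (pb : Problem A' b phi')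
  {s : Hom D G} HA' He' (x : El ((Comp1 A e)⟦s⟧)) {t0 : Hom D G0}
  (Ht : t0 = t ∘ s) (H0 : A' = A0⟦clift II t0⟧) :
  x ≈ comp1_of⟪s⟫ -> stage_solve1 pb HA' He' x ≈ op F H0 pb.
Proof.
  intro Hx. unfold stage_solve1.
  eapply comp2_of_solve; [|eapply app_lam_sub; exact Hx].
  apply comp_wk_pair, Ht.
Qed.
End Of1.
End OfOp.

Lemma solve1_val {G D} {t : Hom D G} {A : Ty (G ▸ II)} {A' : Ty (D ▸ II)} (HA : A' = A⟦clift II t⟧)
  (c : El (Comp A)) (d : El (Comp A')) (b : bool) :
  d ≈ c⟪t⟫ -> solve1 (b := b) d ≈ (unlam (c : El (Pi _)))⟪two_pt b G ∘ t⟫.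
Proof.
  intro Hd.
  assert (H1 : Comp A' = (Comp A)⟦t⟧) by (rewrite Comp_sub, <- HA; reflexivity).
  transitivity (val (app (cast H1 d : El ((Pi _)⟦t⟧)) (elem_arg t (const D (two b))))).
  - refine (app_app_id (H := closed_sub t) _ _ _); [|reflexivity|reflexivity].
    apply Comp0_body, HA.
  - rewrite (app_unlam_sub (y := c) (f := cast H1 d) (elem_arg t (const D (two b))) Hd).
    simpl; f_equal. unfold two_pt. apply ext_eta; nf; [reflexivity|].
    rewrite const_comp; reflexivity.
Qed.

Lemma two_pt_A {G} (A : Ty (G ▸ II)) b :
  (Comp1 (A⟦clift II (wk (Two⟦bang G⟧))⟧) (cvar Two G))⟦two_pt b G⟧ = Comp1 A (const G (two b)).
Proof.
  apply Comp1_sub.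
  - rewrite clift_sub. unfold two_pt; rewrite wk_inst, clift_id, Tsub_id; reflexivity.
  - unfold two_pt; rewrite cvar_inst_elem; reflexivity.
Qed.

(** An operation is indexed by a boolean direction, whereas [Comp] quantifies over the type [Two].
    The case split makes the direction a constant, as [comp1_of] requires. *)
Definition comp_of {G} {A : Ty (G ▸ II)} (F : CompOp A) : El (Comp A) :=
  lam (two_case (fun b => cast (eq_sym (two_pt_A A b))
    (comp1_of F (t := idm G) (clift_idm_eq A) eq_refl))).

Lemma comp_of_solve {G} {A : Ty (G ▸ II)} (F : CompOp A) {D} {t : Hom D G} {A' : Ty (D ▸ II)}
  (HA : A' = A⟦clift II t⟧) {b : bool} {phi : Elc (code Cof) D} (pb : Problem A' b phi)
  (d : El (Comp A')) :
  d ≈ (comp_of F)⟪t⟫ -> solve d pb ≈ op F HA pb.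
Proof.
  intro Hd.
  rewrite (solve_stage1 (c := d) pb HA (const_sub_eq' t eq_refl)
    (x := (comp1_of F (t := idm G) (b := b) (clift_idm_eq A) eq_refl)⟪t⟫)).
  - eapply comp1_of_solve; [rewrite comp_idl|]; reflexivity.
  - rewrite (solve1_val HA _ Hd). unfold comp_of. rewrite unlam_lam.
    etransitivity; [symmetry; apply tsub_comp|].
    exact (f_equal (fun z => tsub z t) (two_case_pt _ b)).
Qed.

Section Injectivity.
Context {b : bool}.

Lemma stage_solve4_congr {D} {A' : Ty (D ▸ II)} {phi' : Elc (code Cof) D} (pb : Problem A' b phi')
  {G} {A : Ty (G ▸ II)} {e : Elc Two G} {phi : Elc (code Cof) G} (f : El (Tube A phi))
  (a : El (at_ A (incl ∘ e))) {s s1 : Hom D G} HA He Hp Hf Ha HA1 He1 Hp1 Hf1 Ha1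
  (x : El ((Comp4 f a)⟦s⟧)) (x1 : El ((Comp4 f a)⟦s1⟧)) :
  s1 = s -> x1 ≈ x ->
  stage_solve4 (pb := pb) HA1 He1 Hp1 Hf1 Ha1 x1 ≈ stage_solve4 (pb := pb) HA He Hp Hf Ha x.
Proof.
  intros -> Hx; apply El_ext in Hx; subst x1.
  rewrite (proof_irrelevance _ HA1 HA), (proof_irrelevance _ He1 He), (proof_irrelevance _ Hp1 Hp),
    (proof_irrelevance _ Hf1 Hf), (proof_irrelevance _ Ha1 Ha); reflexivity.
Qed.

Lemma stage_solve4_beta {D} {A' : Ty (D ▸ II)} {phi' : Elc (code Cof) D} (pb : Problem A' b phi')
  {G} {A : Ty (G ▸ II)} {e : Elc Two G} {phi : Elc (code Cof) G} (f : El (Tube A phi))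
  (a : El (at_ A (incl ∘ e))) {s : Hom D G} HA He Hp Hf Ha
  (y : El (Comp4 f a)) (x : El ((Comp4 f a)⟦s⟧)) r :
  x ≈ y⟪s⟫ -> wk _ ∘ r = s ->
  stage_solve4 (pb := pb) HA He Hp Hf Ha x ≈ (sfst (unlam (y : El (Pi _)) : El ((Sig _)⟦_⟧)))⟪r⟫.
Proof.
  intros Hx Hr. unfold stage_solve4, stage_extn.
  set (ag := stage_agree _ _ _ _ _).
  (* The section [r] is forced, because the last component of its target is the proposition of
     agreement. *)
  assert (r = pair ag) as ->.
  { apply IsProp_hom; [intros K q h h'; apply agree_prop|]. rewrite Hr, wk_pair'; reflexivity. }
  simpl val. refine (sfst_sub (t := pair ag) _ _); [reflexivity|].
  apply app_unlam_sub, Hx.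
Qed.

Section Inj4.
Context {G} {A : Ty (G ▸ II)} {e : Elc Two G} {phi : Elc (code Cof) G}
  (f : El (Tube A phi)) (a : El (at_ A (incl ∘ e))) (He : e = const G (two b))
  (y y' : El (Comp4 f a)).

(** Testing on the generic problem at the identity suffices, since there the staged solution is the
    first projection of the body of the function. *)
Lemma comp4_inj :
  (forall D (s : Hom D G) (A' : Ty (D ▸ II)) (HA : A' = A⟦clift II s⟧) He (phi' : Elc (code Cof) D)
     (Hp : phi' = phi ∘ s) (pb : Problem A' b phi') Hf Ha,
     stage_solve4 (pb := pb) HA He Hp Hf Ha (y⟪s⟫) ≈ stage_solve4 HA He Hp Hf Ha (y'⟪s⟫)) ->
  y = y'.
Proof.
  intro H.
  rewrite <- (lam_unlam (y : El (Pi _))), <- (lam_unlam (y' : El (Pi _))). f_equal.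
  apply extn_ext.
  specialize (H _ (wk (Agree f a)) _ eq_refl (const_sub_eq' _ He) _ eq_refl (generic_problem f a He)
    (problem_of_fun _ _ _) eq_refl).
  rewrite !(stage_solve4_beta _ _ _ _ _ (r := idm _) eq_refl (comp_idr _)) in H.
  simpl in H; rewrite !tsub_id in H; exact H.
Qed.
End Inj4.

Section Inj3.
Context {G} {A : Ty (G ▸ II)} {e : Elc Two G} {phi : Elc (code Cof) G}
  (f : El (Tube A phi)) (He : e = const G (two b)) (y y' : El (Comp3 e f)).

Lemma comp3_inj :
  (forall D (s : Hom D G) (A' : Ty (D ▸ II)) (HA : A' = A⟦clift II s⟧) He (phi' : Elc (code Cof) D)
     (Hp : phi' = phi ∘ s) (pb : Problem A' b phi') Hf,
     stage_solve3 (pb := pb) HA He Hp Hf (y⟪s⟫) ≈ stage_solve3 HA He Hp Hf (y'⟪s⟫)) ->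
  y = y'.
Proof.
  intro H.
  rewrite <- (lam_unlam (y : El (Pi _))), <- (lam_unlam (y' : El (Pi _))). f_equal.
  apply comp4_inj; [apply const_sub_eq, He|].
  intros D s A' HA He' phi' Hp pb Hf Ha.
  assert (HA0 : A' = A⟦clift II (wk _ ∘ s)⟧) by (rewrite HA, clift_sub; reflexivity).
  assert (Hp0 : phi' = phi ∘ (wk _ ∘ s)) by (rewrite Hp, comp_assoc; reflexivity).
  assert (Hf0 : tube_fun pb ≈ f⟪wk _ ∘ s⟫) by (rewrite Hf; simpl; apply tsub_comp).
  specialize (H _ (wk _ ∘ s) A' HA0 (const_sub_eq' _ He) phi' Hp0 pb Hf0).
  unfold stage_solve3 in H.
  set (ba := base_arg _ _ _) in H.
  (* A stage of the extended context is its restriction to [G] together with the base of [pb], so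
     the hypothesis at [wk _ ∘ s] covers it. The outer lemmas use the tube and the cofibration of
     [pb] in the same way. *)
  assert (Hs : s = pair ba).
  { apply hom_pair; [reflexivity | symmetry; exact Ha]. }
  assert (Hy : forall q : El (Comp3 e f),
    (unlam (q : El (Pi _)))⟪s⟫ ≈ app (q⟪wk _ ∘ s⟫ : El ((Pi _)⟦_⟧)) ba).
  { intro q. symmetry. etransitivity; [apply (app_unlam_sub (y := q)); reflexivity|].
    exact (f_equal (tsub _) (eq_sym Hs)). }
  etransitivity; [|etransitivity; [exact H|]].
  - apply stage_solve4_congr; [exact Hs | apply Hy].
  - symmetry. apply stage_solve4_congr; [exact Hs | apply Hy].
Qed.
End Inj3.

Section Congr.
Context {D} {A' : Ty (D ▸ II)} {phi' : Elc (code Cof) D} (pb : Problem A' b phi')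
  {G} {A : Ty (G ▸ II)} {e : Elc Two G} {phi : Elc (code Cof) G} (f : El (Tube A phi)).

Lemma stage_solve3_congr {s s1 : Hom D G} HA He Hp Hf HA1 He1 Hp1 Hf1
  (x : El ((Comp3 e f)⟦s⟧)) (x1 : El ((Comp3 e f)⟦s1⟧)) :
  s1 = s -> x1 ≈ x ->
  stage_solve3 (pb := pb) HA1 He1 Hp1 Hf1 x1 ≈ stage_solve3 (pb := pb) HA He Hp Hf x.
Proof.
  intros -> Hx; apply El_ext in Hx; subst x1.
  rewrite (proof_irrelevance _ HA1 HA), (proof_irrelevance _ He1 He), (proof_irrelevance _ Hp1 Hp),
    (proof_irrelevance _ Hf1 Hf); reflexivity.
Qed.

Lemma stage_solve2_congr {s s1 : Hom D G} HA He Hp HA1 He1 Hp1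
  (x : El ((Comp2 A e phi)⟦s⟧)) (x1 : El ((Comp2 A e phi)⟦s1⟧)) :
  s1 = s -> x1 ≈ x -> stage_solve2 pb HA1 He1 Hp1 x1 ≈ stage_solve2 pb HA He Hp x.
Proof.
  intros -> Hx; apply El_ext in Hx; subst x1.
  rewrite (proof_irrelevance _ HA1 HA), (proof_irrelevance _ He1 He), (proof_irrelevance _ Hp1 Hp);
    reflexivity.
Qed.
End Congr.

Section Inj2.
Context {G} {A : Ty (G ▸ II)} {e : Elc Two G} {phi : Elc (code Cof) G}
  (He : e = const G (two b)) (y y' : El (Comp2 A e phi)).

Lemma comp2_inj :
  (forall D (s : Hom D G) (A' : Ty (D ▸ II)) (HA : A' = A⟦clift II s⟧) He (phi' : Elc (code Cof) D)
     (Hp : phi' = phi ∘ s) (pb : Problem A' b phi'),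
     stage_solve2 pb HA He Hp (y⟪s⟫) ≈ stage_solve2 pb HA He Hp (y'⟪s⟫)) ->
  y = y'.
Proof.
  intro H.
  rewrite <- (lam_unlam (y : El (Pi _))), <- (lam_unlam (y' : El (Pi _))). f_equal.
  apply comp3_inj; [apply const_sub_eq, He|].
  intros D s A' HA He' phi' Hp pb Hf.
  assert (HA0 : A' = A⟦clift II (wk _ ∘ s)⟧) by (rewrite HA, clift_sub; reflexivity).
  assert (Hp0 : phi' = phi ∘ (wk _ ∘ s)) by (rewrite Hp, comp_assoc; reflexivity).
  specialize (H _ (wk _ ∘ s) A' HA0 (const_sub_eq' _ He) phi' Hp0 pb).
  unfold stage_solve2 in H.
  set (ba := tube_arg _ _ _) in H.
  assert (Hs : s = pair ba).
  { apply hom_pair; [reflexivity | symmetry; exact Hf]. }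
  assert (Hy : forall q : El (Comp2 A e phi),
    (unlam (q : El (Pi _)))⟪s⟫ ≈ app (q⟪wk _ ∘ s⟫ : El ((Pi _)⟦_⟧)) ba).
  { intro q. symmetry. etransitivity; [apply (app_unlam_sub (y := q)); reflexivity|].
    exact (f_equal (tsub _) (eq_sym Hs)). }
  etransitivity; [|etransitivity; [exact H|]].
  - apply stage_solve3_congr; [exact Hs | apply Hy].
  - symmetry. apply stage_solve3_congr; [exact Hs | apply Hy].
Qed.
End Inj2.

Section Inj1.
Context {G} {A : Ty (G ▸ II)} {e : Elc Two G}
  (He : e = const G (two b)) (y y' : El (Comp1 A e)).

Lemma comp1_inj :
  (forall D (s : Hom D G) (A' : Ty (D ▸ II)) (HA : A' = A⟦clift II s⟧) He (phi' : Elc (code Cof) D)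
     (pb : Problem A' b phi'), stage_solve1 pb HA He (y⟪s⟫) ≈ stage_solve1 pb HA He (y'⟪s⟫)) ->
  y = y'.
Proof.
  intro H.
  rewrite <- (lam_unlam (y : El (Pi _))), <- (lam_unlam (y' : El (Pi _))). f_equal.
  apply comp2_inj; [apply const_sub_eq, He|].
  intros D s A' HA He' phi' Hp pb.
  assert (HA0 : A' = A⟦clift II (wk _ ∘ s)⟧) by (rewrite HA, clift_sub; reflexivity).
  specialize (H _ (wk _ ∘ s) A' HA0 (const_sub_eq' _ He) phi' pb).
  unfold stage_solve1 in H.
  set (ba := elem_arg _ _) in H.
  assert (Hs : s = pair ba).
  { apply hom_pair; [reflexivity|]. rewrite <- var_cvar_assoc. simpl. rewrite Hp; reflexivity. }
  assert (Hy : forall q : El (Comp1 A e),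
    (unlam (q : El (Pi _)))⟪s⟫ ≈ app (q⟪wk _ ∘ s⟫ : El ((Pi _)⟦_⟧)) ba).
  { intro q. symmetry. etransitivity; [apply (app_unlam_sub (y := q)); reflexivity|].
    exact (f_equal (tsub _) (eq_sym Hs)). }
  etransitivity; [|etransitivity; [exact H|]].
  - apply stage_solve2_congr; [exact Hs | apply Hy].
  - symmetry. apply stage_solve2_congr; [exact Hs | apply Hy].
Qed.
End Inj1.
End Injectivity.

(** Maps out of [Two] are determined at its two points, which fixes the direction; the remaining
    quantifiers are handled by [comp1_inj]. *)
Lemma comp_inj {G} {A : Ty (G ▸ II)} (c c' : El (Comp A)) :
  (forall D (t : Hom D G) (A' : Ty (D ▸ II)) (HA : A' = A⟦clift II t⟧) b (phi : Elc (code Cof) D)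
     (pb : Problem A' b phi)
     (d d' : El (Comp A')), d ≈ c⟪t⟫ -> d' ≈ c'⟪t⟫ -> solve d pb ≈ solve d' pb) ->
  c = c'.
Proof.
  intro H.
  rewrite <- (lam_unlam (c : El (Pi _))), <- (lam_unlam (c' : El (Pi _))). f_equal.
  apply two_ext; intro b.
  pose (y q := cast (two_pt_A A b) ((unlam (q : El (Pi _)))⟪two_pt b G⟫)).
  enough (e : y c = y c') by exact (f_equal (@val _ _ _) e).
  apply (comp1_inj (b := b) eq_refl).
  intros D s A' HA He phi' pb.
  assert (HC : (Comp A)⟦s⟧ = Comp A') by (rewrite HA; apply Comp_sub).
  specialize (H D s A' HA b phi' pb (cast HC (c⟪s⟫)) (cast HC (c'⟪s⟫)) eq_refl eq_refl).
  assert (Hy : forall q : El (Comp A), solve1 (b := b) (cast HC (q⟪s⟫)) ≈ (y q)⟪s⟫).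
  { intro q. rewrite (solve1_val HA (c := q)) by reflexivity. simpl. rewrite tsub_comp; reflexivity. }
  rewrite (solve_stage1 pb HA He (Hy c)), (solve_stage1 pb HA He (Hy c')) in H.
  exact H.
Qed.

End CompIntro.

(** * Fibration structures *)

Section Fib.
Context {E : CwF} {T : TypeFormers E} {I : Interval T} {P : PathContexts I}
  {C : Cofibrations I}.

Lemma cur_sub {G D K} (p : Hom (D ▸ II) G) (t : Hom K D) : cur p ∘ t = cur (p ∘ clift II t).
Proof.
  rewrite <- (cur_ev (cur p ∘ t)), <- clift_comp, <- comp_assoc, ev_cur; reflexivity.
Qed.

Lemma exp_map_cur {G G' D} (o : Hom G' G) (p : Hom (D ▸ II) G') :
  exp_map o ∘ cur p = cur (o ∘ p).
Proof. unfold exp_map; rewrite cur_sub, comp_assoc, ev_cur; reflexivity. Qed.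

Lemma exp_map_comp {G G' D} (o : Hom G' G) (o' : Hom D G') :
  exp_map o ∘ exp_map o' = exp_map (o ∘ o').
Proof. unfold exp_map at 2. rewrite exp_map_cur, <- comp_assoc; reflexivity. Qed.

Lemma exp_map_id {G} : exp_map (idm G) = idm (Exp G).
Proof.
  unfold exp_map. rewrite comp_idl. rewrite <- (cur_ev (idm (Exp G))), clift_id, comp_idr.
  reflexivity.
Qed.

(** [st'] is the reindexing of [st] along [o]. *)
Record FNat {G G'} (o : Hom G' G) {A : Ty G} {A' : Ty G'} (st : FibStr A) (st' : FibStr A') :
  Prop := {
  fnat_ty : A' = A⟦o⟧;
  fnat_str : st' ≈ st⟪exp_map o⟫
}.

Lemma fib_sub_nat {G G'} (o : Hom G' G) {A : Ty G} (st : FibStr A) : FNat o st (fib_sub st o).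
Proof. split; reflexivity. Qed.

Lemma FNat_id {G} {A : Ty G} (st : FibStr A) : FNat (idm G) st st.
Proof.
  split; [symmetry; apply Tsub_id|]. simpl. rewrite exp_map_id, tsub_id; reflexivity.
Qed.

(** Base change and change of stage in one law; the naturality of every construction on fibrations
    below rests on it. *)
Lemma fcomp_nat {G G'} {o : Hom G' G} {A : Ty G} {A' : Ty G'} {st : FibStr A} {st' : FibStr A'}
  {D D'} {p : Hom (D ▸ II) G} {p' : Hom (D' ▸ II) G'} {t : Hom D' D} {b : bool}
  {phi : Elc (code Cof) D} {phi' : Elc (code Cof) D'}
  {pb : Problem (A⟦p⟧) b phi} {pb' : Problem (A'⟦p'⟧) b phi'} :
  FNat o st st' -> o ∘ p' = p ∘ clift II t -> PNat t pb pb' ->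
  fcomp st' pb' ≈ (fcomp st pb)⟪t⟫.
Proof.
  intros [_ Hst] Hp Hpb. apply (solve_nat Hpb).
  simpl. rewrite Hst; simpl. rewrite !tsub_comp, exp_map_cur, Hp, cur_sub; reflexivity.
Qed.

Lemma fcomp_ext {G} {A : Ty G} (st : FibStr A) {D} {p : Hom (D ▸ II) G} {b : bool}
  {phi : Elc (code Cof) D} (pb : Problem (A⟦p⟧) b phi) {K} {d : Hom K D} (u : El ((holds phi)⟦d⟧)) :
  tsub (val (fcomp st pb)) d = tapp pb u (endpoint (negb b) K).
Proof. apply solve_ext. Qed.

Definition pcast {D} {A A' : Ty (D ▸ II)} (H : A = A') {b : bool} {phi : Elc (code Cof) D}
  (pb : Problem A b phi) : Problem A' b phi.
Proof.
  refine (mkProblem (tube := cast (f_equal (fun Z => Z⟦clift II (wk (holds phi))⟧) H) (tube pb))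
            (base := cast (f_equal (fun Z => at_ Z (endpoint b D)) H) (base pb)) _).
  exact (tube_base pb).
Defined.

Lemma PNat_pcast {D D'} {t : Hom D' D} {A A1 : Ty (D ▸ II)} {b : bool} {phi : Elc (code Cof) D}
  {pb : Problem A b phi} {A' A1' : Ty (D' ▸ II)} {phi' : Elc (code Cof) D'}
  {pb' : Problem A' b phi'} (H : A = A1) (H' : A' = A1') :
  PNat t pb pb' -> PNat t (pcast H pb) (pcast H' pb').
Proof.
  intros [Ha Hp Ht Hb]; split; [rewrite <- H', <- H; exact Ha | exact Hp | exact Ht | exact Hb].
Qed.

Lemma PNat_idm {D} {A A' : Ty (D ▸ II)} {b : bool} {phi : Elc (code Cof) D}
  (pb : Problem A b phi) (pb' : Problem A' b phi) :
  A' = A -> tube pb' ≈ tube pb -> base pb' ≈ base pb -> PNat (idm D) pb pb'.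
Proof.
  intros HA Ht Hb; split.
  - rewrite HA; apply clift_idm_eq.
  - symmetry; apply comp_idr.
  - intros K d u u' i. transitivity (tapp pb u' i).
    + unfold tapp; rewrite Ht; reflexivity.
    + apply tapp_irr; symmetry; apply comp_idl.
  - simpl; rewrite tsub_id; exact Hb.
Qed.

Lemma solve_congr {D} {A A' : Ty (D ▸ II)} {b : bool} {phi : Elc (code Cof) D}
  (pb : Problem A b phi) (pb' : Problem A' b phi) (c : El (Comp A)) (c' : El (Comp A')) :
  A' = A -> tube pb' ≈ tube pb -> base pb' ≈ base pb -> c' ≈ c -> solve c' pb' ≈ solve c pb.
Proof.
  intros HA Ht Hb Hc. etransitivity; [|apply tsub_id].
  apply (solve_nat (PNat_idm HA Ht Hb)). rewrite Hc; simpl; rewrite tsub_id; reflexivity.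
Qed.

(** The values of a fibration structure on all problems in all contexts; by naturality
    they determine it. *)
Record FibOp {G} (A : Ty G) := {
  fop : forall D (p : Hom (D ▸ II) G) b (phi : Elc (code Cof) D),
    Problem (A⟦p⟧) b phi -> El (at_ (A⟦p⟧) (endpoint (negb b) D));
  fop_ext : forall D (p : Hom (D ▸ II) G) b (phi : Elc (code Cof) D) (pb : Problem (A⟦p⟧) b phi)
    K (d : Hom K D) (u : El ((holds phi)⟦d⟧)),
    tapp pb u (endpoint (negb b) K) = tsub (val (fop pb)) d;
  fop_nat : forall D (p : Hom (D ▸ II) G) b (phi : Elc (code Cof) D) (pb : Problem (A⟦p⟧) b phi)
    D1 (p1 : Hom (D1 ▸ II) G) (phi1 : Elc (code Cof) D1) (pb1 : Problem (A⟦p1⟧) b phi1)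
    (r : Hom D1 D), p1 = p ∘ clift II r -> PNat r pb pb1 -> fop pb1 ≈ (fop pb)⟪r⟫
}.

Section FibOf.
Context {G} {A : Ty G} (F : FibOp A).

Lemma fib_of_ty {D} {t : Hom D (Exp G)} {A' : Ty (D ▸ II)} :
  A' = A⟦ev G⟧⟦clift II t⟧ -> A' = A⟦ev G ∘ clift II t⟧.
Proof. intros ->; apply Tsub_comp. Qed.

(** A stage [t] of [Exp G] is the same as the path [ev G ∘ clift II t], so an operation on paths in
    [G] becomes one on stages of [Exp G]. *)
Definition fib_of_op D (t : Hom D (Exp G)) (A' : Ty (D ▸ II)) (HA : A' = A⟦ev G⟧⟦clift II t⟧) b
  (phi : Elc (code Cof) D) (pb : Problem A' b phi) : El (at_ A' (endpoint (negb b) D)) :=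
  cast (f_equal (fun Z => at_ Z _) (eq_sym (fib_of_ty HA))) (fop F (pcast (fib_of_ty HA) pb)).

Definition fib_of_comp : CompOp (A⟦ev G⟧).
Proof.
  refine {| op := fib_of_op |}.
  - intros. simpl. rewrite <- (fop_ext F _ u). reflexivity.
  - intros D t A' HA b phi pb D1 t1 A1 HA1 phi1 pb1 r Ht Hpb.
    refine (fop_nat (pb := pcast _ pb) _ _ _).
    + rewrite Ht, comp_assoc, clift_comp; reflexivity.
    + apply PNat_pcast, Hpb.
Defined.

Definition fib_of : FibStr A := comp_of fib_of_comp.

(** Computation rule: the path belonging to the stage [cur p] is [p] again, by [ev_cur]. *)
Lemma fcomp_fib_of {D} (p : Hom (D ▸ II) G) {b : bool} {phi : Elc (code Cof) D}
  (pb : Problem (A⟦p⟧) b phi) : fcomp fib_of pb ≈ fop F pb.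
Proof.
  assert (HA : A⟦p⟧ = A⟦ev G⟧⟦clift II (cur p)⟧) by (rewrite Tsub_comp, ev_cur; reflexivity).
  unfold fcomp. rewrite (comp_of_solve (F := fib_of_comp) HA) by reflexivity.
  simpl. etransitivity; [refine (fop_nat (pb := pb) (r := idm D) _ _ _)|apply tsub_id].
  - rewrite ev_cur, clift_id, comp_idr; reflexivity.
  - apply PNat_idm; [rewrite ev_cur; reflexivity | reflexivity | reflexivity].
Qed.

End FibOf.

(** Uniqueness: by [cur_ev] every stage of [Exp G] comes from a path, so [comp_inj] has only
    problems along paths to test. *)
Lemma fib_ext {G} {A : Ty G} (st st' : FibStr A) :
  (forall D (p : Hom (D ▸ II) G) b (phi : Elc (code Cof) D) (pb : Problem (A⟦p⟧) b phi),
     fcomp st pb ≈ fcomp st' pb) -> st = st'.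
Proof.
  intro H. apply comp_inj. intros D t A' HA b phi pb d d' Hd Hd'.
  specialize (H D (ev G ∘ clift II t) b phi (pcast (fib_of_ty HA) pb)).
  etransitivity; [|etransitivity; [exact H|]]; unfold fcomp; apply solve_congr;
    try reflexivity; simpl; try (rewrite cur_ev; assumption).
  - apply fib_of_ty, HA.
  - symmetry; apply fib_of_ty, HA.
  - rewrite cur_ev; symmetry; assumption.
Qed.

End Fib.

(** * Partial lines over unions of cofibrations *)

Section OrTube.
Context {E : CwF} {T : TypeFormers E} {I : Interval T} {C : Cofibrations I}.

(** Values of partial lines are raw terms whose types are known only up to equality, hence the
    hypothesis on [ty]. *)
Lemma or_cases_tm {K D} {phi psi : Elc (code Cof) D} {d : Hom K D}
  (u : El ((holds (cof_or phi psi))⟦d⟧)) (a b : Tm K) :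
  ty a = ty b ->
  (forall K' (r : Hom K' K), El ((holds phi)⟦d ∘ r⟧) -> tsub a r = tsub b r) ->
  (forall K' (r : Hom K' K), El ((holds psi)⟦d ∘ r⟧) -> tsub a r = tsub b r) -> a = b.
Proof.
  intros Hty H1 H2.
  exact (f_equal (@val _ _ _) (or_cases u (a := mkEl (A := ty b) Hty) (b := mkEl eq_refl) H1 H2)).
Qed.

(** The value at [u] and [i] of a partial line defined on [phi]. *)
Definition tval {D} {phi : Elc (code Cof) D} (f : Tm (D ▹ holds phi ▸ II)) {K} {d : Hom K D}
  (u : El ((holds phi)⟦d⟧)) (i : Elc II K) : Tm K := tsub f (cpair (pair u) i).

Lemma tval_irr {D} {phi : Elc (code Cof) D} (f : Tm (D ▹ holds phi ▸ II)) {K} {d d' : Hom K D}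
  (u : El ((holds phi)⟦d⟧)) (u' : El ((holds phi)⟦d'⟧)) (i : Elc II K) :
  d = d' -> tval f u i = tval f u' i.
Proof. intros ->. rewrite (holds_prop u u'); reflexivity. Qed.

Lemma tval_sub {D} {phi : Elc (code Cof) D} (f : Tm (D ▹ holds phi ▸ II))
  {K K'} {d : Hom K D} (u : El ((holds phi)⟦d⟧)) (i : Elc II K) (r : Hom K' K)
  (u' : El ((holds phi)⟦d ∘ r⟧)) : tsub (tval f u i) r = tval f u' (i ∘ r).
Proof.
  unfold tval; rewrite tsub_comp; f_equal. rewrite cpair_comp; f_equal.
  apply holds_hom; nf; reflexivity.
Qed.

Lemma tval_ty {D} {B : Ty (D ▸ II)} {phi : Elc (code Cof) D}
  (f : El (B⟦clift II (wk (holds phi))⟧)) {K} {d : Hom K D} (u : El ((holds phi)⟦d⟧)) (i : Elc II K) :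
  ty (tval (val f) u i) = B⟦cpair d i⟧.
Proof.
  unfold tval. rewrite ty_tsub, (val_ty f), Tsub_comp. f_equal. hom_eq.
Qed.

Lemma tval_eta {D} {phi : Elc (code Cof) D} (f : Tm (D ▹ holds phi ▸ II)) {K}
  (r : Hom K (D ▹ holds phi ▸ II))
  (u : El ((holds phi)⟦wk (holds phi) ∘ (wk (II⟦bang _⟧) ∘ r)⟧)) :
  tsub f r = tval f u (cvar II _ ∘ r).
Proof.
  unfold tval; f_equal. apply chom_ext; [|nf; reflexivity].
  apply holds_hom; nf; reflexivity.
Qed.

Section Glue.
Context {D} {B : Ty (D ▸ II)} {phi psi : Elc (code Cof) D}
  (f1 : El (B⟦clift II (wk (holds phi))⟧)) (f2 : El (B⟦clift II (wk (holds psi))⟧))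
  (compat : forall K (d : Hom K D) (u : El ((holds phi)⟦d⟧)) (v : El ((holds psi)⟦d⟧)) (i : Elc II K),
    tval (val f1) u i = tval (val f2) v i).

Let chi := cof_or phi psi.
Let di : Hom (D ▹ holds chi ▸ II) D := wk (holds chi) ∘ wk (II⟦bang _⟧).

Lemma or_tube_u : El ((holds chi)⟦di⟧).
Proof. exact (ecomp ((evar (holds chi))⟪wk (II⟦bang _⟧)⟫)). Qed.

Definition or_tube_a {theta : Elc (code Cof) D} (f : El (B⟦clift II (wk (holds theta))⟧)) :
  El (B⟦clift II (wk (holds chi))⟧⟦wk ((holds theta)⟦di⟧)⟧).
Proof.
  refine (mkEl (val := tval (val f) (d := di ∘ wk ((holds theta)⟦di⟧)) (ecomp (evar ((holds theta)⟦di⟧)))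
      (cvar II (D ▹ holds chi) ∘ wk ((holds theta)⟦di⟧))) _).
  rewrite tval_ty, Tsub_comp. f_equal. unfold di; hom_eq.
Defined.

Lemma or_tube_a_val {theta : Elc (code Cof) D} (f : El (B⟦clift II (wk (holds theta))⟧))
  {K} {r : Hom K (D ▹ holds chi ▸ II)} (x : El ((holds theta)⟦di⟧⟦r⟧)) :
  tsub (val (or_tube_a f)) (pair x) = tval (val f) (ecomp x) (cvar II _ ∘ r).
Proof.
  simpl.
  assert (v : El ((holds theta)⟦di ∘ wk ((holds theta)⟦di⟧) ∘ pair x⟧)).
  { refine (hcast (ecomp x) _). nf; reflexivity. }
  rewrite (tval_sub _ _ _ v).
  etransitivity; [apply (tval_irr _ _ (ecomp x))|].
  - nf; reflexivity.
  - f_equal. nf; reflexivity.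
Qed.

Lemma or_tube_compat K (r : Hom K (D ▹ holds chi ▸ II)) (x : El ((holds phi)⟦di⟧⟦r⟧))
  (y : El ((holds psi)⟦di⟧⟦r⟧)) :
  tsub (val (or_tube_a f1)) (pair x) = tsub (val (or_tube_a f2)) (pair y).
Proof. rewrite !or_tube_a_val. apply compat. Qed.

(** Glued in the context extended by the union and a point of the interval, where the disjunction
    holds by the variable; [f1] and [f2] are pulled back there along the projection [di] to [D]. *)
Definition or_tube : El (B⟦clift II (wk (holds (cof_or phi psi)))⟧) :=
  or_glue (IsProp_sub (s := di) (holds_prop (phi := phi))) (IsProp_sub (s := di) (holds_prop (phi := psi)))
    (cof_or_elim or_tube_u) or_tube_compat.

Lemma or_tube_val {theta : Elc (code Cof) D} (f : El (B⟦clift II (wk (holds theta))⟧)) :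
  or_tube⟪wk ((holds theta)⟦di⟧)⟫ ≈ or_tube_a f ->
  forall K (d : Hom K D) (x : El ((holds (cof_or phi psi))⟦d⟧)) (u : El ((holds theta)⟦d⟧)) i,
    tval (val or_tube) x i = tval (val f) u i.
Proof.
  intros H K d x u i.
  assert (v : El ((holds theta)⟦di⟧⟦cpair (pair x) i⟧)).
  { rewrite Tsub_comp. refine (hcast u _). f_equal. unfold di; nf; reflexivity. }
  transitivity (tsub (val (or_tube_a f)) (pair v)).
  - rewrite <- H. unfold tval; simpl. rewrite tsub_comp; f_equal; hom_eq.
  - rewrite or_tube_a_val. etransitivity; [apply (tval_irr _ _ u)|].
    + unfold di; nf; reflexivity.
    + f_equal. nf; reflexivity.
Qed.

Lemma or_tube_l {K} {d : Hom K D} (x : El ((holds (cof_or phi psi))⟦d⟧)) (u : El ((holds phi)⟦d⟧)) i :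
  tval (val or_tube) x i = tval (val f1) u i.
Proof. apply or_tube_val. apply or_glue_spec. Qed.

Lemma or_tube_r {K} {d : Hom K D} (x : El ((holds (cof_or phi psi))⟦d⟧)) (u : El ((holds psi)⟦d⟧)) i :
  tval (val or_tube) x i = tval (val f2) u i.
Proof. apply or_tube_val. apply or_glue_spec. Qed.

End Glue.

Lemma tapp_ty {D} {A : Ty (D ▸ II)} {b : bool} {phi : Elc (code Cof) D} (pb : Problem A b phi)
  {K} {d : Hom K D} (u : El ((holds phi)⟦d⟧)) (i : Elc II K) : ty (tapp pb u i) = A⟦cpair d i⟧.
Proof. apply (tval_ty (tube pb)). Qed.

Lemma base_ty {D} {A : Ty (D ▸ II)} {b : bool} (a : El (at_ A (endpoint b D))) {K} (d : Hom K D) :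
  ty (tsub (val a) d) = A⟦cpair d (endpoint b K)⟧.
Proof.
  rewrite ty_tsub, (val_ty a). unfold at_.
  rewrite Tsub_comp, cpair_comp, comp_idl, endpoint_sub; reflexivity.
Qed.

(** The boundary condition is asked for on values at all stages, where case analysis on the
    cofibration is possible. *)
Definition mk_problem {D} {A : Ty (D ▸ II)} {b : bool} {phi : Elc (code Cof) D}
  (f : El (A⟦clift II (wk (holds phi))⟧)) (a : El (at_ A (endpoint b D)))
  (H : forall K (d : Hom K D) (u : El ((holds phi)⟦d⟧)),
    tval (val f) u (endpoint b K) = tsub (val a) d) : Problem A b phi.
Proof.
  refine (mkProblem (tube := f) (base := a) _).
  rewrite <- (endpoint_sub b (wk (holds phi))). etransitivity; [|apply (H _ _ (evar _))].
  unfold tval; simpl. f_equal. rewrite endpoint_sub. f_equal. hom_eq.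
Defined.

End OrTube.

(** * Filling from composition along connections *)

Section Fill.
Context {E : CwF} {T : TypeFormers E} {I : Interval T} {P : PathContexts I}
  {C : Cofibrations I}.

Lemma conn_path_cpair (b : bool) {D K} (d : Hom K (D ▸ II)) (j : Elc II K) :
  conn_path b D ∘ cpair d j
  = cpair (wk (II⟦bang D⟧) ∘ d) (conn b (cvar II D ∘ d) j).
Proof.
  unfold conn_path. rewrite cpair_comp, conn_sub. f_equal.
  - nf; reflexivity.
  - f_equal; nf; reflexivity.
Qed.

Section FillProblem.
Context {G} {A : Ty G} {D} (p : Hom (D ▸ II) G) {b : bool} {phi : Elc (code Cof) D}
  (pb : Problem (A⟦p⟧) b phi).

Definition fill_cof : Elc (code Cof) (D ▸ II) :=
  cof_or (phi ∘ wk (II⟦bang D⟧)) (cof_eq b (cvar II D)).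

Lemma fill_u {theta : Elc (code Cof) D} {K} {d : Hom K (D ▸ II)} :
  El ((holds (theta ∘ wk (II⟦bang D⟧)))⟦d⟧) -> El ((holds theta)⟦wk (II⟦bang D⟧) ∘ d⟧).
Proof. intro u; refine (hcast u _). apply comp_assoc. Qed.

Lemma fill_u' {theta : Elc (code Cof) D} {K} {d : Hom K (D ▸ II)} :
  El ((holds theta)⟦wk (II⟦bang D⟧) ∘ d⟧) -> El ((holds (theta ∘ wk (II⟦bang D⟧)))⟦d⟧).
Proof. intro u; refine (hcast u _). symmetry; apply comp_assoc. Qed.

Lemma gen_holds {D'} (theta : Elc (code Cof) D') :
  El ((holds theta)⟦wk (holds theta) ∘ wk (II⟦bang _⟧)⟧).
Proof. exact (ecomp ((evar (holds theta))⟪wk (II⟦bang _⟧)⟫)). Qed.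

Definition fill_tube_l :
  El (A⟦p ∘ conn_path b D⟧⟦clift II (wk (holds (phi ∘ wk (II⟦bang D⟧))))⟧).
Proof.
  set (theta := phi ∘ wk (II⟦bang D⟧)).
  set (d := wk (holds theta) ∘ wk (II⟦bang (D ▸ II ▹ holds theta)⟧)).
  refine (mkEl (val := tapp pb (fill_u (gen_holds theta)) (conn b (cvar II D ∘ d) (cvar II _))) _).
  rewrite tapp_ty, !Tsub_comp. f_equal. rewrite comp_assoc; f_equal.
  unfold clift; rewrite conn_path_cpair. reflexivity.
Defined.

Lemma fill_tube_l_val {K} {d : Hom K (D ▸ II)} (u : El ((holds (phi ∘ wk (II⟦bang D⟧)))⟦d⟧))
  (v : El ((holds phi)⟦wk (II⟦bang D⟧) ∘ d⟧)) (j : Elc II K) :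
  tval (val fill_tube_l) u j = tapp pb v (conn b (cvar II D ∘ d) j).
Proof.
  unfold tval; simpl.
  assert (w : El ((holds phi)⟦wk (II⟦bang D⟧) ∘ (wk (holds (phi ∘ wk (II⟦bang D⟧))) ∘ wk (II⟦bang _⟧))
     ∘ cpair (pair u) j⟧)).
  { refine (hcast v _). nf; reflexivity. }
  rewrite (tapp_sub _ _ _ w).
  etransitivity; [apply (tapp_irr _ _ v)|].
  - nf; reflexivity.
  - f_equal. rewrite conn_sub; f_equal; nf; reflexivity.
Qed.

Definition fill_tube_r :
  El (A⟦p ∘ conn_path b D⟧⟦clift II (wk (holds (cof_eq b (cvar II D))))⟧).
Proof.
  set (theta := cof_eq b (cvar II D)).
  set (d := wk (holds theta) ∘ wk (II⟦bang (D ▸ II ▹ holds theta)⟧)).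
  refine (mkEl (val := tsub (val (base pb)) (wk (II⟦bang D⟧) ∘ d)) _).
  rewrite ty_tsub, (val_ty (base pb)). unfold at_; rewrite !Tsub_comp. f_equal.
  rewrite !comp_assoc; f_equal.
  unfold clift; rewrite conn_path_cpair, cpair_comp. rewrite comp_idl, endpoint_sub. f_equal.
  (* On the face [i = b] the path [j |-> conn b i j] stays at [b], so the base has the type required
     of a line over it. *)
  change (endpoint b _ = conn b (cvar II D ∘ d) (cvar II _)).
  rewrite (cof_eq_elim (gen_holds theta) : cvar II D ∘ d = _), conn_end_l; reflexivity.
Defined.

Lemma fill_tube_r_val {K} {d : Hom K (D ▸ II)} (u : El ((holds (cof_eq b (cvar II D)))⟦d⟧))
  (j : Elc II K) : tval (val fill_tube_r) u j = tsub (val (base pb)) (wk (II⟦bang D⟧) ∘ d).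
Proof. unfold tval; simpl. rewrite tsub_comp; f_equal. nf; reflexivity. Qed.

(** On the overlap [i = b] the connection is [b] too, and the tube at [b] is the base. *)
Lemma fill_compat K (d : Hom K (D ▸ II)) (u : El ((holds (phi ∘ wk (II⟦bang D⟧)))⟦d⟧))
  (v : El ((holds (cof_eq b (cvar II D)))⟦d⟧)) (i : Elc II K) :
  tval (val fill_tube_l) u i = tval (val fill_tube_r) v i.
Proof.
  rewrite (fill_tube_l_val _ (fill_u u)), fill_tube_r_val.
  rewrite (cof_eq_elim v), conn_end_l, tapp_base; reflexivity.
Qed.

Definition fill_tube : El (A⟦p ∘ conn_path b D⟧⟦clift II (wk (holds fill_cof))⟧) :=
  or_tube fill_compat.

Lemma fill_base_ty :
  (at_ (A⟦p⟧) (endpoint b D))⟦wk (II⟦bang D⟧)⟧ = at_ (A⟦p ∘ conn_path b D⟧) (endpoint b (D ▸ II)).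
Proof.
  unfold at_. rewrite !Tsub_comp. f_equal. rewrite !comp_assoc; f_equal.
  rewrite conn_path_cpair, cpair_comp, conn_end, comp_idl, comp_idr, endpoint_sub; reflexivity.
Qed.

Lemma fill_tube_base K (d : Hom K (D ▸ II)) (u : El ((holds fill_cof)⟦d⟧)) :
  tval (val fill_tube) u (endpoint b K)
  = tsub (val (cast fill_base_ty ((base pb)⟪wk (II⟦bang D⟧)⟫))) d.
Proof.
  apply (or_cases_tm u).
  - rewrite tval_ty, base_ty; reflexivity.
  - intros K' r v.
    assert (u' : El ((holds fill_cof)⟦d ∘ r⟧)) by exact (ecomp (u⟪r⟫)).
    rewrite (tval_sub _ _ _ u'). etransitivity; [apply (or_tube_l _ _ v)|].
    rewrite (fill_tube_l_val _ (fill_u v)).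
    rewrite endpoint_sub, conn_end, tapp_base. simpl. rewrite !tsub_comp; reflexivity.
  - intros K' r v.
    assert (u' : El ((holds fill_cof)⟦d ∘ r⟧)) by exact (ecomp (u⟪r⟫)).
    rewrite (tval_sub _ _ _ u'). etransitivity; [apply (or_tube_r _ _ v)|].
    rewrite fill_tube_r_val.
    simpl. rewrite !tsub_comp; reflexivity.
Qed.

Definition fill_problem : Problem (A⟦p ∘ conn_path b D⟧) b fill_cof := mk_problem fill_tube_base.

Context (st : FibStr A).

(** The path [j |-> conn b i j] ends at [i], so composites over it form a line in [A⟦p⟧] itself. *)
Lemma fill_ty : at_ (A⟦p ∘ conn_path b D⟧) (endpoint (negb b) (D ▸ II)) = A⟦p⟧.
Proof.
  unfold at_. rewrite !Tsub_comp, comp_assoc, conn_path_cpair, conn_opp, !comp_idr.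
  f_equal. etransitivity; [|apply comp_idr]. f_equal. hom_eq.
Qed.

Definition fill : El (A⟦p⟧) := cast fill_ty (fcomp st fill_problem).

Lemma fill_is_fill : IsFill st pb fill.
Proof.
  exists fill_problem. split; [|split; reflexivity].
  intros K r di d i j.
  assert (u : El ((holds fill_cof)⟦di⟧)).
  { unfold di. rewrite <- (comp_assoc (wk _)). exact (ecomp ((gen_holds _)⟪r⟫)). }
  split.
  - intro v. etransitivity; [apply (tval_eta _ u)|].
    etransitivity; [apply (or_tube_l _ _ (fill_u' v))|]. apply (fill_tube_l_val _ v).
  - intro Hi. etransitivity; [apply (tval_eta _ u)|].
    etransitivity; [apply (or_tube_r _ _ (cof_eq_intro Hi))|]. apply fill_tube_r_val.
Qed.

(** Composition extends its system. The system contains the tube, whence this lemma, and the face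
    [i = b], whence [fill_end]. *)
Lemma fill_on {K} {r : Hom K (D ▸ II)} (u : El ((holds phi)⟦wk (II⟦bang D⟧) ∘ r⟧)) :
  tsub (val fill) r = tapp pb u (cvar II D ∘ r).
Proof.
  simpl. etransitivity; [apply (fcomp_ext st fill_problem (cof_inl (fill_u' u)))|].
  etransitivity; [apply (or_tube_l _ _ (fill_u' u))|].
  rewrite (fill_tube_l_val _ u), conn_opp; reflexivity.
Qed.

Lemma fill_end {K} {r : Hom K (D ▸ II)} :
  cvar II D ∘ r = endpoint b K -> tsub (val fill) r = tsub (val (base pb)) (wk (II⟦bang D⟧) ∘ r).
Proof.
  intro Hr. simpl. pose (u := cof_eq_intro Hr : El ((holds (cof_eq b (cvar II D)))⟦r⟧)).
  etransitivity; [apply (fcomp_ext st fill_problem (cof_inr u))|].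
  etransitivity; [apply (or_tube_r _ _ u)|]. apply fill_tube_r_val.
Qed.

End FillProblem.
Arguments fill_cof {D} b phi.

Lemma conn_path_nat (b : bool) {D D'} (t : Hom D' D) :
  conn_path b D ∘ clift II (clift II t) = clift II t ∘ conn_path b D'.
Proof.
  unfold clift at 1; rewrite conn_path_cpair. apply chom_ext.
  - unfold conn_path; nf; hom_eq.
  - rewrite cvar_cpair. unfold clift, conn_path. rewrite !cvar_cpair_assoc, cvar_cpair.
    f_equal.
Qed.

Section FillNat.
Context {G G'} {o : Hom G' G} {A : Ty G} {A' : Ty G'} {st : FibStr A} {st' : FibStr A'}
  (Hst : FNat o st st') {D D'} {p : Hom (D ▸ II) G} {p' : Hom (D' ▸ II) G'} {t : Hom D' D}
  (Hp : o ∘ p' = p ∘ clift II t) {b : bool} {phi : Elc (code Cof) D} {phi' : Elc (code Cof) D'}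
  {pb : Problem (A⟦p⟧) b phi} {pb' : Problem (A'⟦p'⟧) b phi'} (Hpb : PNat t pb pb').

(** Checked face by face. A witness of the union over [D'] gives a case for both problems, because
    the cofibrations correspond. *)
Lemma fill_problem_nat : PNat (clift II t) (fill_problem pb) (fill_problem pb').
Proof.
  split.
  - rewrite (fnat_ty Hst), !Tsub_comp. f_equal.
    rewrite <- comp_assoc, Hp, !comp_assoc, conn_path_nat; reflexivity.
  - unfold fill_cof. rewrite cof_or_sub, cof_eq_sub, (pnat_phi Hpb). f_equal.
    + rewrite !comp_assoc. f_equal. symmetry; apply clift_hom.
    + f_equal. hom_eq.
  - intros K d u u' i.
    apply (or_cases_tm u').
    + rewrite !tapp_ty, (fnat_ty Hst), !Tsub_comp. f_equal.
      rewrite !comp_assoc, <- (comp_assoc o p'), Hp, !comp_assoc. f_equal. rewrite !conn_path_cpair.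
      unfold clift; rewrite cpair_comp, !comp_assoc. f_equal; nf; reflexivity.
    + intros K' r v.
      assert (x' : El ((holds (fill_cof b phi'))⟦d ∘ r⟧)) by exact (ecomp (u'⟪r⟫)).
      assert (x : El ((holds (fill_cof b phi))⟦clift II t ∘ d ∘ r⟧)) by exact (ecomp (u⟪r⟫)).
      rewrite (tapp_sub _ _ _ x'), (tapp_sub _ _ _ x).
      pose (w' := fill_u v).
      assert (w0 : El ((holds phi)⟦t ∘ (wk (II⟦bang D'⟧) ∘ (d ∘ r))⟧)).
      { refine (hcast w' _). rewrite (pnat_phi Hpb), comp_assoc; reflexivity. }
      assert (w : El ((holds phi)⟦wk (II⟦bang D⟧) ∘ (clift II t ∘ d ∘ r)⟧)).
      { refine (hcast w0 _). unfold clift; nf; reflexivity. }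
      etransitivity; [apply (or_tube_l _ _ v)|]. rewrite (fill_tube_l_val _ _ w').
      symmetry. etransitivity; [apply (or_tube_l _ _ (fill_u' w))|]. rewrite (fill_tube_l_val _ _ w).
      symmetry. rewrite (pnat_tube Hpb w0).
      etransitivity; [apply (tapp_irr _ _ w)|].
      * unfold clift; nf; reflexivity.
      * f_equal. f_equal. unfold clift; nf; reflexivity.
    + intros K' r v.
      assert (x' : El ((holds (fill_cof b phi'))⟦d ∘ r⟧)) by exact (ecomp (u'⟪r⟫)).
      assert (x : El ((holds (fill_cof b phi))⟦clift II t ∘ d ∘ r⟧)) by exact (ecomp (u⟪r⟫)).
      rewrite (tapp_sub _ _ _ x'), (tapp_sub _ _ _ x).
      assert (w : El ((holds (cof_eq b (cvar II D)))⟦clift II t ∘ d ∘ r⟧)).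
      { apply cof_eq_intro. rewrite <- (cof_eq_elim v). unfold clift; nf; reflexivity. }
      etransitivity; [apply (or_tube_r _ _ v)|]. rewrite fill_tube_r_val.
      symmetry. etransitivity; [apply (or_tube_r _ _ w)|]. rewrite fill_tube_r_val.
      symmetry. rewrite (pnat_base Hpb). simpl. rewrite tsub_comp. f_equal. unfold clift; nf; reflexivity.
  - simpl. rewrite (pnat_base Hpb). simpl. rewrite !tsub_comp. f_equal. unfold clift; nf; reflexivity.
Qed.

Lemma fill_nat : fill pb' st' ≈ (fill pb st)⟪clift II t⟫.
Proof.
  simpl. refine (fcomp_nat Hst _ fill_problem_nat).
  rewrite comp_assoc, conn_path_nat, <- !comp_assoc, Hp. reflexivity.
Qed.
End FillNat.
End Fill.

(** * Reindexed problems and criteria for naturality *)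

Section Misc.
Context {E : CwF} {T : TypeFormers E} {I : Interval T} {P : PathContexts I}
  {C : Cofibrations I}.

Lemma app_pi_lam_sub {G D K} {A : Ty G} {B : Ty (G ▹ A)} {s : Hom D G} {t : Hom K D} {s' : Hom K G}
  (b : El (B⟦lift (s := s) (A := A) eq_refl⟧)) (f : El ((Pi B)⟦s'⟧)) (x : El (A⟦s'⟧))
  (x0 : El (A⟦s⟧⟦t⟧)) :
  s' = s ∘ t -> f ≈ (pi_lam b)⟪t⟫ -> x0 ≈ x -> app f x ≈ b⟪pair x0⟫.
Proof.
  intros Hs Hf Hx.
  assert (e : (Pi B)⟦s'⟧ = (Pi (B⟦lift (s := s) (A := A) eq_refl⟧))⟦t⟧).
  { rewrite <- Pi_sub, Tsub_comp, Hs; reflexivity. }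
  rewrite <- (app_lam_sub (b := b) (f := cast e f) x0) by exact Hf.
  symmetry. etransitivity; [|apply tsub_id].
  refine (app_nat (o := s) (HA := eq_refl) eq_refl (t := idm K) _ _ _).
  - rewrite comp_idr; symmetry; exact Hs.
  - simpl; rewrite tsub_id; reflexivity.
  - simpl; rewrite tsub_id; exact Hx.
Qed.

Section Psub.
Context {D} {A : Ty (D ▸ II)} {b : bool} {phi : Elc (code Cof) D} (pb : Problem A b phi)
  {D'} (t : Hom D' D) {A' : Ty (D' ▸ II)} (HA : A' = A⟦clift II t⟧).

Lemma psub_tube_ty : A⟦clift II (wk (holds phi))⟧⟦clift II (lift_el phi t)⟧
  = A'⟦clift II (wk (holds (phi ∘ t)))⟧.
Proof. rewrite HA, !clift_sub; unfold lift_el; rewrite wk_lift; reflexivity. Qed.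

Lemma psub_base_ty : (at_ A (endpoint b D))⟦t⟧ = at_ A' (endpoint b D').
Proof. rewrite HA, at_sub, endpoint_sub; reflexivity. Qed.

Lemma psub_tval {K} {d : Hom K D'} (u : El ((holds phi)⟦t ∘ d⟧)) (u' : El ((holds (phi ∘ t))⟦d⟧)) i :
  tval (val (cast psub_tube_ty ((tube pb)⟪clift II (lift_el phi t)⟫))) u' i = tapp pb u i.
Proof.
  unfold tval, tapp; simpl. rewrite tsub_comp; f_equal.
  apply chom_ext; [apply holds_hom|]; unfold clift, lift_el; nf; reflexivity.
Qed.

Definition psub : Problem A' b (phi ∘ t).
Proof.
  refine (mk_problem (f := cast psub_tube_ty ((tube pb)⟪clift II (lift_el phi t)⟫))
    (a := cast psub_base_ty ((base pb)⟪t⟫)) _).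
  intros K d u.
  assert (v : El ((holds phi)⟦t ∘ d⟧)) by (refine (hcast u _); apply comp_assoc).
  rewrite (psub_tval v), tapp_base. simpl; rewrite tsub_comp; reflexivity.
Defined.

Lemma psub_nat : PNat t pb psub.
Proof.
  split; [exact HA | reflexivity | | reflexivity].
  intros. apply psub_tval.
Qed.

Lemma PNat_trans {D2} (t2 : Hom D2 D') (t3 : Hom D2 D) {A2 : Ty (D2 ▸ II)} {phi1 : Elc (code Cof) D'}
  {phi2 : Elc (code Cof) D2}
  (pb1 : Problem A' b phi1) (pb2 : Problem A2 b phi2) :
  t3 = t ∘ t2 -> PNat t pb pb1 -> PNat t2 pb1 pb2 -> PNat t3 pb pb2.
Proof.
  intros -> [Ha Hp Ht Hb] [Ha2 Hp2 Ht2 Hb2]; split.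
  - rewrite Ha2, Ha, clift_sub; reflexivity.
  - rewrite Hp2, Hp, comp_assoc; reflexivity.
  - intros K d u u' i.
    assert (v : El ((holds phi1)⟦t2 ∘ d⟧)).
    { refine (hcast u' _). rewrite Hp2, comp_assoc; reflexivity. }
    assert (w : El ((holds phi)⟦t ∘ (t2 ∘ d)⟧)).
    { refine (hcast u _). rewrite !comp_assoc; reflexivity. }
    rewrite (Ht2 _ _ v u'), (Ht _ _ w v). apply tapp_irr. rewrite comp_assoc; reflexivity.
  - rewrite Hb2; simpl; rewrite Hb; simpl; rewrite tsub_comp; reflexivity.
Qed.

(** Compares two independently chosen reindexings of one problem when their stages factor, for
    instance one made by [psub] and one given by hypothesis. *)
Lemma PNat_cancel {D2} (t2 : Hom D2 D') (t3 : Hom D2 D) {A2 : Ty (D2 ▸ II)} {phi1 : Elc (code Cof) D'}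
  {phi2 : Elc (code Cof) D2}
  (pb1 : Problem A' b phi1) (pb2 : Problem A2 b phi2) :
  t3 = t ∘ t2 -> PNat t pb pb1 -> PNat t3 pb pb2 -> PNat t2 pb1 pb2.
Proof.
  intros -> [Ha Hp Ht Hb] [Ha2 Hp2 Ht2 Hb2]; split.
  - rewrite Ha2, Ha, clift_sub; reflexivity.
  - rewrite Hp2, Hp, comp_assoc; reflexivity.
  - intros K d u u' i.
    assert (v : El ((holds phi)⟦t ∘ (t2 ∘ d)⟧)).
    { refine (hcast u _). rewrite Hp, comp_assoc; reflexivity. }
    assert (w : El ((holds phi)⟦t ∘ t2 ∘ d⟧)).
    { refine (hcast v _). rewrite !comp_assoc; reflexivity. }
    rewrite (Ht2 _ _ w u'), (Ht _ _ v u). apply tapp_irr. rewrite comp_assoc; reflexivity.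
  - rewrite Hb2; simpl; rewrite Hb; simpl; rewrite tsub_comp; reflexivity.
Qed.
End Psub.

Lemma FNat_idm {G} {A : Ty G} (st : FibStr A) (o : Hom G G) : o = idm G -> FNat o st st.
Proof. intros ->; apply FNat_id. Qed.

Lemma lift_idm {G} {A : Ty G} (H : A = A⟦idm G⟧) : lift H = idm (G ▹ A).
Proof. apply ext_eta; nf; reflexivity. Qed.

(** By [fib_ext] stability of a structure under base change is a statement about solutions at one
    and the same stage. *)
Lemma FNat_intro {G G'} (o : Hom G' G) {A : Ty G} {A' : Ty G'} (st : FibStr A) (st' : FibStr A') :
  A' = A⟦o⟧ ->
  (forall D (p' : Hom (D ▸ II) G') b (phi : Elc (code Cof) D) (pb' : Problem (A'⟦p'⟧) b phi)
     (pb : Problem (A⟦o ∘ p'⟧) b phi), PNat (idm D) pb pb' -> fcomp st' pb' ≈ fcomp st pb) ->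
  FNat o st st'.
Proof.
  intros HA H; subst A'. enough (st' = fib_sub st o) as -> by apply fib_sub_nat.
  apply fib_ext. intros D p b phi pb.
  pose (pb0 := pcast (Tsub_comp A o p) pb).
  assert (H0 : PNat (idm D) pb0 pb) by (apply PNat_idm; [apply Tsub_comp | reflexivity | reflexivity]).
  rewrite (H _ _ _ _ pb pb0 H0). symmetry. etransitivity; [|apply tsub_id].
  refine (fcomp_nat (fib_sub_nat o st) _ H0).
  rewrite clift_id, comp_idr; reflexivity.
Qed.

End Misc.

(** * Products, sums, paths and identity types of fibrations *)

Section PiFib.
Context {E : CwF} {T : TypeFormers E} {I : Interval T} {P : PathContexts I}
  {C : Cofibrations I}.

Section Sol.
Context {G} {A : Ty G} {B : Ty (G ▹ A)} (sa : FibStr A) (sb : FibStr B)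
  {D} (p : Hom (D ▸ II) G) {b : bool} {phi : Elc (code Cof) D}
  (pb : Problem ((Pi B)⟦p⟧) b phi) (x : El (at_ (A⟦p⟧) (endpoint (negb b) D))).

(** The argument [x] of the composite lives at [negb b], so its line is filled from there. [cof_bot]
    asserts [0 = 1], and the boundary condition holds by absurdity. *)
Definition empty_problem : Problem (A⟦p⟧) (negb b) (cof_bot D).
Proof.
  refine (mk_problem (f := absurd _ (cof_bot_elim (gen_holds (cof_bot D)))) (a := x) _).
  intros K d u.
  assert (z : El (Zero K)) by exact (cof_bot_elim u).
  exact (absurd_eq (mkEl (tval_ty _ u _)) (mkEl (base_ty x d)) eq_refl z).
Defined.

Definition pi_arg : El (A⟦p⟧) := fill empty_problem sa.

Lemma pi_arg_end {K} (d : Hom K D) :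
  tsub (val pi_arg) (cpair d (endpoint (negb b) K)) = tsub (val x) d.
Proof.
  unfold pi_arg. rewrite fill_end by apply cvar_cpair. simpl. rewrite cpair_wk; reflexivity.
Qed.

Lemma pi_tube_ty : B⟦pair (ecomp (pi_arg⟪clift II (wk (holds phi))⟫))⟧
  = B⟦pair pi_arg⟧⟦clift II (wk (holds phi))⟧.
Proof. rewrite Tsub_comp, pair_comp; reflexivity. Qed.

Lemma pi_base_ty : B⟦pair (ecomp (pi_arg⟪cpair (idm D) (endpoint b D)⟫))⟧
  = at_ (B⟦pair pi_arg⟧) (endpoint b D).
Proof. unfold at_; rewrite Tsub_comp, pair_comp; reflexivity. Qed.

Definition pi_problem : Problem (B⟦pair pi_arg⟧) b phi.
Proof.
  refine (mk_problem
    (f := cast pi_tube_ty (app (ecomp (tube pb)) (ecomp (pi_arg⟪clift II (wk (holds phi))⟫))))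
    (a := cast pi_base_ty (app (ecomp (base pb)) (ecomp (pi_arg⟪cpair (idm D) (endpoint b D)⟫)))) _).
  intros K d u. unfold tval. simpl val.
  assert (e1 : (Pi B)⟦p ∘ (cpair d (endpoint b K))⟧ = (Pi B)⟦p⟧⟦cpair d (endpoint b K)⟧)
   by (rewrite Tsub_comp; reflexivity).
  pose (f := cast (eq_sym e1) (mkEl (tapp_ty pb u (endpoint b K)))).
  pose (a := ecomp (pi_arg⟪cpair d (endpoint b K)⟫)).
  transitivity (val (app f a)).
  - symmetry. refine (app_sub (t := cpair (pair u) (endpoint b K)) _ _ _).
    + rewrite comp_assoc; f_equal. hom_eq.
    + reflexivity.
    + simpl. rewrite tsub_comp; f_equal. hom_eq.
  - refine (app_sub (t := d) _ _ _).
    + rewrite comp_assoc, cpair_comp, comp_idl, endpoint_sub; reflexivity.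
    + simpl. apply tapp_base.
    + simpl. rewrite tsub_comp, cpair_comp, comp_idl, endpoint_sub; reflexivity.
Defined.

Lemma pi_problem_tapp {K} {d : Hom K D} (u : El ((holds phi)⟦d⟧)) (i : Elc II K) {s : Hom K G}
  (f : El ((Pi B)⟦s⟧)) (a : El (A⟦s⟧)) :
  s = p ∘ cpair d i -> f ≈ mkEl (tapp_ty pb u i) -> a ≈ pi_arg⟪cpair d i⟫ ->
  tapp pi_problem u i = val (app f a).
Proof.
  intros Hs Hf Ha. symmetry. refine (app_sub (t := cpair (pair u) i) _ _ _).
  - rewrite Hs, comp_assoc; f_equal. hom_eq.
  - exact Hf.
  - rewrite Ha. simpl. rewrite tsub_comp; f_equal. hom_eq.
Qed.

Definition pi_sol : El (at_ (B⟦pair pi_arg⟧) (endpoint (negb b) D)) := fcomp sb pi_problem.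

End Sol.

Section SolNat.
Context {G} {A : Ty G} {B : Ty (G ▹ A)} {sa : FibStr A} {sb : FibStr B}.
Context {G'} {A' : Ty G'} {B' : Ty (G' ▹ A')} {sa' : FibStr A'} {sb' : FibStr B'}.
Context {o : Hom G' G} (HA : A' = A⟦o⟧) (Ha : FNat o sa sa') (Hb : FNat (lift HA) sb sb').
Context {D} {p : Hom (D ▸ II) G} {D'} {p' : Hom (D' ▸ II) G'} {t : Hom D' D}
  (Hp : o ∘ p' = p ∘ clift II t) {b : bool}
  {phi : Elc (code Cof) D} {pb : Problem ((Pi B)⟦p⟧) b phi}
  {phi' : Elc (code Cof) D'} {pb' : Problem ((Pi B')⟦p'⟧) b phi'} (Hpb : PNat t pb pb')
  {x : El (at_ (A⟦p⟧) (endpoint (negb b) D))} {x' : El (at_ (A'⟦p'⟧) (endpoint (negb b) D'))}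
  (Hx : x' ≈ x⟪t⟫).

Lemma pi_arg_nat : pi_arg sa' x' ≈ (pi_arg sa x)⟪clift II t⟫.
Proof.
  apply (fill_nat Ha Hp). split.
  - rewrite (fnat_ty Ha), !Tsub_comp, Hp; reflexivity.
  - symmetry; apply cof_bot_sub.
  - intros K d u u' i.
    (* No values have to be compared: a witness of the empty cofibration makes the stage
       inconsistent. *)
    assert (z : El (Zero K)) by exact (cof_bot_elim u).
    refine (absurd_eq (mkEl (tapp_ty _ u' i)) (mkEl (tapp_ty _ u i)) _ z).
    rewrite HA, !Tsub_comp, <- (comp_assoc o p'), Hp, comp_assoc. do 2 f_equal. unfold clift. rewrite cpair_comp.
    f_equal; nf; reflexivity.
  - exact Hx.
Qed.

Lemma pi_path_nat : lift HA ∘ pair (pi_arg sa' x') = pair (pi_arg sa x) ∘ clift II t.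
Proof. apply pair_lift; [exact Hp | exact pi_arg_nat]. Qed.

Lemma pi_sol_nat : pi_sol sa' sb' pb' x' ≈ (pi_sol sa sb pb x)⟪t⟫.
Proof.
  refine (fcomp_nat Hb pi_path_nat _). split.
  - rewrite (fnat_ty Hb), !Tsub_comp, pi_path_nat; reflexivity.
  - apply (pnat_phi Hpb).
  - intros K d u u' i.
    assert (Hs : o ∘ (p' ∘ cpair d i) = p ∘ cpair (t ∘ d) i ∘ idm K).
    { rewrite <- comp_assoc, Hp, comp_idr, comp_assoc. f_equal. unfold clift; rewrite cpair_comp.
      f_equal; nf; reflexivity. }
    rewrite (pi_problem_tapp (sa := sa) (pb := pb) (x := x) (u := u) (i := i) (s := p ∘ cpair (t ∘ d) i)
      (f := ecomp (mkEl (tapp_ty pb u i)))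
      (a := ecomp ((pi_arg sa x)⟪cpair (t ∘ d) i⟫))) by reflexivity.
    rewrite (pi_problem_tapp (sa := sa') (pb := pb') (x := x') (u := u') (i := i) (s := p' ∘ cpair d i)
      (f := ecomp (mkEl (tapp_ty pb' u' i)))
      (a := ecomp ((pi_arg sa' x')⟪cpair d i⟫))) by reflexivity.
    etransitivity; [refine (app_nat (o := o) (HA := HA) (fnat_ty Hb) Hs _ _)|apply tsub_id].
    + change (tapp pb' u' i = tsub (tapp pb u i) (idm K)). rewrite tsub_id; apply (pnat_tube Hpb).
    + change (tsub (val (pi_arg sa' x')) (cpair d i)
        = tsub (tsub (val (pi_arg sa x)) (cpair (t ∘ d) i)) (idm K)).
      rewrite tsub_id, pi_arg_nat; simpl. rewrite tsub_comp; f_equal.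
      unfold clift; rewrite cpair_comp; f_equal; nf; reflexivity.
  - simpl val. refine (app_nat (o := o) (HA := HA) (fnat_ty Hb) _ _ _).
    + rewrite <- comp_assoc, Hp, !comp_assoc. f_equal. unfold clift; rewrite !cpair_comp.
      f_equal; nf; reflexivity.
    + exact (pnat_base Hpb).
    + change (tsub (val (pi_arg sa' x')) (cpair (idm D') (endpoint b D'))
        = tsub (tsub (val (pi_arg sa x)) (cpair (idm D) (endpoint b D))) t).
      rewrite pi_arg_nat; simpl. rewrite !tsub_comp; f_equal.
      unfold clift; rewrite !cpair_comp; f_equal; nf; reflexivity.
Qed.
End SolNat.

Section PiOp.
Context {G} {A : Ty G} {B : Ty (G ▹ A)} (sa : FibStr A) (sb : FibStr B).

Section Fop.
Context {D} (p : Hom (D ▸ II) G) {b : bool} {phi : Elc (code Cof) D}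
  (pb : Problem ((Pi B)⟦p⟧) b phi).

Let p1 := p ∘ cpair (idm D) (endpoint (negb b) D).
Let w := wk (A⟦p1⟧).

Lemma pi_body_arg_ty : A⟦p1⟧⟦w⟧ = at_ (A⟦p ∘ clift II w⟧) (endpoint (negb b) (D ▹ A⟦p1⟧)).
Proof.
  unfold at_. rewrite !Tsub_comp. f_equal. unfold p1. rewrite !comp_assoc. f_equal.
  unfold clift; rewrite !cpair_comp, endpoint_sub. f_equal; nf; reflexivity.
Qed.

Definition pi_body_arg : El (at_ (A⟦p ∘ clift II w⟧) (endpoint (negb b) (D ▹ A⟦p1⟧))) :=
  cast pi_body_arg_ty (evar (A⟦p1⟧)).

Definition pi_body_problem : Problem ((Pi B)⟦p ∘ clift II w⟧) b (phi ∘ w) :=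
  psub pb (eq_sym (Tsub_comp (Pi B) p (clift II w))).

Lemma pi_body_ty :
  at_ (B⟦pair (pi_arg sa pi_body_arg)⟧) (endpoint (negb b) (D ▹ A⟦p1⟧))
  = B⟦lift (s := p1) (A := A) eq_refl⟧.
Proof.
  unfold at_. rewrite Tsub_comp. f_equal. rewrite pair_comp. apply pair_ext.
  - unfold p1. rewrite !comp_assoc. f_equal. unfold clift; rewrite !cpair_comp, endpoint_sub.
    f_equal; nf; reflexivity.
  - exact (eq_trans (pi_arg_end sa pi_body_arg (idm _)) (tsub_id _)).
Qed.

(** The composite is a function, hence the abstraction of the solution at the generic argument, with
    the problem reindexed to the context extended by that argument. The retyping uses that the line
    of arguments ends in it. *)
Definition pi_body : El (B⟦lift (s := p1) (A := A) eq_refl⟧) :=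
  cast pi_body_ty (pi_sol sa sb pi_body_problem pi_body_arg).

Definition pi_fop : El (at_ ((Pi B)⟦p⟧) (endpoint (negb b) D)) :=
  cast (eq_sym (Tsub_comp _ _ _)) (pi_lam pi_body).

(** Beta reduction combined with naturality of [pi_sol]. The remaining properties of [pi_fop] are
    obtained by applying it to an argument and using this rule. *)
Lemma pi_fop_app {K} {d : Hom K D} {p2 : Hom (K ▸ II) G} {phi2 : Elc (code Cof) K}
  {pb2 : Problem ((Pi B)⟦p2⟧) b phi2} {x2 : El (at_ (A⟦p2⟧) (endpoint (negb b) K))}
  {s : Hom K G} (f : El ((Pi B)⟦s⟧)) (x : El (A⟦s⟧)) :
  p2 = p ∘ clift II d -> PNat d pb pb2 ->
  s = p1 ∘ d -> f ≈ pi_fop⟪d⟫ -> x ≈ x2 -> app f x ≈ pi_sol sa sb pb2 x2.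
Proof.
  intros Hp Hpb Hs Hf Hx.
  assert (e : A⟦s⟧ = A⟦p1⟧⟦d⟧) by (rewrite Tsub_comp, Hs; reflexivity).
  rewrite (app_pi_lam_sub (s := p1) (t := d) (b := pi_body) (x0 := cast e x) Hs Hf eq_refl).
  symmetry. refine (pi_sol_nat (o := idm G) (HA := eq_sym (Tsub_id A)) (t := pair (cast e x)) _ _ _ _ _).
  - apply FNat_id.
  - apply FNat_idm, lift_idm.
  - rewrite comp_idl, Hp, comp_assoc, clift_comp. unfold w; rewrite wk_pair'; reflexivity.
  (* The problem over the extended context and [pb2] both reindex [pb], so the second is a
     reindexing of the first. *)
  - refine (PNat_cancel (t := w) _ (psub_nat _ _) Hpb). unfold w; rewrite wk_pair'; reflexivity.
  - simpl. rewrite var_pair'. symmetry; exact Hx.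
Qed.
End Fop.

(** Applied to [x], the composite on [phi] is the tube applied to the line of arguments at [negb b],
    and that line ends in [x] by [pi_arg_end]. *)
Lemma pi_fop_ext {D} (p : Hom (D ▸ II) G) {b : bool} {phi : Elc (code Cof) D}
  (pb : Problem ((Pi B)⟦p⟧) b phi) {K} {d : Hom K D} (u : El ((holds phi)⟦d⟧)) :
  tapp pb u (endpoint (negb b) K) = tsub (val (pi_fop pb)) d.
Proof.
  set (e := endpoint (negb b) K).
  assert (Hd : p ∘ cpair (idm D) (endpoint (negb b) D) ∘ d = p ∘ cpair d e).
  { rewrite comp_assoc, cpair_comp, comp_idl, endpoint_sub; reflexivity. }
  assert (HT : (at_ ((Pi B)⟦p⟧) (endpoint (negb b) D))⟦d⟧ = (Pi B)⟦p ∘ cpair d e⟧).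
  { unfold at_; rewrite !Tsub_comp, <- comp_assoc, Hd; reflexivity. }
  pose (f1 := ecomp (mkEl (tapp_ty pb u e)) : El ((Pi B)⟦p ∘ cpair d e⟧)).
  pose (f2 := cast HT ((pi_fop pb)⟪d⟫)).
  enough (e0 : f1 = f2) by exact (f_equal (@val _ _ _) e0).
  apply pi_ext. intros K' r x.
  assert (Hr : cpair d e ∘ r = cpair (d ∘ r) (endpoint (negb b) K')).
  { rewrite cpair_comp. unfold e; rewrite endpoint_sub; reflexivity. }
  pose (pb2 := psub pb (eq_sym (Tsub_comp (Pi B) p (clift II (d ∘ r))))).
  assert (Hpb2 : PNat (d ∘ r) pb pb2) by apply psub_nat.
  assert (HX : A⟦p ∘ cpair d e ∘ r⟧ = at_ (A⟦p ∘ clift II (d ∘ r)⟧) (endpoint (negb b) K')).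
  { unfold at_. rewrite Tsub_comp, !comp_assoc, Hr. do 2 f_equal. unfold clift; rewrite cpair_comp.
    f_equal; nf; reflexivity. }
  rewrite (pi_fop_app (pb := pb) (d := d ∘ r) (pb2 := pb2) (x2 := cast HX x)
    (f := ecomp (f2⟪r⟫)) (x := x)).
  - assert (v : El ((holds (phi ∘ (d ∘ r)))⟦idm K'⟧)).
    { rewrite Tsub_id, holds_sub. exact (ecomp (u⟪r⟫)). }
    symmetry. etransitivity; [symmetry; apply tsub_id|].
    etransitivity; [apply (fcomp_ext sb _ v)|].
    assert (w : El ((holds phi)⟦d ∘ r ∘ idm K'⟧)).
    { rewrite comp_idr. exact (ecomp (u⟪r⟫)). }
    assert (Hs : p ∘ cpair d e ∘ r = p ∘ clift II (d ∘ r) ∘ cpair (idm K') (endpoint (negb b) K')).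
    { rewrite !comp_assoc, Hr. f_equal. unfold clift; rewrite cpair_comp. f_equal; nf; reflexivity. }
    apply (pi_problem_tapp Hs).
    + change (tsub (tapp pb u e) r = tapp pb2 v (endpoint (negb b) K')).
      rewrite (pnat_tube Hpb2 w v).
      rewrite (tapp_sub pb u e (ecomp (u⟪r⟫))). unfold e; rewrite endpoint_sub.
      apply tapp_irr. symmetry; apply comp_idr.
    + change (val x = tsub (val (pi_arg sa (cast HX x))) (cpair (idm K') (endpoint (negb b) K'))).
      rewrite pi_arg_end, tsub_id; reflexivity.
  - reflexivity.
  - exact Hpb2.
  - rewrite <- Hd, !comp_assoc; reflexivity.
  - simpl. apply tsub_comp.
  - reflexivity.
Qed.
End PiOp.

Section PiNat.
Context {G} {A : Ty G} {B : Ty (G ▹ A)} {sa : FibStr A} {sb : FibStr B}.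
Context {G'} {A' : Ty G'} {B' : Ty (G' ▹ A')} {sa' : FibStr A'} {sb' : FibStr B'}.
Context {o : Hom G' G} (HA : A' = A⟦o⟧) (Ha : FNat o sa sa') (Hb : FNat (lift HA) sb sb').

(** After application to an argument both sides are solutions of reindexings of [pb], which
    [PNat_cancel] relates and [pi_sol_nat] compares. *)
Lemma pi_fop_nat {D} {p : Hom (D ▸ II) G} {D'} {p' : Hom (D' ▸ II) G'} {t : Hom D' D}
  (Hp : o ∘ p' = p ∘ clift II t) {b : bool}
  {phi : Elc (code Cof) D} {pb : Problem ((Pi B)⟦p⟧) b phi}
  {phi' : Elc (code Cof) D'} {pb' : Problem ((Pi B')⟦p'⟧) b phi'} (Hpb : PNat t pb pb') :
  pi_fop sa' sb' pb' ≈ (pi_fop sa sb pb)⟪t⟫.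
Proof.
  set (e := cpair (idm D) (endpoint (negb b) D)).
  set (e' := cpair (idm D') (endpoint (negb b) D')).
  assert (He : o ∘ (p' ∘ e') = p ∘ e ∘ t).
  { rewrite <- comp_assoc, Hp, !comp_assoc. f_equal. unfold e, e', clift.
    rewrite !cpair_comp, endpoint_sub. f_equal; nf; reflexivity. }
  assert (HP : Pi B' = (Pi B)⟦o⟧) by (apply (Pi_nat_ty (HA := HA)), (fnat_ty Hb)).
  assert (HT : (at_ ((Pi B)⟦p⟧) (endpoint (negb b) D))⟦t⟧ = (Pi B')⟦p' ∘ e'⟧).
  { rewrite HP, (Tsub_comp (Pi B)), He. unfold at_; rewrite !Tsub_comp, ?comp_assoc; reflexivity. }
  pose (f1 := ecomp (pi_fop sa' sb' pb') : El ((Pi B')⟦p' ∘ e'⟧)).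
  pose (f2 := cast HT ((pi_fop sa sb pb)⟪t⟫)).
  enough (e0 : f1 = f2) by exact (f_equal (@val _ _ _) e0).
  apply pi_ext. intros K r x.
  pose (pb1' := psub pb' (eq_sym (Tsub_comp (Pi B') p' (clift II r)))).
  pose (pb1 := psub pb (eq_sym (Tsub_comp (Pi B) p (clift II (t ∘ r))))).
  assert (Hpb1' : PNat r pb' pb1') by apply psub_nat.
  assert (Hpb1 : PNat (t ∘ r) pb pb1) by apply psub_nat.
  assert (Hr : e' ∘ r = clift II r ∘ cpair (idm K) (endpoint (negb b) K)).
  { unfold e', clift. rewrite !cpair_comp, endpoint_sub. f_equal; nf; reflexivity. }
  assert (HX : A'⟦p' ∘ e' ∘ r⟧ = at_ (A'⟦p' ∘ clift II r⟧) (endpoint (negb b) K)).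
  { unfold at_. rewrite Tsub_comp, !comp_assoc, Hr; reflexivity. }
  assert (Hs : o ∘ (p' ∘ e' ∘ r) = p ∘ e ∘ (t ∘ r)).
  { rewrite <- (comp_assoc (p ∘ e)), <- He, !comp_assoc; reflexivity. }
  assert (Hq : e ∘ (t ∘ r) = clift II (t ∘ r) ∘ cpair (idm K) (endpoint (negb b) K)).
  { unfold e, clift. rewrite !cpair_comp, endpoint_sub. f_equal; nf; reflexivity. }
  assert (HX1 : A'⟦p' ∘ e' ∘ r⟧ = A⟦p ∘ e ∘ (t ∘ r)⟧) by (rewrite HA, Tsub_comp, Hs; reflexivity).
  assert (HX2 : A⟦p ∘ e ∘ (t ∘ r)⟧ = at_ (A⟦p ∘ clift II (t ∘ r)⟧) (endpoint (negb b) K)).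
  { unfold at_. rewrite Tsub_comp, !comp_assoc, Hq; reflexivity. }
  rewrite (pi_fop_app (pb := pb') (d := r) (pb2 := pb1') (x2 := cast HX x) (f := ecomp (f1⟪r⟫)) (x := x)
    eq_refl Hpb1' eq_refl eq_refl eq_refl).
  assert (HF : (at_ ((Pi B)⟦p⟧) (endpoint (negb b) D))⟦t ∘ r⟧ = (Pi B)⟦p ∘ e ∘ (t ∘ r)⟧).
  { unfold at_; rewrite !Tsub_comp, ?comp_assoc; reflexivity. }
  transitivity (val (app (cast HF ((pi_fop sa sb pb)⟪t ∘ r⟫)) (cast HX1 x))).
  - rewrite (pi_fop_app (pb := pb) (d := t ∘ r) (pb2 := pb1) (x2 := cast HX2 (cast HX1 x))
      (f := cast HF ((pi_fop sa sb pb)⟪t ∘ r⟫)) (x := cast HX1 x)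
      eq_refl Hpb1 eq_refl eq_refl eq_refl).
    etransitivity; [refine (pi_sol_nat Ha Hb (t := idm K) _ _ _)|apply tsub_id].
    + rewrite clift_id, comp_idr, <- comp_assoc, Hp, comp_assoc, clift_comp; reflexivity.
    + apply (PNat_cancel (t := t ∘ r) (pb := pb) (t3 := t ∘ r)); [symmetry; apply comp_idr | exact Hpb1|].
      exact (PNat_trans eq_refl Hpb Hpb1').
    + simpl; rewrite tsub_id; reflexivity.
  - symmetry. etransitivity; [|apply tsub_id].
    refine (app_nat (o := o) (HA := HA) (fnat_ty Hb) (t := idm K) _ _ _).
    + rewrite comp_idr; exact Hs.
    + simpl. rewrite !tsub_comp, comp_idr; reflexivity.
    + simpl; rewrite tsub_id; reflexivity.
Qed.
End PiNat.

Definition pi_op {G} {A : Ty G} {B : Ty (G ▹ A)} (sa : FibStr A) (sb : FibStr B) : FibOp (Pi B).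
Proof.
  refine {| fop := fun D p b phi pb => pi_fop sa sb pb |}.
  - intros; apply pi_fop_ext.
  - intros D p b phi pb D1 p1 phi1 pb1 r Hp Hpb.
    (* Naturality in the stage is the two-sided law with an identity as change of base. *)
    refine (pi_fop_nat (o := idm G) (HA := eq_sym (Tsub_id A)) _ _ _ Hpb).
    + apply FNat_id.
    + apply FNat_idm, lift_idm.
    + rewrite comp_idl; exact Hp.
Defined.

Definition pi_fib {G} {A : Ty G} {B : Ty (G ▹ A)} (sa : FibStr A) (sb : FibStr B) :
  FibStr (Pi B) := fib_of (pi_op sa sb).

(** The same two-sided law, now with an identity as change of stage. This is what makes the product
    code commute strictly with substitution. *)
Lemma pi_fib_nat {G G'} {A : Ty G} {B : Ty (G ▹ A)} {sa : FibStr A} {sb : FibStr B}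
  {A' : Ty G'} {B' : Ty (G' ▹ A')} {sa' : FibStr A'} {sb' : FibStr B'} {o : Hom G' G}
  (HA : A' = A⟦o⟧) : FNat o sa sa' -> FNat (lift HA) sb sb' ->
  FNat o (pi_fib sa sb) (pi_fib sa' sb').
Proof.
  intros Ha Hb. apply FNat_intro.
  - apply (Pi_nat_ty (HA := HA)), (fnat_ty Hb).
  - intros D p' b phi pb' pb Hpb. unfold pi_fib; rewrite !fcomp_fib_of.
    etransitivity; [refine (pi_fop_nat Ha Hb _ Hpb)|apply tsub_id].
    rewrite clift_id, comp_idr; reflexivity.
Qed.

Lemma pi_fib_canon {G} {A : Ty G} {B : Ty (G ▹ A)} (sa : FibStr A) (sb : FibStr B) :
  CanonPi sa sb (pi_fib sa sb).
Proof.
  intros D p b phi pb x.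
  exists (empty_problem x), (pi_arg sa x), (pi_problem sa pb x).
  split; [reflexivity|]. split; [apply fill_is_fill|]. split; [reflexivity|]. split; [reflexivity|].
  refine (pi_fop_app (sb := sb) (pb := pb) (d := idm D) _ _ _ _ _).
  - rewrite clift_id, comp_idr; reflexivity.
  - apply PNat_idm; reflexivity.
  - rewrite comp_idr; reflexivity.
  - change (val (fcomp (pi_fib sa sb) pb) = tsub (val (pi_fop sa sb pb)) (idm D)).
    unfold pi_fib; rewrite fcomp_fib_of. symmetry; apply tsub_id.
  - reflexivity.
Qed.
End PiFib.

(** * Dependent sums *)

Section SigFib.
Context {E : CwF} {T : TypeFormers E} {I : Interval T} {P : PathContexts I}
  {C : Cofibrations I}.

Lemma clift_cpair {X : Ty emp} {G D K} (s : Hom D G) (d : Hom K D) (x : Elc X K) :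
  clift X s ∘ cpair d x = cpair (s ∘ d) x.
Proof. unfold clift; rewrite cpair_comp; f_equal; nf; reflexivity. Qed.

Lemma line_ty_nat {G G' D D'} {o : Hom G' G} {A : Ty G} {A' : Ty G'} (HA : A' = A⟦o⟧)
  {p : Hom (D ▸ II) G} {p' : Hom (D' ▸ II) G'} {t : Hom D' D} :
  o ∘ p' = p ∘ clift II t -> A'⟦p'⟧ = A⟦p⟧⟦clift II t⟧.
Proof. intro Hp; rewrite HA, !Tsub_comp, Hp; reflexivity. Qed.

Lemma path_cpair_nat {G G' D D' K} {o : Hom G' G} {p : Hom (D ▸ II) G} {p' : Hom (D' ▸ II) G'}
  {t : Hom D' D} (Hp : o ∘ p' = p ∘ clift II t) (d : Hom K D') (i : Elc II K) :
  o ∘ (p' ∘ cpair d i) = p ∘ cpair (t ∘ d) i.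
Proof. rewrite <- comp_assoc, Hp, comp_assoc, clift_cpair; reflexivity. Qed.

Lemma path_end_nat {G G' D D'} {o : Hom G' G} {p : Hom (D ▸ II) G} {p' : Hom (D' ▸ II) G'}
  {t : Hom D' D} (Hp : o ∘ p' = p ∘ clift II t) (b : bool) :
  o ∘ (p' ∘ cpair (idm D') (endpoint b D')) = p ∘ cpair (idm D) (endpoint b D) ∘ t.
Proof.
  rewrite (path_cpair_nat Hp), comp_assoc, cpair_comp, endpoint_sub, comp_idl, comp_idr; reflexivity.
Qed.

Section Sol.
Context {G} {A : Ty G} {B : Ty (G ▹ A)} (sa : FibStr A) (sb : FibStr B)
  {D} (p : Hom (D ▸ II) G) {b : bool} {phi : Elc (code Cof) D}
  (pb : Problem ((Sig B)⟦p⟧) b phi).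

Definition sig_tube : El ((Sig B)⟦p ∘ clift II (wk (holds phi))⟧) := ecomp (tube pb).
Definition sig_base : El ((Sig B)⟦p ∘ cpair (idm D) (endpoint b D)⟧) := ecomp (base pb).

Lemma sig_tube_stage {K} {d : Hom K D} (u : El ((holds phi)⟦d⟧)) (i : Elc II K) {s : Hom K G}
  (f : El ((Sig B)⟦s⟧)) :
  s = p ∘ cpair d i -> val f = tapp pb u i ->
  tval (val (sfst sig_tube)) u i = val (sfst f) /\ tval (val (ssnd sig_tube)) u i = val (ssnd f).
Proof.
  intros Hs Hf.
  assert (e : s = p ∘ clift II (wk (holds phi)) ∘ cpair (pair u) i).
  { rewrite Hs, comp_assoc, clift_cpair, wk_pair'; reflexivity. }
  split; symmetry; [apply (sfst_sub e) | apply (ssnd_sub e)]; exact Hf.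
Qed.

Lemma sig_base_stage {K} (d : Hom K D) {s : Hom K G} (f : El ((Sig B)⟦s⟧)) :
  s = p ∘ cpair d (endpoint b K) -> val f = tsub (val (base pb)) d ->
  tsub (val (sfst sig_base)) d = val (sfst f) /\ tsub (val (ssnd sig_base)) d = val (ssnd f).
Proof.
  intros Hs Hf.
  assert (e : s = p ∘ cpair (idm D) (endpoint b D) ∘ d).
  { rewrite Hs, comp_assoc, cpair_comp, comp_idl, endpoint_sub; reflexivity. }
  split; symmetry; [apply (sfst_sub e) | apply (ssnd_sub e)]; exact Hf.
Qed.

Lemma sig_tube_base K (d : Hom K D) (u : El ((holds phi)⟦d⟧)) :
  tval (val (sfst sig_tube)) u (endpoint b K) = tsub (val (sfst sig_base)) d /\
  tval (val (ssnd sig_tube)) u (endpoint b K) = tsub (val (ssnd sig_base)) d.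
Proof.
  pose (f := ecomp (mkEl (tapp_ty pb u (endpoint b K))) : El ((Sig B)⟦p ∘ cpair d (endpoint b K)⟧)).
  destruct (sig_tube_stage (u := u) (f := f) eq_refl eq_refl) as [-> ->].
  destruct (sig_base_stage (d := d) (f := f) eq_refl (tapp_base _ _)) as [-> ->].
  split; reflexivity.
Qed.

Definition sig_fst_problem : Problem (A⟦p⟧) b phi.
Proof.
  refine (mk_problem (f := cast (eq_sym (Tsub_comp _ _ _)) (sfst sig_tube))
    (a := cast (eq_sym (Tsub_comp _ _ _)) (sfst sig_base)) _).
  intros K d u. apply sig_tube_base.
Defined.

Definition sig_fill : El (A⟦p⟧) := fill sig_fst_problem sa.

(** The second components of the tube live over its first components. They form a partial line in
    [B⟦pair sig_fill⟧] because the filler restricts to those first components; [sig_fill_base] does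
    the same for the base. *)
Lemma sig_fill_tube : sfst sig_tube ≈ sig_fill⟪clift II (wk (holds phi))⟫.
Proof.
  unfold sig_fill; symmetry.
  assert (u : El ((holds phi)⟦wk (II⟦bang D⟧) ∘ clift II (wk (holds phi))⟧)).
  { refine (hcast (gen_holds phi) _). rewrite clift_hom; reflexivity. }
  etransitivity; [apply (fill_on sig_fst_problem sa u)|].
  unfold tapp. simpl val. etransitivity; [|apply tsub_id]. f_equal.
  apply chom_ext; [apply holds_hom|]; unfold clift; nf; reflexivity.
Qed.

Lemma sig_fill_base : sfst sig_base ≈ sig_fill⟪cpair (idm D) (endpoint b D)⟫.
Proof.
  unfold sig_fill; symmetry.
  etransitivity; [apply (fill_end sig_fst_problem sa); apply cvar_cpair|].
  rewrite cpair_wk. apply tsub_id.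
Qed.

Lemma sig_tube_ty : B⟦pair (sfst sig_tube)⟧ = B⟦pair sig_fill⟧⟦clift II (wk (holds phi))⟧.
Proof.
  rewrite Tsub_comp, pair_comp. f_equal. apply pair_ext; [reflexivity | apply sig_fill_tube].
Qed.

Lemma sig_base_ty : B⟦pair (sfst sig_base)⟧ = at_ (B⟦pair sig_fill⟧) (endpoint b D).
Proof.
  unfold at_; rewrite Tsub_comp, pair_comp. f_equal. apply pair_ext; [reflexivity | apply sig_fill_base].
Qed.

Definition sig_snd_problem : Problem (B⟦pair sig_fill⟧) b phi.
Proof.
  refine (mk_problem (f := cast sig_tube_ty (ssnd sig_tube)) (a := cast sig_base_ty (ssnd sig_base)) _).
  intros K d u. apply sig_tube_base.
Defined.

Lemma sig_fop_ty : B⟦pair sig_fill⟧⟦cpair (idm D) (endpoint (negb b) D)⟧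
  = B⟦pair (ecomp (sig_fill⟪cpair (idm D) (endpoint (negb b) D)⟫))⟧.
Proof. rewrite Tsub_comp, pair_comp; reflexivity. Qed.

Definition sig_fop0 : El ((Sig B)⟦p ∘ cpair (idm D) (endpoint (negb b) D)⟧) :=
  sig_pair (a := ecomp (sig_fill⟪cpair (idm D) (endpoint (negb b) D)⟫))
    (cast sig_fop_ty (fcomp sb sig_snd_problem)).

Definition sig_fop : El (at_ ((Sig B)⟦p⟧) (endpoint (negb b) D)) :=
  cast (eq_sym (Tsub_comp _ _ _)) sig_fop0.

Lemma sig_fop_fst : sfst sig_fop0 ≈ sig_fill⟪cpair (idm D) (endpoint (negb b) D)⟫.
Proof. unfold sig_fop0; rewrite sfst_pair; reflexivity. Qed.

Lemma sig_fop_snd : ssnd sig_fop0 ≈ fcomp sb sig_snd_problem.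
Proof. unfold sig_fop0; rewrite ssnd_pair; reflexivity. Qed.

Lemma sig_fop_ext {K} {d : Hom K D} (u : El ((holds phi)⟦d⟧)) :
  tapp pb u (endpoint (negb b) K) = tsub (val sig_fop) d.
Proof.
  set (e := endpoint (negb b) K).
  assert (Hs : p ∘ cpair d e = p ∘ cpair (idm D) (endpoint (negb b) D) ∘ d).
  { rewrite comp_assoc, cpair_comp, comp_idl, endpoint_sub; reflexivity. }
  pose (f1 := ecomp (mkEl (tapp_ty pb u e)) : El ((Sig B)⟦p ∘ cpair d e⟧)).
  destruct (sig_tube_stage (u := u) (f := f1) eq_refl eq_refl) as [H1 H2].
  change (val f1 = val (ecomp (sig_fop0⟪d⟫))).
  apply (sig_ext' Hs).
  - rewrite (sfst_sub (t := d) eq_refl (x := sig_fop0)) by reflexivity.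
    change (val (sfst f1) = tsub (val (sfst sig_fop0)) d). rewrite sig_fop_fst.
    change (val (sfst f1) = tsub (tsub (val sig_fill) (cpair (idm D) (endpoint (negb b) D))) d).
    rewrite tsub_comp, cpair_comp, comp_idl, endpoint_sub.
    assert (v : El ((holds phi)⟦wk (II⟦bang D⟧) ∘ cpair d (endpoint (negb b) K)⟧)).
    { rewrite cpair_wk; exact u. }
    symmetry. etransitivity; [apply (fill_on sig_fst_problem sa v)|].
    rewrite cvar_cpair. etransitivity; [apply (tapp_irr _ _ u), cpair_wk|].
    exact H1.
  - rewrite (ssnd_sub (t := d) eq_refl (x := sig_fop0)) by reflexivity.
    change (val (ssnd f1) = tsub (val (ssnd sig_fop0)) d). rewrite sig_fop_snd.
    symmetry. etransitivity; [apply (fcomp_ext sb sig_snd_problem u)|]. exact H2.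
Qed.

End Sol.

Section ProblemNat.
Context {G} {A : Ty G} {B : Ty (G ▹ A)} {G'} {A' : Ty G'} {B' : Ty (G' ▹ A')}
  {o : Hom G' G} (HA : A' = A⟦o⟧) (HB : B' = B⟦lift HA⟧).
Context {D} {p : Hom (D ▸ II) G} {D'} {p' : Hom (D' ▸ II) G'} {t : Hom D' D}
  (Hp : o ∘ p' = p ∘ clift II t) {b : bool}
  {phi : Elc (code Cof) D} {pb : Problem ((Sig B)⟦p⟧) b phi}
  {phi' : Elc (code Cof) D'} {pb' : Problem ((Sig B')⟦p'⟧) b phi'} (Hpb : PNat t pb pb').

Lemma sig_tube_nat {K} {d : Hom K D'} (u : El ((holds phi)⟦t ∘ d⟧)) (u' : El ((holds phi')⟦d⟧))
  (i : Elc II K) :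
  tval (val (sfst (sig_tube pb'))) u' i = tval (val (sfst (sig_tube pb))) u i /\
  tval (val (ssnd (sig_tube pb'))) u' i = tval (val (ssnd (sig_tube pb))) u i.
Proof.
  pose (f := ecomp (mkEl (tapp_ty pb u i)) : El ((Sig B)⟦p ∘ cpair (t ∘ d) i⟧)).
  pose (f' := ecomp (mkEl (tapp_ty pb' u' i)) : El ((Sig B')⟦p' ∘ cpair d i⟧)).
  destruct (sig_tube_stage (u := u) (f := f) eq_refl eq_refl) as [-> ->].
  destruct (sig_tube_stage (u := u') (f := f') eq_refl eq_refl) as [-> ->].
  assert (Hs : o ∘ (p' ∘ cpair d i) = p ∘ cpair (t ∘ d) i ∘ idm K).
  { rewrite comp_idr; apply path_cpair_nat, Hp. }
  assert (Hf : val f' = tsub (val f) (idm K)).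
  { rewrite tsub_id; apply (pnat_tube Hpb). }
  destruct (sfst_ssnd_nat (HA := HA) HB Hs Hf) as [H1 H2].
  rewrite H1, H2. simpl. rewrite !tsub_id. split; reflexivity.
Qed.

Lemma sig_base_nat :
  sfst (sig_base pb') ≈ (sfst (sig_base pb))⟪t⟫ /\ ssnd (sig_base pb') ≈ (ssnd (sig_base pb))⟪t⟫.
Proof.
  apply (sfst_ssnd_nat (HA := HA) HB).
  - apply path_end_nat, Hp.
  - exact (pnat_base Hpb).
Qed.

(** Stated from an equality of families rather than of fibration structures, because it is reused
    for identity types, whose family [ConstOn] is given no structure. *)
Lemma sig_fst_problem_nat : PNat t (sig_fst_problem pb) (sig_fst_problem pb').
Proof.
  split.
  - apply (line_ty_nat HA Hp).
  - apply (pnat_phi Hpb).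
  - intros K d u u' i. apply sig_tube_nat.
  - apply sig_base_nat.
Qed.
End ProblemNat.

Section Nat.
Context {G} {A : Ty G} {B : Ty (G ▹ A)} {sa : FibStr A} {sb : FibStr B}.
Context {G'} {A' : Ty G'} {B' : Ty (G' ▹ A')} {sa' : FibStr A'} {sb' : FibStr B'}.
Context {o : Hom G' G} (HA : A' = A⟦o⟧) (Ha : FNat o sa sa') (Hb : FNat (lift HA) sb sb').
Context {D} {p : Hom (D ▸ II) G} {D'} {p' : Hom (D' ▸ II) G'} {t : Hom D' D}
  (Hp : o ∘ p' = p ∘ clift II t) {b : bool}
  {phi : Elc (code Cof) D} {pb : Problem ((Sig B)⟦p⟧) b phi}
  {phi' : Elc (code Cof) D'} {pb' : Problem ((Sig B')⟦p'⟧) b phi'} (Hpb : PNat t pb pb').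

Lemma sig_fill_nat : sig_fill sa' pb' ≈ (sig_fill sa pb)⟪clift II t⟫.
Proof.
  exact (fill_nat Ha Hp (sig_fst_problem_nat (fnat_ty Hb) Hp Hpb)).
Qed.

Lemma sig_fop_nat : sig_fop sa' sb' pb' ≈ (sig_fop sa sb pb)⟪t⟫.
Proof.
  assert (Hs : o ∘ (p' ∘ cpair (idm D') (endpoint (negb b) D'))
     = p ∘ cpair (idm D) (endpoint (negb b) D) ∘ t) by apply path_end_nat, Hp.
  assert (HP : Sig B' = (Sig B)⟦o⟧) by (apply (Sig_nat_ty (HA := HA)), (fnat_ty Hb)).
  assert (HT : (Sig B)⟦p ∘ cpair (idm D) (endpoint (negb b) D)⟧⟦t⟧
    = (Sig B')⟦p' ∘ cpair (idm D') (endpoint (negb b) D')⟧).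
  { rewrite HP, (Tsub_comp (Sig B) o), Hs, Tsub_comp; reflexivity. }
  pose (f := cast HT ((sig_fop0 sa sb pb)⟪t⟫)).
  enough (e0 : sig_fop0 sa' sb' pb' = f) by exact (f_equal (@val _ _ _) e0).
  destruct (sfst_ssnd_nat (HA := HA) (fnat_ty Hb) Hs (x := sig_fop0 sa sb pb) (x' := f) eq_refl) as [H1 H2].
  apply sig_ext.
  - rewrite H1, sig_fop_fst.
    change (tsub (val (sig_fill sa' pb')) (cpair (idm D') (endpoint (negb b) D'))
      = tsub (val (sfst (sig_fop0 sa sb pb))) t).
    rewrite sig_fop_fst, sig_fill_nat. simpl. rewrite !tsub_comp. f_equal.
    rewrite clift_cpair, cpair_comp, comp_idl, comp_idr, endpoint_sub; reflexivity.
  - rewrite H2, sig_fop_snd.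
    change (val (fcomp sb' (sig_snd_problem sa' pb')) = tsub (val (ssnd (sig_fop0 sa sb pb))) t).
    rewrite sig_fop_snd.
    assert (Hq : lift HA ∘ pair (sig_fill sa' pb') = pair (sig_fill sa pb) ∘ clift II t).
    { apply pair_lift; [exact Hp | apply sig_fill_nat]. }
    refine (fcomp_nat Hb Hq _). split.
    + apply (line_ty_nat (fnat_ty Hb) Hq).
    + apply (pnat_phi Hpb).
    + intros K d u u' i. apply (sig_tube_nat (fnat_ty Hb) Hp Hpb).
    + apply (sig_base_nat (fnat_ty Hb) Hp Hpb).
Qed.
End Nat.

Definition sig_op {G} {A : Ty G} {B : Ty (G ▹ A)} (sa : FibStr A) (sb : FibStr B) : FibOp (Sig B).
Proof.
  refine {| fop := fun D p b phi pb => sig_fop sa sb pb |}.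
  - intros; apply sig_fop_ext.
  - intros D p b phi pb D1 p1 phi1 pb1 r Hp Hpb.
    refine (sig_fop_nat (o := idm G) (HA := eq_sym (Tsub_id A)) _ _ _ Hpb).
    + apply FNat_id.
    + apply FNat_idm, lift_idm.
    + rewrite comp_idl; exact Hp.
Defined.

Definition sig_fib {G} {A : Ty G} {B : Ty (G ▹ A)} (sa : FibStr A) (sb : FibStr B) :
  FibStr (Sig B) := fib_of (sig_op sa sb).

Lemma sig_fib_nat {G G'} {A : Ty G} {B : Ty (G ▹ A)} {sa : FibStr A} {sb : FibStr B}
  {A' : Ty G'} {B' : Ty (G' ▹ A')} {sa' : FibStr A'} {sb' : FibStr B'} {o : Hom G' G}
  (HA : A' = A⟦o⟧) : FNat o sa sa' -> FNat (lift HA) sb sb' ->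
  FNat o (sig_fib sa sb) (sig_fib sa' sb').
Proof.
  intros Ha Hb. apply FNat_intro.
  - apply (Sig_nat_ty (HA := HA)), (fnat_ty Hb).
  - intros D p' b phi pb' pb Hpb. unfold sig_fib; rewrite !fcomp_fib_of.
    etransitivity; [refine (sig_fop_nat Ha Hb _ Hpb)|apply tsub_id].
    rewrite clift_id, comp_idr; reflexivity.
Qed.

Lemma sig_fib_canon {G} {A : Ty G} {B : Ty (G ▹ A)} (sa : FibStr A) (sb : FibStr B) :
  CanonSig sa sb (sig_fib sa sb).
Proof.
  intros D p b phi pb.
  exists (sig_fst_problem pb), (sig_fill sa pb), (sig_snd_problem sa pb).
  split; [reflexivity|]. split; [reflexivity|]. split; [apply fill_is_fill|].
  split; [reflexivity|]. split; [reflexivity|].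
  assert (e : ecomp (fcomp (sig_fib sa sb) pb) = sig_fop0 sa sb pb).
  { apply El_ext. exact (fcomp_fib_of (sig_op sa sb) pb). }
  split.
  - rewrite <- sig_fop_fst with (sb := sb). f_equal. f_equal. exact e.
  - rewrite <- sig_fop_snd. exact (f_equal (fun z => val (ssnd z)) e).
Qed.
End SigFib.

(** * Lines and path types *)

Section PathCalculus.
Context {E : CwF} {T : TypeFormers E} {I : Interval T} {P : PathContexts I}
  {C : Cofibrations I}.

Definition Line {G} (A : Ty G) : Ty G := Arr (II⟦bang G⟧) A.

Lemma Line_sub {G G'} {A : Ty G} {A' : Ty G'} {o : Hom G' G} : A' = A⟦o⟧ -> Line A' = (Line A)⟦o⟧.
Proof.
  intros ->. apply (Pi_nat_ty (HA := closed_sub o)).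
  rewrite !Tsub_comp, wk_lift; reflexivity.
Qed.

Lemma line_app_nat {G G'} {A : Ty G} {A' : Ty G'} {o : Hom G' G} (HA : A' = A⟦o⟧)
  {D D'} {s : Hom D G} {s' : Hom D' G'} {t : Hom D' D} (Hs : o ∘ s' = s ∘ t)
  (f : El ((Line A)⟦s⟧)) (f' : El ((Line A')⟦s'⟧)) (i : Elc II D) (i' : Elc II D') :
  f' ≈ f⟪t⟫ -> i' = i ∘ t -> line_app f' i' ≈ (line_app f i)⟪t⟫.
Proof.
  intros Hf ->. simpl val.
  refine (app_nat (HA := closed_sub o) _ Hs Hf _).
  - rewrite HA, !Tsub_comp, wk_lift; reflexivity.
  - simpl. rewrite tsub_comp; reflexivity.
Qed.

Lemma line_app_sub {G} {A : Ty G} {D D'} {s : Hom D G} {s' : Hom D' G} {t : Hom D' D}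
  (Hs : s' = s ∘ t) (f : El ((Line A)⟦s⟧)) (f' : El ((Line A)⟦s'⟧)) (i : Elc II D) (i' : Elc II D') :
  f' ≈ f⟪t⟫ -> i' = i ∘ t -> line_app f' i' ≈ (line_app f i)⟪t⟫.
Proof.
  apply (line_app_nat (o := idm G)); [symmetry; apply Tsub_id | rewrite comp_idl; exact Hs].
Qed.

Lemma line_app_congr {G} {A : Ty G} {D} {s s' : Hom D G}
  (Hs : s' = s) (f : El ((Line A)⟦s⟧)) (f' : El ((Line A)⟦s'⟧)) (i i' : Elc II D) :
  f' ≈ f -> i' = i -> line_app f' i' ≈ line_app f i.
Proof. subst s'; intros Hf ->; apply El_ext in Hf; subst; reflexivity. Qed.

Lemma line_lam_ty {G} (A : Ty G) {D} (s : Hom D G) :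
  Pi (A⟦s⟧⟦wk (II⟦bang D⟧)⟧) = (Line A)⟦s⟧.
Proof.
  apply (Pi_nat_ty (HA := closed_sub s)).
  rewrite !Tsub_comp, wk_lift; reflexivity.
Qed.

Definition line_lam {G} {A : Ty G} {D} {s : Hom D G} (l : El (A⟦s⟧⟦wk (II⟦bang D⟧)⟧)) :
  El ((Line A)⟦s⟧) := cast (line_lam_ty A s) (lam l).

Lemma line_app_lam {G} {A : Ty G} {D K} {s : Hom D G} {t : Hom K D} {s' : Hom K G}
  (Hs : s' = s ∘ t) (l : El (A⟦s⟧⟦wk (II⟦bang D⟧)⟧)) (f : El ((Line A)⟦s'⟧)) (i : Elc II K) :
  f ≈ (line_lam l)⟪t⟫ -> line_app f i ≈ l⟪cpair t i⟫.
Proof.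
  intro Hf. subst s'.
  assert (e : (Line A)⟦s ∘ t⟧ = (Pi (A⟦s⟧⟦wk (II⟦bang D⟧)⟧))⟦t⟧).
  { rewrite line_lam_ty, Tsub_comp; reflexivity. }
  assert (ei : II⟦bang K⟧ = II⟦bang D⟧⟦t⟧) by apply closed_sub.
  transitivity (val (app (cast e f) (cast ei (elem i)))).
  - symmetry. etransitivity; [|apply tsub_id]. simpl val.
    refine (app_nat (o := s) (HA := closed_sub s) _ (t := idm K) _ _ _).
    + rewrite !Tsub_comp, wk_lift; reflexivity.
    + symmetry; apply comp_idr.
    + simpl. rewrite tsub_id; reflexivity.
    + simpl. rewrite tsub_id; reflexivity.
  - rewrite (app_lam_sub (b := l) (f := cast e f) (cast ei (elem i))) by exact Hf.
    simpl. f_equal. apply chom_ext; nf; [reflexivity|].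
    apply elc_ext. rewrite var_cvar_assoc; nf; reflexivity.
Qed.

Lemma line_ext {G} {A : Ty G} {D} {s s' : Hom D G} (Hs : s' = s)
  (f : El ((Line A)⟦s⟧)) (f' : El ((Line A)⟦s'⟧)) :
  (forall K (t : Hom K D) (i : Elc II K), line_app (ecomp (f'⟪t⟫)) i ≈ line_app (ecomp (f⟪t⟫)) i) ->
  f' ≈ f.
Proof.
  intro H. apply (pi_ext' Hs). intros K t x x' Hx.
  assert (e : (II⟦bang G⟧)⟦s ∘ t⟧ = II⟦bang K⟧) by (symmetry; apply closed_sub).
  (* An element of the reindexed interval is a morphism into [emp ▹ II] in disguise, so [line_app]
     reaches every argument. *)
  assert (H0 : exists i : Elc II K, val (elem i) = val x).
  { unshelve eexists (pair (s := bang K) (cast _ x)); [exact e|]. simpl. rewrite var_pair'; reflexivity. }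
  destruct H0 as [i Hi]. specialize (H K t i). simpl val in H.
  etransitivity; [|etransitivity; [exact H|]]; apply app_congr; try reflexivity; simpl.
  - rewrite Hx; symmetry; exact Hi.
  - exact Hi.
Qed.

Lemma And_sub {G D} (X Y : Ty G) (s : Hom D G) : (And X Y)⟦s⟧ = And (X⟦s⟧) (Y⟦s⟧).
Proof. unfold And. rewrite Sig_sub. f_equal. rewrite !Tsub_comp, wk_lift; reflexivity. Qed.

Lemma wk_lift_ty {G G'} {A X : Ty G} {A' X' : Ty G'} {o : Hom G' G} (H : X' = X⟦o⟧) :
  A' = A⟦o⟧ -> A'⟦wk X'⟧ = A⟦wk X⟧⟦lift H⟧.
Proof. intros ->; rewrite !Tsub_comp, wk_lift; reflexivity. Qed.

Section Path.
Context {G} {A : Ty G} (a0 a1 : El A).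

(** Names the family inside [Path], which is convertible to [Sig PathEnds], so that it can be passed
    to [sfst] and [ssnd]. *)
Definition PathEnds : Ty (G ▹ Line A) :=
  And (Id (line_app (evar (Line A)) (endpoint false _)) (a0⟪wk (Line A)⟫))
      (Id (line_app (evar (Line A)) (endpoint true _)) (a1⟪wk (Line A)⟫)).

Lemma PathEnds_nat {G'} {A' : Ty G'} (b0 b1 : El A') {o : Hom G' G} (HA : A' = A⟦o⟧)
  (H0 : b0 ≈ a0⟪o⟫) (H1 : b1 ≈ a1⟪o⟫) (HL : Line A' = (Line A)⟦o⟧) :
  And (Id (line_app (evar (Line A')) (endpoint false _)) (b0⟪wk (Line A')⟫))
      (Id (line_app (evar (Line A')) (endpoint true _)) (b1⟪wk (Line A')⟫)) = PathEnds⟦lift HL⟧.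
Proof.
  unfold PathEnds. rewrite And_sub.
  assert (Hl : forall b, line_app (evar (Line A')) (endpoint b (G' ▹ Line A'))
    ≈ (line_app (evar (Line A)) (endpoint b (G ▹ Line A)))⟪lift HL⟫).
  { intro b. apply (line_app_nat HA).
    - symmetry; apply wk_lift.
    - simpl. rewrite var_lift; reflexivity.
    - rewrite endpoint_sub; reflexivity. }
  assert (HT : A'⟦wk (Line A')⟧ = A⟦wk (Line A)⟧⟦lift HL⟧).
  { apply wk_lift_ty, HA. }
  f_equal; symmetry; apply Id_sub'; try apply Hl; try exact HT; simpl;
    rewrite ?H0, ?H1; simpl; rewrite !tsub_comp, wk_lift; reflexivity.
Qed.

Lemma Path_nat {G'} {A' : Ty G'} (b0 b1 : El A') {o : Hom G' G} (HA : A' = A⟦o⟧)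
  (H0 : b0 ≈ a0⟪o⟫) (H1 : b1 ≈ a1⟪o⟫) : Path b0 b1 = (Path a0 a1)⟦o⟧.
Proof. apply (Sig_nat_ty (HA := Line_sub HA)). apply PathEnds_nat; assumption. Qed.

Lemma PathEnds_prop : IsProp PathEnds.
Proof. apply And_prop; intros D s x y; apply Id_prop. Qed.

Lemma path_end {D} {s : Hom D G} (x : El ((Path a0 a1)⟦s⟧)) (b : bool) :
  path_app x (endpoint b D) ≈ (if b then a1 else a0)⟪s⟫.
Proof.
  pose proof (ssnd (B := PathEnds) x) as q.
  set (f := sfst (B := PathEnds) x) in *.
  assert (H : forall b, line_app f (endpoint b D)
     ≈ (line_app (evar (Line A)) (endpoint b (G ▹ Line A)))⟪pair f⟫).
  { intro b'. apply line_app_sub.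
    - symmetry; apply wk_pair'.
    - simpl; rewrite var_pair'; reflexivity.
    - rewrite endpoint_sub; reflexivity. }
  transitivity (val (line_app f (endpoint b D))); [reflexivity|].
  rewrite H. destruct b.
  - pose proof (Id_eq (and_snd q)) as e. simpl val in e |- *. rewrite e, tsub_comp, wk_pair'; reflexivity.
  - pose proof (Id_eq (and_fst q)) as e. simpl val in e |- *. rewrite e, tsub_comp, wk_pair'; reflexivity.
Qed.

(** The end-point conditions are identity types, hence propositions, so the values of a path
    determine it. *)
Lemma path_ext {D} {s s' : Hom D G} (Hs : s' = s) (x : El ((Path a0 a1)⟦s⟧))
  (x' : El ((Path a0 a1)⟦s'⟧)) :
  (forall K (t : Hom K D) (i : Elc II K), path_app (ecomp (x'⟪t⟫)) i ≈ path_app (ecomp (x⟪t⟫)) i) ->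
  x' ≈ x.
Proof.
  subst s'. intro H. f_equal. apply (sig_ext_prop (B := PathEnds)); [exact PathEnds_prop|].
  apply (line_ext eq_refl). intros K t i. specialize (H K t i). unfold path_app in H.
  etransitivity; [|etransitivity; [exact H|]]; apply line_app_congr; try reflexivity.
  - symmetry. apply (sfst_sub (B := PathEnds) (t := t)); reflexivity.
  - apply (sfst_sub (B := PathEnds) (t := t)); reflexivity.
Qed.

Section Intro.
Context {D} {s : Hom D G} (l : El (A⟦s⟧⟦wk (II⟦bang D⟧)⟧))
  (Hl : forall b, l⟪cpair (idm D) (endpoint b D)⟫ ≈ (if b then a1 else a0)⟪s⟫).

Lemma path_intro_end b :
  tsub (val (line_app (evar (Line A)) (endpoint b (G ▹ Line A)))) (pair (line_lam l))
  = tsub (val ((if b then a1 else a0)⟪wk (Line A)⟫)) (pair (line_lam l)).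
Proof.
  transitivity (val (line_app (line_lam l) (endpoint b D))).
  - symmetry. apply (line_app_sub (t := pair (line_lam l))).
    + symmetry; apply wk_pair'.
    + simpl; rewrite var_pair'; reflexivity.
    + rewrite endpoint_sub; reflexivity.
  - rewrite (line_app_lam (eq_sym (comp_idr s)) (l := l)).
    + rewrite Hl. simpl. rewrite tsub_comp, wk_pair'; reflexivity.
    + symmetry; apply tsub_id.
Qed.

Definition path_intro : El ((Path a0 a1)⟦s⟧) :=
  sig_pair (B := PathEnds) (a := line_lam l)
    (and_intro (Id_intro (path_intro_end false)) (Id_intro (path_intro_end true))).

Lemma path_intro_app {K} {t : Hom K D} {s' : Hom K G} (Hs : s' = s ∘ t)
  (x : El ((Path a0 a1)⟦s'⟧)) (i : Elc II K) :
  x ≈ path_intro⟪t⟫ -> path_app x i ≈ l⟪cpair t i⟫.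
Proof.
  intro Hx. apply (line_app_lam Hs).
  etransitivity; [apply (sfst_sub (B := PathEnds) Hs Hx)|].
  unfold path_intro; simpl. rewrite sfst_pair; reflexivity.
Qed.
End Intro.
End Path.

Lemma path_app_congr {G} {A : Ty G} {a0 a1 : El A} {D} {s s' : Hom D G} (Hs : s' = s)
  (x : El ((Path a0 a1)⟦s⟧)) (x' : El ((Path a0 a1)⟦s'⟧)) (i i' : Elc II D) :
  x' ≈ x -> i' = i -> path_app x' i' ≈ path_app x i.
Proof. subst s'; intros Hf ->; apply El_ext in Hf; subst; reflexivity. Qed.

Lemma path_app_nat {G G'} {A : Ty G} {A' : Ty G'} {a0 a1 : El A} {b0 b1 : El A'}
  {o : Hom G' G} (HA : A' = A⟦o⟧)
  (H0 : b0 ≈ a0⟪o⟫) (H1 : b1 ≈ a1⟪o⟫)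
  {D D'} {s : Hom D G} {s' : Hom D' G'} {t : Hom D' D} (Hs : o ∘ s' = s ∘ t)
  (x : El ((Path a0 a1)⟦s⟧)) (x' : El ((Path b0 b1)⟦s'⟧)) (i : Elc II D) (i' : Elc II D') :
  x' ≈ x⟪t⟫ -> i' = i ∘ t -> path_app x' i' ≈ (path_app x i)⟪t⟫.
Proof.
  intros Hx Hi. apply (line_app_nat HA Hs); [|exact Hi].
  refine (sfst_nat (HA := Line_sub HA) _ Hs Hx). apply PathEnds_nat; assumption.
Qed.

Lemma path_app_sub {G} {A : Ty G} {a0 a1 : El A} {D D'} {s : Hom D G} {s' : Hom D' G}
  {t : Hom D' D} (Hs : s' = s ∘ t)
  (x : El ((Path a0 a1)⟦s⟧)) (x' : El ((Path a0 a1)⟦s'⟧)) (i : Elc II D) (i' : Elc II D') :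
  x' ≈ x⟪t⟫ -> i' = i ∘ t -> path_app x' i' ≈ (path_app x i)⟪t⟫.
Proof.
  apply (path_app_nat (o := idm G)).
  - symmetry; apply Tsub_id.
  - simpl; rewrite tsub_id; reflexivity.
  - simpl; rewrite tsub_id; reflexivity.
  - rewrite comp_idl; exact Hs.
Qed.

End PathCalculus.

(** * Composition in path types *)

Section PathFib.
Context {E : CwF} {T : TypeFormers E} {I : Interval T} {P : PathContexts I}
  {C : Cofibrations I}.

Section Sol.
Context {G} {A : Ty G} {a0 a1 : El A} (sa : FibStr A)
  {D} (p : Hom (D ▸ II) G) {b : bool} {phi : Elc (code Cof) D}
  (pb : Problem ((Path a0 a1)⟦p⟧) b phi).

Let w := wk (II⟦bang D⟧).
Let B : Ty (D ▸ II ▸ II) := A⟦p ∘ clift II w⟧.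

Definition ends_cof : Elc (code Cof) (D ▸ II) :=
  cof_or (cof_eq false (cvar II D)) (cof_eq true (cvar II D)).
Definition path_cof : Elc (code Cof) (D ▸ II) := cof_or (phi ∘ w) ends_cof.

Definition path_at {K} {d : Hom K D} (u : El ((holds phi)⟦d⟧)) (i : Elc II K) :
  El ((Path a0 a1)⟦p ∘ cpair d i⟧) := ecomp (mkEl (tapp_ty pb u i)).

Definition path_base_at {K} (d : Hom K D) : El ((Path a0 a1)⟦p ∘ cpair d (endpoint b K)⟧) :=
  ecomp (mkEl (base_ty (base pb) d)).

Lemma path_at_sub {K K'} {d : Hom K D} (u : El ((holds phi)⟦d⟧)) (i k : Elc II K) (r : Hom K' K)
  (u' : El ((holds phi)⟦d ∘ r⟧)) :
  tsub (val (path_app (path_at u i) k)) r = val (path_app (path_at u' (i ∘ r)) (k ∘ r)).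
Proof.
  symmetry. apply (path_app_sub (t := r)).
  - rewrite comp_assoc, cpair_comp; reflexivity.
  - symmetry. apply tapp_sub.
  - reflexivity.
Qed.

Lemma path_at_irr {K} {d d' : Hom K D} (u : El ((holds phi)⟦d⟧)) (u' : El ((holds phi)⟦d'⟧))
  (i k i' k' : Elc II K) : d = d' -> i = i' -> k = k' ->
  path_app (path_at u i) k ≈ path_app (path_at u' i') k'.
Proof. intros -> -> ->. rewrite (holds_prop u u'); reflexivity. Qed.

Definition path_tube_l : El (B⟦clift II (wk (holds (phi ∘ w)))⟧).
Proof.
  set (theta := phi ∘ w).
  set (dk := wk (holds theta) ∘ wk (II⟦bang (D ▸ II ▹ holds theta)⟧)).
  refine (cast _ (path_app (path_at (d := w ∘ dk) (fill_u (gen_holds theta)) (cvar II _))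
     (cvar II D ∘ dk))).
  unfold B; rewrite !Tsub_comp. f_equal. rewrite comp_assoc. f_equal.
  unfold dk; hom_eq.
Defined.

Lemma path_tube_l_val {K} {d : Hom K (D ▸ II)} (u : El ((holds (phi ∘ w))⟦d⟧))
  (v : El ((holds phi)⟦w ∘ d⟧)) (j : Elc II K) :
  tval (val path_tube_l) u j = val (path_app (path_at v j) (cvar II D ∘ d)).
Proof.
  unfold tval, path_tube_l. simpl val.
  assert (x : El ((holds phi)⟦w ∘ (wk (holds (phi ∘ w)) ∘ wk (II⟦bang _⟧)) ∘ cpair (pair u) j⟧)).
  { refine (hcast v _). nf; reflexivity. }
  etransitivity; [apply (path_at_sub _ _ _ x)|].
  apply path_at_irr; nf; reflexivity.
Qed.

Definition path_tube_e (c : bool) : El (B⟦clift II (wk (holds (cof_eq c (cvar II D))))⟧).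
Proof.
  refine (cast _ ((if c then a1 else a0)⟪p ∘ clift II w ∘ clift II (wk (holds (cof_eq c (cvar II D))))⟫)).
  unfold B; rewrite !Tsub_comp; reflexivity.
Defined.

Lemma path_tube_e_val (c : bool) {K} {d : Hom K (D ▸ II)} (u : El ((holds (cof_eq c (cvar II D)))⟦d⟧))
  (j : Elc II K) :
  tval (val (path_tube_e c)) u j = tsub (val (if c then a1 else a0)) (p ∘ cpair (w ∘ d) j).
Proof.
  unfold tval. simpl val. rewrite tsub_comp, !comp_assoc, !clift_cpair, wk_pair'; reflexivity.
Qed.

(** The faces [k = 0] and [k = 1] never meet, because the end-points are disjoint. *)
Lemma ends_compat K (d : Hom K (D ▸ II)) (u : El ((holds (cof_eq false (cvar II D)))⟦d⟧))
  (v : El ((holds (cof_eq true (cvar II D)))⟦d⟧)) (i : Elc II K) :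
  tval (val (path_tube_e false)) u i = tval (val (path_tube_e true)) v i.
Proof.
  assert (z : El (Zero K)).
  { apply endpoints_disjoint. rewrite <- (cof_eq_elim u). apply (cof_eq_elim v). }
  exact (absurd_eq (mkEl (tval_ty _ u i)) (mkEl (tval_ty _ v i)) eq_refl z).
Qed.

Definition ends_tube : El (B⟦clift II (wk (holds ends_cof))⟧) := or_tube ends_compat.

(** At an end-point, each path of the tube takes the prescribed value [a0] or [a1]. *)
Lemma path_compat K (d : Hom K (D ▸ II)) (u : El ((holds (phi ∘ w))⟦d⟧))
  (v : El ((holds ends_cof)⟦d⟧)) (i : Elc II K) :
  tval (val path_tube_l) u i = tval (val ends_tube) v i.
Proof.
  assert (H : forall c K' (r : Hom K' K) (x : El ((holds (cof_eq c (cvar II D)))⟦d ∘ r⟧)),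
    tsub (tval (val path_tube_l) u i) r = tval (val (path_tube_e c)) x (i ∘ r)).
  { intros c K' r x.
    assert (u' : El ((holds (phi ∘ w))⟦d ∘ r⟧)) by exact (ecomp (u⟪r⟫)).
    rewrite (tval_sub _ _ _ u'), (path_tube_l_val _ (fill_u u')), path_tube_e_val.
    rewrite (cof_eq_elim x). apply path_end. }
  apply (or_cases_tm v).
  - rewrite !tval_ty; reflexivity.
  - intros K' r x. rewrite (H _ _ _ x).
    assert (v' : El ((holds ends_cof)⟦d ∘ r⟧)) by exact (ecomp (v⟪r⟫)).
    rewrite (tval_sub _ _ _ v'). symmetry; apply (or_tube_l _ _ x).
  - intros K' r x. rewrite (H _ _ _ x).
    assert (v' : El ((holds ends_cof)⟦d ∘ r⟧)) by exact (ecomp (v⟪r⟫)).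
    rewrite (tval_sub _ _ _ v'). symmetry; apply (or_tube_r _ _ x).
Qed.

Definition path_tube : El (B⟦clift II (wk (holds path_cof))⟧) := or_tube path_compat.

Lemma path_tube_phi {K} {d : Hom K (D ▸ II)} (x : El ((holds path_cof)⟦d⟧))
  (u : El ((holds phi)⟦w ∘ d⟧)) (j : Elc II K) :
  tval (val path_tube) x j = val (path_app (path_at u j) (cvar II D ∘ d)).
Proof.
  etransitivity; [apply (or_tube_l _ _ (fill_u' u))|]. apply path_tube_l_val.
Qed.

Lemma path_tube_end {K} {d : Hom K (D ▸ II)} (x : El ((holds path_cof)⟦d⟧)) (c : bool) (j : Elc II K) :
  cvar II D ∘ d = endpoint c K ->
  tval (val path_tube) x j = tsub (val (if c then a1 else a0)) (p ∘ cpair (w ∘ d) j).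
Proof.
  intro Hd. pose (v := cof_eq_intro Hd : El ((holds (cof_eq c (cvar II D)))⟦d⟧)).
  rewrite <- (path_tube_e_val v). destruct c.
  - etransitivity; [apply (or_tube_r _ _ (cof_inr v))|]. apply (or_tube_r _ _ v).
  - etransitivity; [apply (or_tube_r _ _ (cof_inl v))|]. apply (or_tube_l _ _ v).
Qed.

Lemma path_cof_cases {K} {d : Hom K (D ▸ II)} (x : El ((holds path_cof)⟦d⟧)) (m n : Tm K) :
  ty m = ty n ->
  (forall K' (r : Hom K' K) (u : El ((holds phi)⟦w ∘ (d ∘ r)⟧)), tsub m r = tsub n r) ->
  (forall K' (r : Hom K' K) c, cvar II D ∘ (d ∘ r) = endpoint c K' -> tsub m r = tsub n r) ->
  m = n.
Proof.
  intros Hty H1 H2. apply (or_cases_tm x Hty).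
  - intros K' r u. apply H1. exact (fill_u u).
  - intros K' r v. apply (or_cases_tm v).
    + rewrite !ty_tsub, Hty; reflexivity.
    + intros K'' r' y. rewrite !tsub_comp. apply (H2 _ _ false). rewrite <- (comp_assoc d). apply (cof_eq_elim y).
    + intros K'' r' y. rewrite !tsub_comp. apply (H2 _ _ true). rewrite <- (comp_assoc d). apply (cof_eq_elim y).
Qed.

Lemma path_base_ty : A⟦p ∘ cpair w (endpoint b (D ▸ II))⟧ = at_ B (endpoint b (D ▸ II)).
Proof.
  unfold at_, B. rewrite Tsub_comp, comp_assoc, clift_cpair, comp_idr; reflexivity.
Qed.

Definition path_base : El (at_ B (endpoint b (D ▸ II))) :=
  cast path_base_ty (path_app (path_base_at w) (cvar II D)).

Lemma path_base_val {K} (d : Hom K (D ▸ II)) :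
  tsub (val path_base) d = val (path_app (path_base_at (w ∘ d)) (cvar II D ∘ d)).
Proof.
  simpl val. symmetry. apply (path_app_sub (t := d)).
  - rewrite comp_assoc, cpair_comp, endpoint_sub; reflexivity.
  - simpl. rewrite tsub_comp; reflexivity.
  - reflexivity.
Qed.

Lemma path_tube_base K (d : Hom K (D ▸ II)) (x : El ((holds path_cof)⟦d⟧)) :
  tval (val path_tube) x (endpoint b K) = tsub (val path_base) d.
Proof.
  apply (path_cof_cases x).
  - rewrite tval_ty, base_ty; reflexivity.
  - intros K' r u.
    assert (x' : El ((holds path_cof)⟦d ∘ r⟧)) by exact (ecomp (x⟪r⟫)).
    rewrite (tval_sub _ _ _ x'), (path_tube_phi _ u), tsub_comp, path_base_val, endpoint_sub.
    apply path_app_congr; try reflexivity. apply tapp_base.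
  - intros K' r c Hc.
    assert (x' : El ((holds path_cof)⟦d ∘ r⟧)) by exact (ecomp (x⟪r⟫)).
    rewrite (tval_sub _ _ _ x'), (path_tube_end _ _ Hc), tsub_comp, path_base_val, endpoint_sub, Hc.
    symmetry. apply path_end.
Qed.

Definition path_problem : Problem B b path_cof := mk_problem path_tube_base.

Let e := endpoint (negb b) D.

Lemma path_line_ty : at_ B (endpoint (negb b) (D ▸ II)) = A⟦p ∘ cpair (idm D) e⟧⟦w⟧.
Proof.
  unfold at_, B. rewrite !Tsub_comp, !comp_assoc, clift_cpair, cpair_comp, comp_idr, comp_idl.
  unfold e; rewrite endpoint_sub; reflexivity.
Qed.

Definition path_line : El (A⟦p ∘ cpair (idm D) e⟧⟦w⟧) := cast path_line_ty (fcomp sa path_problem).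

Lemma path_line_phi {K} {d : Hom K (D ▸ II)} (u : El ((holds phi)⟦w ∘ d⟧)) :
  tsub (val path_line) d = val (path_app (path_at u (endpoint (negb b) K)) (cvar II D ∘ d)).
Proof.
  simpl val. etransitivity; [apply (fcomp_ext sa path_problem (cof_inl (fill_u' u)))|].
  apply path_tube_phi.
Qed.

(** The faces [k = 0] and [k = 1] were put into the system so that the composite line has the right
    end-points. *)
Lemma path_line_end (c : bool) : path_line⟪cpair (idm D) (endpoint c D)⟫
  ≈ (if c then a1 else a0)⟪p ∘ cpair (idm D) e⟫.
Proof.
  simpl val.
  assert (Hd : cvar II D ∘ cpair (idm D) (endpoint c D) = endpoint c D) by apply cvar_cpair.
  pose (v := cof_eq_intro Hd : El ((holds (cof_eq c (cvar II D)))⟦_⟧)).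
  assert (x : El ((holds path_cof)⟦cpair (idm D) (endpoint c D)⟧)).
  { apply cof_inr. destruct c; [exact (cof_inr v) | exact (cof_inl v)]. }
  etransitivity; [apply (fcomp_ext sa path_problem x)|].
  etransitivity; [apply (path_tube_end _ _ Hd)|].
  unfold w; rewrite cpair_wk; reflexivity.
Qed.

Definition path_fop0 : El ((Path a0 a1)⟦p ∘ cpair (idm D) e⟧) := path_intro path_line_end.

Definition path_fop : El (at_ ((Path a0 a1)⟦p⟧) (endpoint (negb b) D)) :=
  cast (eq_sym (Tsub_comp _ _ _)) path_fop0.

Lemma path_fop_app {K} {t : Hom K D} {s' : Hom K G} (x : El ((Path a0 a1)⟦s'⟧)) (i : Elc II K) :
  s' = p ∘ cpair t (endpoint (negb b) K) -> x ≈ path_fop⟪t⟫ -> path_app x i ≈ path_line⟪cpair t i⟫.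
Proof.
  intros Hs Hx. apply (path_intro_app (t := t) (Hl := path_line_end)).
  - rewrite Hs, comp_assoc, cpair_comp, comp_idl. unfold e; rewrite endpoint_sub; reflexivity.
  - exact Hx.
Qed.

Lemma path_fop_ext {K} {d : Hom K D} (u : El ((holds phi)⟦d⟧)) :
  tapp pb u (endpoint (negb b) K) = tsub (val path_fop) d.
Proof.
  change (val (path_at u (endpoint (negb b) K)) = val (ecomp (path_fop0⟪d⟫))).
  apply path_ext.
  { rewrite comp_assoc, cpair_comp, comp_idl. unfold e; rewrite endpoint_sub; reflexivity. }
  intros K' r i.
  rewrite (path_fop_app (t := d ∘ r) (x := ecomp ((ecomp (path_fop0⟪d⟫))⟪r⟫))).
  - assert (u' : El ((holds phi)⟦d ∘ r⟧)) by exact (ecomp (u⟪r⟫)).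
    assert (v : El ((holds phi)⟦w ∘ cpair (d ∘ r) i⟧)).
    { unfold w. rewrite cpair_wk. exact u'. }
    symmetry. etransitivity; [apply (path_line_phi v)|].
    apply path_app_congr.
    + unfold w. rewrite cpair_wk, comp_assoc, cpair_comp, endpoint_sub; reflexivity.
    + symmetry. etransitivity; [apply (tapp_sub _ _ _ u')|]. rewrite endpoint_sub.
      apply tapp_irr. symmetry; apply cpair_wk.
    + apply cvar_cpair.
  - rewrite !comp_assoc, cpair_comp, comp_idl. unfold e; rewrite endpoint_sub; reflexivity.
  - simpl. apply tsub_comp.
Qed.

End Sol.
Arguments path_cof {D} phi.

Section Nat.
Context {G} {A : Ty G} {a0 a1 : El A} {sa : FibStr A}.
Context {G'} {A' : Ty G'} {b0 b1 : El A'} {sa' : FibStr A'}.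
Context {o : Hom G' G} (Ha : FNat o sa sa') (H0 : b0 ≈ a0⟪o⟫) (H1 : b1 ≈ a1⟪o⟫).
Context {D} {p : Hom (D ▸ II) G} {D'} {p' : Hom (D' ▸ II) G'} {t : Hom D' D}
  (Hp : o ∘ p' = p ∘ clift II t) {b : bool}
  {phi : Elc (code Cof) D} {pb : Problem ((Path a0 a1)⟦p⟧) b phi}
  {phi' : Elc (code Cof) D'} {pb' : Problem ((Path b0 b1)⟦p'⟧) b phi'} (Hpb : PNat t pb pb').

Lemma path_plane_nat : o ∘ (p' ∘ clift II (wk (II⟦bang D'⟧)))
  = p ∘ clift II (wk (II⟦bang D⟧)) ∘ clift II (clift II t).
Proof. rewrite <- comp_assoc, Hp, !comp_assoc, !clift_comp, clift_hom; reflexivity. Qed.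

(** The tubes are compared on [phi] by naturality of path application, and on the end faces by the
    hypotheses on [b0] and [b1]. *)
Lemma path_problem_nat : PNat (clift II t) (path_problem pb) (path_problem pb').
Proof.
  assert (HA := fnat_ty Ha).
  assert (Hw : forall K (d : Hom K (D' ▸ II)),
    wk (II⟦bang D⟧) ∘ (clift II t ∘ d) = t ∘ (wk (II⟦bang D'⟧) ∘ d)).
  { intros K d. rewrite <- comp_assoc, clift_hom, comp_assoc; reflexivity. }
  assert (Hk : forall K (d : Hom K (D' ▸ II)), cvar II D ∘ (clift II t ∘ d) = cvar II D' ∘ d).
  { intros K d. unfold clift; nf; reflexivity. }
  split.
  - apply (line_ty_nat HA path_plane_nat).
  - unfold path_cof, ends_cof. rewrite !cof_or_sub, !cof_eq_sub, (pnat_phi Hpb). f_equal.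
    + rewrite !comp_assoc, clift_hom; reflexivity.
    + assert (e : cvar II D' = cvar II D ∘ clift II t) by (unfold clift; nf; reflexivity).
      rewrite <- e; reflexivity.
  - intros K d x x' i. apply (path_cof_cases x').
    + rewrite !tapp_ty, HA, !Tsub_comp. f_equal.
      rewrite <- (comp_assoc o), path_plane_nat, !comp_assoc, !clift_cpair; reflexivity.
    + intros K' r u'.
      assert (y' : El ((holds (path_cof phi'))⟦d ∘ r⟧)) by exact (ecomp (x'⟪r⟫)).
      assert (y : El ((holds (path_cof phi))⟦clift II t ∘ d ∘ r⟧)) by exact (ecomp (x⟪r⟫)).
      assert (u0 : El ((holds phi)⟦t ∘ (wk (II⟦bang D'⟧) ∘ (d ∘ r))⟧)).
      { refine (hcast u' _). rewrite (pnat_phi Hpb), comp_assoc; reflexivity. }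
      assert (u : El ((holds phi)⟦wk (II⟦bang D⟧) ∘ (clift II t ∘ d ∘ r)⟧)).
      { refine (hcast u0 _). rewrite (comp_assoc (clift II t)), Hw; reflexivity. }
      rewrite (tapp_sub _ _ _ y'), (tapp_sub _ _ _ y).
      etransitivity; [apply (path_tube_phi pb' y' u')|]. symmetry.
      etransitivity; [apply (path_tube_phi pb y u)|]. symmetry.
      etransitivity; [|apply tsub_id].
      refine (path_app_nat HA H0 H1 (t := idm K') _ _ _).
      * rewrite comp_idr, (path_cpair_nat Hp), (comp_assoc (clift II t)), Hw; reflexivity.
      * change (tapp pb' u' (i ∘ r) = tsub (tapp pb u (i ∘ r)) (idm K')).
        rewrite tsub_id, (pnat_tube Hpb u0). apply tapp_irr.
        rewrite (comp_assoc (clift II t)), Hw; reflexivity.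
      * rewrite comp_idr, (comp_assoc (clift II t)), Hk; reflexivity.
    + intros K' r c Hc.
      assert (y' : El ((holds (path_cof phi'))⟦d ∘ r⟧)) by exact (ecomp (x'⟪r⟫)).
      assert (y : El ((holds (path_cof phi))⟦clift II t ∘ d ∘ r⟧)) by exact (ecomp (x⟪r⟫)).
      assert (Hc' : cvar II D ∘ (clift II t ∘ d ∘ r) = endpoint c K').
      { rewrite (comp_assoc (clift II t)), Hk; exact Hc. }
      rewrite (tapp_sub _ _ _ y'), (tapp_sub _ _ _ y).
      etransitivity; [apply (path_tube_end pb' y' _ Hc)|]. symmetry.
      etransitivity; [apply (path_tube_end pb y _ Hc')|]. symmetry.
      rewrite (comp_assoc (clift II t)), Hw, <- (path_cpair_nat Hp).
      destruct c; rewrite ?H0, ?H1; simpl; rewrite tsub_comp; reflexivity.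
  - simpl val. refine (path_app_nat HA H0 H1 (t := clift II t) _ _ _).
    + rewrite (path_cpair_nat Hp), comp_assoc, cpair_comp, endpoint_sub, clift_hom; reflexivity.
    + simpl. rewrite (pnat_base Hpb). simpl. rewrite !tsub_comp, clift_hom; reflexivity.
    + unfold clift; nf; reflexivity.
Qed.

Lemma path_line_nat : path_line sa' pb' ≈ (path_line sa pb)⟪clift II t⟫.
Proof. exact (fcomp_nat Ha path_plane_nat path_problem_nat). Qed.

Lemma path_fop_nat : path_fop sa' pb' ≈ (path_fop sa pb)⟪t⟫.
Proof.
  assert (Hs := path_end_nat Hp (negb b)).
  assert (HP := Path_nat (fnat_ty Ha) H0 H1).
  assert (HT : (Path a0 a1)⟦p ∘ cpair (idm D) (endpoint (negb b) D)⟧⟦t⟧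
    = (Path b0 b1)⟦p' ∘ cpair (idm D') (endpoint (negb b) D')⟧).
  { rewrite HP, (Tsub_comp (Path a0 a1) o), Hs, Tsub_comp; reflexivity. }
  pose (f := cast HT ((path_fop0 sa pb)⟪t⟫)).
  change (val (path_fop0 sa' pb') = val f).
  apply (path_ext eq_refl). intros K r i.
  rewrite (path_fop_app (t := r) (sa := sa') (pb := pb')).
  - assert (HT2 : (Path b0 b1)⟦p' ∘ cpair (idm D') (endpoint (negb b) D') ∘ r⟧
      = (Path a0 a1)⟦p ∘ cpair (t ∘ r) (endpoint (negb b) K)⟧).
    { rewrite HP, (Tsub_comp (Path a0 a1) o). f_equal.
      rewrite <- comp_assoc, Hs, !comp_assoc, cpair_comp, comp_idl, endpoint_sub; reflexivity. }
    transitivity (val (path_app (cast HT2 (ecomp (f⟪r⟫))) i)).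
    + rewrite (path_fop_app (t := t ∘ r) (sa := sa) (pb := pb)).
      * change (tsub (val (path_line sa' pb')) (cpair r i)
          = tsub (val (path_line sa pb)) (cpair (t ∘ r) i)).
        rewrite path_line_nat. simpl. rewrite tsub_comp, clift_cpair; reflexivity.
      * reflexivity.
      * simpl. apply tsub_comp.
    + symmetry. etransitivity; [|apply tsub_id].
      refine (path_app_nat (fnat_ty Ha) H0 H1 (t := idm K) _ _ _).
      * rewrite comp_idr, <- comp_assoc, Hs, !comp_assoc, cpair_comp, comp_idl, endpoint_sub; reflexivity.
      * simpl. rewrite tsub_id; reflexivity.
      * symmetry; apply comp_idr.
  - rewrite comp_assoc, cpair_comp, comp_idl, endpoint_sub; reflexivity.
  - reflexivity.
Qed.
End Nat.

Definition path_op {G} {A : Ty G} (a0 a1 : El A) (sa : FibStr A) : FibOp (Path a0 a1).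
Proof.
  refine {| fop := fun D p b phi pb => path_fop sa pb |}.
  - intros; apply path_fop_ext.
  - intros D p b phi pb D1 p1 phi1 pb1 r Hp Hpb.
    refine (path_fop_nat (o := idm G) _ _ _ _ Hpb).
    + apply FNat_id.
    + simpl; rewrite tsub_id; reflexivity.
    + simpl; rewrite tsub_id; reflexivity.
    + rewrite comp_idl; exact Hp.
Defined.

Definition path_fib {G} {A : Ty G} (a0 a1 : El A) (sa : FibStr A) : FibStr (Path a0 a1) :=
  fib_of (path_op a0 a1 sa).

Lemma path_fib_nat {G G'} {A : Ty G} {a0 a1 : El A} {sa : FibStr A}
  {A' : Ty G'} {b0 b1 : El A'} {sa' : FibStr A'} {o : Hom G' G} :
  FNat o sa sa' -> b0 ≈ a0⟪o⟫ -> b1 ≈ a1⟪o⟫ ->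
  FNat o (path_fib a0 a1 sa) (path_fib b0 b1 sa').
Proof.
  intros Ha H0 H1. apply FNat_intro.
  - exact (Path_nat (fnat_ty Ha) H0 H1).
  - intros D p' b phi pb' pb Hpb. unfold path_fib; rewrite !fcomp_fib_of.
    etransitivity; [refine (path_fop_nat Ha H0 H1 _ Hpb)|apply tsub_id].
    rewrite clift_id, comp_idr; reflexivity.
Qed.

Lemma path_fib_canon {G} {A : Ty G} (a0 a1 : El A) (sa : FibStr A) :
  CanonPath sa (path_fib a0 a1 sa).
Proof.
  intros D p b phi pb w psi.
  exists (path_problem pb). split; [|split].
  - intros K r dk d k i.
    assert (x : El ((holds (path_cof phi))⟦dk⟧)).
    { unfold dk. rewrite <- (comp_assoc (wk _)). exact (ecomp ((gen_holds _)⟪r⟫)). }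
    split; [|split].
    + intro u. etransitivity; [apply (tval_eta _ x)|].
      etransitivity; [apply (path_tube_phi _ _ u)|].
      apply path_app_congr; try reflexivity.
      rewrite clift_cpair, wk_pair'; reflexivity.
    + intro Hk. etransitivity; [apply (tval_eta _ x)|]. apply (path_tube_end _ _ (c := false) _ Hk).
    + intro Hk. etransitivity; [apply (tval_eta _ x)|]. apply (path_tube_end _ _ (c := true) _ Hk).
  - simpl val. apply path_app_congr; try reflexivity.
    rewrite cpair_comp, comp_idl, endpoint_sub; reflexivity.
  - assert (Hf := fcomp_fib_of (path_op a0 a1 sa) pb).
    etransitivity; [apply (path_fop_app (t := w) (sa := sa) (pb := pb))|].
    + rewrite cpair_comp, comp_idl, endpoint_sub; reflexivity.
    + simpl val. f_equal. exact Hf.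
    (* For the generic stage and the generic point, [cpair w (cvar II D)] is the identity of
       [D ▸ II]. *)
    + change (tsub (val (fcomp sa (path_problem pb))) (cpair w (cvar II D)) = val (fcomp sa (path_problem pb))).
      etransitivity; [|apply tsub_id]. f_equal. unfold w; hom_eq.
Qed.

End PathFib.

(** * Elements of identity types *)

Section IdCalculus.
Context {E : CwF} {T : TypeFormers E} {I : Interval T} {P : PathContexts I}
  {C : Cofibrations I}.

Definition arr_intro {G D} {A B : Ty G} {s : Hom D G} (b : El (B⟦s ∘ wk (A⟦s⟧)⟧)) :
  El ((Arr A B)⟦s⟧).
Proof. apply pi_lam. refine (cast _ b). rewrite Tsub_comp, wk_lift; reflexivity. Defined.

Section Const.
Context {G} {A : Ty G} (a0 a1 : El A).

Let G2 : Con := G ▹ Path a0 a1 ▸ code Cof.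
Let w : Hom (G2 ▸ II) (G ▹ Path a0 a1) := wk ((code Cof)⟦bang _⟧) ∘ wk (II⟦bang G2⟧).

(** Together with [ConstIf] this names the families nested in [ConstOn], which is convertible to
    [Sig (ConstIf a0 a1)]; the projections can then be told their family. *)
Definition ConstLine : Ty G2 :=
  Pi (A := II⟦bang G2⟧)
    (Id (path_app (ecomp ((evar (Path a0 a1))⟪w⟫)) (cvar II G2)) (a0⟪wk (Path a0 a1) ∘ w⟫)).

Definition ConstIf : Ty G2 := Arr (holds (cvar (code Cof) (G ▹ Path a0 a1))) ConstLine.

Lemma ConstIf_prop : IsProp ConstIf.
Proof.
  intros D s f f'. apply pi_ext; intros K t u.
  assert (e : forall K (t : Hom K (G2 ▹ holds (cvar (code Cof) (G ▹ Path a0 a1))))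
     (x y : El (ConstLine⟦wk _⟧⟦t⟧)), x ≈ y).
  { clear. intros K t x y.
    assert (IsProp (ConstLine⟦wk (holds (cvar (code Cof) (G ▹ Path a0 a1)))⟧)) as H.
    { apply IsProp_sub. intros D s f f'. apply pi_ext; intros; f_equal; apply Id_prop. }
    f_equal; apply H. }
  apply e.
Qed.

Lemma const_elim {D} {s : Hom D G} {l : El ((Path a0 a1)⟦s⟧)} {phi : Elc (code Cof) D}
  (c : El (ConstIf⟦cpair (pair l) phi⟧)) {K} (t : Hom K D) (u : El ((holds phi)⟦t⟧)) (i : Elc II K) :
  path_app (ecomp (l⟪t⟫)) i ≈ a0⟪s ∘ t⟫.
Proof.
  pose (r := cpair (pair l) phi ∘ t).
  assert (v : El ((holds (cvar (code Cof) (G ▹ Path a0 a1)))⟦r⟧)).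
  { refine (hcast u _). unfold r; nf; reflexivity. }
  pose proof (app (s := r) (ecomp (c⟪t⟫)) v) as g.
  rewrite Tsub_comp, wk_pair' in g.
  assert (y : exists y : El ((II⟦bang G2⟧)⟦r⟧), y ≈ elem i).
  { exists (cast (closed_sub r) (elem i)); reflexivity. }
  destruct y as [y0 Hy].
  pose proof (Id_eq (app (s := r) g y0)) as e. simpl val in e.
  etransitivity; [|etransitivity; [exact e|]].
  - apply (path_app_sub (t := pair y0)).
    + unfold w, r; nf; reflexivity.
    + simpl. rewrite tsub_comp. unfold w, r; nf; reflexivity.
    + apply elc_ext. rewrite var_cvar_assoc, var_pair', Hy; reflexivity.
  - simpl. rewrite tsub_comp. f_equal. unfold w, r; nf; reflexivity.
Qed.

Definition const_intro {D} {s : Hom D G} {l : El ((Path a0 a1)⟦s⟧)} {phi : Elc (code Cof) D}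
  (H : forall K (t : Hom K D) (u : El ((holds phi)⟦t⟧)) (i : Elc II K),
     path_app (ecomp (l⟪t⟫)) i ≈ a0⟪s ∘ t⟫) : El (ConstIf⟦cpair (pair l) phi⟧).
Proof.
  set (d := cpair (pair l) phi).
  set (X := (holds (cvar (code Cof) (G ▹ Path a0 a1)))⟦d⟧).
  apply (arr_intro (s := d)).
  apply (pi_lam (s := d ∘ wk X)), Id_intro.
  set (q := lift (s := d ∘ wk X) (A := II⟦bang G2⟧) eq_refl).
  set (Y := (II⟦bang G2⟧)⟦d ∘ wk X⟧) in *.
  pose (t := wk X ∘ wk Y).
  assert (u : El ((holds phi)⟦t⟧)).
  { refine (hcast (phi := cvar (code Cof) (G ▹ Path a0 a1)) (d := d ∘ t)
      (ecomp (ecomp ((evar X)⟪wk Y⟫))) _).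
    unfold d; nf; reflexivity. }
  etransitivity; [|etransitivity; [exact (H _ t u (cvar II _ ∘ q))|]].
  - symmetry. apply (path_app_sub (t := q)).
    + unfold w, q, d, t; nf; reflexivity.
    + simpl. rewrite tsub_comp. unfold w, q, d, t; nf; reflexivity.
    + reflexivity.
  - simpl. rewrite tsub_comp. f_equal. unfold w, q, d, t; nf; reflexivity.
Defined.

End Const.

Lemma ConstLine_nat {G} {A : Ty G} (a0 a1 : El A) {G'} {A' : Ty G'} (b0 b1 : El A')
  {o : Hom G' G} (HA : A' = A⟦o⟧) (H0 : b0 ≈ a0⟪o⟫) (H1 : b1 ≈ a1⟪o⟫)
  (HP : Path b0 b1 = (Path a0 a1)⟦o⟧) :
  ConstLine b0 b1 = (ConstLine a0 a1)⟦lift (closed_sub (X := code Cof) (lift HP))⟧.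
Proof.
  set (r := lift (closed_sub (lift HP))).
  apply (Pi_nat_ty (HA := closed_sub r)).
  symmetry; apply Id_sub'.
  - etransitivity; [exact (f_equal (fun Z => Z⟦_⟧) HA)|].
    rewrite !Tsub_comp. f_equal. unfold r; nf; reflexivity.
  - apply (path_app_nat HA H0 H1).
    + unfold r; nf; reflexivity.
    + simpl. rewrite !tsub_comp. unfold r; nf; reflexivity.
    + symmetry; apply cvar_lift'.
  - simpl. rewrite H0. simpl. rewrite !tsub_comp. f_equal. unfold r; nf; reflexivity.
Qed.

Lemma ConstOn_nat {G} {A : Ty G} (a0 a1 : El A) {G'} {A' : Ty G'} (b0 b1 : El A')
  {o : Hom G' G} (HA : A' = A⟦o⟧) (H0 : b0 ≈ a0⟪o⟫) (H1 : b1 ≈ a1⟪o⟫)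
  (HP : Path b0 b1 = (Path a0 a1)⟦o⟧) : ConstOn b0 b1 = (ConstOn a0 a1)⟦lift HP⟧.
Proof.
  apply (Sig_nat_ty (A := (code Cof)⟦bang (G ▹ Path a0 a1)⟧) (HA := closed_sub (lift HP))).
  set (r := lift (closed_sub (lift HP))).
  assert (Hh : holds (cvar (code Cof) (G' ▹ Path b0 b1))
     = (holds (cvar (code Cof) (G ▹ Path a0 a1)))⟦r⟧).
  { rewrite <- holds_sub. unfold r; rewrite cvar_lift'; reflexivity. }
  apply (Pi_nat_ty (HA := Hh)), wk_lift_ty, (ConstLine_nat HA H0 H1 HP).
Qed.

Lemma IdT_nat {G} {A : Ty G} (a0 a1 : El A) {G'} {A' : Ty G'} (b0 b1 : El A')
  {o : Hom G' G} (HA : A' = A⟦o⟧) (H0 : b0 ≈ a0⟪o⟫) (H1 : b1 ≈ a1⟪o⟫) :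
  IdT b0 b1 = (IdT a0 a1)⟦o⟧.
Proof. apply (Sig_nat_ty (HA := Path_nat HA H0 H1)), ConstOn_nat; assumption. Qed.

Section Elements.
Context {G} {A : Ty G} {a0 a1 : El A}.

Lemma id_cof_val {D} {s : Hom D G} (x : El ((IdT a0 a1)⟦s⟧)) :
  val (elem (id_cof x)) = val (sfst (B := ConstIf a0 a1) (ssnd (B := ConstOn a0 a1) x)).
Proof. etransitivity; [apply var_pair'|]; reflexivity. Qed.

Lemma id_const {D} {s : Hom D G} (x : El ((IdT a0 a1)⟦s⟧)) {K} (t : Hom K D)
  (u : El ((holds (id_cof x))⟦t⟧)) (i : Elc II K) :
  path_app (ecomp ((sfst (B := ConstOn a0 a1) x)⟪t⟫)) i ≈ a0⟪s ∘ t⟫.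
Proof.
  refine (const_elim (phi := id_cof x) _ u i).
  refine (cast _ (ssnd (B := ConstIf a0 a1) (ssnd (B := ConstOn a0 a1) x))).
  f_equal. apply pair_ext; [reflexivity|]. symmetry; apply id_cof_val.
Qed.

Section Intro.
Context {D} {s : Hom D G} (l : El ((Path a0 a1)⟦s⟧)) (phi : Elc (code Cof) D)
  (H : forall K (t : Hom K D) (u : El ((holds phi)⟦t⟧)) (i : Elc II K),
     path_app (ecomp (l⟪t⟫)) i ≈ a0⟪s ∘ t⟫).

Lemma id_intro_ty : (ConstIf a0 a1)⟦cpair (pair l) phi⟧
  = (ConstIf a0 a1)⟦pair (cast (closed_sub (pair l)) (elem phi))⟧.
Proof. f_equal. apply pair_ext; reflexivity. Qed.

Definition id_intro : El ((IdT a0 a1)⟦s⟧) :=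
  sig_pair (B := ConstOn a0 a1) (a := l)
    (sig_pair (B := ConstIf a0 a1) (a := cast (closed_sub (pair l)) (elem phi))
      (cast id_intro_ty (const_intro H))).

Lemma id_intro_fst : sfst (B := ConstOn a0 a1) id_intro = l.
Proof. apply sfst_pair. Qed.

Lemma id_intro_cof : id_cof id_intro = phi.
Proof.
  apply elem_eq. rewrite id_cof_val.
  transitivity (val (cast (closed_sub (pair l)) (elem phi))); [|reflexivity].
  unfold id_intro.
  etransitivity; [|refine (f_equal (@val _ _ _) (sfst_pair (B := ConstIf a0 a1) _))].
  apply sfst_congr; [|apply ssnd_pair].
  f_equal. rewrite sfst_pair; reflexivity.
Qed.
End Intro.

(** The constancy condition is a proposition, so a path and a cofibration determine the element. *)
Lemma id_ext {D} {s s' : Hom D G} (x : El ((IdT a0 a1)⟦s⟧)) (x' : El ((IdT a0 a1)⟦s'⟧)) :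
  s' = s -> sfst (B := ConstOn a0 a1) x' ≈ sfst (B := ConstOn a0 a1) x -> id_cof x' = id_cof x ->
  x' ≈ x.
Proof.
  intros Hs H1 H2. apply (sig_ext' (B := ConstOn a0 a1) Hs H1).
  assert (e : pair (sfst (B := ConstOn a0 a1) x') = pair (sfst (B := ConstOn a0 a1) x)).
  { apply pair_ext; assumption. }
  assert (e1 : sfst (B := ConstIf a0 a1) (ssnd (B := ConstOn a0 a1) x')
     ≈ sfst (B := ConstIf a0 a1) (ssnd (B := ConstOn a0 a1) x)).
  { rewrite <- !id_cof_val, H2; reflexivity. }
  apply (sig_ext' (B := ConstIf a0 a1) e e1).
  assert (e2 : pair (sfst (B := ConstIf a0 a1) (ssnd (B := ConstOn a0 a1) x'))
    = pair (sfst (B := ConstIf a0 a1) (ssnd (B := ConstOn a0 a1) x))).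
  { apply pair_ext; assumption. }
  generalize (ssnd (B := ConstIf a0 a1) (ssnd (B := ConstOn a0 a1) x')).
  rewrite e2. intro y. f_equal. apply ConstIf_prop.
Qed.

End Elements.

Lemma id_cof_nat {G G'} {A : Ty G} {A' : Ty G'} {a0 a1 : El A} {b0 b1 : El A'}
  {o : Hom G' G} (HA : A' = A⟦o⟧) (H0 : b0 ≈ a0⟪o⟫) (H1 : b1 ≈ a1⟪o⟫)
  {D D'} {s : Hom D G} {s' : Hom D' G'} {t : Hom D' D} (Hs : o ∘ s' = s ∘ t)
  (x : El ((IdT a0 a1)⟦s⟧)) (x' : El ((IdT b0 b1)⟦s'⟧)) :
  x' ≈ x⟪t⟫ -> id_cof x' = id_cof x ∘ t.
Proof.
  intro Hx. apply elem_eq. rewrite id_cof_val.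
  pose (HP := Path_nat HA H0 H1).
  destruct (sfst_ssnd_nat (HA := HP) (ConstOn_nat HA H0 H1 HP) Hs Hx) as [e1 e2].
  assert (Hh : holds (cvar (code Cof) (G' ▹ Path b0 b1))
     = (holds (cvar (code Cof) (G ▹ Path a0 a1)))⟦lift (closed_sub (lift HP))⟧).
  { rewrite <- holds_sub, cvar_lift'; reflexivity. }
  etransitivity.
  - refine (sfst_nat (A := (code Cof)⟦bang (G ▹ Path a0 a1)⟧) (B := ConstIf a0 a1)
      (HA := closed_sub (lift HP)) _ (t := t) _ e2).
    + apply (Pi_nat_ty (HA := Hh)), wk_lift_ty, (ConstLine_nat HA H0 H1 HP).
    + apply pair_lift; [exact Hs | exact e1].
  - simpl. rewrite <- tsub_comp. f_equal. symmetry; apply id_cof_val.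
Qed.
End IdCalculus.

(** * Composition in identity types *)

Section IdFib.
Context {E : CwF} {T : TypeFormers E} {I : Interval T} {P : PathContexts I}
  {C : Cofibrations I}.

Lemma id_cof_sub {G} {A : Ty G} {a0 a1 : El A} {D D'} {s : Hom D G} {s' : Hom D' G} {t : Hom D' D}
  (x : El ((IdT a0 a1)⟦s⟧)) (x' : El ((IdT a0 a1)⟦s'⟧)) :
  s' = s ∘ t -> x' ≈ x⟪t⟫ -> id_cof x' = id_cof x ∘ t.
Proof.
  intro Hs. apply (id_cof_nat (o := idm G)).
  - symmetry; apply Tsub_id.
  - simpl; rewrite tsub_id; reflexivity.
  - simpl; rewrite tsub_id; reflexivity.
  - rewrite comp_idl; exact Hs.
Qed.

Section Sol.
Context {G} {A : Ty G} {a0 a1 : El A} (sa : FibStr A)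
  {D} (p : Hom (D ▸ II) G) {b : bool} {phi : Elc (code Cof) D}
  (pb : Problem ((IdT a0 a1)⟦p⟧) b phi).

Definition id_path_problem : Problem ((Path a0 a1)⟦p⟧) b phi :=
  sig_fst_problem (B := ConstOn a0 a1) pb.

Definition id_end : Elc (code Cof) (D ▹ holds phi) :=
  id_cof (ecomp (ecomp ((tube pb)⟪cpair (idm _) (endpoint (negb b) _)⟫))).

Definition id_at {K} {d : Hom K D} (u : El ((holds phi)⟦d⟧)) :
  El ((IdT a0 a1)⟦p ∘ cpair d (endpoint (negb b) K)⟧) :=
  ecomp (mkEl (tapp_ty pb u (endpoint (negb b) K))).

Lemma id_end_at {K} {d : Hom K D} (u : El ((holds phi)⟦d⟧)) : id_end ∘ pair u = id_cof (id_at u).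
Proof.
  symmetry; apply id_cof_sub.
  - rewrite !comp_assoc. f_equal. rewrite cpair_comp, endpoint_sub, clift_cpair.
    f_equal. nf; reflexivity.
  - simpl. rewrite tsub_comp. unfold tapp. f_equal.
    rewrite cpair_comp, endpoint_sub, comp_idl; reflexivity.
Qed.

Definition id_path : El ((Path a0 a1)⟦p ∘ cpair (idm D) (endpoint (negb b) D)⟧) :=
  ecomp (fcomp (path_fib a0 a1 sa) id_path_problem).

Lemma id_path_on {K} {d : Hom K D} (u : El ((holds phi)⟦d⟧)) :
  tsub (val id_path) d = val (sfst (B := ConstOn a0 a1) (id_at u)).
Proof.
  etransitivity; [apply (fcomp_ext (path_fib a0 a1 sa) id_path_problem u)|].
  exact (proj1 (sig_tube_stage (B := ConstOn a0 a1) (f := id_at u) eq_refl eq_refl)).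
Qed.

(** Where the new cofibration holds, so does [phi], and the composite path is the path of the tube
    at [negb b]. The cofibration attached to that path holds as well, so it is constant. *)
Lemma id_path_const {K} (t : Hom K D) (w : El ((holds (cof_sig id_end))⟦t⟧)) (i : Elc II K) :
  path_app (ecomp (id_path⟪t⟫)) i ≈ a0⟪p ∘ cpair (idm D) (endpoint (negb b) D) ∘ t⟫.
Proof.
  set (u := cof_sig_fst w).
  assert (v : El ((holds (id_cof (id_at u)))⟦idm K⟧)).
  { refine (hcast (cof_sig_snd w u) _). rewrite id_end_at, comp_idr; reflexivity. }
  assert (e : p ∘ cpair (idm D) (endpoint (negb b) D) ∘ t
    = p ∘ cpair t (endpoint (negb b) K) ∘ idm K).
  { rewrite comp_idr, comp_assoc, cpair_comp, comp_idl, endpoint_sub; reflexivity. }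
  etransitivity; [|etransitivity; [exact (id_const v i)|]].
  - apply (path_app_congr e); [|reflexivity].
    simpl. rewrite tsub_id. apply id_path_on.
  - simpl. rewrite e; reflexivity.
Qed.

Definition id_fop0 : El ((IdT a0 a1)⟦p ∘ cpair (idm D) (endpoint (negb b) D)⟧) :=
  id_intro (@id_path_const).

Definition id_fop : El (at_ ((IdT a0 a1)⟦p⟧) (endpoint (negb b) D)) :=
  cast (eq_sym (Tsub_comp _ _ _)) id_fop0.

Lemma id_fop_fst : sfst (B := ConstOn a0 a1) id_fop0 = id_path.
Proof. apply id_intro_fst. Qed.

Lemma id_fop_cof : id_cof id_fop0 = cof_sig id_end.
Proof. apply id_intro_cof. Qed.

(** The paths agree because composition extends its system. The cofibrations agree by
    extensionality: under a witness of [phi], the sum over [phi] is equivalent to its fibre. *)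
Lemma id_fop_ext {K} {d : Hom K D} (u : El ((holds phi)⟦d⟧)) :
  tapp pb u (endpoint (negb b) K) = tsub (val id_fop) d.
Proof.
  assert (Hs : p ∘ cpair d (endpoint (negb b) K) = p ∘ cpair (idm D) (endpoint (negb b) D) ∘ d).
  { rewrite comp_assoc, cpair_comp, comp_idl, endpoint_sub; reflexivity. }
  change (val (id_at u) = val (ecomp (id_fop0⟪d⟫))).
  apply (id_ext Hs).
  - etransitivity; [symmetry; apply id_path_on|].
    rewrite <- id_fop_fst. symmetry.
    apply (sfst_sub (B := ConstOn a0 a1) (t := d)); reflexivity.
  - etransitivity; [|symmetry; apply (id_cof_sub (x := id_fop0) (t := d)); reflexivity].
    rewrite id_fop_cof, <- id_end_at. apply cof_ext'; intros K' r v.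
    + rewrite holds_sub, Tsub_comp.
      pose (u' := ecomp (u⟪r⟫)).
      apply (cof_sig_intro (v := u')). refine (hcast v _).
      rewrite comp_assoc, pair_comp; reflexivity.
    + rewrite holds_sub, Tsub_comp in v.
      pose (u' := ecomp (u⟪r⟫)).
      refine (hcast (cof_sig_snd v u') _).
      rewrite comp_assoc, pair_comp; reflexivity.
Qed.
End Sol.

Section Nat.
Context {G} {A : Ty G} {a0 a1 : El A} {sa : FibStr A}.
Context {G'} {A' : Ty G'} {b0 b1 : El A'} {sa' : FibStr A'}.
Context {o : Hom G' G} (Ha : FNat o sa sa') (H0 : b0 ≈ a0⟪o⟫) (H1 : b1 ≈ a1⟪o⟫).
Context {D} {p : Hom (D ▸ II) G} {D'} {p' : Hom (D' ▸ II) G'} {t : Hom D' D}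
  (Hp : o ∘ p' = p ∘ clift II t) {b : bool}
  {phi : Elc (code Cof) D} {pb : Problem ((IdT a0 a1)⟦p⟧) b phi}
  {phi' : Elc (code Cof) D'} {pb' : Problem ((IdT b0 b1)⟦p'⟧) b phi'} (Hpb : PNat t pb pb').

Lemma id_path_nat : id_path sa' pb' ≈ (id_path sa pb)⟪t⟫.
Proof.
  pose (HP := Path_nat (fnat_ty Ha) H0 H1).
  refine (fcomp_nat (path_fib_nat Ha H0 H1) Hp _).
  exact (sig_fst_problem_nat (ConstOn_nat (fnat_ty Ha) H0 H1 HP) Hp Hpb).
Qed.

Lemma id_fop_nat : id_fop sa' pb' ≈ (id_fop sa pb)⟪t⟫.
Proof.
  assert (Hs : o ∘ (p' ∘ cpair (idm D') (endpoint (negb b) D'))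
     = p ∘ cpair (idm D) (endpoint (negb b) D) ∘ t) by apply path_end_nat, Hp.
  pose (HP := Path_nat (fnat_ty Ha) H0 H1).
  assert (HT : (IdT a0 a1)⟦p ∘ cpair (idm D) (endpoint (negb b) D)⟧⟦t⟧
    = (IdT b0 b1)⟦p' ∘ cpair (idm D') (endpoint (negb b) D')⟧).
  { rewrite (IdT_nat (fnat_ty Ha) H0 H1), (Tsub_comp (IdT a0 a1) o), Hs, Tsub_comp; reflexivity. }
  pose (f := cast HT ((id_fop0 sa pb)⟪t⟫)).
  change (val (id_fop0 sa' pb') = val f).
  apply id_ext; [reflexivity| |].
  - etransitivity; [|symmetry; refine (sfst_nat (HA := HP) _ Hs (x := id_fop0 sa pb) _)].
    + rewrite id_fop_fst. etransitivity; [apply id_path_nat|].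
      simpl. rewrite id_fop_fst; reflexivity.
    + apply ConstOn_nat; try assumption; apply (fnat_ty Ha).
    + reflexivity.
  - rewrite id_fop_cof.
    rewrite (id_cof_nat (fnat_ty Ha) H0 H1 Hs (x := id_fop0 sa pb) (x' := f)) by reflexivity.
    rewrite id_fop_cof. symmetry. apply cof_sig_sub; [apply (pnat_phi Hpb)|].
    intros K d u u'. rewrite !id_end_at.
    rewrite <- (comp_idr (id_cof (id_at pb u))).
    apply (id_cof_nat (fnat_ty Ha) H0 H1).
    + rewrite comp_idr. apply path_cpair_nat, Hp.
    + simpl. rewrite tsub_id. apply (pnat_tube Hpb).
Qed.
End Nat.

Definition id_op {G} {A : Ty G} (a0 a1 : El A) (sa : FibStr A) : FibOp (IdT a0 a1).
Proof.
  refine {| fop := fun D p b phi pb => id_fop sa pb |}.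
  - intros; apply id_fop_ext.
  - intros D p b phi pb D1 p1 phi1 pb1 r Hp Hpb.
    refine (id_fop_nat (FNat_id sa) _ _ _ Hpb).
    + simpl; rewrite tsub_id; reflexivity.
    + simpl; rewrite tsub_id; reflexivity.
    + rewrite comp_idl; exact Hp.
Defined.

Definition id_fib {G} {A : Ty G} (a0 a1 : El A) (sa : FibStr A) : FibStr (IdT a0 a1) :=
  fib_of (id_op a0 a1 sa).

Lemma id_fib_nat {G G'} {A : Ty G} {a0 a1 : El A} {sa : FibStr A}
  {A' : Ty G'} {b0 b1 : El A'} {sa' : FibStr A'} {o : Hom G' G} :
  FNat o sa sa' -> b0 ≈ a0⟪o⟫ -> b1 ≈ a1⟪o⟫ ->
  FNat o (id_fib a0 a1 sa) (id_fib b0 b1 sa').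
Proof.
  intros Ha H0 H1. apply FNat_intro.
  - apply (IdT_nat (fnat_ty Ha) H0 H1).
  - intros D p' b phi pb' pb Hpb. unfold id_fib; rewrite !fcomp_fib_of.
    etransitivity; [refine (id_fop_nat Ha H0 H1 _ Hpb)|apply tsub_id].
    rewrite clift_id, comp_idr; reflexivity.
Qed.

Lemma id_fib_canon {G} {A : Ty G} (a0 a1 : El A) (sa : FibStr A) :
  CanonId sa (id_fib a0 a1 sa).
Proof.
  exists (path_fib a0 a1 sa). split; [apply path_fib_canon|].
  intros D p b phi pb. exists (id_path_problem pb).
  split; [reflexivity|]. split; [reflexivity|].
  assert (e : ecomp (fcomp (id_fib a0 a1 sa) pb) = id_fop0 sa pb).
  { apply El_ext. exact (fcomp_fib_of (id_op a0 a1 sa) pb). }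
  split.
  - etransitivity; [exact (f_equal (fun z => val (sfst (B := ConstOn a0 a1) z)) e)|].
    rewrite id_fop_fst; reflexivity.
  - etransitivity; [exact (f_equal id_cof e)|]. apply id_fop_cof.
Qed.
End IdFib.

(** * Isomorphisms and codes *)

Section Isos.
Context {E : CwF} {T : TypeFormers E}.

Definition cast_nat {G} {X Y : Ty G} (H : X = Y) : NatMap X Y.
Proof.
  refine {| nfun := fun D s x => cast (f_equal (fun Z => Z⟦s⟧) H) x |}.
  intros D K s t s' x x' _ Hx; exact Hx.
Defined.

Definition iso_eq {G} {X Y : Ty G} (H : X = Y) : Iso X Y.
Proof.
  refine (iso_of (f := cast_nat H) (g := cast_nat (eq_sym H)) _ _);
    intros; apply El_ext; reflexivity.
Defined.

Lemma iso_app_eq {G} {X Y : Ty G} (H : X = Y) {D} {s : Hom D G} (x : El (X⟦s⟧)) :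
  iso_app (iso_eq H) x ≈ x.
Proof. unfold iso_eq; rewrite iso_app_of; reflexivity. Qed.

Definition iso_nat {G} {X Y : Ty G} (h : Iso X Y) : NatMap X Y.
Proof.
  refine {| nfun := fun D s x => iso_app h x |}. intros; apply iso_app_nat; assumption.
Defined.

Definition nat_comp {G} {X Y Z : Ty G} (f : NatMap X Y) (g : NatMap Y Z) : NatMap X Z.
Proof.
  refine {| nfun := fun D s x => nfun g (nfun f x) |}.
  intros D K s t s' x x' Hs Hx. apply nfun_nat; [exact Hs|]. apply nfun_nat; assumption.
Defined.

Definition iso_trans {G} {X Y Z : Ty G} (h : Iso X Y) (k : Iso Y Z) : Iso X Z.
Proof.
  refine (iso_of (f := nat_comp (iso_nat h) (iso_nat k))
    (g := nat_comp (iso_nat (iso_sym k)) (iso_nat (iso_sym h))) _ _); intros; simpl.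
  - rewrite iso_sym_app; apply iso_sym_app.
  - rewrite iso_app_sym; apply iso_app_sym.
Defined.

Lemma iso_app_trans {G} {X Y Z : Ty G} (h : Iso X Y) (k : Iso Y Z) {D} {s : Hom D G}
  (x : El (X⟦s⟧)) : iso_app (iso_trans h k) x = iso_app k (iso_app h x).
Proof. unfold iso_trans; rewrite iso_app_of; reflexivity. Qed.

Lemma iso_trans_reindex {G D} {s : Hom D G} {X Y Z : Ty G} {X' Y' Z' : Ty D} {h : Iso X Y}
  {h' : Iso X' Y'} {k : Iso Y Z} {k' : Iso Y' Z'} :
  IsoReindex s h h' -> IsoReindex s k k' -> IsoReindex s (iso_trans h k) (iso_trans h' k').
Proof. intros H K D' t x x' Hx. rewrite !iso_app_trans. apply K, H, Hx. Qed.

Definition sub_nat {G D} {X Y : Ty G} (f : NatMap X Y) (s : Hom D G) : NatMap (X⟦s⟧) (Y⟦s⟧).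
Proof.
  refine {| nfun := fun K t x => cast (eq_sym (Tsub_comp Y s t)) (nfun f (ecomp x)) |}.
  intros K K' t r t' x x' -> Hx; simpl.
  apply (nfun_nat f (t := r)); [symmetry; apply comp_assoc | exact Hx].
Defined.

Definition iso_sub {G D} {X Y : Ty G} (h : Iso X Y) (s : Hom D G) : Iso (X⟦s⟧) (Y⟦s⟧).
Proof.
  refine (iso_of (f := sub_nat (iso_nat h) s) (g := sub_nat (iso_nat (iso_sym h)) s) _ _);
    intros K t x; apply El_ext; unfold sub_nat, iso_nat, nfun.
  - etransitivity; [|exact (f_equal (@val _ _ _) (iso_sym_app h (ecomp x)))].
    apply iso_app_congr; reflexivity.
  - etransitivity; [|exact (f_equal (@val _ _ _) (iso_app_sym h (ecomp x)))].
    apply iso_app_congr; reflexivity.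
Defined.

Lemma iso_app_sub {G D} {X Y : Ty G} (h : Iso X Y) (s : Hom D G) {K} {t : Hom K D}
  (x : El (X⟦s⟧⟦t⟧)) : iso_app (iso_sub h s) x ≈ iso_app h (ecomp x).
Proof. unfold iso_sub; rewrite iso_app_of; reflexivity. Qed.

Section PiIso.
Context {G} {A : Ty G}.

Section Map.
Context {B B' : Ty (G ▹ A)} (f : NatMap B B').

Definition pi_map_body {D} {s : Hom D G} (x : El ((Pi B)⟦s⟧)) :
  El (B'⟦pair (s := s ∘ wk (A⟦s⟧)) (ecomp (evar (A⟦s⟧)))⟧) :=
  nfun f (app (ecomp (x⟪wk (A⟦s⟧)⟫)) (ecomp (evar (A⟦s⟧)))).

Lemma pi_map_ty {D} (s : Hom D G) :
  B'⟦pair (s := s ∘ wk (A⟦s⟧)) (ecomp (evar (A⟦s⟧)))⟧ = B'⟦lift (s := s) (A := A) eq_refl⟧.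
Proof. f_equal; apply pair_ext; reflexivity. Qed.

Definition pi_map_fun {D} {s : Hom D G} (x : El ((Pi B)⟦s⟧)) : El ((Pi B')⟦s⟧) :=
  pi_lam (cast (pi_map_ty s) (pi_map_body x)).

Lemma app_pi_map {D} {s : Hom D G} (x : El ((Pi B)⟦s⟧)) {K} {t : Hom K D} {s' : Hom K G}
  (y : El ((Pi B')⟦s'⟧)) (x' : El ((Pi B)⟦s'⟧)) (a : El (A⟦s'⟧)) :
  s' = s ∘ t -> y ≈ (pi_map_fun x)⟪t⟫ -> x' ≈ x⟪t⟫ -> app y a ≈ nfun f (app x' a).
Proof.
  intros Hs Hy Hx.
  assert (e : A⟦s'⟧ = A⟦s⟧⟦t⟧) by (rewrite Hs, Tsub_comp; reflexivity).
  rewrite (app_pi_lam_sub (x := a) (x0 := cast e a) Hs Hy eq_refl).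
  assert (Ha : pair a = pair (s := s ∘ wk (A⟦s⟧)) (ecomp (evar (A⟦s⟧))) ∘ pair (cast e a)).
  { rewrite pair_comp. apply pair_ext; [nf; exact Hs|]. simpl. rewrite var_pair'; reflexivity. }
  symmetry. apply (nfun_nat f Ha). apply app_sub.
  - nf; exact Hs.
  - rewrite Hx. simpl. nf; reflexivity.
  - simpl. rewrite var_pair'; reflexivity.
Qed.

Definition pi_map : NatMap (Pi B) (Pi B').
Proof.
  refine {| nfun := fun D s x => pi_map_fun x |}.
  intros D K s t s' x x' Hs Hx.
  transitivity (val (ecomp ((pi_map_fun x)⟪t⟫))); [|reflexivity].
  apply (pi_ext' Hs). intros K' r a a' Ha.
  assert (e : s' ∘ r = s ∘ (t ∘ r)) by (rewrite Hs; apply comp_assoc).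
  etransitivity; [apply (app_pi_map (x := x') (t := r) (x' := ecomp (x'⟪r⟫))); reflexivity|].
  subst s'.
  symmetry. etransitivity; [apply (app_pi_map (x := x) (t := t ∘ r) (x' := ecomp (x'⟪r⟫)) _ e)|].
  - simpl. apply tsub_comp.
  - simpl. rewrite Hx. apply tsub_comp.
  - apply El_ext in Ha; subst a'; reflexivity.
Defined.
End Map.

Definition pi_iso {B B' : Ty (G ▹ A)} (h : Iso B B') : Iso (Pi B) (Pi B').
Proof.
  refine (iso_of (f := pi_map (iso_nat h)) (g := pi_map (iso_nat (iso_sym h))) _ _);
    intros D s x; apply pi_ext; intros K t a.
  - etransitivity; [refine (app_pi_map (f := iso_nat (iso_sym h)) (x := pi_map_fun (iso_nat h) x)
      (x' := ecomp ((pi_map_fun (iso_nat h) x)⟪t⟫)) a eq_refl _ _); reflexivity|].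
    simpl nfun.
    etransitivity; [|exact (f_equal (@val _ _ _) (iso_sym_app h (app (ecomp (x⟪t⟫)) a)))].
    apply iso_app_congr; [reflexivity|].
    refine (app_pi_map (f := iso_nat h) (x := x) a eq_refl _ _); reflexivity.
  - etransitivity; [refine (app_pi_map (f := iso_nat h) (x := pi_map_fun (iso_nat (iso_sym h)) x)
      (x' := ecomp ((pi_map_fun (iso_nat (iso_sym h)) x)⟪t⟫)) a eq_refl _ _); reflexivity|].
    simpl nfun.
    etransitivity; [|exact (f_equal (@val _ _ _) (iso_app_sym h (app (ecomp (x⟪t⟫)) a)))].
    apply iso_app_congr; [reflexivity|].
    refine (app_pi_map (f := iso_nat (iso_sym h)) (x := x) a eq_refl _ _); reflexivity.
Defined.

Lemma app_pi_iso {B B' : Ty (G ▹ A)} (h : Iso B B') {D} {s : Hom D G} (x : El ((Pi B)⟦s⟧)) {K}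
  {t : Hom K D} {s' : Hom K G}
  (y : El ((Pi B')⟦s'⟧)) (x' : El ((Pi B)⟦s'⟧)) (a : El (A⟦s'⟧)) :
  s' = s ∘ t -> y ≈ (iso_app (pi_iso h) x)⟪t⟫ -> x' ≈ x⟪t⟫ -> app y a ≈ iso_app h (app x' a).
Proof.
  unfold pi_iso. rewrite iso_app_of. intros Hs Hy Hx.
  exact (app_pi_map (f := iso_nat h) a Hs Hy Hx).
Qed.
End PiIso.

Lemma pi_iso_reindex {G G'} {A : Ty G} {B C : Ty (G ▹ A)} {A' : Ty G'} {B' C' : Ty (G' ▹ A')}
  {o : Hom G' G} (HA : A' = A⟦o⟧) (HB : B' = B⟦lift HA⟧) (HC : C' = C⟦lift HA⟧) {h : Iso B C} {h' : Iso B' C'} :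
  IsoReindex (lift HA) h h' -> IsoReindex o (pi_iso h) (pi_iso h').
Proof.
  intros H D t x x' Hx.
  assert (e : (Pi C)⟦o ∘ t⟧ = (Pi C')⟦t⟧).
  { rewrite (Pi_nat_ty (HA := HA) HC), Tsub_comp; reflexivity. }
  change (val (cast e (iso_app (pi_iso h) x)) = val (iso_app (pi_iso h') x')).
  f_equal. apply pi_ext. intros K r a.
  assert (ea : A'⟦t ∘ r⟧ = A⟦o ∘ t ∘ r⟧).
  { rewrite HA, Tsub_comp, comp_assoc; reflexivity. }
  assert (Hs : o ∘ (t ∘ r) = o ∘ t ∘ r ∘ idm K) by (rewrite comp_idr, comp_assoc; reflexivity).
  etransitivity; [refine (app_nat (o := o) (HA := HA) HC (t := idm K)
    (f := ecomp ((iso_app (pi_iso h) x)⟪r⟫)) (a := cast ea a) Hs _ _); [|];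
    simpl; rewrite tsub_id; reflexivity|].
  etransitivity; [apply tsub_id|].
  rewrite (app_pi_iso (h := h) (x := x) (t := r) (x' := ecomp (x⟪r⟫)) (cast ea a)) by reflexivity.
  symmetry.
  rewrite (app_pi_iso (h := h') (x := x') (t := r) (x' := ecomp (x'⟪r⟫)) a) by reflexivity.
  symmetry. refine (iso_reindex_app H _ _).
  - unfold lift. apply ext_eta; nf; reflexivity.
  - symmetry. etransitivity; [refine (app_nat (o := o) (HA := HA) HB (t := idm K)
    (f := ecomp (x⟪r⟫)) (a := cast ea a) Hs _ _)|apply tsub_id].
    + simpl; rewrite tsub_id, Hx; reflexivity.
    + simpl; rewrite tsub_id; reflexivity.
Qed.
End Isos.

(** * Isomorphisms of dependent sums *)

Section SigIso.
Context {E : CwF} {T : TypeFormers E}.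

Section Map.
Context {G} {A A1 : Ty G} (h : Iso A A1) {Y B1 : Ty (G ▹ A1)} (k : Iso Y B1)
  {Y0 : Ty (G ▹ A)} (HY : Y0 = Y⟦pair (fwd h)⟧).

Lemma sig_iso_ty {D} {s : Hom D G} (a : El (A⟦s⟧)) (a1 : El (A1⟦s⟧)) :
  a1 ≈ iso_app h a -> Y0⟦pair a⟧ = Y⟦pair a1⟧.
Proof.
  intro Ha. rewrite HY, Tsub_comp, pair_comp. f_equal. apply pair_ext; [nf; reflexivity|].
  symmetry; exact Ha.
Qed.

Definition sig_fwd {D} {s : Hom D G} (z : El ((Sig Y0)⟦s⟧)) : El ((Sig B1)⟦s⟧) :=
  sig_pair (a := iso_app h (sfst z)) (iso_app k (cast (sig_iso_ty eq_refl) (ssnd z))).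

Lemma sig_bwd_ty {D} {s : Hom D G} (a1 : El (A1⟦s⟧)) :
  Y⟦pair a1⟧ = Y0⟦pair (iso_app (iso_sym h) a1)⟧.
Proof. symmetry; apply sig_iso_ty. rewrite iso_app_sym; reflexivity. Qed.

Definition sig_bwd {D} {s : Hom D G} (z : El ((Sig B1)⟦s⟧)) : El ((Sig Y0)⟦s⟧) :=
  sig_pair (a := iso_app (iso_sym h) (sfst z)) (cast (sig_bwd_ty _) (iso_app (iso_sym k) (ssnd z))).

Lemma sig_fwd_fst {D} {s : Hom D G} (z : El ((Sig Y0)⟦s⟧)) :
  sfst (sig_fwd z) = iso_app h (sfst z).
Proof. apply sfst_pair. Qed.

Lemma sig_fwd_snd {D} {s : Hom D G} (z : El ((Sig Y0)⟦s⟧)) :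
  ssnd (sig_fwd z) ≈ iso_app k (cast (sig_iso_ty eq_refl) (ssnd z)).
Proof. etransitivity; [apply ssnd_pair | reflexivity]. Qed.

Lemma sig_bwd_fst {D} {s : Hom D G} (z : El ((Sig B1)⟦s⟧)) :
  sfst (sig_bwd z) = iso_app (iso_sym h) (sfst z).
Proof. apply sfst_pair. Qed.

Lemma sig_bwd_snd {D} {s : Hom D G} (z : El ((Sig B1)⟦s⟧)) :
  ssnd (sig_bwd z) ≈ iso_app (iso_sym k) (ssnd z).
Proof. etransitivity; [apply ssnd_pair | reflexivity]. Qed.

Definition sig_fwd_nat : NatMap (Sig Y0) (Sig B1).
Proof.
  refine {| nfun := fun D s x => sig_fwd x |}.
  intros D K s t s' x x' Hs Hx.
  pose proof (sfst_sub Hs Hx) as H1. pose proof (ssnd_sub Hs Hx) as H2.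
  change (val (sig_fwd x') = val (ecomp ((sig_fwd x)⟪t⟫))).
  apply (sig_ext' Hs).
  - rewrite sig_fwd_fst. etransitivity; [apply (iso_app_nat h Hs H1)|].
    symmetry. etransitivity; [apply (sfst_sub (t := t) eq_refl (x := sig_fwd x)); reflexivity|].
    simpl. rewrite sig_fwd_fst; reflexivity.
  - rewrite sig_fwd_snd.
    symmetry. etransitivity; [apply (ssnd_sub (t := t) eq_refl (x := sig_fwd x)); reflexivity|].
    symmetry. change (val (ssnd (sig_fwd x))⟪t⟫) with (tsub (val (ssnd (sig_fwd x))) t).
    rewrite sig_fwd_snd.
    refine (iso_app_nat k (t := t) _ _); [|exact H2].
    rewrite pair_comp. apply pair_ext; [exact Hs|]. apply (iso_app_nat h Hs H1).
Defined.

Definition sig_bwd_nat : NatMap (Sig B1) (Sig Y0).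
Proof.
  refine {| nfun := fun D s x => sig_bwd x |}.
  intros D K s t s' x x' Hs Hx.
  pose proof (sfst_sub Hs Hx) as H1. pose proof (ssnd_sub Hs Hx) as H2.
  change (val (sig_bwd x') = val (ecomp ((sig_bwd x)⟪t⟫))).
  apply (sig_ext' Hs).
  - rewrite sig_bwd_fst. etransitivity; [apply (iso_app_nat (iso_sym h) Hs H1)|].
    symmetry. etransitivity; [apply (sfst_sub (t := t) eq_refl (x := sig_bwd x)); reflexivity|].
    simpl. rewrite sig_bwd_fst; reflexivity.
  - rewrite sig_bwd_snd.
    symmetry. etransitivity; [apply (ssnd_sub (t := t) eq_refl (x := sig_bwd x)); reflexivity|].
    symmetry. change (val (ssnd (sig_bwd x))⟪t⟫) with (tsub (val (ssnd (sig_bwd x))) t).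
    rewrite sig_bwd_snd.
    refine (iso_app_nat (iso_sym k) (t := t) _ _); [|exact H2].
    rewrite pair_comp. apply pair_ext; [exact Hs|]. exact H1.
Defined.

(** The family [Y0] is [Y] pulled back along [h], because [cSig] needs its second code over the
    decoded type, which is only isomorphic to the given first component. *)
Definition sig_iso : Iso (Sig Y0) (Sig B1).
Proof.
  refine (iso_of (f := sig_fwd_nat) (g := sig_bwd_nat) _ _); intros D s z; simpl nfun.
  - assert (e : sfst (sig_bwd (sig_fwd z)) = sfst z).
    { rewrite sig_bwd_fst, sig_fwd_fst. apply iso_sym_app. }
    apply sig_ext; [rewrite e; reflexivity|].
    rewrite sig_bwd_snd.
    etransitivity; [apply (iso_app_congr (iso_sym k) (x := iso_app k (cast (sig_iso_ty eq_refl) (ssnd z))))|].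
    + apply pair_ext; [reflexivity|]. rewrite sig_fwd_fst; reflexivity.
    + apply sig_fwd_snd.
    + rewrite iso_sym_app; reflexivity.
  - assert (e : sfst (sig_fwd (sig_bwd z)) = sfst z).
    { rewrite sig_fwd_fst, sig_bwd_fst. apply iso_app_sym. }
    apply sig_ext; [rewrite e; reflexivity|].
    rewrite sig_fwd_snd.
    etransitivity; [apply (iso_app_congr k (x := iso_app (iso_sym k) (ssnd z)))|].
    + apply pair_ext; [reflexivity|]. rewrite sig_bwd_fst, iso_app_sym; reflexivity.
    + apply sig_bwd_snd.
    + rewrite iso_app_sym; reflexivity.
Defined.

Lemma sig_iso_app {D} {s : Hom D G} (z : El ((Sig Y0)⟦s⟧)) : iso_app sig_iso z = sig_fwd z.
Proof. unfold sig_iso; rewrite iso_app_of; reflexivity. Qed.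
End Map.

Lemma sig_iso_reindex {G G'} {A A1 : Ty G} {h : Iso A A1} {Y B1 : Ty (G ▹ A1)} {k : Iso Y B1}
  {Y0 : Ty (G ▹ A)} (HY : Y0 = Y⟦pair (fwd h)⟧)
  {A' A1' : Ty G'} {h' : Iso A' A1'} {Y' B1' : Ty (G' ▹ A1')} {k' : Iso Y' B1'}
  {Y0' : Ty (G' ▹ A')} (HY' : Y0' = Y'⟦pair (fwd h')⟧)
  {o : Hom G' G} (HA : A' = A⟦o⟧) (HA1 : A1' = A1⟦o⟧) (HY0 : Y0' = Y0⟦lift HA⟧)
  (HB1 : B1' = B1⟦lift HA1⟧) :
  IsoReindex o h h' -> IsoReindex (lift HA1) k k' ->
  IsoReindex o (sig_iso k HY) (sig_iso k' HY').
Proof.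
  intros Hh Hk D t z z' Hz. rewrite !sig_iso_app.
  assert (e : (Sig B1)⟦o ∘ t⟧ = (Sig B1')⟦t⟧).
  { rewrite (Sig_nat_ty (HA := HA1) HB1), Tsub_comp; reflexivity. }
  change (val (cast e (sig_fwd k HY z)) = val (sig_fwd k' HY' z')).
  assert (Hs : o ∘ t = o ∘ t ∘ idm D) by (rewrite comp_idr; reflexivity).
  assert (Hz0 : val z' = tsub (val z) (idm D)) by (rewrite tsub_id; symmetry; exact Hz).
  destruct (sfst_ssnd_nat (HA := HA) HY0 Hs Hz0) as [z1 z2].
  destruct (sfst_ssnd_nat (HA := HA1) HB1 Hs (x := sig_fwd k HY z) (x' := cast e (sig_fwd k HY z)))
    as [w1 w2]; [simpl; rewrite tsub_id; reflexivity|].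
  apply (fun e => eq_trans e (tsub_id _)) in z1, z2, w1, w2.
  assert (Ha : val (iso_app h (sfst z)) = val (iso_app h' (sfst z'))).
  { apply Hh. symmetry; exact z1. }
  f_equal. apply sig_ext.
  - rewrite w1, !sig_fwd_fst. exact Ha.
  - rewrite w2.
    rewrite !sig_fwd_snd.
    refine (iso_reindex_app Hk _ _).
    + unfold lift. apply ext_eta; nf; [reflexivity|]. exact Ha.
    + symmetry; exact z2.
Qed.
End SigIso.

(** * Types with a code up to isomorphism *)

Section Coded.
Context {E : CwF} {T : TypeFormers E} {U : Universe} {HU : Impredicative T U}.

(** The isomorphism is kept as data and not merely asserted to exist, because strict stability of
    the final codes needs code and isomorphism to reindex together. *)
Record Coded {G} (X : Ty G) := mkCoded {
  cd : Elc (code U) G;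
  ciso : Iso ((el U)⟦cd⟧) X
}.

(** [x'] is the reindexing of [x] along [o]. *)
Record CNat {G G'} (o : Hom G' G) {X : Ty G} {X' : Ty G'} (x : Coded X) (x' : Coded X') : Prop := {
  cnat_ty : X' = X⟦o⟧;
  cnat_cd : cd x' = cd x ∘ o;
  cnat_iso : IsoReindex o (ciso x) (ciso x')
}.

Definition coded_el {G} (c : Elc (code U) G) {X : Ty G} (H : (el U)⟦c⟧ = X) : Coded X :=
  {| cd := c; ciso := iso_eq H |}.

Lemma coded_el_nat {G G'} {o : Hom G' G} {c : Elc (code U) G} {X : Ty G} (H : (el U)⟦c⟧ = X)
  {c' : Elc (code U) G'} {X' : Ty G'} (H' : (el U)⟦c'⟧ = X') :
  c' = c ∘ o -> CNat o (coded_el H) (coded_el H').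
Proof.
  intros Hc; split.
  - rewrite <- H', <- H, Hc, Tsub_comp; reflexivity.
  - exact Hc.
  - intros D t x x' Hx. unfold coded_el, ciso. rewrite !iso_app_eq. exact Hx.
Qed.

Definition coded_sub {G D} {X : Ty G} (x : Coded X) (s : Hom D G) : Coded (X⟦s⟧) :=
  {| cd := cd x ∘ s;
     ciso := iso_trans (iso_eq (eq_sym (Tsub_comp (el U) (cd x) s))) (iso_sub (ciso x) s) |}.

Lemma coded_sub_spec {G D} {X : Ty G} (x : Coded X) (s : Hom D G) : CNat s x (coded_sub x s).
Proof.
  split; [reflexivity | reflexivity|].
  intros K t y y' Hy. unfold coded_sub, ciso. rewrite iso_app_trans, iso_app_sub.
  apply iso_app_congr; [reflexivity|]. rewrite Hy. symmetry; apply iso_app_eq.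
Qed.

Lemma CNat_comp {G G' G''} {o : Hom G' G} {o' : Hom G'' G'} {o1 : Hom G'' G} {X : Ty G}
  {X' : Ty G'} {X'' : Ty G''} {x : Coded X} {x' : Coded X'} {x'' : Coded X''} :
  o1 = o ∘ o' -> CNat o x x' -> CNat o' x' x'' -> CNat o1 x x''.
Proof.
  intros -> [-> e1 H1] [-> e2 H2]; split.
  - apply Tsub_comp.
  - rewrite e2, e1; apply comp_assoc.
  - intros D t y y' Hy.
    assert (e : (el U)⟦cd x⟧⟦o ∘ o' ∘ t⟧ = (el U)⟦cd x'⟧⟦o' ∘ t⟧).
    { rewrite e1, !Tsub_comp. f_equal. rewrite !comp_assoc; reflexivity. }
    transitivity (val (iso_app (ciso x') (cast e y))).
    + apply (iso_reindex_app H1); [apply comp_assoc | reflexivity].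
    + apply H2. exact Hy.
Qed.

Lemma CNat_cancel {G G' G''} {o : Hom G' G} {o' : Hom G'' G'} {o1 : Hom G'' G} {X : Ty G}
  {X' : Ty G'} {X'' : Ty G''} {x : Coded X} {x' : Coded X'} {x'' : Coded X''} :
  o1 = o ∘ o' -> CNat o x x' -> CNat o1 x x'' -> CNat o' x' x''.
Proof.
  intros -> [-> e1 H1] [-> e2 H2]; split.
  - symmetry; apply Tsub_comp.
  - rewrite e2, e1; symmetry; apply comp_assoc.
  - intros D t y y' Hy.
    assert (e : (el U)⟦cd x'⟧⟦o' ∘ t⟧ = (el U)⟦cd x⟧⟦o ∘ o' ∘ t⟧).
    { rewrite e1, !Tsub_comp. f_equal. rewrite !comp_assoc; reflexivity. }
    transitivity (val (iso_app (ciso x) (cast e y))).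
    + symmetry. apply (iso_reindex_app H1); [apply comp_assoc | reflexivity].
    + apply H2. exact Hy.
Qed.

Lemma coded_sub_nat {G G' D D'} {o : Hom G' G} {X : Ty G} {X' : Ty G'} {x : Coded X} {x' : Coded X'}
  {s : Hom D G} {s' : Hom D' G'} {t : Hom D' D} :
  o ∘ s' = s ∘ t -> CNat o x x' -> CNat t (coded_sub x s) (coded_sub x' s').
Proof.
  intros H Hx. apply (CNat_cancel (eq_refl (s ∘ t)) (coded_sub_spec x s)).
  rewrite <- H. exact (CNat_comp eq_refl Hx (coded_sub_spec x' s')).
Qed.

Definition coded_pi {G} {A : Ty G} {B : Ty (G ▹ A)} (y : Coded B) : Coded (Pi B) :=
  {| cd := cPi (cd y); ciso := iso_trans (cPi_iso (cd y)) (pi_iso (ciso y)) |}.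

Lemma coded_pi_nat {G G'} {o : Hom G' G} {A : Ty G} {B : Ty (G ▹ A)} {y : Coded B}
  {A' : Ty G'} {B' : Ty (G' ▹ A')} {y' : Coded B'} (HA : A' = A⟦o⟧) :
  CNat (lift HA) y y' -> CNat o (coded_pi y) (coded_pi y').
Proof.
  subst A'. destruct y' as [c' h']. intros [HB e Hh]. simpl in e. subst c'. split.
  - apply (Pi_nat_ty (HA := eq_refl)), HB.
  - symmetry; apply cPi_sub.
  - apply iso_trans_reindex; [apply cPi_iso_sub|].
    refine (pi_iso_reindex (HA := eq_refl) _ HB Hh).
    symmetry; apply Tsub_comp.
Qed.

Section CodedSig.
Context {G} {A : Ty G} {B : Ty (G ▹ A)} (x : Coded A) (y : Coded B).

Definition coded_sig : Coded (Sig B) :=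
  {| cd := cSig (A := cd x) (cd y ∘ pair (fwd (ciso x)));
     ciso := iso_trans (cSig_iso (cd y ∘ pair (fwd (ciso x))))
       (sig_iso (h := ciso x) (ciso y) (eq_sym (Tsub_comp _ _ _))) |}.
End CodedSig.

Lemma fwd_reindex {G D} {s : Hom D G} {X Y : Ty G} {X' Y' : Ty D} {h : Iso X Y}
  {h' : Iso X' Y'} (HX : X' = X⟦s⟧) : IsoReindex s h h' -> fwd h' ≈ (fwd h)⟪lift HX⟫.
Proof.
  intro H.
  assert (e : X'⟦wk X'⟧ = X⟦s ∘ wk X'⟧) by (rewrite HX, Tsub_comp; reflexivity).
  pose proof (H _ (wk X') (cast e (evar X')) (evar X') eq_refl) as H0. simpl in H0.
  etransitivity; [|etransitivity; [symmetry; exact H0|]].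
  - etransitivity; [symmetry; apply tsub_id|]. f_equal. apply ext_eta; nf; reflexivity.
  - simpl. f_equal. apply ext_eta; nf; reflexivity.
Qed.

Lemma cSig_iso_nat {G D} (A : Elc (code U) G) (B : Elc (code U) (G ▹ (el U)⟦A⟧)) (s : Hom D G)
  (B' : Elc (code U) (D ▹ (el U)⟦A ∘ s⟧)) :
  B' = B ∘ lift_el A s -> cSig B' = cSig B ∘ s /\ IsoReindex s (cSig_iso B) (cSig_iso B').
Proof. intros ->; split; [symmetry; apply cSig_sub | apply cSig_iso_sub]. Qed.

Lemma coded_sig_nat {G G'} {o : Hom G' G} {A : Ty G} {B : Ty (G ▹ A)} {x : Coded A} {y : Coded B}
  {A' : Ty G'} {B' : Ty (G' ▹ A')} {x' : Coded A'} {y' : Coded B'} (HA : A' = A⟦o⟧) :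
  CNat o x x' -> CNat (lift HA) y y' -> CNat o (coded_sig x y) (coded_sig x' y').
Proof.
  destruct x' as [c' h']. intros [_ e Hx]. simpl in e. subst c'. simpl in Hx.
  intros [HB e Hy].
  assert (e' : cd y' ∘ pair (fwd h') = cd y ∘ pair (fwd (ciso x)) ∘ lift_el (cd x) o).
  { rewrite e, !comp_assoc. f_equal.
    unfold lift_el. apply ext_eta; nf; [reflexivity|].
    exact (fwd_reindex _ Hx). }
  destruct (cSig_iso_nat e') as [H1 H2]. split.
  - apply (Sig_nat_ty (HA := HA)), HB.
  - exact H1.
  - apply (iso_trans_reindex H2).
    refine (sig_iso_reindex (HA := eq_sym (Tsub_comp _ _ _)) _ _ _ HB Hx Hy).
    etransitivity; [exact (f_equal (Tsub (el U)) e')|]. symmetry; apply Tsub_comp.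
Qed.

Section Back.
Context {G} {X Y : Ty G} (h : Iso X Y).

(** [cId] takes elements of the decoded type, so end-points given in [Y] are first carried back. *)
Definition iso_back (y : El Y) : El X :=
  cast (Tsub_id X) (iso_app (iso_sym h) (cast (eq_sym (Tsub_id Y)) y)).

Lemma iso_app_back (y : El Y) {D} (s : Hom D G) : iso_app h ((iso_back y)⟪s⟫) ≈ y⟪s⟫.
Proof.
  etransitivity; [|exact (f_equal (@val _ _ _) (iso_app_sym h (y⟪s⟫)))].
  apply iso_app_congr; [reflexivity|].
  symmetry. apply (iso_app_nat (iso_sym h) (s := idm G) (t := s)).
  - rewrite comp_idl; reflexivity.
  - reflexivity.
Qed.

(** An isomorphism preserves and reflects equality at every stage; both identity types being
    propositions, this already makes them isomorphic. *)
Lemma iso_back_inj {D} (s : Hom D G) (a b : El Y) :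
  tsub (val (iso_back a)) s = tsub (val (iso_back b)) s <-> tsub (val a) s = tsub (val b) s.
Proof.
  split; intro H.
  - change (val (a⟪s⟫) = val (b⟪s⟫)). rewrite <- !iso_app_back.
    apply iso_app_congr; [reflexivity | exact H].
  - assert (e : forall c, val ((iso_back c)⟪s⟫) = val (iso_app (iso_sym h) (c⟪s⟫))).
    { intro c. symmetry. apply (iso_app_nat (iso_sym h) (s := idm G) (t := s)).
      - rewrite comp_idl; reflexivity.
      - reflexivity. }
    change (val ((iso_back a)⟪s⟫) = val ((iso_back b)⟪s⟫)). rewrite !e.
    apply iso_app_congr; [reflexivity | exact H].
Qed.

Definition id_map {X1 Y1 : Ty G} {a b : El X1} {a' b' : El Y1}
  (H : forall D (s : Hom D G), tsub (val a) s = tsub (val b) s -> tsub (val a') s = tsub (val b') s) :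
  NatMap (Id a b) (Id a' b').
Proof.
  refine {| nfun := fun D s e => Id_intro (H D s (Id_eq e)) |}.
  intros D K s t s' x x' -> Hx.
  change (val (Id_intro (H K _ (Id_eq x'))) = val (ecomp ((Id_intro (H D s (Id_eq x)))⟪t⟫))).
  f_equal; apply Id_prop.
Defined.

Definition id_iso (a b : El Y) : Iso (Id (iso_back a) (iso_back b)) (Id a b).
Proof.
  refine (iso_of (f := id_map (fun D s => proj1 (iso_back_inj s a b)))
    (g := id_map (fun D s => proj2 (iso_back_inj s a b))) _ _); intros; apply Id_prop.
Defined.
End Back.

Definition coded_id {G} {A : Ty G} (x : Coded A) (a b : El A) : Coded (Id a b) :=
  {| cd := cId (iso_back (ciso x) a) (iso_back (ciso x) b);
     ciso := iso_trans (cId_iso _ _) (id_iso (ciso x) a b) |}.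

Lemma iso_back_nat {G G'} {o : Hom G' G} {X Y : Ty G} {X' Y' : Ty G'} (h : Iso X Y) (h' : Iso X' Y')
  (a : El Y) (a' : El Y') : X' = X⟦o⟧ -> Y' = Y⟦o⟧ -> IsoReindex o h h' -> a' ≈ a⟪o⟫ ->
  iso_back h' a' ≈ (iso_back h a)⟪o⟫.
Proof.
  intros HX HY H Ha.
  assert (e : Y' = Y⟦o ∘ idm G'⟧) by (rewrite HY, comp_idr; reflexivity).
  etransitivity; [symmetry; refine (iso_sym_reindex HX HY H (x := cast e a') (x' := cast (eq_sym (Tsub_id _)) a') eq_refl)|].
  apply (iso_app_nat (iso_sym h) (s := idm G) (t := o)).
  - rewrite comp_idl, comp_idr; reflexivity.
  - exact Ha.
Qed.

Lemma coded_id_nat {G G'} {o : Hom G' G} {A : Ty G} {x : Coded A} {a b : El A}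
  {A' : Ty G'} {x' : Coded A'} {a' b' : El A'} :
  CNat o x x' -> a' ≈ a⟪o⟫ -> b' ≈ b⟪o⟫ -> CNat o (coded_id x a b) (coded_id x' a' b').
Proof.
  intros [HA e Hx] Ha Hb. destruct x' as [c' h']; simpl in e; subst c'; simpl in Hx.
  pose proof (iso_back_nat (eq_sym (Tsub_comp _ _ _)) HA Hx Ha) as Ha'.
  pose proof (iso_back_nat (eq_sym (Tsub_comp _ _ _)) HA Hx Hb) as Hb'.
  split.
  - symmetry; apply (Id_sub' HA Ha Hb).
  - symmetry; apply (cId_sub Ha' Hb').
  - intros D t u u' Hu.
    assert (e : (Id a b)⟦o ∘ t⟧ = (Id a' b')⟦t⟧).
    { rewrite <- (Id_sub' HA Ha Hb), Tsub_comp; reflexivity. }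
    (* Both images lie in an identity type, hence are equal without any computation of the
       isomorphisms. *)
    change (val (cast e (iso_app (ciso (coded_id x a b)) u))
      = val (iso_app (ciso (coded_id (mkCoded h') a' b')) u')).
    f_equal. apply Id_prop.
Qed.
End Coded.

(** * Transport of fibration structures along isomorphisms *)

Section FibIso.
Context {E : CwF} {T : TypeFormers E} {I : Interval T} {P : PathContexts I}
  {C : Cofibrations I}.

Section Map.
Context {G} {X Y : Ty G} (h : Iso X Y) {D} {p : Hom (D ▸ II) G} {b : bool}
  {phi : Elc (code Cof) D} (pb : Problem (X⟦p⟧) b phi).

Definition problem_at {K} {d : Hom K D} (u : El ((holds phi)⟦d⟧)) (i : Elc II K) :
  El (X⟦p ∘ cpair d i⟧) := ecomp (mkEl (tapp_ty pb u i)).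

Definition map_tube : El (Y⟦p ∘ clift II (wk (holds phi))⟧) := iso_app h (ecomp (tube pb)).
Definition map_base : El (Y⟦p ∘ cpair (idm D) (endpoint b D)⟧) := iso_app h (ecomp (base pb)).

Lemma map_tube_at {K} {d : Hom K D} (u : El ((holds phi)⟦d⟧)) (i : Elc II K) :
  tval (val map_tube) u i = val (iso_app h (problem_at u i)).
Proof.
  symmetry; apply (iso_app_nat h (t := cpair (pair u) i)); [|reflexivity].
  rewrite comp_assoc, clift_cpair, wk_pair'; reflexivity.
Qed.

Definition map_problem : Problem (Y⟦p⟧) b phi.
Proof.
  refine (mk_problem (f := cast (eq_sym (Tsub_comp _ _ _)) map_tube)
    (a := cast (eq_sym (Tsub_comp _ _ _)) map_base) _).
  intros K d u. etransitivity; [apply map_tube_at|].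
  apply (iso_app_nat h (t := d)); [|apply tapp_base].
  rewrite comp_assoc, cpair_comp, comp_idl, endpoint_sub; reflexivity.
Defined.

Lemma map_problem_at {K} {d : Hom K D} (u : El ((holds phi)⟦d⟧)) (i : Elc II K) :
  tapp map_problem u i = val (iso_app h (problem_at u i)).
Proof. apply map_tube_at. Qed.

Context (sy : FibStr Y).

Definition iso_fop0 : El (X⟦p ∘ cpair (idm D) (endpoint (negb b) D)⟧) :=
  iso_app (iso_sym h) (ecomp (fcomp sy map_problem)).
Definition iso_fop : El (at_ (X⟦p⟧) (endpoint (negb b) D)) :=
  cast (eq_sym (Tsub_comp _ _ _)) iso_fop0.

Lemma iso_fop_ext {K} {d : Hom K D} (u : El ((holds phi)⟦d⟧)) :
  tapp pb u (endpoint (negb b) K) = tsub (val iso_fop) d.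
Proof.
  set (e := endpoint (negb b) K).
  transitivity (val (iso_app (iso_sym h) (iso_app h (problem_at u e)))).
  - rewrite iso_sym_app; reflexivity.
  - apply (iso_app_nat (iso_sym h) (t := d)).
    + rewrite comp_assoc, cpair_comp, comp_idl, endpoint_sub; reflexivity.
    + symmetry. etransitivity; [apply (fcomp_ext sy map_problem u)|]. apply map_problem_at.
Qed.
End Map.

Section Nat.
Context {G G'} {o : Hom G' G} {X Y : Ty G} {h : Iso X Y} {X' Y' : Ty G'} {h' : Iso X' Y'}
  {sy : FibStr Y} {sy' : FibStr Y'}
  (HX : X' = X⟦o⟧) (Hh : IsoReindex o h h') (Hs : FNat o sy sy')
  {D} {p : Hom (D ▸ II) G} {D'} {p' : Hom (D' ▸ II) G'} {t : Hom D' D}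
  (Hp : o ∘ p' = p ∘ clift II t) {b : bool}
  {phi : Elc (code Cof) D} {pb : Problem (X⟦p⟧) b phi}
  {phi' : Elc (code Cof) D'} {pb' : Problem (X'⟦p'⟧) b phi'} (Hpb : PNat t pb pb').

Lemma iso_app_square {Z W : Ty G} {Z' W' : Ty G'} (k : Iso Z W) (k' : Iso Z' W') {K K'}
  {s : Hom K G} {s' : Hom K' G'} {r : Hom K' K} (z : El (Z⟦s⟧)) (z' : El (Z'⟦s'⟧)) :
  Z' = Z⟦o⟧ -> IsoReindex o k k' -> o ∘ s' = s ∘ r -> z' ≈ z⟪r⟫ -> iso_app k' z' ≈ (iso_app k z)⟪r⟫.
Proof.
  intros HZ Hk Ho Hz.
  assert (e : Z'⟦s'⟧ = Z⟦s ∘ r⟧) by (rewrite HZ, Tsub_comp, Ho; reflexivity).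
  transitivity (val (iso_app k (cast e z'))).
  - symmetry; apply (iso_reindex_app Hk); [symmetry; exact Ho | reflexivity].
  - apply iso_app_nat; [reflexivity | exact Hz].
Qed.

Lemma map_problem_nat : PNat t (map_problem h pb) (map_problem h' pb').
Proof.
  split.
  - apply (line_ty_nat (fnat_ty Hs) Hp).
  - apply (pnat_phi Hpb).
  - intros K d u u' i. rewrite !map_problem_at.
    etransitivity; [apply (iso_app_square (r := idm K) HX Hh (z := problem_at pb u i))|apply tsub_id].
    + rewrite comp_idr. apply path_cpair_nat, Hp.
    + simpl. rewrite tsub_id. apply (pnat_tube Hpb).
  - apply (iso_app_square (r := t) HX Hh (z := ecomp (base pb))).
    + apply path_end_nat, Hp.
    + apply (pnat_base Hpb).
Qed.

Lemma iso_fop_nat : iso_fop h' pb' sy' ≈ (iso_fop h pb sy)⟪t⟫.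
Proof.
  apply (iso_app_square (r := t) (k := iso_sym h) (k' := iso_sym h') (fnat_ty Hs)
    (iso_sym_reindex HX (fnat_ty Hs) Hh) (z := ecomp (fcomp sy (map_problem h pb)))).
  - apply path_end_nat, Hp.
  - apply (fcomp_nat Hs Hp map_problem_nat).
Qed.
End Nat.

Lemma iso_reindex_id {G} {X Y : Ty G} (h : Iso X Y) : IsoReindex (idm G) h h.
Proof.
  intros D t x x' Hx. apply iso_app_congr; [apply comp_idl | exact Hx].
Qed.

Definition fib_iso_op {G} {X Y : Ty G} (h : Iso X Y) (sy : FibStr Y) : FibOp X.
Proof.
  refine {| fop := fun D p b phi pb => iso_fop h pb sy |}.
  - intros; apply iso_fop_ext.
  - intros D p b phi pb D1 p1 phi1 pb1 r Hp Hpb.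
    refine (iso_fop_nat (eq_sym (Tsub_id X)) (iso_reindex_id h) (FNat_id sy) _ Hpb).
    rewrite comp_idl; exact Hp.
Defined.

Definition fib_iso {G} {X Y : Ty G} (h : Iso X Y) (sy : FibStr Y) : FibStr X :=
  fib_of (fib_iso_op h sy).

Lemma fib_iso_nat {G G'} {o : Hom G' G} {X Y : Ty G} {h : Iso X Y} {X' Y' : Ty G'}
  {h' : Iso X' Y'} {sy : FibStr Y} {sy' : FibStr Y'} :
  X' = X⟦o⟧ -> IsoReindex o h h' -> FNat o sy sy' -> FNat o (fib_iso h sy) (fib_iso h' sy').
Proof.
  intros HX Hh Hs. apply FNat_intro; [exact HX|].
  intros D p' b phi pb' pb Hpb. unfold fib_iso; rewrite !fcomp_fib_of.
  etransitivity; [refine (iso_fop_nat HX Hh Hs _ Hpb)|apply tsub_id].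
  rewrite clift_id, comp_idr; reflexivity.
Qed.

Lemma fib_iso_spec {G} {X Y : Ty G} (h : Iso X Y) (sy : FibStr Y) :
  IsFibIso h (fib_iso h sy) sy.
Proof.
  intros D p b phi px py Ht Hb.
  assert (e : ecomp (fcomp (fib_iso h sy) px) = iso_fop0 h px sy).
  { apply El_ext. exact (fcomp_fib_of (fib_iso_op h sy) px). }
  transitivity (val (fcomp sy (map_problem h px))).
  - etransitivity; [|apply tsub_id].
    apply (fcomp_nat (FNat_id sy)).
    + rewrite clift_id, comp_idl, comp_idr; reflexivity.
    + apply PNat_idm; [reflexivity | exact Ht | exact Hb].
  - symmetry. etransitivity; [exact (f_equal (fun z => val (iso_app h z)) e)|].
    unfold iso_fop0. rewrite iso_app_sym; reflexivity.
Qed.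

(** A code in [UF U] decodes to a type that only equals the one on which the structure was built.
    This lemma stands in for a transport along that equality. *)
Lemma IsFibIso_eq {G} {X X0 Y : Ty G} (h : Iso X Y) (h0 : Iso X0 Y) (sx : FibStr X)
  (s0 : FibStr X0) (sy : FibStr Y) : X0 = X -> s0 ≈ sx ->
  (forall D (s : Hom D G) (x : El (X⟦s⟧)) (x0 : El (X0⟦s⟧)), x0 ≈ x -> iso_app h0 x0 ≈ iso_app h x) ->
  IsFibIso h sx sy -> IsFibIso h0 s0 sy.
Proof.
  intros -> Hs Hh H. apply El_ext in Hs; subst s0.
  intros D p b phi px py Ht Hb.
  rewrite (H D p b phi px py).
  - symmetry; apply Hh; reflexivity.
  - rewrite Ht; apply Hh; reflexivity.
  - rewrite Hb; apply Hh; reflexivity.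
Qed.
End FibIso.

(** * Codes of fibrations *)

Section UF.
Context {E : CwF} {T : TypeFormers E} {I : Interval T} {P : PathContexts I}
  {R : DependentRightAdjoint P} {C : Cofibrations I} {U : Universe}.

Lemma transp_nat {G D} {s : Hom D G} {A : Ty (Exp G)} {A' : Ty (Exp D)} (a : El A) (a' : El A') :
  A' = A⟦exp_map s⟧ -> a' ≈ a⟪exp_map s⟫ -> transp a' ≈ (transp a)⟪s⟫.
Proof.
  intros -> Ha; apply El_ext in Ha; subst a'. symmetry; apply transp_sub.
Qed.

(** Only [transp] is assumed to commute with reindexing. Its inverse does too, because [b'] is the
    transpose of the reindexed [untransp b]. *)
Lemma untransp_nat {G D} {s : Hom D G} {A : Ty (Exp G)} {A' : Ty (Exp D)} (b : El (Rt A))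
  (b' : El (Rt A')) :
  A' = A⟦exp_map s⟧ -> b' ≈ b⟪s⟫ -> untransp b' ≈ (untransp b)⟪exp_map s⟫.
Proof.
  intros -> Hb.
  assert (b' = transp ((untransp b)⟪exp_map s⟫)) as ->.
  { apply El_ext. rewrite Hb, <- transp_sub, transp_untransp; reflexivity. }
  rewrite untransp_transp; reflexivity.
Qed.

Lemma CompPath_sub {G D} (A : Ty G) (s : Hom D G) : CompPath (A⟦s⟧) = (CompPath A)⟦exp_map s⟧.
Proof.
  unfold CompPath; rewrite Comp_sub, !Tsub_comp; unfold exp_map. rewrite ev_cur; reflexivity.
Qed.

Lemma pair_elem {X : Ty emp} {G} (c : Elc X G) : pair (s := bang G) (elem c) = c.
Proof. apply ext_eta; [apply bang_uniq | apply var_pair']. Qed.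

Section Code.
Context {G} (c : Elc (code U) G) (st : FibStr ((el U)⟦c⟧)).

Lemma ufc_ty : Rt (CompPath ((el U)⟦c⟧)) = (FF (el U))⟦pair (s := bang G) (elem c)⟧.
Proof. unfold FF. rewrite pair_elem, Rt_sub, CompPath_sub; reflexivity. Qed.

Definition ufc_el : El ((UFcode U)⟦bang G⟧) := sig_pair (a := elem c) (cast ufc_ty (transp st)).

Definition ufc : Elc (code (UF U)) G := pair (s := bang G) ufc_el.

Lemma ufc_stage : bang G = wk (UFcode U) ∘ ufc.
Proof. apply bang_uniq. Qed.

Lemma UFfst_ufc : UFfst U ∘ ufc = c.
Proof.
  apply elc_ext. unfold UFfst. rewrite var_pair_assoc.
  etransitivity; [symmetry; refine (sfst_sub ufc_stage (x := evar (UFcode U)) (x' := ufc_el) _)|].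
  - unfold ufc; simpl. rewrite var_pair'; reflexivity.
  - unfold ufc_el. rewrite sfst_pair; reflexivity.
Qed.

(** The tautological structure is an inverse transpose. Reindexed along [ufc] it becomes the inverse
    transpose of [transp st], that is, [st]. *)
Lemma code_fib_ufc : code_fib ufc ≈ st.
Proof.
  unfold code_fib, UFstr. simpl val. symmetry.
  etransitivity; [exact (f_equal (@val _ _ _) (eq_sym (untransp_transp st)))|].
  apply (untransp_nat (s := ufc)).
  - rewrite CompPath_sub, Tsub_comp. f_equal.
    rewrite exp_map_comp, UFfst_ufc; reflexivity.
  - simpl val.
    etransitivity; [|refine (ssnd_sub ufc_stage (x := evar (UFcode U)) (x' := ufc_el) _)].
    + unfold ufc_el; rewrite ssnd_pair; reflexivity.
    + unfold ufc; simpl. rewrite var_pair'; reflexivity.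
Qed.
End Code.

Lemma ufc_nat {G G'} {o : Hom G' G} {c : Elc (code U) G} {st : FibStr ((el U)⟦c⟧)}
  {c' : Elc (code U) G'} {st' : FibStr ((el U)⟦c'⟧)} :
  c' = c ∘ o -> FNat o st st' -> ufc st ∘ o = ufc st'.
Proof.
  intros Hc Hs. symmetry. apply elc_ext. unfold ufc. rewrite var_pair_assoc, var_pair'.
  assert (e : bang G' = bang G ∘ o) by apply bang_uniq.
  change (val (ufc_el st') = val (ecomp ((ufc_el st)⟪o⟫))).
  apply (sig_ext' e).
  - symmetry. etransitivity; [apply (sfst_sub (t := o) eq_refl (x := ufc_el st)); reflexivity|].
    simpl val. unfold ufc_el. rewrite !sfst_pair. simpl. rewrite Hc, tsub_comp; reflexivity.
  - symmetry. etransitivity; [apply (ssnd_sub (t := o) eq_refl (x := ufc_el st)); reflexivity|].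
    unfold ufc_el. rewrite ssnd_pair.
    change (tsub (val (ssnd (ufc_el st))) o = val (transp st')).
    unfold ufc_el. rewrite ssnd_pair. symmetry. apply transp_nat.
    + rewrite (fnat_ty Hs), CompPath_sub; reflexivity.
    + apply (fnat_str Hs).
Qed.
End UF.

(** * Closure of the universe of fibrations *)

Section Closure.
Context {E : CwF} {T : TypeFormers E} {I : Interval T} {P : PathContexts I}
  {R : DependentRightAdjoint P} {C : Cofibrations I} {U : Universe} {HU : Impredicative T U}.

Section Uf.
Context {G} {X : Ty G} (x : Coded (U := U) X) (st : FibStr X).

Definition uf : Elc (code (UF U)) G := ufc (fib_iso (ciso x) st).

Lemma uf_ty : (el (UF U))⟦uf⟧ = (el U)⟦cd x⟧.
Proof. simpl el. rewrite Tsub_comp. unfold uf; rewrite UFfst_ufc; reflexivity. Qed.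

Definition uf_iso : Iso ((el (UF U))⟦uf⟧) X := iso_trans (iso_eq uf_ty) (ciso x).

Lemma uf_fib : IsFibIso uf_iso (code_fib uf) st.
Proof.
  eapply (IsFibIso_eq (h := ciso x) (sx := fib_iso (ciso x) st));
    [apply uf_ty | apply code_fib_ufc | | apply fib_iso_spec].
  intros D s y y0 Hy. unfold uf_iso; rewrite iso_app_trans.
  apply iso_app_congr; [reflexivity|]. rewrite iso_app_eq; exact Hy.
Qed.
End Uf.

(** Both substitution fields of each closure record reduce to this: a reindexed coding and a
    reindexed fibration structure give the same code as the substitution and a compatible
    isomorphism. *)
Lemma uf_nat {G G'} {o : Hom G' G} {X : Ty G} {x : Coded (U := U) X} {st : FibStr X} {X' : Ty G'}
  {x' : Coded (U := U) X'} {st' : FibStr X'} :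
  CNat o x x' -> FNat o st st' ->
  uf x st ∘ o = uf x' st' /\ IsoReindex o (uf_iso x st) (uf_iso x' st').
Proof.
  intros Hx Hs.
  assert (e : uf x st ∘ o = uf x' st').
  { apply (ufc_nat (cnat_cd Hx)). apply fib_iso_nat; [|apply (cnat_iso Hx) | exact Hs].
    rewrite (cnat_cd Hx), Tsub_comp; reflexivity. }
  split; [exact e|].
  apply iso_trans_reindex; [|apply (cnat_iso Hx)].
  intros D t y y' Hy. rewrite !iso_app_eq; exact Hy.
Qed.

Lemma code_fib_nat {G D} (c : Elc (code (UF U)) G) (s : Hom D G) (c' : Elc (code (UF U)) D) :
  c' = c ∘ s -> FNat s (code_fib c) (code_fib c').
Proof.
  intros ->. split.
  - symmetry; apply Tsub_comp.
  - unfold code_fib. simpl val. rewrite tsub_comp, exp_map_comp; reflexivity.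
Qed.

(** [el (UF U)] is by definition [el U] reindexed along [UFfst U], so the isomorphism is a mere
    retyping. *)
Definition coded_uf {G} (c : Elc (code (UF U)) G) : Coded (U := U) ((el (UF U))⟦c⟧) :=
  coded_el (c := UFfst U ∘ c) (eq_sym (Tsub_comp (el U) (UFfst U) c)).

Lemma coded_uf_nat {G D} (c : Elc (code (UF U)) G) (s : Hom D G) (c' : Elc (code (UF U)) D) :
  c' = c ∘ s -> CNat s (coded_uf c) (coded_uf c').
Proof. intros ->. apply coded_el_nat. symmetry; apply comp_assoc. Qed.

Lemma closed_pi : ClosedPi U.
Proof.
  refine {| ufPi := fun G A sa B => uf (coded_pi (coded_uf B)) (pi_fib sa (code_fib B));
            ufPi_iso := fun G A sa B => uf_iso (coded_pi (coded_uf B)) (pi_fib sa (code_fib B)) |}.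
  - intros. apply uf_nat.
    + apply (coded_pi_nat (HA := eq_refl)), coded_uf_nat, eq_refl.
    + apply (pi_fib_nat (HA := eq_refl)); [apply fib_sub_nat | apply code_fib_nat, eq_refl].
  - intros. apply uf_nat.
    + apply (coded_pi_nat (HA := eq_refl)), coded_uf_nat, eq_refl.
    + apply (pi_fib_nat (HA := eq_refl)); [apply fib_sub_nat | apply code_fib_nat, eq_refl].
  - intros. exists (pi_fib sa (code_fib B)). split; [apply pi_fib_canon | apply uf_fib].
Qed.

Lemma closed_sig : ClosedSig U.
Proof.
  pose (x G A B := coded_sig (coded_uf (G := G) A) (coded_uf (G := G ▹ (el (UF U))⟦A⟧) B)).
  pose (st G A B := sig_fib (code_fib (U := U) (G := G) A) (code_fib (U := U) (G := G ▹ (el (UF U))⟦A⟧) B)).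
  assert (H : forall G D A B (s : Hom D G), CNat s (x G A B) (x D (A ∘ s) (B ∘ lift_el A s))
    /\ FNat s (st G A B) (st D (A ∘ s) (B ∘ lift_el A s))).
  { intros; split.
    - apply (coded_sig_nat (HA := eq_sym (Tsub_comp _ _ _))); apply coded_uf_nat, eq_refl.
    - apply (sig_fib_nat (HA := eq_sym (Tsub_comp _ _ _))); apply code_fib_nat, eq_refl. }
  refine {| ufSig := fun G A B => uf (x G A B) (st G A B);
            ufSig_iso := fun G A B => uf_iso (x G A B) (st G A B) |}.
  - intros; apply uf_nat; apply H.
  - intros; apply uf_nat; apply H.
  - intros. exists (st G A B). split; [apply sig_fib_canon | apply uf_fib].
Qed.

Section CodedPath.
Context {G} {A : Ty G} (x : Coded (U := U) A) (a0 a1 : El A).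

(** The interval enters only as the index type of a product, so impredicativity applies to it. *)
Definition coded_line : Coded (U := U) (Line A) := coded_pi (coded_sub x (wk (II⟦bang G⟧))).

Definition coded_end (b : bool) (a : El A) :=
  coded_id (coded_sub x (wk (Line A))) (line_app (evar (Line A)) (endpoint b _)) (a⟪wk (Line A)⟫).

Definition coded_path : Coded (U := U) (Path a0 a1) :=
  coded_sig coded_line (coded_sig (coded_end false a0) (coded_sub (coded_end true a1) (wk _))).
End CodedPath.

Lemma coded_line_nat {G G'} {o : Hom G' G} {A : Ty G} {A' : Ty G'} {x : Coded (U := U) A}
  {x' : Coded (U := U) A'} : CNat o x x' -> CNat o (coded_line x) (coded_line x').
Proof.
  intro Hx. apply (coded_pi_nat (HA := closed_sub o)).
  apply (coded_sub_nat (o := o)); [|exact Hx]. symmetry; apply wk_lift.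
Qed.

Lemma coded_end_nat {G G'} {o : Hom G' G} {A : Ty G} {A' : Ty G'} {x : Coded (U := U) A}
  {x' : Coded (U := U) A'} (b : bool) (a : El A) (a' : El A') (HL : Line A' = (Line A)⟦o⟧) :
  CNat o x x' -> a' ≈ a⟪o⟫ -> CNat (lift HL) (coded_end x b a) (coded_end x' b a').
Proof.
  intros Hx Ha. apply coded_id_nat.
  - apply (coded_sub_nat (o := o)); [symmetry; apply wk_lift | exact Hx].
  - apply (line_app_nat (cnat_ty Hx)).
    + symmetry; apply wk_lift.
    + simpl; rewrite var_lift; reflexivity.
    + rewrite endpoint_sub; reflexivity.
  - simpl. rewrite Ha; simpl. rewrite !tsub_comp, wk_lift; reflexivity.
Qed.

Lemma coded_path_nat {G G'} {o : Hom G' G} {A : Ty G} {A' : Ty G'} {x : Coded (U := U) A}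
  {x' : Coded (U := U) A'} {a0 a1 : El A} {b0 b1 : El A'} :
  CNat o x x' -> b0 ≈ a0⟪o⟫ -> b1 ≈ a1⟪o⟫ -> CNat o (coded_path x a0 a1) (coded_path x' b0 b1).
Proof.
  intros Hx H0 H1. pose (HL := Line_sub (cnat_ty Hx)).
  pose proof (coded_end_nat false HL Hx H0) as e0.
  pose proof (coded_end_nat true HL Hx H1) as e1.
  apply (coded_sig_nat (HA := HL)); [apply coded_line_nat, Hx|].
  apply (coded_sig_nat (HA := cnat_ty e0) e0).
  apply (coded_sub_nat (o := lift HL)); [symmetry; apply wk_lift | exact e1].
Qed.

Lemma closed_path : ClosedPath U.
Proof.
  pose (x G A a0 a1 := coded_path (coded_uf (G := G) A) a0 a1).
  pose (st G A a0 a1 := path_fib a0 a1 (code_fib (U := U) (G := G) A)).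
  assert (H : forall G D A a0 a1 (s : Hom D G) (b0 b1 : El ((el (UF U))⟦A ∘ s⟧)),
    b0 ≈ a0⟪s⟫ -> b1 ≈ a1⟪s⟫ ->
    CNat s (x G A a0 a1) (x D _ b0 b1) /\ FNat s (st G A a0 a1) (st D _ b0 b1)).
  { intros; split.
    - apply coded_path_nat; try assumption; apply coded_uf_nat, eq_refl.
    - apply path_fib_nat; try assumption; apply code_fib_nat, eq_refl. }
  refine {| ufPath := fun G A a0 a1 => uf (x G A a0 a1) (st G A a0 a1);
            ufPath_iso := fun G A a0 a1 => uf_iso (x G A a0 a1) (st G A a0 a1) |}.
  - intros; apply uf_nat; apply H; assumption.
  - intros; apply uf_nat; apply H; assumption.
  - intros. exists (st G A a0 a1). split; [apply path_fib_canon | apply uf_fib].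
Qed.

Section CodedId.
Context (c : Coded (U := U) (code Cof)).

Section Obj.
Context {G} {A : Ty G} (x : Coded (U := U) A) (a0 a1 : El A).

Let G2 : Con := G ▹ Path a0 a1 ▸ code Cof.
Let w : Hom (G2 ▸ II) (G ▹ Path a0 a1) := wk ((code Cof)⟦bang _⟧) ∘ wk (II⟦bang G2⟧).

Definition coded_const_line : Coded (U := U) (ConstLine a0 a1) :=
  coded_pi (A := II⟦bang G2⟧)
    (coded_id (coded_sub x (wk (Path a0 a1) ∘ w))
       (path_app (ecomp ((evar (Path a0 a1))⟪w⟫)) (cvar II G2)) (a0⟪wk (Path a0 a1) ∘ w⟫)).

(** The proposition [holds] is again only an index type. The place where a code of [Cof] itself is
    required is the sum over cofibrations in [coded_IdT]. *)
Definition coded_const_if : Coded (U := U) (ConstIf a0 a1) :=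
  coded_pi (A := holds (cvar (code Cof) (G ▹ Path a0 a1))) (coded_sub coded_const_line (wk _)).

Definition coded_IdT : Coded (U := U) (IdT a0 a1) :=
  coded_sig (coded_path x a0 a1)
    (coded_sig (coded_sub c (bang (G ▹ Path a0 a1))) coded_const_if).
End Obj.

Lemma coded_IdT_nat {G G'} {o : Hom G' G} {A : Ty G} {A' : Ty G'} {x : Coded (U := U) A}
  {x' : Coded (U := U) A'} {a0 a1 : El A} {b0 b1 : El A'} :
  CNat o x x' -> b0 ≈ a0⟪o⟫ -> b1 ≈ a1⟪o⟫ -> CNat o (coded_IdT x a0 a1) (coded_IdT x' b0 b1).
Proof.
  intros Hx H0 H1. pose proof (coded_path_nat Hx H0 H1) as Hp.
  apply (coded_sig_nat (HA := cnat_ty Hp) Hp).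
  set (r := lift (cnat_ty Hp)).
  (* The code of [Cof] is closed: both sides are its reindexings along the unique maps to [emp], so
     they match along any morphism. *)
  assert (Hc : CNat r (coded_sub c (bang (G ▹ Path a0 a1))) (coded_sub c (bang (G' ▹ Path b0 b1)))).
  { refine (CNat_cancel _ (coded_sub_spec c _) (coded_sub_spec c _)); apply bang_uniq. }
  refine (coded_sig_nat (HA := closed_sub r) Hc _).
  set (r' := lift (closed_sub r)).
  assert (Hh : holds (cvar (code Cof) (G' ▹ Path b0 b1))
     = (holds (cvar (code Cof) (G ▹ Path a0 a1)))⟦r'⟧).
  { rewrite <- holds_sub. unfold r'; rewrite cvar_lift'; reflexivity. }
  apply (coded_pi_nat (HA := Hh)).
  apply (coded_sub_nat (o := r')); [symmetry; apply wk_lift|].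
  apply (coded_pi_nat (HA := closed_sub r')).
  apply coded_id_nat.
  - apply (coded_sub_nat (o := o)); [|exact Hx].
    unfold r', r; nf; reflexivity.
  - apply (path_app_nat (cnat_ty Hx) H0 H1).
    + unfold r', r; nf; reflexivity.
    + simpl. rewrite !tsub_comp. unfold r', r; nf; reflexivity.
    + symmetry; apply cvar_lift'.
  - simpl. rewrite H0. simpl. rewrite !tsub_comp. f_equal. unfold r', r; nf; reflexivity.
Qed.

Lemma closed_id : ClosedId U.
Proof.
  pose (x G A a0 a1 := coded_IdT (coded_uf (G := G) A) a0 a1).
  pose (st G A a0 a1 := id_fib a0 a1 (code_fib (U := U) (G := G) A)).
  assert (H : forall G D A a0 a1 (s : Hom D G) (b0 b1 : El ((el (UF U))⟦A ∘ s⟧)),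
    b0 ≈ a0⟪s⟫ -> b1 ≈ a1⟪s⟫ ->
    CNat s (x G A a0 a1) (x D _ b0 b1) /\ FNat s (st G A a0 a1) (st D _ b0 b1)).
  { intros; split.
    - apply coded_IdT_nat; try assumption; apply coded_uf_nat, eq_refl.
    - apply id_fib_nat; try assumption; apply code_fib_nat, eq_refl. }
  refine {| ufId := fun G A a0 a1 => uf (x G A a0 a1) (st G A a0 a1);
            ufId_iso := fun G A a0 a1 => uf_iso (x G A a0 a1) (st G A a0 a1) |}.
  - intros; apply uf_nat; apply H; assumption.
  - intros; apply uf_nat; apply H; assumption.
  - intros. exists (st G A a0 a1). split; [apply id_fib_canon | apply uf_fib].
Qed.
End CodedId.
End Closure.

Theorem theorem3p7 (E : CwF) (T : TypeFormers E) (I : Interval T) (P : PathContexts I)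
  (R : DependentRightAdjoint P) (C : Cofibrations I)
  (U : Universe) (HU : Impredicative T U) (HS : Strictification C U) :
  inhabited (ClosedPi U) /\
  inhabited (ClosedSig U) /\
  inhabited (ClosedPath U) /\
  (HasCode (G := emp) U (code Cof) -> inhabited (ClosedId U)).
Proof.
  split; [constructor; apply closed_pi|].
  split; [constructor; apply closed_sig|].
  split; [constructor; apply closed_path|].
  intros [c [h]]. constructor. exact (closed_id (mkCoded h)).
Qed.
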